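(* Let $G$ be a complex torus with maximal compact subgroup $K$, acting linearly on $X=\mathbb C^k$ with weights $\nu_1,\dots,\nu_k\in\mathfrak g^\vee$ contained in an open half space and spanning $\mathfrak g^\vee$. Equip $X$ with the standard Kähler structure and a moment map $\Phi$ for the $K$-action such that $G$ acts on $X^{ss}=G\Phi^{-1}(0)$ with finite stabilizers, and let $n$ be a positive integer such that $|G_x|$ divides $n$ for all $x\in X^{ss}$. Then, under the bijection between gauge equivalence classes of finite energy affine $K$-vortices with bounded image in $X$ and isomorphism classes of stable $G$-gauged holomorphic maps from $\mathbb P(1,n)$ to $X$ (which sends a stable $G$-gauged map to the vortex obtained by a suitable reduction of structure group to $K$), affine vortices of degree $d\in\mathfrak k\subset\mathfrak g$ correspond to isomorphism classes of tuples of polynomial maps $u=(u_1,\dots,u_k):\mathbb C\to X$ satisfying: 1. the degree of $u_j$ is at most $\langle\nu_j,d\rangle$ for each $j=1,\dots,k$; and 2. the vector $u(\infty)=(u_j(\infty))_{j=1}^k$ defined by $$u_j(\infty):=\begin{cases}u_j^{(\langle\nu_j,d\rangle)}/\langle\nu_j,d\rangle! & \langle\nu_j,d\rangle\in\mathbb Z\\ 0&\text{otherwise}\end{cases}$$ (where $u_j^{(m)}$ is the $m$-th derivative, so $u_j(\infty)$ is the coefficient of $z^{\langle\nu_j,d\rangle}$ in $u_j$, understood as $0$ if $\langle\nu_j,d\rangle<0$) lies in $X^{ss}$. Two such tuples are isomorphic if and only if they are related by the action of $G$.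
   Context: **Moment map.** With $\xi_X(x)=\frac d{dt}|_{t=0}\exp(t\xi)x$ and $\mathfrak k\simeq\mathfrak k^\vee$ via an invariant inner product, $\Phi:X\to\mathfrak k$ is $K$-equivariant with $\iota(\xi_X)\omega=d\langle\Phi,\xi\rangle$. Weights are normalized so that they are real on $\mathfrak k$: $\exp(\xi)$, $\xi\in\mathfrak k$, acts on the $j$-th coordinate by $e^{i\langle\nu_j,\xi\rangle}$. **Affine vortices.** Pairs $(A,u)$ on the trivial bundle $\mathbb C\times K$, with $A=\mathrm D+a$ a connection, $u:\mathbb C\to X$, $\bar\partial_Au=(du+a_u)^{0,1}=0$ (where $a_u$ is the infinitesimal action of $a$ at $u$) and $*F_A+\Phi(u)=0$ ($*$ Euclidean). Energy: $\int_{\mathbb C}|F_A|^2+|d_Au|^2+|\Phi(u)|^2$. Gauge transformations $k:\mathbb C\to K$ act by $k(A)=\mathrm D+(k\,dk^{-1}+\mathrm{Ad}_ka)$, $u\mapsto ku$. **Stable $G$-gauged maps.** $\mathbb P(1,n)=(\mathbb C^2\setminus0)/\mathbb C^*$ (weights $1,n$) has charts $\tilde U_1=\mathbb C$, $U_2=\mathbb C$ with $z\sim e^{2\pi i/n}z$ on $\tilde U_1$ and $z\sim w=z^{-n}$ between $\tilde U_1\setminus0$ and $U_2\setminus0$; $\infty$ is $0\in\tilde U_1$ and $U_2$ is identified with $\mathbb C$. A $G$-gauged holomorphic map is a holomorphic (orbifold) principal $G$-bundle $P_{\mathbb C}\to\mathbb P(1,n)$ with a holomorphic section $u$ of $P_{\mathbb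 C}\times_GX$; it is stable if $u(\infty)\in X^{ss}$ (i.e. in $(P_{\mathbb C}\times_G X^{ss})|_\infty$). A reduction of structure group $\sigma$ of $P_{\mathbb C}$ to $K$ gives a $K$-bundle with a $K$-connection $A$ inducing the holomorphic structure of $P_{\mathbb C}$. Every stable $G$-gauged map has a unique reduction, smooth on $\mathbb C$ and $W^{1,p}$ near $\infty$ in $\tilde U_1$ (any fixed $2<p<2(1+1/n)$), for which $(A,u)|_{\mathbb C}$ is an affine vortex, and this gives the bijection referred to in the claim. **Degree.** The degree of a finite energy affine vortex with bounded image is the characteristic class $[P]\in H_2(BK,\mathbb Q)\cong\{\lambda\in\mathfrak k:\exists m\in\mathbb Z_{>0},\ e^{2\pi m\lambda}=\mathrm{Id}\}$ of the corresponding orbifold bundle; equivalently it is the $d\in\mathfrak k$ such that for each weight $\nu$ the associated orbifold line bundle $P\times_\nu\mathbb C\to\mathbb P(1,n)$ has degree (first Chern class paired with the rational fundamental class) $\langle\nu,d\rangle\in\mathbb Q$. *)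

(* Defs.v *)
From HB Require Import structures.
From mathcomp Require Import all_boot all_order all_algebra.
From mathcomp Require Import complex.
From mathcomp Require Import all_classical all_reals all_analysis.

Set Implicit Arguments.
Unset Strict Implicit.
Unset Printing Implicit Defensive.

Import Order.TTheory GRing.Theory Num.Theory.
Import numFieldNormedType.Exports.

Local Open Scope classical_set_scope.
Local Open Scope ring_scope.
Local Open Scope complex_scope.

(* R[i]^o rather than R[i]: the former carries the topology and is a normed
   module over itself, so [derivable] below is complex differentiability. *)
Notation Cplx R := (R[i]^o).

Notation leb2 R := (@lebesgue_measure R \x @lebesgue_measure R)%E.

Section PlaneCalculus.
Variable R : realType.
Local Notation C := (Cplx R).

Definition holo_on (V : set C) (f : C -> C) : Prop :=
  forall z, V z -> derivable f z 1.

Definition absq (z : C) : R := complex.Re z ^+ 2 + complex.Im z ^+ 2.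

(* Real directional derivative: [pd 1] is d/dx and [pd 'i] is d/dy. *)
Definition pd (v : C) (f : C -> R) (z : C) : R :=
  derive1 (fun t : R => f (z + t%:C * v)) 0.

Definition cpd (v : C) (f : C -> C) (z : C) : C :=
  pd v (fun w => complex.Re (f w)) z +i* pd v (fun w => complex.Im (f w)) z.

Definition laplacian (f : C -> R) (z : C) : R :=
  pd 1 (pd 1 f) z + pd 'i%C (pd 'i%C f) z.

Fixpoint Cm_on (m : nat) (V : set C) (f : C -> R) : Prop :=
  match m with
  | 0 => forall z, V z -> {for z, continuous f}
  | m'.+1 =>
      [/\ forall z, V z -> derivable (fun t : R => f (z + t%:C)) 0 1,
          forall z, V z -> derivable (fun t : R => f (z + t%:C * 'i%C)) 0 1,
          Cm_on m' V (pd 1 f) & Cm_on m' V (pd 'i%C f)]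
  end.

Definition smooth_on (V : set C) (f : C -> R) : Prop := forall m, Cm_on m V f.

Definition csmooth_on (V : set C) (f : C -> C) : Prop :=
  smooth_on V (fun z => complex.Re (f z)) /\
  smooth_on V (fun z => complex.Im (f z)).

Definition cplx (q : R * R) : C := q.1 +i* q.2.

Definition integral_over (V : set C) (f : C -> R) : R :=
  \int[leb2 R]_(q in cplx @^-1` V) f (cplx q).

Definition Lp_on (p : R) (V : set C) (f : C -> R) : Prop :=
  measurable_fun (cplx @^-1` V) (f \o cplx) /\
  (\int[leb2 R]_(q in cplx @^-1` V) (`|f (cplx q)| `^ p)%:E < +oo)%E.

Definition weak_pd (V : set C) (v : C) (f g : C -> R) : Prop :=
  forall (phi : C -> R) (A : set C),
    smooth_on setT phi -> compact A -> A `<=` V ->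
    (forall z, ~ A z -> phi z = 0) ->
    integral_over V (fun z => f z * pd v phi z) =
    - integral_over V (fun z => g z * phi z).

Definition W1p_on (p : R) (V : set C) (f : C -> R) : Prop :=
  Lp_on p V f /\
  exists gx gy : C -> R,
    [/\ Lp_on p V gx, Lp_on p V gy, weak_pd V 1 f gx & weak_pd V 'i%C f gy].

End PlaneCalculus.

(* Bijection between the quotient of {a | PA a} by eqA and the quotient of
   {b | PB b} by eqB whose graph is induced by the relation T. *)
Definition induces_bijection (A B : Type)
    (PA : A -> Prop) (eqA : A -> A -> Prop)
    (PB : B -> Prop) (eqB : B -> B -> Prop) (T : A -> B -> Prop) : Prop :=
  [/\ forall a, PA a -> exists b, PB b /\ T a b,
      forall b, PB b -> exists a, PA a /\ T a b &
      forall a a' b b', PA a -> PA a' -> PB b -> PB b' -> T a b -> T a' b' ->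
        (eqA a a' <-> eqB b b')].

(* G = (C^* )^r sits in C^r and K = U(1)^r in G; k = R^r with
   exp(xi) = (e^{i xi_1}, ..., e^{i xi_r}). Weights are the rows of an integer
   matrix, and a row chi is the character t |-> prod_a t_a^chi_a, whose value at
   exp(xi) is e^{i <chi, xi>}. *)
Section Torus.
Variables (R : realType) (r k : nat).
Local Notation C := (Cplx R).

Definition torus (t : 'rV[C]_r) : Prop := forall a, t 0 a != 0.
Definition ctorus (t : 'rV[C]_r) : Prop := forall a, `|t 0 a| = 1.
Definition tmul (s t : 'rV[C]_r) : 'rV[C]_r := \row_a (s 0 a * t 0 a).
Definition tinv (t : 'rV[C]_r) : 'rV[C]_r := \row_a (t 0 a)^-1.
Definition logabs (t : 'rV[C]_r) : 'rV[R]_r := \row_a ln (complex.Re `|t 0 a|).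

Definition character (chi : 'rV[int]_r) (t : 'rV[C]_r) : C :=
  \prod_a t 0 a ^ chi 0 a.

Definition pairing (chi : 'rV[int]_r) (xi : 'rV[R]_r) : R :=
  \sum_a (chi 0 a)%:~R * xi 0 a.

Variable nu : 'M[int]_(k, r).

Definition tact (t : 'rV[C]_r) (x : 'rV[C]_k) : 'rV[C]_k :=
  \row_j (character (row j nu) t * x 0 j).

Definition stabilizer (x : 'rV[C]_k) : set 'rV[C]_r :=
  [set t | torus t /\ tact t x = x].

Definition in_open_half_space : Prop :=
  exists xi : 'rV[R]_r, xi != 0 /\ forall j, 0 < pairing (row j nu) xi.

Definition weights_span : bool :=
  row_full (map_mx (fun m : int => m%:~R : C) nu).

(* xi_X(x) = d/dt exp(t xi) x at t = 0 *)
Definition inf_act (xi : 'rV[R]_r) (x : 'rV[C]_k) : 'rV[C]_k :=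
  \row_j ('i%C * (pairing (row j nu) xi)%:C * x 0 j).

(* (i/2) sum_j dz_j /\ d(conj z_j) = sum_j dx_j /\ dy_j *)
Definition omega (v w : 'rV[C]_k) : R :=
  \sum_j complex.Im ((v 0 j)^* * w 0 j).

Definition ip (Q : 'M[R]_r) (xi eta : 'rV[R]_r) : R :=
  (xi *m Q *m eta^T) 0 0.

Definition inner_product (Q : 'M[R]_r) : Prop :=
  Q^T = Q /\ forall xi, xi != 0 -> 0 < ip Q xi xi.

(* The coadjoint action is trivial, so equivariance is invariance. *)
Definition moment_map (Q : 'M[R]_r) (Phi : 'rV[C]_k -> 'rV[R]_r) : Prop :=
  (forall t x, ctorus t -> Phi (tact t x) = Phi x) /\
  (forall (xi : 'rV[R]_r) (x v : 'rV[C]_k),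
     is_derive (0 : R) (1 : R) (fun s : R => ip Q (Phi (x + s%:C *: v)) xi)
       (omega (inf_act xi x) v)).

Definition Xss (Phi : 'rV[C]_k -> 'rV[R]_r) (x : 'rV[C]_k) : Prop :=
  exists t y, [/\ torus t, Phi y = 0 & x = tact t y].

End Torus.

Section Bundles.
Variables (R : realType) (r : nat).
Local Notation C := (Cplx R).

Definition holo_torus_on (V : set C) (g : C -> 'rV[C]_r) : Prop :=
  (forall z, V z -> torus (g z)) /\
  (forall a, holo_on V (fun z => g z 0 a)).

(* Holomorphic principal G-bundle over C. The complex structure of the total
   space is given by an atlas [plsec] of local sections, defined on open sets
   covering C (their values outside of these sets are irrelevant), which differ
   by holomorphic G-valued functions on overlaps. *)
Record pbundle := PBundle {
  ptot :> Type ;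
  pproj : ptot -> C ;
  pact : 'rV[C]_r -> ptot -> ptot ;
  pact_proj : forall t x, torus t -> pproj (pact t x) = pproj x ;
  pact1 : forall x, pact (const_mx 1) x = x ;
  pactM : forall s t x, torus s -> torus t ->
    pact s (pact t x) = pact (tmul s t) x ;
  pact_free : forall t x, torus t -> pact t x = x -> t = const_mx 1 ;
  pact_trans : forall x y, pproj x = pproj y ->
    exists t, torus t /\ y = pact t x ;
  plsec : set C -> (C -> ptot) -> Prop ;
  plsec_open : forall V s, plsec V s -> open V ;
  plsec_proj : forall V s z, plsec V s -> V z -> pproj (s z) = z ;
  plsec_cover : forall z, exists V s, plsec V s /\ V z ;
  plsec_holo : forall V s W t, plsec V s -> plsec W t ->
    exists g, holo_torus_on (V `&` W) g /\
      forall z, (V `&` W) z -> s z = pact (g z) (t z)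
}.

Definition holo_section (E : pbundle) (V : set C) (s : C -> E) : Prop :=
  [/\ open V, forall z, V z -> pproj (s z) = z &
      forall W t, @plsec E W t ->
        exists g, holo_torus_on (V `&` W) g /\
          forall z, (V `&` W) z -> s z = pact (g z) (t z)].

Definition zeta (n : nat) : C :=
  cos (2 * pi / n%:R) +i* sin (2 * pi / n%:R).

(* Holomorphic orbifold principal G-bundle over P(1,n): a bundle on each of the
   charts U~_1 = C and U_2 = C, a lift of the Z_n-action on U~_1, and a
   Z_n-invariant lift of the chart change z |-> z^(-n) from U~_1 \ 0 to U_2 \ 0.
   The point at infinity is 0 in U~_1. *)
Record orbibundle (n : nat) := OrbiBundle {
  ob1 : pbundle ;
  ob2 : pbundle ;
  orot : ob1 -> ob1 ;
  orot_proj : forall x, pproj (orot x) = zeta n * pproj x ;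
  orot_act : forall t x, torus t -> orot (pact t x) = pact t (orot x) ;
  orot_order : forall x, iter n orot x = x ;
  orot_holo : forall V s, @plsec ob1 V s ->
    holo_section [set z | V ((zeta n)^-1 * z)]
                 (fun z => orot (s ((zeta n)^-1 * z))) ;
  oglue : ob1 -> ob2 ;
  oglue_proj : forall x, pproj x != 0 -> pproj (oglue x) = pproj x ^- n ;
  oglue_act : forall t x, torus t -> pproj x != 0 ->
    oglue (pact t x) = pact t (oglue x) ;
  oglue_rot : forall x, pproj x != 0 -> oglue (orot x) = oglue x ;
  oglue_holo : forall V s W t, @plsec ob1 V s -> @plsec ob2 W t ->
    let U := [set z : C | [/\ V z, z != 0 & W (z ^- n)]] in
    exists g, holo_torus_on U g /\
      forall z, U z -> oglue (s z) = pact (g z) (t (z ^- n))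
}.

(* A Hermitian metric on the orbifold line bundle P x_chi C, as the function
   x |-> |[x, 1]|^2 on P; recall [t x, 1] = [x, chi(t)]. *)
Definition hermitian_metric n (P : orbibundle n) (chi : 'rV[int]_r)
    (h1 : ob1 P -> R) (h2 : ob2 P -> R) : Prop :=
  [/\ (forall x, 0 < h1 x) /\ (forall x, 0 < h2 x),
      (forall t x, torus t -> h1 (pact t x) = absq (character chi t) * h1 x) /\
      (forall t x, torus t -> h2 (pact t x) = absq (character chi t) * h2 x),
      (forall x, h1 (orot x) = h1 x) /\
      (forall x, pproj x != 0 -> h2 (oglue x) = h1 x),
      (forall V s, @plsec (ob1 P) V s -> smooth_on V (fun z => h1 (s z))) &
      (forall V s, @plsec (ob2 P) V s -> smooth_on V (fun z => h2 (s z)))].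

(* First Chern class paired with the rational fundamental class, by Chern-Weil:
   for a metric h, c_1 is represented by (i/2 pi) times the curvature of the
   Chern connection, that is - (1/4 pi) Laplacian(log h(s)) dx dy for any local
   holomorphic frame s; and P(1,n) is U_2 = C up to a point. *)
Definition line_degree n (P : orbibundle n) (chi : 'rV[int]_r) (delta : R)
    : Prop :=
  exists h1 h2 (c1 : C -> R),
    [/\ @hermitian_metric n P chi h1 h2,
        forall V s, @plsec (ob2 P) V s -> forall z, V z ->
          c1 z = - (4 * pi)^-1 * laplacian (fun w => ln (h2 (s w))) z,
        (leb2 R).-integrable setT (fun q => (c1 (cplx q))%:E) &
        delta = integral_over setT c1].

Definition has_degree n (P : orbibundle n) (d : 'rV[R]_r) : Prop :=
  forall chi : 'rV[int]_r, line_degree P chi (pairing chi d).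

End Bundles.

Section GaugedMaps.
Variables (R : realType) (r k n : nat) (nu : 'M[int]_(k, r)).
Local Notation C := (Cplx R).

(* A section of P x_G X is encoded as an equivariant map P -> X. *)
Record gauged_map := GaugedMap {
  gbundle :> orbibundle R r n ;
  gsec1 : ob1 gbundle -> 'rV[C]_k ;
  gsec2 : ob2 gbundle -> 'rV[C]_k ;
  gsec1_act : forall t x, torus t ->
    gsec1 (pact t x) = tact nu (tinv t) (gsec1 x) ;
  gsec2_act : forall t x, torus t ->
    gsec2 (pact t x) = tact nu (tinv t) (gsec2 x) ;
  gsec1_rot : forall x, gsec1 (orot x) = gsec1 x ;
  gsec_glue : forall x, pproj x != 0 -> gsec2 (oglue x) = gsec1 x ;
  gsec1_holo : forall V s, @plsec _ _ (ob1 gbundle) V s ->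
    forall j, holo_on V (fun z => gsec1 (s z) 0 j) ;
  gsec2_holo : forall V s, @plsec _ _ (ob2 gbundle) V s ->
    forall j, holo_on V (fun z => gsec2 (s z) 0 j)
}.

Definition stable (Phi : 'rV[C]_k -> 'rV[R]_r) (m : gauged_map) : Prop :=
  forall x : ob1 m, pproj x = 0 -> Xss nu Phi (gsec1 x).

(* Bijectivity, and holomorphy of the inverse, follow from equivariance. *)
Definition gauged_iso (m m' : gauged_map) : Prop :=
  exists (f1 : ob1 m -> ob1 m') (f2 : ob2 m -> ob2 m'),
  [/\ (forall x, pproj (f1 x) = pproj x) /\ (forall x, pproj (f2 x) = pproj x),
      (forall t x, torus t -> f1 (pact t x) = pact t (f1 x)) /\
      (forall t x, torus t -> f2 (pact t x) = pact t (f2 x)),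
      (forall V s, @plsec _ _ (ob1 m) V s -> holo_section V (f1 \o s)) /\
      (forall V s, @plsec _ _ (ob2 m) V s -> holo_section V (f2 \o s)),
      (forall x, f1 (orot x) = orot (f1 x)) /\
      (forall x, pproj x != 0 -> f2 (oglue x) = oglue (f1 x)) &
      (forall x, gsec1 (f1 x) = gsec1 x) /\ (forall x, gsec2 (f2 x) = gsec2 x)].

(* a = ax dx + ay dy is the connection form with values in k = R^r, that is,
   d_A u_j = d u_j + i <nu_j, a> u_j. *)
Record kpair := KPair {
  kax : C -> 'rV[R]_r ;
  kay : C -> 'rV[R]_r ;
  kmap : C -> 'rV[C]_k
}.

Definition dAx (v : kpair) (j : 'I_k) (z : C) : C :=
  cpd 1 (fun w => kmap v w 0 j) z
  + 'i%C * (pairing (row j nu) (kax v z))%:C * kmap v z 0 j.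

Definition dAy (v : kpair) (j : 'I_k) (z : C) : C :=
  cpd 'i%C (fun w => kmap v w 0 j) z
  + 'i%C * (pairing (row j nu) (kay v z))%:C * kmap v z 0 j.

Definition star_curv (v : kpair) (z : C) : 'rV[R]_r :=
  \row_b (pd 1 (fun w => kay v w 0 b) z - pd 'i%C (fun w => kax v w 0 b) z).

Definition energy_density (Q : 'M[R]_r) (Phi : 'rV[C]_k -> 'rV[R]_r)
    (v : kpair) (z : C) : R :=
  ip Q (star_curv v z) (star_curv v z)
  + \sum_j (absq (dAx v j z) + absq (dAy v j z))
  + ip Q (Phi (kmap v z)) (Phi (kmap v z)).

Definition affine_vortex (Phi : 'rV[C]_k -> 'rV[R]_r) (v : kpair) : Prop :=
  [/\ forall b, smooth_on setT (fun z => kax v z 0 b) /\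
                smooth_on setT (fun z => kay v z 0 b),
      forall j, csmooth_on setT (fun z => kmap v z 0 j),
      forall j z, dAx v j z + 'i%C * dAy v j z = 0 &
      forall z, star_curv v z + Phi (kmap v z) = 0].

Definition finite_energy (Q : 'M[R]_r) (Phi : 'rV[C]_k -> 'rV[R]_r)
    (v : kpair) : Prop :=
  (\int[leb2 R]_q (energy_density Q Phi v (cplx q))%:E < +oo)%E.

Definition bounded_image (v : kpair) : Prop :=
  exists M : R, forall z j, absq (kmap v z 0 j) <= M.

Definition fe_vortex (Q : 'M[R]_r) (Phi : 'rV[C]_k -> 'rV[R]_r)
    (v : kpair) : Prop :=
  [/\ affine_vortex Phi v, finite_energy Q Phi v & bounded_image v].

(* The factors 'i come from Lie(U(1)) = iR. *)
Definition gauge_equiv (v w : kpair) : Prop :=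
  exists g : C -> 'rV[C]_r,
  [/\ forall z, ctorus (g z),
      forall b, csmooth_on setT (fun z => g z 0 b),
      forall z, kmap w z = tact nu (g z) (kmap v z),
      forall z b, 'i%C * (kax w z 0 b)%:C =
        g z 0 b * cpd 1 (fun y => (g y 0 b)^-1) z + 'i%C * (kax v z 0 b)%:C &
      forall z b, 'i%C * (kay w z 0 b)%:C =
        g z 0 b * cpd 'i%C (fun y => (g y 0 b)^-1) z + 'i%C * (kay v z 0 b)%:C].

(* A reduction of structure group to K is a section of P/K = P x_G (G/K); as
   G/K = R^r by t |-> log|t|, it is an equivariant map P -> R^r, the reduced
   bundle being its zero set. *)
Definition reduction (P : orbibundle R r n) (H1 : ob1 P -> 'rV[R]_r)
    (H2 : ob2 P -> 'rV[R]_r) : Prop :=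
  [/\ forall t x, torus t -> H1 (pact t x) = H1 x + logabs t,
      forall t x, torus t -> H2 (pact t x) = H2 x + logabs t,
      forall x, H1 (orot x) = H1 x &
      forall x, pproj x != 0 -> H2 (oglue x) = H1 x].

Definition reduction_regular (p : R) (P : orbibundle R r n)
    (H1 : ob1 P -> 'rV[R]_r) (H2 : ob2 P -> 'rV[R]_r) : Prop :=
  (forall V s, @plsec _ _ (ob2 P) V s ->
     forall b, smooth_on V (fun z => H2 (s z) 0 b)) /\
  (exists V s (eps : R), let D := [set z : C | absq z < eps ^+ 2] in
     [/\ @plsec _ _ (ob1 P) V s, 0 < eps, D `<=` V &
         forall b, W1p_on p D (fun z => H1 (s z) 0 b)]).

(* v is the restriction to C = U_2 of (A, u) in the smooth frame e of the
   reduced bundle, A being the K-connection which induces the holomorphic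
   structure: writing e = s tau with s a local holomorphic section, the latter
   means i a^{0,1} = tau^{-1} dbar tau. *)
Definition in_unitary_frame (m : gauged_map) (H2 : ob2 m -> 'rV[R]_r)
    (v : kpair) : Prop :=
  exists e : C -> ob2 m,
  [/\ forall z, pproj (e z) = z,
      forall z, H2 (e z) = 0,
      forall z, kmap v z = gsec2 (e z) &
      forall V s, @plsec _ _ (ob2 m) V s ->
        exists tau : C -> 'rV[C]_r,
        [/\ forall z, V z -> torus (tau z) /\ e z = pact (tau z) (s z),
            forall b, csmooth_on V (fun z => tau z 0 b) &
            forall z b, V z ->
              cpd 1 (fun w => tau w 0 b) z
              + 'i%C * cpd 'i%C (fun w => tau w 0 b) z
              = tau z 0 b
                * ('i%C * ((kax v z 0 b)%:C + 'i%C * (kay v z 0 b)%:C))]].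

Definition reduces_to (p : R) (m : gauged_map) (v : kpair) : Prop :=
  exists (H1 : ob1 m -> 'rV[R]_r) (H2 : ob2 m -> 'rV[R]_r),
  [/\ reduction H1 H2, reduction_regular p H1 H2 & in_unitary_frame H2 v].

(* The classification of affine vortices by stable gauged maps. *)
Definition vortex_bijection (p : R) (Q : 'M[R]_r)
    (Phi : 'rV[C]_k -> 'rV[R]_r) : Prop :=
  induces_bijection (stable Phi) gauged_iso (fe_vortex Q Phi) gauge_equiv
    (reduces_to p).

(* The degree of a vortex is that of the corresponding orbifold bundle. *)
Definition vortex_degree (p : R) (Phi : 'rV[C]_k -> 'rV[R]_r) (v : kpair)
    (d : 'rV[R]_r) : Prop :=
  exists m : gauged_map,
    [/\ stable Phi m, reduces_to p m v & has_degree m d].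

Definition value_at_infinity (d : 'rV[R]_r) (u : 'I_k -> {poly R[i]})
    : 'rV[C]_k :=
  \row_j (let delta := pairing (row j nu) d in
          if delta \is a Num.nat then (u j)`_(Num.truncn delta) else 0).

(* The zero polynomial has degree -oo. *)
Definition polynomial_data (Phi : 'rV[C]_k -> 'rV[R]_r) (d : 'rV[R]_r)
    (u : 'I_k -> {poly R[i]}) : Prop :=
  (forall j, u j != 0 ->
     ((size (u j)).-1%:R : R) <= pairing (row j nu) d) /\
  Xss nu Phi (value_at_infinity d u).

Definition poly_equiv (u u' : 'I_k -> {poly R[i]}) : Prop :=
  exists t : 'rV[C]_r, torus t /\
    forall j, u' j = (character (row j nu) t : R[i]) *: u j.

(* u is the expression of the section of m in some global holomorphic
   trivialization of the bundle over C = U_2. *)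
Definition expressed_by (m : gauged_map) (u : 'I_k -> {poly R[i]}) : Prop :=
  exists s : C -> ob2 m, holo_section setT s /\
    forall z, gsec2 (s z) = \row_j ((u j).[z] : C).

Definition vortex_expressed_by (p : R) (Phi : 'rV[C]_k -> 'rV[R]_r)
    (v : kpair) (u : 'I_k -> {poly R[i]}) : Prop :=
  exists m : gauged_map,
    [/\ stable Phi m, reduces_to p m v & expressed_by m u].

End GaugedMaps.

(* Main.v *)
(* A weight basis nu_J with nonzero coordinates at infinity gives, the stabilizer
   being finite, an isogeny G -> (C^* )^r. The coordinates u_J have finitely many
   zeros on U_2 = C, so that each of them is a polynomial q_i times a unit in any
   local frame; the frames in which u_J = q are unique up to a finite group, hence
   the bundle is trivial over U_2. In such a frame, and in a suitable one near
   infinity, the bundle is glued by a cocharacter z^e. Then u_j is entire of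
   polynomial growth, hence a polynomial, and z^N u_j(z^-n) with N = - <nu_j, e>
   extends to infinity, where its value is the coefficient of z^(N/n). Computing
   the Chern-Weil integral in this frame gives e = - n d, so N/n = <nu_j, d>.
   Conversely exp(2 pi d) fixes the value at infinity of the tuple, hence has
   order dividing n; thus n d is integral, and the tuple is a section of the
   bundle glued by z^(- n d). An isomorphism of gauged maps is, in frames over
   U_2, a holomorphic function C -> G whose nu_J-characters are quotients of
   polynomials without zeros and poles, hence constant. The vortices of
   degree d are the image of the gauged maps of degree d. *)
Require Import Defs.
From HB Require Import structures.
From mathcomp Require Import all_boot all_order all_algebra.
From mathcomp Require Import complex.
From mathcomp Require Import all_classical all_reals all_analysis.
From mathcomp Require Import measurable_realfun.
From mathcomp Require Import ring lra.

Set Implicit Arguments.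
Unset Strict Implicit.
Unset Printing Implicit Defensive.
Import Order.TTheory GRing.Theory Num.Theory.
Import numFieldNormedType.Exports.
Local Open Scope classical_set_scope.
Local Open Scope ring_scope.
Local Open Scope complex_scope.

(** * Complex derivatives and line integrals *)

Section ComplexDerivative.
Variable R : realType.
Local Notation C := (Cplx R).
Implicit Types (z w l : C) (f g : C -> C) (A V : set C).

(** Two obstacles shape the proof. Bundles are given by local sections only, and trivialising one
    over C is in general a multiplicative Cousin problem. Here the local sections with [u_J = q]
    differ by constants of a finite group on convex overlaps, so that they can be glued square by
    square. They exist because holomorphic units have local [|det|]-th roots, the adjugate of the
    matrix of [nu_J] inverting the isogeny up to the power [det]. The same device governs infinity:
    a power of each coordinate of the transition function has an order at [0], hence so has the
    coordinate itself. The degree is an integral for an arbitrary metric. Once a multiple of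
    [ln (1 + |w|^2)] and a constant are subtracted, the potential tends to [0] at infinity, but its
    derivatives there are not controlled. Hence Green's formula is applied against a polynomial
    cutoff, on which all derivatives are moved. Passages from local to global on the plane (Cauchy's
    theorem, the identity theorem, finiteness of zeros, gluing of frames) rest on one bisection
    principle for squares. *)

Definition cmod (z : C) : R := Normc.normc z.

Lemma cmodE z : `|z| = (cmod z)%:C. Proof. by []. Qed.
Lemma cmod0 : cmod 0 = 0. Proof. exact: Normc.normc0. Qed.
Lemma cmod1 : cmod 1 = 1. Proof. exact: Normc.normc1. Qed.
Lemma cmodD z w : cmod (z + w) <= cmod z + cmod w. Proof. exact: le_normcD. Qed.
Lemma cmodM z w : cmod (z * w) = cmod z * cmod w. Proof. exact: Normc.normcM. Qed.
Lemma cmodV z : cmod z^-1 = (cmod z)^-1. Proof. exact: Normc.normcV. Qed.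
Lemma cmodN z : cmod (- z) = cmod z. Proof. exact: normcN. Qed.
Lemma cmod_ge0 z : 0 <= cmod z.
Proof. by rewrite -(lecR 0 (cmod z)) -cmodE normr_ge0. Qed.
Lemma cmod_eq0 z : (cmod z == 0) = (z == 0).
Proof. by apply/eqP/eqP => [/Normc.eq0_normc//|->]; rewrite cmod0. Qed.
Lemma cmod_gt0 z : (0 < cmod z) = (z != 0).
Proof. by rewrite lt_neqAle cmod_ge0 andbT eq_sym cmod_eq0. Qed.
Lemma cmodC z w : cmod (z - w) = cmod (w - z).
Proof. by rewrite -cmodN opprB. Qed.
Lemma cmodB z w : cmod z - cmod w <= cmod (z - w).
Proof. by rewrite lerBlDr (le_trans _ (cmodD _ _)) ?subrK. Qed.
Lemma cmodX z n : cmod (z ^+ n) = cmod z ^+ n.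
Proof. by elim: n => [|n IH]; rewrite ?expr0 ?cmod1// !exprS cmodM IH. Qed.
Lemma cmodXz z (n : int) : cmod (z ^ n) = cmod z ^ n.
Proof. by case: n => n; rewrite ?NegzE -?exprnN ?cmodV ?cmodX // -!exprnP ?cmodX. Qed.
Lemma cmod_real (x : R) : cmod x%:C = `|x|.
Proof. by rewrite /cmod /= expr0n /= addr0 sqrtr_sqr. Qed.
Lemma absqE z : absq z = cmod z ^+ 2.
Proof. by case: z => a b; rewrite /absq /cmod /= sqr_sqrtr // addr_ge0 ?sqr_ge0. Qed.
Lemma absq_ge0 z : 0 <= absq z.
Proof. by rewrite absqE sqr_ge0. Qed.
Lemma absqM z w : absq (z * w) = absq z * absq w.
Proof. by rewrite !absqE cmodM exprMn. Qed.
Lemma Re_le_cmod z : `|complex.Re z| <= cmod z.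
Proof. by case: z => a b /=; rewrite /cmod/= -sqrtr_sqr ler_wsqrtr// lerDl sqr_ge0. Qed.
Lemma Im_le_cmod z : `|complex.Im z| <= cmod z.
Proof. by case: z => a b /=; rewrite /cmod/= -sqrtr_sqr ler_wsqrtr// lerDr sqr_ge0. Qed.
Lemma cmod_le_ReIm z : cmod z <= `|complex.Re z| + `|complex.Im z|.
Proof.
case: z => a b; rewrite (_ : a +i* b = a%:C + b%:C * 'i%C :> C); last first.
  by apply/eqP; rewrite eq_complex /=; apply/andP; split; apply/eqP; ring.
rewrite (le_trans (cmodD _ _))// cmodM !cmod_real.
rewrite {1}/cmod /= expr0n expr1n add0r sqrtr1 mulr1 /=.
by rewrite !mul0r !mulr0 !subr0 !addr0 mulr1 add0r.
Qed.
Lemma cmod_i : cmod 'i%C = 1.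
Proof. by rewrite /cmod /= expr0n expr1n add0r sqrtr1. Qed.

Lemma nbhsC_cmod z V :
  nbhs z V <-> exists2 e : R, 0 < e & forall w, cmod (w - z) < e -> V w.
Proof.
split=> [/nbhs_normP[[e i]] /=|[e e0 H]].
  rewrite /= ltcE /= => /andP[/eqP i0 e0] H.
  exists e => // w wz; apply: H => /=.
  by rewrite cmodE ltcE /= -i0 eqxx cmodC.
apply: (proj2 (@nbhs_normP _ C z V)); exists (e%:C : R[i]); first by rewrite /= ltcR.
by move=> w /=; rewrite cmodE ltcR cmodC; exact: H.
Qed.

Lemma openC_cmod V :
  open V <-> forall z, V z -> exists2 e : R, 0 < e & forall w, cmod (w - z) < e -> V w.
Proof.
rewrite openE; split=> H z Vz; first by apply/nbhsC_cmod; exact: H.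
by apply/nbhsC_cmod; exact: H.
Qed.

(** Relative to a set [A], so that one notion serves both for functions on the plane and for curves,
    which are functions on the real line inside C. *)
Definition ccont A f z := forall e : R, 0 < e ->
  exists2 d : R, 0 < d & forall w, A w -> cmod (w - z) < d -> cmod (f w - f z) < e.

Lemma ccont_cst A (c : C) z : ccont A (fun=> c) z.
Proof. by move=> e e0; exists 1 => // w _ _; rewrite subrr cmod0. Qed.

Lemma ccont_id A z : ccont A id z.
Proof. by move=> e e0; exists e. Qed.

Lemma ccontD A f g z : ccont A f z -> ccont A g z -> ccont A (fun w => f w + g w) z.
Proof.
move=> cf cg e e0; have e2 : 0 < e / 2 by rewrite divr_gt0.
have [d1 d10 h1] := cf _ e2; have [d2 d20 h2] := cg _ e2.
exists (Num.min d1 d2) => [|w Aw]; first by rewrite lt_min d10.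
rewrite lt_min => /andP[/(h1 w Aw) H1 /(h2 w Aw) H2].
rewrite (_ : _ - _ = (f w - f z) + (g w - g z)); last by ring.
by rewrite (le_lt_trans (cmodD _ _))// [e]splitr ltrD.
Qed.

Lemma ccontM A f g z : ccont A f z -> ccont A g z -> ccont A (fun w => f w * g w) z.
Proof.
move=> cf cg e e0.
set M := cmod (f z) + cmod (g z) + 1.
have M0 : 0 < M by rewrite /M ltr_wpDl ?addr_ge0 ?cmod_ge0.
have eM : 0 < Num.min 1 (e / (2 * M)) by rewrite lt_min ltr01 divr_gt0 // mulr_gt0.
have [d1 d10 h1] := cf _ eM; have [d2 d20 h2] := cg _ eM.
exists (Num.min d1 d2) => [|w Aw]; first by rewrite lt_min d10.
rewrite lt_min => /andP[/(h1 w Aw) + /(h2 w Aw)].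
rewrite !lt_min => /andP[H1 H1'] /andP[H2 H2'].
rewrite (_ : _ - _ = (f w - f z) * g w + f z * (g w - g z)); last by ring.
rewrite (le_lt_trans (cmodD _ _))// !cmodM.
have gw : cmod (g w) <= cmod (g z) + 1.
  by rewrite -[g w](subrK (g z)) (le_trans (cmodD _ _))// addrC lerD2l ltW.
have fz0 := cmod_ge0 (f z); have gz0 := cmod_ge0 (g z).
have -> : e = e / (2 * M) * M + e / (2 * M) * M.
  by field; rewrite gt_eqF.
apply: (@ltr_leD _ _ _ _ _ ) .
  apply: (@le_lt_trans _ _ (cmod (f w - f z) * M)).
    by rewrite ler_wpM2l ?cmod_ge0// /M (le_trans gw)// lerD2r lerDr.
  by rewrite ltr_pM2r.
rewrite mulrC ler_pM ?cmod_ge0//; first exact: ltW.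
by rewrite /M -addrA lerDl addr_ge0.
Qed.

Lemma ccontN A f z : ccont A f z -> ccont A (fun w => - f w) z.
Proof.
by move=> cf e /cf[d d0 h]; exists d => // w Aw /(h w Aw); rewrite -opprD cmodN.
Qed.

Lemma ccont_bound0 A f z : ccont A f z -> f z != 0 ->
  exists2 d : R, 0 < d & forall w, A w -> cmod (w - z) < d -> cmod (f z) / 2 < cmod (f w).
Proof.
rewrite -cmod_gt0 => cf fz; have [|d d0 h] := cf (cmod (f z) / 2); first by rewrite divr_gt0.
exists d => // w Aw /(h w Aw); rewrite cmodC => H.
have := cmodB (f z) (f w); lra.
Qed.

Lemma ccontV A f z : ccont A f z -> f z != 0 -> ccont A (fun w => (f w)^-1) z.
Proof.
move=> cf fz0; have [d1 d10 h1] := ccont_bound0 cf fz0 => e e0.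
move: (fz0); rewrite -cmod_gt0 => fz.
have [|d2 d20 h2] := cf (e * (cmod (f z) * (cmod (f z) / 2))).
  by rewrite !mulr_gt0.
exists (Num.min d1 d2) => [|w Aw]; first by rewrite lt_min d10.
rewrite lt_min => /andP[/(h1 w Aw) H1 /(h2 w Aw) H2].
have fw : 0 < cmod (f w) by rewrite (lt_trans _ H1)// divr_gt0.
have fw0 : f w != 0 by rewrite -cmod_gt0.
rewrite (_ : _ - _ = (f z - f w) / (f w * f z)); last by field; apply/andP.
rewrite cmodM cmodV cmodM cmodC ltr_pdivrMr ?mulr_gt0//.
rewrite (lt_trans H2)// ltr_pM2l// mulrC ltr_pM2r//.
Qed.

Lemma ccont_comp A B f g z : ccont B f (g z) -> ccont A g z ->
  (forall w, A w -> B (g w)) -> ccont A (fun w => f (g w)) z.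
Proof.
move=> cf cg AB e /cf[d d0 h]; have [d' d'0 h'] := cg _ d0.
by exists d' => // w Aw /(h' w Aw); apply: h; exact: AB.
Qed.

Lemma ccont_near A f g z (d : R) : 0 < d ->
  (forall w, A w -> cmod (w - z) < d -> f w = g w) -> f z = g z ->
  ccont A f z -> ccont A g z.
Proof.
move=> d0 fg fgz cf e /cf[d' d'0 h].
exists (Num.min d d') => [|w Aw]; first by rewrite lt_min d0.
by rewrite lt_min => /andP[/(fg w Aw) <- /(h w Aw)]; rewrite fgz.
Qed.

(* Caratheodory's form of the derivative of f at z within A. *)
Definition cder A f z l := exists phi : C -> C,
  [/\ ccont A phi z, phi z = l & forall w, A w -> f w = f z + phi w * (w - z)].

Lemma cder_cont A f z l : cder A f z l -> ccont A f z.
Proof.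
move=> [phi [cphi _ fE]] e e0.
have : ccont A (fun w => f z + phi w * (w - z)) z.
  apply: ccontD; first exact: ccont_cst.
  apply: ccontM => //; apply: ccontD; first exact: ccont_id.
  exact: ccont_cst.
move=> /(_ e e0)[d d0 h]; exists d => // w Aw /(h w Aw).
by rewrite -fE// subrr mulr0 addr0.
Qed.

Lemma cder_eps A f z l : cder A f z l <->
  forall e : R, 0 < e -> exists2 d : R, 0 < d & forall w, A w -> cmod (w - z) < d ->
    cmod (f w - f z - l * (w - z)) <= e * cmod (w - z).
Proof.
split=> [[phi [cphi <- fE]] e /cphi[d d0 h]|H].
  exists d => // w Aw wz; rewrite fE//.
  rewrite (_ : _ - _ = (phi w - phi z) * (w - z)); last by ring.
  by rewrite cmodM ler_wpM2r ?cmod_ge0// ltW// h.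
exists (fun w => if w == z then l else (f w - f z) / (w - z)); split.
- move=> e e0; have [|d d0 h] := H (e / 2); first by rewrite divr_gt0.
  exists d => // w Aw wz; rewrite eqxx; case: eqP => [_|/eqP wz0].
    by rewrite subrr cmod0.
  have wz1 : w - z != 0 by rewrite subr_eq0.
  have := h w Aw wz.
  rewrite (_ : _ - _ - _ = ((f w - f z) / (w - z) - l) * (w - z)); last by field.
  rewrite cmodM ler_pM2r ?cmod_gt0// => /le_lt_trans; apply.
  by rewrite ltr_pdivrMr// ltr_pMr// ltr1n.
- by rewrite eqxx.
- move=> w Aw; case: eqP => [->|/eqP wz]; first by rewrite subrr mulr0 addr0.
  by field; rewrite subr_eq0.
Qed.

Lemma cder_cst A (c : C) z : cder A (fun=> c) z 0.
Proof. by exists (fun=> 0); split=> [|//|w _]; [exact: ccont_cst|rewrite mul0r addr0]. Qed.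

Lemma cder_id A z : cder A id z 1.
Proof.
exists (fun=> 1); split=> [|//|w _]; [exact: ccont_cst|].
by rewrite mul1r addrC subrK.
Qed.

Lemma cderD A f g z l m : cder A f z l -> cder A g z m ->
  cder A (fun w => f w + g w) z (l + m).
Proof.
move=> [p [cp <- fE]] [q [cq <- gE]]; exists (fun w => p w + q w); split=> //.
  exact: ccontD.
by move=> w Aw; rewrite fE// gE//; ring.
Qed.

Lemma cderM A f g z l m : cder A f z l -> cder A g z m ->
  cder A (fun w => f w * g w) z (l * g z + f z * m).
Proof.
move=> [p [cp <- fE]] dg; have cg := cder_cont dg; move: dg => [q [cq <- gE]].
exists (fun w => p w * g w + f z * q w); split=> //.
  by apply: ccontD; apply: ccontM => //; exact: ccont_cst.
by move=> w Aw; rewrite fE// gE//; ring.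
Qed.

Lemma cderN A f z l : cder A f z l -> cder A (fun w => - f w) z (- l).
Proof.
move=> [p [cp <- fE]]; exists (fun w => - p w); split=> //; first exact: ccontN.
by move=> w Aw; rewrite fE//; ring.
Qed.

Lemma cderB A f g z l m : cder A f z l -> cder A g z m ->
  cder A (fun w => f w - g w) z (l - m).
Proof. by move=> df dg; apply: cderD => //; exact: cderN. Qed.

Lemma cder_near A f g z l (d : R) : 0 < d ->
  (forall w, A w -> cmod (w - z) < d -> f w = g w) -> f z = g z ->
  cder A f z l -> cder A g z l.
Proof.
move=> d0 fg fgz /cder_eps H; apply/cder_eps => e /H[d' d'0 h].
exists (Num.min d d') => [|w Aw]; first by rewrite lt_min d0.
by rewrite lt_min => /andP[/(fg w Aw) <- /(h w Aw)]; rewrite fgz.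
Qed.

Lemma cderV A f z l : cder A f z l -> f z != 0 ->
  cder A (fun w => (f w)^-1) z (- l / (f z) ^+ 2).
Proof.
move=> df fz0; have cf := cder_cont df.
have [d d0 h] := ccont_bound0 cf fz0.
move: df => [p [cp <- fE]].
have fw0 w : A w -> cmod (w - z) < d -> f w != 0.
  move=> Aw /(h w Aw) H; rewrite -cmod_gt0 (lt_trans _ H)// divr_gt0//.
  by rewrite cmod_gt0.
(* Where [f] vanishes its inverse is [0] by convention, and the slope must be the actual difference
   quotient; near [z] this branch does not occur. *)
pose q w := if f w == 0 then ((f w)^-1 - (f z)^-1) / (w - z) else - p w * ((f z)^-1 * (f w)^-1).
exists q; split.
- apply: (@ccont_near A (fun w => - p w * ((f z)^-1 * (f w)^-1)) q z d) => //.
  + by move=> w Aw wz; rewrite /q (negbTE (fw0 w Aw wz)).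
  + by rewrite /q (negbTE fz0).
  + apply: ccontM; first exact: ccontN.
    by apply: ccontM; [exact: ccont_cst|exact: ccontV].
- by rewrite /q (negbTE fz0) expr2 invfM.
- move=> w Aw; rewrite /q; case: eqP => [fw|/eqP fw].
    have wz : w - z != 0.
      by apply: contra_neq fz0 => /subr0_eq <-.
    by rewrite divfK// addrC subrK.
  move: (fw); rewrite [in X in _ -> X^-1 = _]fE// => fw'.
  have -> : p w * (w - z) = f w - f z by rewrite fE//; ring.
  rewrite mulNr [- _ * _]mulNr mulrAC.
  have -> : p w * (w - z) = f w - f z by rewrite fE//; ring.
  by rewrite addrC subrK; field; apply/andP.
Qed.

Lemma cder_comp A B f g z l m : cder B f (g z) l -> cder A g z m ->
  (forall w, A w -> B (g w)) -> cder A (fun w => f (g w)) z (l * m).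
Proof.
move=> [p [cp <- fE]] dg AB; have cg := cder_cont dg; move: dg => [q [cq <- gE]].
exists (fun w => p (g w) * q w); split=> //.
  by apply: ccontM => //; apply: ccont_comp cp cg AB.
move=> w Aw; rewrite fE; last exact: AB.
by rewrite -mulrA; have -> : q w * (w - z) = g w - g z by rewrite gE//; ring.
Qed.

Lemma cder_eq A f z l m : cder A f z l -> l = m -> cder A f z m.
Proof. by move=> + <-. Qed.

Lemma cderXn A z n : cder A (fun w => w ^+ n) z (n%:R * z ^+ n.-1).
Proof.
elim: n => [|n IH].
  by rewrite mul0r; apply: (@cder_near A (fun=> 1)) ltr01 _ _ _ => //; exact: cder_cst.
have := cderM (cder_id A z) IH; congr (cder A _ z _).
  by apply/funext => w; rewrite exprS.
by case: n {IH} => [|n]; rewrite /= ?mul0r ?mulr0 ?addr0 ?expr0 ?mul1r // !exprS (natrD _ 1 n.+1); ring.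
Qed.

(** The link with the notion of holomorphy used in the statement. A positive complex number is real,
    which turns complex radii into real ones. *)
Lemma derivable_cder f z : derivable f z 1 <-> exists l, cder setT f z l.
Proof.
split.
- move=> /cvg_ex[l /= /cvgrPdist_lt H]; exists l; apply/cder_eps => e e0.
  have /nbhs_normP[[d i] /=] := H e%:C (ltac:(by rewrite ltcR)).
  rewrite ltcE /= => /andP[/eqP i0 d0] h.
  exists d => // w _ wz; have [->|wz0] := eqVneq w z.
    by rewrite !subrr mulr0 subrr cmod0 mulr0.
  have wz1 : w - z != 0 by rewrite subr_eq0.
  have := h (w - z); rewrite /= sub0r normrN cmodE ltcE /= -i0 eqxx => /(_ wz wz1).
  rewrite cmodE ltcR [_ *: 1]mulr1 subrK => H'.
  rewrite (_ : _ - _ - _ = - (l - (w - z)^-1 *: (f w - f z)) * (w - z)); last first.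
    by rewrite /GRing.scale /=; field.
  by rewrite cmodM cmodN ler_wpM2r ?cmod_ge0// ltW.
- move=> [l /cder_eps H]; apply/cvg_ex; exists l; apply/cvgrPdist_lt => -[e i].
  rewrite ltcE /= => /andP[/eqP i0 e0]; rewrite i0 {i i0}.
  have [|d d0 h] := H (e / 2); first by rewrite divr_gt0.
  apply/nbhs_normP; exists d%:C; first by rewrite /= ltcR.
  move=> k /=; rewrite sub0r normrN cmodE ltcR => kd k0.
  have := h (k + z) I; rewrite addrK => /(_ kd) H'.
  rewrite [_ *: 1]mulr1 cmodE -[e +i* 0]/(e%:C) ltcR.
  rewrite (_ : _ - _ = - (f (k + z) - f z - l * k) / k); last first.
    by rewrite /GRing.scale /=; field.
  rewrite cmodM cmodN cmodV ltr_pdivrMr ?cmod_gt0// (le_lt_trans H')//.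
  by rewrite ltr_pM2r ?cmod_gt0// ltr_pdivrMr// ltr_pMr// ltr1n.
Qed.

End ComplexDerivative.

Arguments cmod {R} z : simpl never.

(** * The bisection principle for squares *)

Section Bisection.
Variable R : realType.

(** If [P] fails for the large square it fails for one of its quarters; iterating, bad squares
    shrink to a point, near which [P] holds by the local hypothesis. *)
Lemma square_bisection (P : R -> R -> R -> Prop) (x0 y0 h0 : R) : 0 < h0 ->
  (forall x y h, 0 < h -> P x y (h / 2) -> P (x + h / 2) y (h / 2) ->
     P x (y + h / 2) (h / 2) -> P (x + h / 2) (y + h / 2) (h / 2) -> P x y h) ->
  (forall a b, x0 <= a <= x0 + h0 -> y0 <= b <= y0 + h0 ->
     exists2 d : R, 0 < d & forall x y h, 0 < h < d ->
       x <= a <= x + h -> y <= b <= y + h ->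
       x0 <= x -> x + h <= x0 + h0 -> y0 <= y -> y + h <= y0 + h0 -> P x y h) ->
  P x0 y0 h0.
Proof.
move=> h00 glue loc; apply: contrapT => nP.
(* The outcome is constrained only for bad squares of positive side, which makes the choice of a bad
   quarter a total function that can be iterated. *)
have step (q : R * R * R) : {q' : R * R * R | 0 < q.2 -> ~ P q.1.1 q.1.2 q.2 ->
    [/\ ~ P q'.1.1 q'.1.2 q'.2, q'.2 = q.2 / 2,
     q.1.1 <= q'.1.1, q'.1.1 + q'.2 <= q.1.1 + q.2 &
     q.1.2 <= q'.1.2 /\ q'.1.2 + q'.2 <= q.1.2 + q.2]}.
  apply: cid; case: q => -[x y] h /=; apply: contrapT => H.
  have hpos : 0 < h by apply: contrapT => hN; apply: H; exists (x, y, h).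
  have nPh : ~ P x y h by move=> Ph; apply: H; exists (x, y, h) => _ /(_ Ph).
  have hh : h = h / 2 + h / 2 by rewrite -splitr.
  apply: nPh; apply: glue => //; apply: contrapT => nQ; apply: H.
  - by exists (x, y, h / 2) => _ _ /=; split=> //; lra.
  - by exists (x + h / 2, y, h / 2) => _ _ /=; split=> //; lra.
  - by exists (x, y + h / 2, h / 2) => _ _ /=; split=> //; lra.
  - by exists (x + h / 2, y + h / 2, h / 2) => _ _ /=; split=> //; lra.
pose s := fix s n := if n is n'.+1 then sval (step (s n')) else (x0, y0, h0).
have sP n : [/\ ~ P (s n).1.1 (s n).1.2 (s n).2, (s n).2 = h0 / 2 ^+ n & 0 < (s n).2].
  elim: n => [|n [IH1 IH2 IH3]]; first by split=> //=; rewrite expr0 divr1.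
  have /= [//|//|] := svalP (step (s n)).
  by move=> H1 H2 _ _ _; split=> //; rewrite H2 ?divr_gt0// IH2 exprS invfM; ring.
have sS n : [/\ (s n).1.1 <= (s n.+1).1.1, (s n.+1).1.1 + (s n.+1).2 <= (s n).1.1 + (s n).2,
     (s n).1.2 <= (s n.+1).1.2 & (s n.+1).1.2 + (s n.+1).2 <= (s n).1.2 + (s n).2].
  by have [H1 H2 H3] := sP n; have /= [//|//|? ? ? ? []] := svalP (step (s n)).
have sM n m : (n <= m)%N ->
    [/\ (s n).1.1 <= (s m).1.1, (s m).1.1 + (s m).2 <= (s n).1.1 + (s n).2,
     (s n).1.2 <= (s m).1.2 & (s m).1.2 + (s m).2 <= (s n).1.2 + (s n).2].
  elim: m => [|m IH]; first by rewrite leqn0 => /eqP ->.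
  rewrite leq_eqVlt => /orP[/eqP ->//|/IH [a b c d]].
  by have [a' b' c' d'] := sS m; split; [exact: le_trans a'|exact: le_trans b|exact: le_trans c'|exact: le_trans d].
have lim (u : nat -> R) (v : nat -> R) : (forall n m, (n <= m)%N -> u n <= u m /\ v m <= v n) ->
   (forall n, u n <= v n) -> exists a, forall n, u n <= a <= v n.
  move=> uv uvn.
  have uvmn n m : u n <= v m.
    have /orP[/uv[h1 h2]|/uv[h1 h2]] := leq_total n m.
      exact: le_trans (uvn m).
    by apply: le_trans h2.
  exists (sup (range u)) => n; apply/andP; split.
    apply: ub_le_sup; last by exists n.
    by exists (v 0%N) => _ [m _ <-].
  apply: ge_sup; first by exists (u 0%N), 0%N.
  by move=> _ [m _ <-].
have [a Ha] := lim (fun n => (s n).1.1) (fun n => (s n).1.1 + (s n).2)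
  (fun n m nm => let: And4 p q _ _ := sM n m nm in conj p q)
  (fun n => ltac:(by have [_ _ p] := sP n; rewrite lerDl ltW)).
have [b Hb] := lim (fun n => (s n).1.2) (fun n => (s n).1.2 + (s n).2)
  (fun n m nm => let: And4 _ _ p q := sM n m nm in conj p q)
  (fun n => ltac:(by have [_ _ p] := sP n; rewrite lerDl ltW)).
have [d d0 H] := loc a b (Ha 0%N) (Hb 0%N).
have [n hn] : exists n, (s n).2 < d.
  exists (Num.bound (h0 / d)); have [_ -> _] := sP (Num.bound (h0 / d)).
  rewrite ltr_pdivrMr ?exprn_gt0// mulrC -ltr_pdivrMr//.
  have := archi_boundP (ltW (divr_gt0 h00 d0)).
  move/lt_trans; apply; rewrite -natrX ltr_nat; exact: ltn_expl.
have [n1 n2 n3] := sP n; have [p q p' q'] := sM 0%N n (leq0n n).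
by apply: n1; apply: H => //; rewrite n3 hn.
Qed.

End Bisection.

(** * Primitives and integrals along segments *)

Section SegmentIntegral.
Variable R : realType.
Local Notation C := (Cplx R).
Implicit Types (z w p q v : C) (f g F G : C -> C).

Definition realline : set C := [set w | complex.Im w = 0].

Lemma realline_real (t : R) : realline t%:C. Proof. by []. Qed.

Lemma reallineP w : realline w -> exists t : R, w = t%:C.
Proof. by case: w => a b; rewrite /realline /= => ->; exists a. Qed.

(** Clamping the argument to [[0, 1]] extends [f] continuously to the line, so that the fundamental
    theorem of calculus yields two-sided derivatives at the end points too. *)
Lemma real_antiderivative (f : R -> R) :
  (forall t : R, 0 <= t <= 1 -> {for t, continuous f}) ->
  exists g : R -> R, forall t : R, 0 <= t <= 1 -> is_derive t (1 : R) g (f t).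
Proof.
move=> cf; pose cl (t : R) : R := Num.max 0 (Num.min t 1).
have clP t : 0 <= cl t <= 1.
  by rewrite /cl le_max lexx /= ge_max ler01 ge_min lexx orbT.
have clE t : 0 <= t <= 1 -> cl t = t.
  by move=> /andP[t0 t1]; rewrite /cl (min_idPl t1) (max_idPr t0).
have clc : continuous cl.
  move=> t; apply/cvgrPdist_lt => e e0; near=> s.
  have : `|t - s| < e by near: s; apply: cvgr_dist_lt.
  apply: le_lt_trans; rewrite /cl.
  have h1 : t - s <= `|t - s| := ler_norm _.
  have h2 : s - t <= `|t - s| by rewrite distrC ler_norm.
  rewrite ler_norml; case: (leP t 1) => ?; case: (leP s 1) => ?;
    rewrite ?(max_idPr (@ler01 R)); case: (leP 0 t) => ?; case: (leP 0 s) => ?; lra.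
have cfc : continuous (f \o cl).
  by move=> t; apply: continuous_comp; [exact: clc|exact: cf].
exists (fun x => (\int[lebesgue_measure]_(t in `[(-1)%R, x]) (f (cl t)))%R) => t t01.
have [| | | |] := @continuous_FTC1_closed R (f \o cl) (-1) t 2.
- lra.
- apply: continuous_compact_integrable; first exact: segment_compact.
  exact: continuous_subspaceT.
- lra.
- exact: cfc.
- move=> dG GE; apply: DeriveDef => //; rewrite -derive1E GE /= clE//.
Unshelve. all: by end_near. Qed.

Lemma ccont_Re (f : C -> C) (t : R) : ccont realline f t%:C ->
  {for t, continuous (fun s : R => complex.Re (f s%:C))} /\
  {for t, continuous (fun s : R => complex.Im (f s%:C))}.
Proof.
move=> cf; split; apply/cvgrPdist_lt => e e0; have [d d0 h] := cf e e0;
  near=> s; (have sd : cmod (s%:C - t%:C) < d;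
  [by rewrite -rmorphB cmod_real distrC; near: s; apply: cvgr_dist_lt|]);
  have := h s%:C (realline_real s) sd; rewrite cmodC; apply: le_lt_trans.
- by rewrite -raddfB Re_le_cmod.
- by rewrite -raddfB Im_le_cmod.
Unshelve. all: by end_near. Qed.

Lemma is_derive_eps (k : R -> R) (t l : R) :
  (forall e, 0 < e -> exists2 d : R, 0 < d & forall s, `|s - t| < d ->
     `|k s - k t - l * (s - t)| <= e * `|s - t|) <-> is_derive t (1 : R) k l.
Proof.
split.
- move=> H.
  have cv : h^-1 *: ((k \o shift t) (h *: 1) - k t) @[h --> 0^'] --> l.
    apply/cvgrPdist_lt => e e0; have [|d d0 h] := H (e / 2); first by rewrite divr_gt0.
    near=> x; have x0 : x != 0 by near: x; exact: nbhs_dnbhs_neq.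
    have xd : `|x| < d by near: x; apply: dnbhs0_lt.
    rewrite /= [x *: 1]mulr1; have := h (x + t); rewrite addrK => /(_ xd) H'.
    rewrite /GRing.scale /= (_ : _ - _ = - (k (x + t) - k t - l * x) / x); last by field.
    rewrite normrM normrN normfV ltr_pdivrMr ?normr_gt0// (le_lt_trans H')//.
    by rewrite ltr_pM2r ?normr_gt0// ltr_pdivrMr// ltr_pMr// ltr1n.
  by apply: DeriveDef; [apply/cvg_ex; exists l|apply/cvg_lim].
- case=> dk <- e e0; move: dk => /cvg_ex[m cv].
  have -> : 'D_1 k t = m by apply/cvg_lim.
  move/cvgrPdist_lt : cv => /(_ e e0) [d /= d0 h].
  exists d => // s sd; have [->|st] := eqVneq s t.
    by rewrite !subrr mulr0 subrr normr0 mulr0.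
  have st1 : s - t != 0 by rewrite subr_eq0.
  have := h (s - t); rewrite /= sub0r normrN => /(_ sd st1).
  rewrite [_ *: 1]mulr1 subrK => H'.
  rewrite (_ : _ - _ - _ = - (m - (s - t)^-1 *: (k s - k t)) * (s - t)); last first.
    by rewrite /GRing.scale /=; field.
  by rewrite normrM normrN ler_wpM2r// ltW.
Unshelve. all: by end_near. Qed.

Lemma cder_Re_line (G : C -> C) (t : R) (c l : C) : cder realline G t%:C l ->
  is_derive t (1 : R) (fun s : R => complex.Re (c * G s%:C)) (complex.Re (c * l)).
Proof.
move=> dG; apply/is_derive_eps => e e0.
have /cder_eps /(_ e e0)[d d0 h] : cder realline (fun w => c * G w) t%:C (c * l).
  have := cderM (cder_cst realline c t%:C) dG.
  by rewrite mul0r add0r.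
exists d => // s sd; have := h s%:C (realline_real s).
rewrite -rmorphB cmod_real => /(_ sd); apply: le_trans.
apply: le_trans (Re_le_cmod _); rewrite le_eqVlt; apply/orP; left; apply/eqP.
by congr `|_|; rewrite !raddfB /=; congr (_ - _); case: (c * l) => x y /=; ring.
Qed.

Lemma ex_primitive (F : C -> C) :
  (forall t : R, 0 <= t <= 1 -> ccont realline F t%:C) ->
  exists G, forall t : R, 0 <= t <= 1 -> cder realline G t%:C (F t%:C).
Proof.
move=> cF.
have [g1 h1] := real_antiderivative (fun t t01 => (ccont_Re (cF t t01)).1).
have [g2 h2] := real_antiderivative (fun t t01 => (ccont_Re (cF t t01)).2).
exists (fun w => g1 (complex.Re w) +i* g2 (complex.Re w)) => t t01.
apply/cder_eps => e e0; have e2 : 0 < e / 2 by rewrite divr_gt0.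
have [d1 d10 H1] := (is_derive_eps _ _ _).2 (h1 t t01) _ e2.
have [d2 d20 H2] := (is_derive_eps _ _ _).2 (h2 t t01) _ e2.
exists (Num.min d1 d2) => [|w /reallineP[s ->]]; first by rewrite lt_min d10.
rewrite -(rmorphB (real_complex R)) cmod_real lt_min.
move=> /andP[/H1 {}H1 /H2 {}H2].
apply: le_trans (cmod_le_ReIm _) _.
rewrite [e]splitr mulrDl lerD//.
  apply: le_trans H1; rewrite le_eqVlt; apply/orP; left; apply/eqP; congr `|_|.
  by rewrite /=; case: (F t%:C) => a b /=; ring.
apply: le_trans H2; rewrite le_eqVlt; apply/orP; left; apply/eqP; congr `|_|.
by rewrite /=; case: (F t%:C) => a b /=; ring.
Qed.

Lemma primitive_Re_le (F G : C -> C) (c : C) (M : R) :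
  (forall t : R, 0 <= t <= 1 -> cder realline G t%:C (F t%:C)) ->
  (forall t : R, 0 <= t <= 1 -> complex.Re (c * F t%:C) <= M) ->
  complex.Re (c * (G 1 - G 0)) <= M.
Proof.
move=> dG FM.
have [t||x x01 H] := @MVT_segment R (fun s : R => complex.Re (c * G s%:C))
  (fun s : R => complex.Re (c * F s%:C)) 0 1 ler01.
- move=> /[!in_itv]/= /andP[t0 t1]; apply: cder_Re_line; apply: dG.
  by rewrite !ltW.
- apply: derivable_within_continuous => t /[!in_itv]/= t01.
  by apply: ex_derive; apply: cder_Re_line; exact: dG.
- move: x01; rewrite in_itv /= => x01; rewrite mulrBr raddfB.
  by move: H; rewrite subr0 mulr1 /= => ->; apply: FM.
Qed.

(** Multiplication by the conjugate of the increment [v] turns the increment into [|v|^2], a real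
    number, to which the real mean value theorem applies. *)
Lemma primitive_bound (F G : C -> C) (M : R) :
  (forall t : R, 0 <= t <= 1 -> cder realline G t%:C (F t%:C)) ->
  (forall t : R, 0 <= t <= 1 -> cmod (F t%:C) <= M) ->
  cmod (G 1 - G 0) <= M.
Proof.
move=> dG FM; set v := G 1 - G 0.
have [->|v0] := eqVneq v 0.
  by rewrite cmod0 (le_trans (cmod_ge0 _) (FM 0 _))// lexx ler01.
have v1 : 0 < cmod v by rewrite cmod_gt0.
have vv : cmod v * cmod v = complex.Re (v^*%C * v).
  by rewrite -expr2 -absqE /absq; case: (v) => a b /=; ring.
have cj : cmod v^*%C = cmod v by rewrite /cmod; case: (v) => a b /=; rewrite sqrrN.
rewrite -(ler_pM2l v1) vv /v; apply: primitive_Re_le dG _ => t t01.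
rewrite (le_trans (ler_norm _))// (le_trans (Re_le_cmod _))// cmodM cj.
by rewrite ler_wpM2l ?cmod_ge0// FM.
Qed.

(** The integral along a segment is encoded as the increment of a primitive of the pulled-back
    integrand, so that its rules become rules of differentiation. *)
Definition is_segint f p q v := exists2 G : C -> C,
  (forall t : R, 0 <= t <= 1 -> cder realline G t%:C (f (p + t%:C * (q - p)) * (q - p))) &
  v = G 1 - G 0.

Lemma is_segint_uniq f p q v w : is_segint f p q v -> is_segint f p q w -> v = w.
Proof.
move=> [G dG ->] [H dH ->]; apply/eqP; rewrite -subr_eq0 -cmod_eq0 eq_le cmod_ge0 andbT.
rewrite (_ : _ - _ = (G 1 - H 1) - (G 0 - H 0)); last by ring.
apply: (@primitive_bound (fun w => 0) (fun w => G w - H w)) => t t01.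
  by have := cderB (dG t t01) (dH t t01); rewrite subrr.
by rewrite cmod0.
Qed.

Definition segint f p q : C := xget 0 (is_segint f p q).

Lemma segint_is f p q v : is_segint f p q v -> segint f p q = v.
Proof. by move=> H; exact: (is_segint_uniq (xgetI 0 H) H). Qed.

Definition cont_seg f p q := forall t : R, 0 <= t <= 1 -> ccont setT f (p + t%:C * (q - p)).

Lemma ccont_affine A (p v z : C) : ccont A (fun w => p + w * v) z.
Proof.
apply: ccontD; first exact: ccont_cst.
by apply: ccontM; [exact: ccont_id|exact: ccont_cst].
Qed.

Lemma cder_affine A (p v z : C) : cder A (fun w => p + w * v) z v.
Proof.
have := cderD (cder_cst A p z) (cderM (cder_id A z) (cder_cst A v z)).
by rewrite mulr0 addr0 add0r mul1r.
Qed.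

Lemma segintP f p q : cont_seg f p q -> is_segint f p q (segint f p q).
Proof.
move=> cf; have [|G dG] := @ex_primitive (fun w => f (p + w * (q - p)) * (q - p)).
  move=> t t01; apply: ccontM; last exact: ccont_cst.
  apply: (@ccont_comp _ _ setT f (fun w => p + w * (q - p))) => //; first exact: cf.
  exact: ccont_affine.
have H : is_segint f p q (G 1 - G 0) by exists G.
by rewrite (segint_is H).
Qed.

Lemma segint_bound f p q M : cont_seg f p q ->
  (forall t : R, 0 <= t <= 1 -> cmod (f (p + t%:C * (q - p))) <= M) ->
  cmod (segint f p q) <= M * cmod (q - p).
Proof.
move=> /segintP[G dG ->] fM.
apply: (@primitive_bound (fun w => f (p + w * (q - p)) * (q - p))) => // t t01.
by rewrite cmodM ler_wpM2r ?cmod_ge0// fM.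
Qed.

Lemma segint_rev f p q : cont_seg f p q -> segint f q p = - segint f p q.
Proof.
move=> /segintP[G dG ->]; apply: segint_is; exists (fun w => G (1 - w)).
  move=> t t01; have t01' : 0 <= 1 - t <= 1 by lra.
  have dGt := dG _ t01'; rewrite (rmorphB (real_complex R)) /= -/(1%:C) in dGt.
  have d1 : cder realline (fun w => 1 - w) t%:C (0 - 1).
    by apply: cderB; [exact: cder_cst|exact: cder_id].
  have := @cder_comp R realline realline G (fun w => 1 - w) t%:C _ _ dGt d1; move=> H.
  apply: (eq_ind _ (cder realline _ _) (H _)).
    by move=> _ /reallineP[u ->]; rewrite -(rmorphB (real_complex R) 1).
  have -> : p + (1%:C - t%:C) * (q - p) = q + t%:C * (p - q) by ring.
  by ring.
by rewrite subrr subr0 opprB.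
Qed.

Lemma segint_ext f g p q : (forall t : R, 0 <= t <= 1 -> f (p + t%:C * (q - p)) = g (p + t%:C * (q - p))) ->
  segint f p q = segint g p q.
Proof.
move=> fg; congr xget; apply/funext => v; apply/propext; split=> -[G dG ->];
  by exists G => // t t01; have := dG t t01; rewrite fg.
Qed.

Lemma segintD f g p q : cont_seg f p q -> cont_seg g p q ->
  segint (fun w => f w + g w) p q = segint f p q + segint g p q.
Proof.
move=> /segintP[G dG ->] /segintP[H dH ->]; apply: segint_is.
exists (fun w => G w + H w); last by ring.
by move=> t t01; rewrite mulrDl; apply: cderD; [exact: dG|exact: dH].
Qed.

Lemma segintZ c f p q : cont_seg f p q ->
  segint (fun w => c * f w) p q = c * segint f p q.
Proof.
move=> /segintP[G dG ->]; apply: segint_is.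
exists (fun w => c * G w); last by ring.
move=> t t01; rewrite -mulrA.
by have := cderM (cder_cst realline c t%:C) (dG t t01); rewrite mul0r add0r.
Qed.

Lemma half01 (t : R) : 0 <= t <= 1 -> 0 <= t / 2 <= 1 /\ 0 <= (1 + t) / 2 <= 1.
Proof. by move=> ?; split; lra. Qed.

Lemma segint_half f p q m : cont_seg f p q -> m = (p + q) / 2 ->
  segint f p q = segint f p m + segint f m q.
Proof.
move=> /segintP[G dG ->] ->.
have two0 : (2 : C) != 0 by rewrite pnatr_eq0.
have hC (t : R) : (t / 2)%:C = t%:C / 2 :> C by rewrite rmorphM fmorphV rmorph_nat.
have rl2 w : realline w -> realline (w / 2).
  by move=> /reallineP[t ->]; rewrite -hC.
have -> : segint f p ((p + q) / 2) = G (1 / 2) - G 0.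
  apply: segint_is; exists (fun w => G (w / 2)); last by rewrite mul0r.
  move=> t /half01[t01 _]; have dGt := dG _ t01; rewrite hC in dGt.
  have d1 : cder realline (fun w => w / 2) t%:C (1 / 2 + t%:C * 0).
    by apply: cderM; [exact: cder_id|exact: cder_cst].
  apply: (cder_eq (@cder_comp R realline realline G (fun w => w / 2) _ _ _ dGt d1 rl2)).
  have -> : p + t%:C / 2 * (q - p) = p + t%:C * ((p + q) / 2 - p) by field.
  by field.
have -> : segint f ((p + q) / 2) q = G 1 - G (1 / 2).
  apply: segint_is; exists (fun w => G ((1 + w) / 2)).
    move=> t /half01[_ t01]; have dGt := dG _ t01.
    rewrite hC rmorphD rmorph1 in dGt.
    have d1 : cder realline (fun w => (1 + w) / 2) t%:C ((0 + 1) / 2 + (1 + t%:C) * 0).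
      apply: cderM; last exact: cder_cst.
      by apply: cderD; [exact: cder_cst|exact: cder_id].
    apply: (cder_eq (@cder_comp R realline realline G (fun w => (1 + w) / 2) _ _ _ dGt d1 _)).
      move=> _ /reallineP[u ->]; apply: rl2.
      by rewrite -(rmorphD (real_complex R) 1).
    have -> : p + (1 + t%:C) / 2 * (q - p) = (p + q) / 2 + t%:C * (q - (p + q) / 2) by field.
    by field.
  by rewrite addr0; congr (G _ - _); field.
by ring.
Qed.

Lemma segint_prim f F p q :
  (forall t : R, 0 <= t <= 1 -> cder setT F (p + t%:C * (q - p)) (f (p + t%:C * (q - p)))) ->
  segint f p q = F q - F p.
Proof.
move=> dF; apply: segint_is; exists (fun w => F (p + w * (q - p))).
  move=> t t01; apply: (@cder_comp R realline setT F (fun w => p + w * (q - p))) => //.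
    exact: dF.
  exact: cder_affine.
by congr (F _ - F _); ring.
Qed.

Lemma segint_affine (a b p q : C) :
  segint (fun w => a + b * w) p q = (a * q + b * q ^+ 2 / 2) - (a * p + b * p ^+ 2 / 2).
Proof.
have two0 : (2 : C) != 0 by rewrite pnatr_eq0.
rewrite (@segint_prim _ (fun w => a * w + b * w ^+ 2 / 2))// => t _.
set z := p + _.
have := cderD (cderM (cder_cst setT a z) (cder_id setT z))
  (cderM (cderM (cder_cst setT b z) (cderXn setT z 2)) (cder_cst setT 2^-1 z)).
by congr (cder _ _ _ _); rewrite /=; field.
Qed.

End SegmentIntegral.

(** * Cauchy's theorem *)

Section Cauchy.
Variable R : realType.
Local Notation C := (Cplx R).
Implicit Types (z w p q v a b : C) (f g F G : C -> C).

Definition quadint f p q r s : C :=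
  segint f p q + segint f q r + segint f r s + segint f s p.

(** The outer edges are halved, and each inner edge ending at [p11] is traversed once in each
    direction. *)
Lemma midpoint_quadint f (p00 p20 p22 p02 p10 p21 p12 p01 p11 : C) :
  p10 = (p00 + p20) / 2 -> p21 = (p20 + p22) / 2 -> p12 = (p02 + p22) / 2 ->
  p01 = (p00 + p02) / 2 ->
  cont_seg f p00 p20 -> cont_seg f p20 p22 -> cont_seg f p22 p02 -> cont_seg f p02 p00 ->
  cont_seg f p10 p11 -> cont_seg f p21 p11 -> cont_seg f p12 p11 -> cont_seg f p01 p11 ->
  quadint f p00 p20 p22 p02 =
  quadint f p00 p10 p11 p01 + quadint f p10 p20 p21 p11
  + quadint f p01 p11 p12 p02 + quadint f p11 p21 p22 p12.
Proof.
move=> e10 e21 e12 e01 c1 c2 c3 c4 d1 d2 d3 d4; rewrite /quadint.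
rewrite (segint_half c1 e10) (segint_half c2 e21).
rewrite (segint_half (m := p12) c3); last by rewrite e12 [p02 + _]addrC.
rewrite (segint_half (m := p01) c4); last by rewrite e01 [p00 + _]addrC.
rewrite (segint_rev d1) (segint_rev d2) (segint_rev d3) (segint_rev d4).
by ring.
Qed.

Section Goursat.
Variables (f : C -> C) (A B D E : C).
(** A bilinear image of the unit square, possibly degenerate. Horizontal and vertical lines go to
    straight segments, so the pieces of a subdivision again have polygonal boundary. *)
Let Gam (t s : R) : C := A + t%:C * B + s%:C * D + t%:C * s%:C * E.
Hypothesis df : forall t s : R, 0 <= t <= 1 -> 0 <= s <= 1 ->
  exists l, cder setT f (Gam t s) l.

Let Q x y h := quadint f (Gam x y) (Gam (x + h) y) (Gam (x + h) (y + h)) (Gam x (y + h)).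
Let L : R := cmod B + cmod D + cmod E + 1.

Let L0 : 0 < L. Proof. by rewrite ltr_wpDl// !addr_ge0 ?cmod_ge0. Qed.

Let cS t s : 0 <= t <= 1 -> 0 <= s <= 1 -> ccont setT f (Gam t s).
Proof. by move=> t01 s01; have [l] := df t01 s01; exact: cder_cont. Qed.

Let horiz (t1 t2 y u : R) : Gam t1 y + u%:C * (Gam t2 y - Gam t1 y) = Gam (t1 + u * (t2 - t1)) y.
Proof. by rewrite /Gam !(rmorphD, rmorphB, rmorphM) /=; ring. Qed.

Let vert (x s1 s2 u : R) : Gam x s1 + u%:C * (Gam x s2 - Gam x s1) = Gam x (s1 + u * (s2 - s1)).
Proof. by rewrite /Gam !(rmorphD, rmorphB, rmorphM) /=; ring. Qed.

Let conv (a b x y u : R) : a <= x <= b -> a <= y <= b -> 0 <= u <= 1 -> a <= x + u * (y - x) <= b.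
Proof. by move=> /andP[? ?] /andP[? ?] /andP[? ?]; apply/andP; split; nra. Qed.

Let dist (h c u v : R) : c <= u <= c + h -> c <= v <= c + h -> `|u - v| <= h.
Proof. by rewrite ler_norml => /andP[? ?] /andP[? ?]; apply/andP; split; lra. Qed.

Let ch t1 t2 y : 0 <= t1 <= 1 -> 0 <= t2 <= 1 -> 0 <= y <= 1 -> cont_seg f (Gam t1 y) (Gam t2 y).
Proof. by move=> h1 h2 h3 u u01; rewrite horiz; apply: cS => //; exact: conv. Qed.

Let cv x s1 s2 : 0 <= x <= 1 -> 0 <= s1 <= 1 -> 0 <= s2 <= 1 -> cont_seg f (Gam x s1) (Gam x s2).
Proof. by move=> h1 h2 h3 u u01; rewrite vert; apply: cS => //; exact: conv. Qed.

Let lip t s t' s' : 0 <= t <= 1 -> 0 <= s <= 1 -> 0 <= t' <= 1 -> 0 <= s' <= 1 ->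
  cmod (Gam t s - Gam t' s') <= L * (`|t - t'| + `|s - s'|).
Proof.
move=> /andP[t0 t1] /andP[s0 s1] /andP[t0' t1'] /andP[s0' s1'].
have -> : Gam t s - Gam t' s' = (t - t')%:C * (B + s%:C * E) + (s - s')%:C * (D + t'%:C * E).
  by rewrite /Gam !rmorphB /=; ring.
rewrite [L * _]mulrDr; apply: le_trans (cmodD _ _) _.
have bE (X : C) (u : R) : 0 <= u <= 1 -> cmod (X + u%:C * E) <= cmod X + cmod E.
  move=> /andP[u0 u1]; apply: le_trans (cmodD _ _) _; rewrite lerD2l cmodM cmod_real ger0_norm//.
  by rewrite ler_piMl ?cmod_ge0.
rewrite !cmodM !cmod_real lerD//.
  rewrite mulrC ler_wpM2r//; apply: le_trans (bE _ _ _) _; first by rewrite s0.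
  by rewrite /L; have := cmod_ge0 D; lra.
rewrite mulrC ler_wpM2r//; apply: le_trans (bE _ _ _) _; first by rewrite t0'.
by rewrite /L; have := cmod_ge0 B; lra.
Qed.

(** Goursat's argument: by bisection it is enough to bound the integral around small squares of side
    [h] by [e h^2]. Near a point, [f] is an affine function, whose contour integral vanishes, plus a
    remainder that is small compared with [h], and the contour has length of order [h]. *)
Lemma goursat : quadint f A (A + B) (A + B + D + E) (A + D) = 0.
Proof.
suff : forall e : R, 0 < e -> cmod (Q 0 0 1) <= e * 1 ^+ 2.
  move=> H; apply/eqP; rewrite -cmod_eq0 eq_le cmod_ge0 andbT.
  apply/ler_addgt0Pr => e /H; rewrite expr1n mulr1 add0r /Q add0r => H'.
  apply: le_trans H'; rewrite le_eqVlt; apply/orP; left; apply/eqP; congr cmod.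
  by rewrite /Gam !rmorph0 !rmorph1; congr quadint; ring.
move=> e e0.
pose P x y h := 0 <= x -> x + h <= 1 -> 0 <= y -> y + h <= 1 ->
   cmod (Q x y h) <= e * h ^+ 2.
suff : P 0 0 1 by apply; rewrite ?add0r.
apply: square_bisection => //.
- move=> x y h h0 P1 P2 P3 P4 x0 x1 y0 y1.
  have xh : x + h / 2 + h / 2 = x + h by field.
  have yh : y + h / 2 + h / 2 = y + h by field.
  have two0 : (2 : C) != 0 by rewrite pnatr_eq0.
  have hC : (h / 2)%:C = h%:C / 2 :> C by rewrite rmorphM fmorphV rmorph_nat.
  have mh y' : Gam (x + h / 2) y' = (Gam x y' + Gam (x + h) y') / 2.
    by rewrite /Gam !rmorphD /= hC; field.
  have mv x' : Gam x' (y + h / 2) = (Gam x' y + Gam x' (y + h)) / 2.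
    by rewrite /Gam !rmorphD /= hC; field.
  have X0 : 0 <= x <= 1 by lra.
  have X1 : 0 <= x + h / 2 <= 1 by lra.
  have X2 : 0 <= x + h <= 1 by lra.
  have Y0 : 0 <= y <= 1 by lra.
  have Y1 : 0 <= y + h / 2 <= 1 by lra.
  have Y2 : 0 <= y + h <= 1 by lra.
  rewrite /Q (midpoint_quadint (mh y) (mv (x + h)) (mh (y + h)) (mv x)
    (ch X0 X2 Y0) (cv X2 Y0 Y2) (ch X2 X0 Y2) (cv X0 Y2 Y0)
    (cv X1 Y0 Y1) (ch X2 X1 Y1) (cv X1 Y2 Y1) (ch X0 X1 Y1)).
  have -> : e * h ^+ 2 = e * (h / 2) ^+ 2 + e * (h / 2) ^+ 2 + e * (h / 2) ^+ 2 + e * (h / 2) ^+ 2.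
    by field.
  have h2 : 0 <= h / 2 by rewrite divr_ge0// ltW.
  have xh1 : x + h / 2 <= 1 by case/andP: X1.
  have yh1 : y + h / 2 <= 1 by case/andP: Y1.
  have xh0 : 0 <= x + h / 2 by rewrite addr_ge0.
  have yh0 : 0 <= y + h / 2 by rewrite addr_ge0.
  have {}P1 := P1 x0 xh1 y0 yh1.
  have {}P2 : cmod (Q (x + h / 2) y (h / 2)) <= e * (h / 2) ^+ 2 by apply: P2; rewrite ?xh.
  have {}P3 : cmod (Q x (y + h / 2) (h / 2)) <= e * (h / 2) ^+ 2 by apply: P3; rewrite ?yh.
  have {}P4 : cmod (Q (x + h / 2) (y + h / 2) (h / 2)) <= e * (h / 2) ^+ 2 by apply: P4; rewrite ?xh ?yh.
  rewrite /Q ?xh ?yh in P1 P2 P3 P4.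
  apply: le_trans (cmodD _ _) _; apply: lerD => //.
  apply: le_trans (cmodD _ _) _; apply: lerD => //.
  by apply: le_trans (cmodD _ _) _; apply: lerD.
- move=> a b a01 b01; rewrite !add0r in a01 b01.
  have [l dl] := df a01 b01; move/cder_eps : (dl) => dle.
  set z := Gam a b in dl dle.
  (* On each of the four edges the remainder is at most [e' * (2 L h)] and the length at most [L h],
     so that each edge contributes at most [e h^2 / 4]. *)
  set e' := e / (8 * L ^+ 2).
  have L20 : 0 < 8 * L ^+ 2 by rewrite mulr_gt0// exprn_gt0.
  have e'0 : 0 < e' by rewrite divr_gt0.
  have [//|d d0 hd] := dle e'.
  exists (d / (2 * L)); first by rewrite divr_gt0// mulr_gt0.
  move=> x y h /andP[h0 hd'] xa yb x0 x1 y0 y1 _ _ _ _; rewrite add0r in x1 y1.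
  rewrite ltr_pdivlMr ?mulr_gt0// in hd'.
  pose r w := f w - f z - l * (w - z).
  pose k w := (f z - l * z) + l * w.
  have fE : f = fun w => r w + k w by apply/funext => w; rewrite /r /k; ring.
  have ck w : ccont setT k w.
    apply: ccontD; first exact: ccont_cst.
    by apply: ccontM; [exact: ccont_cst|exact: ccont_id].
  have cr t s : 0 <= t <= 1 -> 0 <= s <= 1 -> ccont setT r (Gam t s).
    move=> t01 s01; apply: ccontD; first (apply: ccontD; first exact: cS).
      exact: ccont_cst.
    apply: ccontN; apply: ccontM; first exact: ccont_cst.
    by apply: ccontD; [exact: ccont_id|exact: ccont_cst].
  have xP t : x <= t <= x + h -> 0 <= t <= 1.
    by move=> /andP[xt tx]; rewrite (le_trans x0)//= (le_trans tx).
  have yP s : y <= s <= y + h -> 0 <= s <= 1.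
    by move=> /andP[ys sy]; rewrite (le_trans y0)//= (le_trans sy).
  have rb t s : x <= t <= x + h -> y <= s <= y + h -> cmod (r (Gam t s)) <= e' * (L * (2 * h)).
    move=> tx sy.
    have zz : cmod (Gam t s - z) <= L * (2 * h).
      apply: le_trans (lip (xP t tx) (yP s sy) (xP a xa) (yP b yb)) _.
      by rewrite ler_pM2l// mulr2n mulrDl mul1r; apply: lerD; [exact: dist tx xa|exact: dist sy yb].
    apply: le_trans (hd _ _ _) _ => //; last by rewrite ler_wpM2l// ltW.
    by apply: le_lt_trans zz _; rewrite mulrCA [L * h]mulrC mulrCA.
  have edge t s t' s' : x <= t <= x + h -> y <= s <= y + h -> x <= t' <= x + h -> y <= s' <= y + h ->
     (forall u, Gam t s + u%:C * (Gam t' s' - Gam t s) = Gam (t + u * (t' - t)) (s + u * (s' - s))) ->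
     `|t' - t| + `|s' - s| <= h ->
     segint f (Gam t s) (Gam t' s') = segint r (Gam t s) (Gam t' s') + segint k (Gam t s) (Gam t' s')
     /\ cmod (segint r (Gam t s) (Gam t' s')) <= e * h ^+ 2 / 4.
    move=> tx sy tx' sy' path len.
    have crpq : cont_seg r (Gam t s) (Gam t' s').
      by move=> u u01; rewrite path; apply: cr; [apply: xP|apply: yP]; exact: conv.
    split; first by rewrite {1}fE segintD.
    apply: le_trans (@segint_bound _ _ _ _ (e' * (L * (2 * h))) crpq _) _.
      by move=> u u01; rewrite path; apply: rb; exact: conv.
    have -> : e * h ^+ 2 / 4 = e' * (L * (2 * h)) * (L * h).
      by rewrite /e'; field; rewrite gt_eqF.
    rewrite ler_wpM2l//; first by rewrite ltW// mulr_gt0// mulr_gt0// mulr_gt0.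
    by apply: le_trans (lip (xP _ tx') (yP _ sy') (xP _ tx) (yP _ sy)) _; rewrite ler_pM2l.
  have hor t t' s u : Gam t s + u%:C * (Gam t' s - Gam t s) = Gam (t + u * (t' - t)) (s + u * (s - s)).
    by rewrite horiz subrr mulr0 addr0.
  have ver t s s' u : Gam t s + u%:C * (Gam t s' - Gam t s) = Gam (t + u * (t - t)) (s + u * (s' - s)).
    by rewrite vert subrr mulr0 addr0.
  have mem0 (c : R) : c <= c <= c + h by rewrite lexx lerDl ltW.
  have mem1 (c : R) : c <= c + h <= c + h by rewrite lexx lerDl ltW.
  have l0 (u v w : R) : `|u - v| <= h -> `|u - v| + `|w - w| <= h by rewrite subrr normr0 addr0.
  have l1 (u v w : R) : `|u - v| <= h -> `|w - w| + `|u - v| <= h by rewrite subrr normr0 add0r.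
  have [E1 B1] := edge _ _ _ _ (mem0 x) (mem0 y) (mem1 x) (mem0 y) (hor _ _ _) (l0 _ _ _ (dist (mem1 x) (mem0 x))).
  have [E2 B2] := edge _ _ _ _ (mem1 x) (mem0 y) (mem1 x) (mem1 y) (ver _ _ _) (l1 _ _ _ (dist (mem1 y) (mem0 y))).
  have [E3 B3] := edge _ _ _ _ (mem1 x) (mem1 y) (mem0 x) (mem1 y) (hor _ _ _) (l0 _ _ _ (dist (mem0 x) (mem1 x))).
  have [E4 B4] := edge _ _ _ _ (mem0 x) (mem1 y) (mem0 x) (mem0 y) (ver _ _ _) (l1 _ _ _ (dist (mem0 y) (mem1 y))).
  rewrite /Q /quadint E1 E2 E3 E4 /k !segint_affine.
  set R1 := segint r _ _ in B1 *; set R2 := segint r _ _ in B2 *.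
  set R3 := segint r _ _ in B3 *; set R4 := segint r _ _ in B4 *.
  rewrite (_ : _ + _ = R1 + R2 + R3 + R4); last by ring.
  have -> : e * h ^+ 2 = e * h ^+ 2 / 4 + e * h ^+ 2 / 4 + e * h ^+ 2 / 4 + e * h ^+ 2 / 4 by field.
  apply: le_trans (cmodD _ _) _; apply: lerD => //.
  apply: le_trans (cmodD _ _) _; apply: lerD => //.
  by apply: le_trans (cmodD _ _) _; apply: lerD.
Qed.

End Goursat.

End Cauchy.

(** * Cauchy's formula and estimates on a diamond *)

Section CauchyDiamond.
Variable R : realType.
Local Notation C := (Cplx R).
Implicit Types (z w p q v b : C) (f g F G : C -> C).

Section Fixed.
Variables (a : C) (rho : R).
Hypothesis rho0 : 0 < rho.

Lemma quarter_le : rho / 4 <= rho. Proof. by have := rho0; lra. Qed.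

(* A square standing on a vertex, so that its edges can be indexed by the powers
   of 'i. *)
Definition vertex k : C := a + rho%:C * 'i%C ^+ k.
Definition edgept k (t : R) : C := vertex k + t%:C * (vertex k.+1 - vertex k).
Definition dint f : C := \sum_(k < 4) segint f (vertex k) (vertex k.+1).
Definition cont_diamond f := forall k, cont_seg f (vertex k) (vertex k.+1).

Lemma vertex4 : vertex 4 = vertex 0.
Proof. by rewrite /vertex (exprM _ 2 2) sqr_i sqrrN !expr1n expr0. Qed.

Lemma edgeptE k t : edgept k t - a = rho%:C * 'i%C ^+ k * ((1 - t) +i* t).
Proof.
have -> : (1 - t) +i* t = 1 - t%:C + t%:C * 'i%C :> C.
  by apply/eqP; rewrite eq_complex /=; apply/andP; split; apply/eqP; ring.
by rewrite /edgept /vertex exprS; ring.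
Qed.

Lemma edge_vec k : vertex k.+1 - vertex k = rho%:C * 'i%C ^+ k * ('i%C - 1).
Proof. by rewrite /vertex exprS; ring. Qed.

Lemma cmod_ik k : cmod ('i%C ^+ k : C) = 1.
Proof. by rewrite cmodX cmod_i expr1n. Qed.

(** The true distance of the edges from the centre is [rho / sqrt 2]; the weaker [rho / 2] keeps the
    constants rational. Points within [rho / 4] of the centre then stay at distance [rho / 4] from
    the contour. *)
Lemma edgept_norm k t : 0 <= t <= 1 -> rho / 2 <= cmod (edgept k t - a) <= rho.
Proof.
move=> /andP[t0 t1]; rewrite edgeptE !cmodM cmod_ik mulr1 cmod_real gtr0_norm//.
have c0 := cmod_ge0 ((1 - t) +i* t).
have c2 : cmod ((1 - t) +i* t) ^+ 2 = (1 - t) ^+ 2 + t ^+ 2 by rewrite -absqE.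
have c1 : cmod ((1 - t) +i* t) <= 1.
  by rewrite -(@ler_pXn2r _ 2) ?nnegrE// c2 expr1n; nra.
have ch : 1 / 2 <= cmod ((1 - t) +i* t).
  by rewrite -(@ler_pXn2r _ 2) ?nnegrE ?divr_ge0// c2; have := sqr_ge0 (t - 1 / 2); nra.
apply/andP; split; last by rewrite ler_piMr// ltW.
by rewrite ler_pM2l//; lra.
Qed.

Lemma edge_len k : cmod (vertex k.+1 - vertex k) <= 2 * rho.
Proof.
rewrite edge_vec !cmodM cmod_ik mulr1 cmod_real gtr0_norm// mulrC ler_pM2r//.
by apply: le_trans (cmodD _ _) _; rewrite cmodN cmod_i cmod1; lra.
Qed.

Lemma edgept_dist k t b : 0 <= t <= 1 -> cmod (b - a) < rho / 4 ->
  rho / 4 <= cmod (edgept k t - b) /\ edgept k t - b != 0.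
Proof.
move=> /(edgept_norm k)/andP[h1 h2] hb.
have := cmodB (edgept k t - a) (b - a).
rewrite (_ : _ - _ - _ = edgept k t - b); last by ring.
by move=> h3; split; [lra|rewrite -cmod_gt0; lra].
Qed.

Lemma dint_bound f M : cont_diamond f ->
  (forall k t, (k < 4)%N -> 0 <= t <= 1 -> cmod (f (edgept k t)) <= M) ->
  cmod (dint f) <= 8 * rho * M.
Proof.
move=> cf fM.
have M0 : 0 <= M by apply: le_trans (cmod_ge0 _) (fM 0%N 0 _ _); rewrite ?lexx ?ler01.
have b k : (k < 4)%N -> cmod (segint f (vertex k) (vertex k.+1)) <= 2 * rho * M.
  move=> k4; apply: le_trans (segint_bound (cf k) (fun t => fM k t k4)) _.
  by rewrite mulrC ler_wpM2r// edge_len.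
have -> : 8 * rho * M = 2 * rho * M + 2 * rho * M + 2 * rho * M + 2 * rho * M by ring.
rewrite /dint !big_ord_recr big_ord0 /= add0r.
apply: le_trans (cmodD _ _) _; apply: lerD; last exact: b.
apply: le_trans (cmodD _ _) _; apply: lerD; last exact: b.
by apply: le_trans (cmodD _ _) _; apply: lerD; exact: b.
Qed.

Lemma dint_ext f g : (forall k t, 0 <= t <= 1 -> f (edgept k t) = g (edgept k t)) ->
  dint f = dint g.
Proof. by move=> fg; apply: eq_bigr => k _; apply: segint_ext => t; exact: fg. Qed.

Lemma dintD f g : cont_diamond f -> cont_diamond g ->
  dint (fun z => f z + g z) = dint f + dint g.
Proof. by move=> cf cg; rewrite /dint -big_split /=; apply: eq_bigr => k _; exact: segintD. Qed.

Lemma dintZ c f : cont_diamond f -> dint (fun z => c * f z) = c * dint f.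
Proof. by move=> cf; rewrite /dint mulr_sumr; apply: eq_bigr => k _; exact: segintZ. Qed.

Lemma cont_diamondM f g : cont_diamond f -> cont_diamond g -> cont_diamond (fun z => f z * g z).
Proof. by move=> cf cg k t t01; apply: ccontM; [exact: cf|exact: cg]. Qed.

Lemma cont_diamondD f g : cont_diamond f -> cont_diamond g -> cont_diamond (fun z => f z + g z).
Proof. by move=> cf cg k t t01; apply: ccontD; [exact: cf|exact: cg]. Qed.

Lemma dintB f g : cont_diamond f -> cont_diamond g ->
  dint (fun z => f z - g z) = dint f - dint g.
Proof.
move=> cf cg; rewrite -[- dint g]mulN1r -dintZ// -dintD//.
  by apply: dint_ext => k t _; rewrite mulN1r.
by move=> k t t01; apply: ccontM; [exact: ccont_cst|exact: cg].
Qed.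

Lemma cont_diamond_cst c : cont_diamond (fun=> c).
Proof. by move=> k t t01; exact: ccont_cst. Qed.

Lemma cont_diamond_ker b : cmod (b - a) < rho / 4 -> cont_diamond (fun z => (z - b)^-1).
Proof.
move=> hb k t t01; apply: ccontV; last by have [] := edgept_dist k t01 hb.
by apply: ccontD; [exact: ccont_id|exact: ccont_cst].
Qed.

(** The diamond is contracted towards [b] by the ratio [ep]. The region in between consists of four
    quadrilaterals, on which [goursat] applies, and the integral around the contracted diamond is of
    order [ep] because [h] is bounded near [b]. *)
Lemma cauchy_zero h b (M delta : R) : cmod (b - a) < rho / 4 ->
  (forall z, cmod (z - a) <= rho -> z != b -> exists l, cder setT h z l) ->
  0 < delta -> (forall z, z != b -> cmod (z - b) < delta -> cmod (h z) <= M) ->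
  dint h = 0.
Proof.
move=> hb dh d0 hM; apply/eqP; rewrite -cmod_eq0 eq_le cmod_ge0 andbT.
apply/ler_addgt0Pr => e e0; rewrite add0r.
pose M' := `|M| + 1; have M'0 : 0 < M' by rewrite ltr_wpDl.
(* The second entry puts the contracted diamond where [h] is bounded by [M]; the third makes its
   integral, at most [8 rho M' ep], at most [e]. *)
pose ep : R := Num.min (1 / 2) (Num.min (delta / (4 * rho)) (e / (8 * rho * M'))).
have ep0 : 0 < ep.
  by rewrite !lt_min !divr_gt0// !mulr_gt0.
have ep1 : ep <= 1 / 2 by rewrite ge_min lexx.
have epd : ep * (2 * rho) < delta.
  have : ep <= delta / (4 * rho) by rewrite !ge_min lexx orbT.
  by rewrite ler_pdivlMr ?mulr_gt0// => h1; nra.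
have epe : 8 * rho * (M' * ep) <= e.
  have : ep <= e / (8 * rho * M') by rewrite !ge_min lexx !orbT.
  by rewrite ler_pdivlMr ?mulr_gt0// mulrC mulrA.
pose q k := b + ep%:C * (vertex k - b).
have GE k (t s : R) : q k + t%:C * ((1 - ep)%:C * (vertex k - b)) + s%:C * (ep%:C * (vertex k.+1 - vertex k))
   + t%:C * s%:C * ((1 - ep)%:C * (vertex k.+1 - vertex k))
   = b + (ep + (1 - ep) * t)%:C * (edgept k s - b).
  by rewrite /q /edgept !(rmorphD, rmorphB, rmorphM, rmorph1) /=; ring.
have dE k (u s : R) : 0 <= s <= 1 -> 0 < u <= 1 ->
   let z := b + u%:C * (edgept k s - b) in
   [/\ cmod (z - a) <= rho, z != b & cmod (z - b) <= u * (2 * rho)].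
  move=> s01 /andP[u0 u1] z; have [h1 h2] := edgept_dist k s01 hb.
  have /andP[h3 h4] := edgept_norm k s01.
  have u00 : u%:C != 0 :> C by rewrite -cmod_gt0 cmod_real gtr0_norm.
  split.
  - have -> : z - a = (1 - u)%:C * (b - a) + u%:C * (edgept k s - a).
      by rewrite /z rmorphB rmorph1 /=; ring.
    apply: le_trans (cmodD _ _) _; rewrite !cmodM !cmod_real !ger0_norm; [|lra|lra].
    by have := cmod_ge0 (b - a); nra.
  - rewrite /z -subr_eq0 addrAC subrr add0r mulf_neq0//.
  - rewrite /z addrAC subrr add0r cmodM cmod_real gtr0_norm// ler_pM2l//.
    have := cmodD (edgept k s - a) (a - b); rewrite (cmodC a) addrA subrK => h5.
    by lra.
have cE k (t s : R) : 0 <= s <= 1 -> 0 <= t <= 1 ->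
    ccont setT h (b + (ep + (1 - ep) * t)%:C * (edgept k s - b)).
  move=> s01 t01; have [|h1 h2 _] := dE k (ep + (1 - ep) * t) s s01; first nra.
  by have [l] := dh _ h1 h2; exact: cder_cont.
have cout k : cont_seg h (vertex k) (vertex k.+1).
  move=> s s01; have := cE k 1 s s01; rewrite lexx ler01 => /(_ isT).
  congr (ccont _ _ _).
  by rewrite mulr1 [ep + _]addrC subrK rmorph1 mul1r addrC subrK.
have cin k : cont_seg h (q k) (q k.+1).
  move=> s s01; have := cE k 0 s s01; rewrite lexx ler01 => /(_ isT).
  rewrite mulr0 addr0; congr (ccont _ _ _).
  by rewrite /q /edgept; ring.
have crad k : cont_seg h (q k) (vertex k).
  move=> s s01; have := cE k s 0; rewrite lexx ler01 => /(_ isT s01).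
  congr (ccont _ _ _).
  by rewrite /q /edgept !(rmorphD, rmorphB, rmorphM, rmorph1, rmorph0) /=; ring.
have gz k : segint h (vertex k) (vertex k.+1) =
   segint h (q k) (q k.+1) + (segint h (q k.+1) (vertex k.+1) - segint h (q k) (vertex k)).
  have := @goursat R h (q k) ((1 - ep)%:C * (vertex k - b)) (ep%:C * (vertex k.+1 - vertex k))
    ((1 - ep)%:C * (vertex k.+1 - vertex k)) _.
  have -> : q k + (1 - ep)%:C * (vertex k - b) = vertex k by rewrite /q rmorphB rmorph1; ring.
  have -> : vertex k + ep%:C * (vertex k.+1 - vertex k) + (1 - ep)%:C * (vertex k.+1 - vertex k) = vertex k.+1.
    by rewrite rmorphB rmorph1; ring.
  have -> : q k + ep%:C * (vertex k.+1 - vertex k) = q k.+1 by rewrite /q; ring.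
  rewrite /quadint (segint_rev (crad k.+1)) (segint_rev (cin k)) => H.
  apply/eqP; rewrite -subr_eq0; apply/eqP; rewrite -[RHS]H; first by ring.
  move=> t s t01 s01; rewrite GE.
  by have [|h1 h2 _] := dE k (ep + (1 - ep) * t) s s01; [nra|exact: dh].
(* The radial edges telescope around the diamond, since [vertex 4] is [vertex 0]. *)
have -> : dint h = \sum_(k < 4) segint h (q k) (q k.+1).
  rewrite /dint (eq_bigr _ (fun (k : 'I_4) _ => gz k)) big_split /=.
  rewrite -[RHS]addr0; congr (_ + _).
  rewrite !big_ord_recr big_ord0 /= add0r.
  have -> : q 4 = q 0%N by rewrite /q vertex4.
  by rewrite vertex4; ring.
have bq k : cmod (segint h (q k) (q k.+1)) <= 2 * rho * (M' * ep).
  apply: le_trans (segint_bound (M := M') (cin k) _) _.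
    move=> s s01; have -> : q k + s%:C * (q k.+1 - q k) = b + ep%:C * (edgept k s - b).
      by rewrite /q /edgept; ring.
    have [|h1 h2 h3] := dE k ep s s01; first by rewrite ep0; lra.
    apply: le_trans (hM _ h2 _) _; first exact: le_lt_trans epd.
    by rewrite /M'; have := ler_norm M; lra.
  have -> : q k.+1 - q k = ep%:C * (vertex k.+1 - vertex k) by rewrite /q; ring.
  rewrite cmodM cmod_real gtr0_norm// mulrA mulrC ler_wpM2r ?edge_len// mulr_ge0 ?ltW//.
apply: le_trans epe.
have -> : 8 * rho * (M' * ep) = 2 * rho * (M' * ep) + 2 * rho * (M' * ep) + 2 * rho * (M' * ep) + 2 * rho * (M' * ep) by ring.
rewrite !big_ord_recr big_ord0 /= add0r.
apply: le_trans (cmodD _ _) _; apply: lerD; last exact: bq.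
apply: le_trans (cmodD _ _) _; apply: lerD; last exact: bq.
by apply: le_trans (cmodD _ _) _; apply: lerD; exact: bq.
Qed.

(** Cauchy integrals without normalisation: rather than evaluating the integral of [1 / (z - b)] as
    [2 pi i], one divides by [ck (fun=> 1) b], whose modulus is bounded below by [winding_norm]. *)
Definition ck f b : C := dint (fun z => f z * (z - b)^-1).
Definition ck2 f b : C := dint (fun z => f z * (z - b)^-1 * (z - b)^-1).

Section KernelDerivative.
Variable b : C.
Hypothesis hb : cmod (b - a) < rho / 4.

(** The difference quotient of [f] at [b] is holomorphic off [b] and bounded near it, so that
    [cauchy_zero] applies to it. *)
Lemma cauchy_formula f : (forall z, cmod (z - a) <= rho -> exists l, cder setT f z l) ->
  ck f b = f b * ck (fun=> 1) b.
Proof.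
move=> df; have cf : cont_diamond f.
  move=> k t t01; have /andP[_ h1] := edgept_norm k t01.
  by have [l] := df _ h1; exact: cder_cont.
have [l dl] : exists l, cder setT f b l by apply: df; apply: ltW; exact: lt_le_trans hb quarter_le.
have [d d0 hd] : exists2 d : R, 0 < d & forall z, z != b -> cmod (z - b) < d ->
    cmod ((f z - f b) * (z - b)^-1) <= cmod l + 1.
  have /cder_eps /(_ 1 ltr01)[d d0 hd] := dl; exists d => // z zb /(hd z I).
  have zb0 : 0 < cmod (z - b) by rewrite cmod_gt0 subr_eq0.
  rewrite mul1r => h1; rewrite cmodM cmodV ler_pdivrMr// mulrDl mul1r.
  rewrite -[f z - f b](subrK (l * (z - b))) addrC (le_trans (cmodD _ _))//.
  by rewrite cmodM lerD2l.
have ck1 := cont_diamond_ker hb.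
have : dint (fun z => (f z - f b) * (z - b)^-1) = 0.
  apply: (cauchy_zero hb _ d0 hd) => z /df[m dm] zb.
  eexists; apply: cderM.
    by apply: cderD; [exact: dm|exact: (cder_cst _ (- f b))].
  apply: cderV; last by rewrite subr_eq0.
  by apply: cderD; [exact: cder_id|exact: (cder_cst _ (- b))].
have -> : (fun z => (f z - f b) * (z - b)^-1) = fun z => f z * (z - b)^-1 + - f b * (1 * (z - b)^-1).
  by apply/funext => z; ring.
rewrite dintD; [|exact: cont_diamondM|].
  rewrite dintZ; last by apply: cont_diamondM => //; exact: cont_diamond_cst.
  by rewrite -/(ck f b) -/(ck (fun=> 1) b) => /eqP; rewrite mulNr subr_eq0 => /eqP.
apply: cont_diamondM; first exact: cont_diamond_cst.
by apply: cont_diamondM => //; exact: cont_diamond_cst.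
Qed.

(** Each edge contributes at least [1 / 4]. Multiplied by ['i], the integrand has real part
    [- (x + y) / (x^2 + y^2)], where [x +i* y] is the rescaled vector from [b] to the edge, and
    [x^2 + y^2 <= 4 (x + y)] there. *)
Lemma winding_ge1 : 1 <= complex.Im (ck (fun=> 1) b).
Proof.
have side k : 1 / 4 <= complex.Im (segint (fun z => 1 * (z - b)^-1) (vertex k) (vertex k.+1)).
  have : cont_seg (fun z => 1 * (z - b)^-1) (vertex k) (vertex k.+1).
    by apply: cont_diamondM; [exact: cont_diamond_cst|exact: cont_diamond_ker].
  move=> /segintP[G dG ->].
  have H : complex.Re ('i%C * (G 1 - G 0)) <= - (1 / 4).
    apply: (@primitive_Re_le R (fun w => 1 * (vertex k + w * (vertex k.+1 - vertex k) - b)^-1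
       * (vertex k.+1 - vertex k)) G 'i%C _ dG) => t t01; rewrite mul1r -/(edgept k t).
    have ik0 : rho%:C * 'i%C ^+ k != 0 :> C.
      by rewrite -cmod_gt0 cmodM cmod_ik mulr1 cmod_real gtr0_norm.
    (* The offset of [b] from the centre, scaled and rotated so that all four edges become the same
       segment [(1 - t) +i* t]. *)
    pose be := (a - b) / (rho%:C * 'i%C ^+ k).
    have beb : cmod be < 1 / 4.
      rewrite /be cmodM cmodV cmodM cmod_ik mulr1 cmod_real gtr0_norm// ltr_pdivrMr//.
      by rewrite cmodC (lt_le_trans hb)//; lra.
    have -> : edgept k t - b = rho%:C * 'i%C ^+ k * (((1 - t) +i* t) + be).
      by rewrite mulrDr -edgeptE /be [_ * (_ / _)]mulrC divfK//; ring.
    rewrite edge_vec invfM mulrACA mulVf// mul1r.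
    have h1 := Re_le_cmod be; have h2 := Im_le_cmod be.
    move: h1 h2 beb; case: (be) => b1 b2 /= h1 h2 beb.
    have {h1 h2 beb} : - (1 / 4) < b1 < 1 / 4 /\ - (1 / 4) < b2 < 1 / 4.
      by rewrite -!ltr_norml; split; apply: le_lt_trans beb.
    move=> [/andP[b11 b12] /andP[b21 b22]]; move: t01 => /andP[t0 t1].
    rewrite -!/(GRing.mul _ _) /=.
    set x := 1 - t + b1; set y := t + b2.
    have xb : - (1 / 4) <= x <= 5 / 4 by rewrite /x; lra.
    have yb : - (1 / 4) <= y <= 5 / 4 by rewrite /y; lra.
    have xyb : 1 / 2 <= x + y by rewrite /x /y; lra.
    clearbody x y; move: xb yb => /andP[x1 x2] /andP[y1 y2].
    have X : 0 <= (5 / 4 - x) * (x + 1 / 4) by rewrite mulr_ge0//; lra.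
    have Y : 0 <= (5 / 4 - y) * (y + 1 / 4) by rewrite mulr_ge0//; lra.
    have D0 : 0 < x ^+ 2 + y ^+ 2 by have := sqr_ge0 (x - y); nra.
    have D1 : x ^+ 2 + y ^+ 2 <= 4 * (x + y) by nra.
    rewrite [leLHS](_ : _ = - ((x + y) / (x ^+ 2 + y ^+ 2))); last first.
      by field; rewrite gt_eqF.
    rewrite lerN2 ler_pdivlMr//; lra.
  move: H; case: (G 1 - G 0) => x y /=; lra.
rewrite /ck /dint !big_ord_recr big_ord0 /= add0r !raddfD /=.
have := side 0%N; have := side 1%N; have := side 2%N; have := side 3%N; lra.
Qed.

Lemma winding_neq0 : ck (fun=> 1) b != 0.
Proof. by apply/eqP => H; have := winding_ge1; rewrite H /= ler10. Qed.

Lemma winding_norm : 1 <= cmod (ck (fun=> 1) b).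
Proof. by apply: le_trans winding_ge1 _; apply: le_trans (ler_norm _) (Im_le_cmod _). Qed.

(** The factor [32] is the length bound [8 rho] times the kernel bound [4 / rho]. The values of [f]
    are only compared with [M] on an annulus around the contour, which matters when [f] is a
    quotient by a power of [z - a]. *)
Lemma cauchy_bound f M : (forall z, cmod (z - a) <= rho -> exists l, cder setT f z l) ->
  (forall z, rho / 2 <= cmod (z - a) <= rho -> cmod (f z) <= M) -> cmod (f b) <= 32 * M.
Proof.
move=> df fM; have cf : cont_diamond f.
  move=> k t t01; have /andP[_ h1] := edgept_norm k t01.
  by have [l] := df _ h1; exact: cder_cont.
have M0 : 0 <= M.
  apply: le_trans (cmod_ge0 _) (fM (edgept 0 0) _); apply: edgept_norm.
  by rewrite lexx ler01.
have : cmod (ck f b) <= 8 * rho * (M * (4 / rho)).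
  apply: dint_bound; first by apply: cont_diamondM => //; exact: cont_diamond_ker.
  move=> k t _ t01; have [h1 h2] := edgept_dist k t01 hb.
  rewrite cmodM cmodV ler_pM ?invr_ge0 ?cmod_ge0//; first exact: fM (edgept_norm k t01).
  rewrite -[4 / rho]invf_div lef_pV2// posrE; first by rewrite cmod_gt0.
  by rewrite divr_gt0.
rewrite cauchy_formula// cmodM.
have -> : 8 * rho * (M * (4 / rho)) = 32 * M by field; rewrite gt_eqF.
apply: le_trans; rewrite -[leLHS]mulr1 ler_wpM2l ?cmod_ge0//; exact: winding_norm.
Qed.

(** The resolvent identity of the kernels. It reduces differentiation under the integral sign to
    algebra and to uniform bounds on Cauchy integrals. *)
Lemma ck_resolvent f b' : cont_diamond f -> cmod (b' - a) < rho / 4 ->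
  ck f b' - ck f b = (b' - b) * ck (fun z => f z * (z - b)^-1) b'.
Proof.
move=> cf hb'; rewrite /ck.
have c1 := cont_diamondM cf (cont_diamond_ker hb').
have c2 := cont_diamondM cf (cont_diamond_ker hb).
rewrite -dintB// -dintZ; last first.
  by apply: cont_diamondM => //; exact: cont_diamond_ker.
apply: dint_ext => k t t01.
have [_ n1] := edgept_dist k t01 hb; have [_ n2] := edgept_dist k t01 hb'.
by field; apply/andP.
Qed.

Lemma ck2_resolvent f b' : cont_diamond f -> cmod (b' - a) < rho / 4 ->
  ck2 f b' - ck2 f b = (b' - b) *
   (ck2 (fun z => f z * (z - b)^-1) b' + ck (fun z => f z * (z - b)^-1 * (z - b)^-1) b').
Proof.
move=> cf hb'; rewrite /ck /ck2.
have k1 := cont_diamond_ker hb'; have k2 := cont_diamond_ker hb.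
have c1 := cont_diamondM (cont_diamondM cf k1) k1.
have c2 := cont_diamondM (cont_diamondM cf k2) k2.
have d1 := cont_diamondM (cont_diamondM (cont_diamondM cf k2) k1) k1.
have d2 := cont_diamondM (cont_diamondM (cont_diamondM cf k2) k2) k1.
rewrite -dintB// -dintD// -dintZ; last exact: cont_diamondD.
apply: dint_ext => k t t01.
have [_ n1] := edgept_dist k t01 hb; have [_ n2] := edgept_dist k t01 hb'.
by field; apply/andP.
Qed.

Lemma cont_diamond_bounded f : cont_diamond f ->
  exists2 M, 0 < M & forall k t, (k < 4)%N -> 0 <= t <= 1 -> cmod (f (edgept k t)) <= M.
Proof.
move=> cf.
have ex k : exists M : R, forall t : R, 0 <= t <= 1 -> cmod (f (edgept k t)) <= M.
  have [|t t01 tM] := @EVT_max R (fun t : R => cmod (f (edgept k t))) 0 1 ler01.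
    apply: continuous_in_subspaceT => t /[!inE]/= /[!in_itv]/= t01.
    apply/cvgrPdist_lt => e e0; have [d d0 hd] := cf k t t01 e e0.
    have L0 : 0 < cmod (vertex k.+1 - vertex k) + 1 by rewrite ltr_wpDl ?cmod_ge0.
    near=> s.
    have sd : `|t - s| < d / (cmod (vertex k.+1 - vertex k) + 1).
      by near: s; apply: cvgr_dist_lt => //; rewrite divr_gt0.
    have := hd (edgept k s) I.
    have -> : edgept k s - (vertex k + t%:C * (vertex k.+1 - vertex k)) = (s - t)%:C * (vertex k.+1 - vertex k).
      by rewrite /edgept rmorphB /=; ring.
    rewrite cmodM cmod_real distrC.
    move: sd; rewrite ltr_pdivlMr// => sd.
    have sd' : `|t - s| * cmod (vertex k.+1 - vertex k) < d.
      by apply: le_lt_trans sd; rewrite ler_wpM2l// lerDl.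
    move=> /(_ sd'); apply: le_lt_trans.
    rewrite ler_norml; have := cmodB (f (edgept k s)) (f (edgept k t)).
    have := cmodB (f (edgept k t)) (f (edgept k s)).
    by rewrite (cmodC (f (edgept k t))) -/(edgept k t); lra.
  by exists (cmod (f (edgept k t))) => s s01; apply: tM; rewrite in_itv.
have [M0 h0] := ex 0%N; have [M1 h1] := ex 1%N; have [M2 h2] := ex 2%N; have [M3 h3] := ex 3%N.
exists (`|M0| + `|M1| + `|M2| + `|M3| + 1); first by rewrite ltr_wpDl// !addr_ge0.
have n0 := normr_ge0 M0; have n1 := normr_ge0 M1; have n2 := normr_ge0 M2; have n3 := normr_ge0 M3.
have m0 := ler_norm M0; have m1 := ler_norm M1; have m2 := ler_norm M2; have m3 := ler_norm M3.
case=> [|[|[|[|//]]]] t _ t01.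
- by apply: le_trans (h0 t t01) _; lra.
- by apply: le_trans (h1 t t01) _; lra.
- by apply: le_trans (h2 t t01) _; lra.
- by apply: le_trans (h3 t t01) _; lra.
Unshelve. all: by end_near. Qed.

Lemma cont_diamond_kerM f : cont_diamond f -> cont_diamond (fun z => f z * (z - b)^-1).
Proof. by move=> cf; apply: cont_diamondM => //; exact: cont_diamond_ker. Qed.

Lemma ker_bound k t : 0 <= t <= 1 -> cmod (edgept k t - b)^-1 <= 4 / rho.
Proof.
move=> t01; have [h1 h2] := edgept_dist k t01 hb.
by rewrite cmodV -[4 / rho]invf_div lef_pV2 // posrE ?cmod_gt0// divr_gt0.
Qed.

End KernelDerivative.

Lemma ck_bounded f : cont_diamond f ->
  exists K, forall b, cmod (b - a) < rho / 4 -> cmod (ck f b) <= K /\ cmod (ck2 f b) <= K.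
Proof.
move=> cf; have [M M0 fM] := cont_diamond_bounded cf.
have r0 : 0 <= 4 / rho by rewrite divr_ge0// ltW.
exists (8 * rho * (M * (4 / rho)) + 8 * rho * (M * (4 / rho) * (4 / rho))) => b hb.
have rho00 := ltW rho0; have M00 := ltW M0.
have b1 : cmod (ck f b) <= 8 * rho * (M * (4 / rho)).
  apply: dint_bound; first exact: cont_diamond_kerM.
  move=> k t k4 t01; rewrite cmodM ler_pM ?cmod_ge0//; first exact: fM.
  exact: ker_bound.
have b2 : cmod (ck2 f b) <= 8 * rho * (M * (4 / rho) * (4 / rho)).
  apply: dint_bound; first by do 2 apply: cont_diamond_kerM => //.
  move=> k t k4 t01; rewrite !cmodM ler_pM ?mulr_ge0 ?cmod_ge0//; last exact: ker_bound.
  by rewrite ler_pM ?cmod_ge0//; [exact: fM|exact: ker_bound].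
have p1 : 0 <= 8 * rho * (M * (4 / rho)) by exact: mulr_ge0 (mulr_ge0 (ler0n _ _) rho00) (mulr_ge0 M00 r0).
have p2 : 0 <= 8 * rho * (M * (4 / rho) * (4 / rho)) by exact: mulr_ge0 (mulr_ge0 (ler0n _ _) rho00) (mulr_ge0 (mulr_ge0 M00 r0) r0).
by split; [apply: le_trans b1 _; rewrite lerDl|apply: le_trans b2 _; rewrite lerDr].
Qed.

Lemma cder_quadratic F b l K : cmod (b - a) < rho / 4 ->
  (forall b', cmod (b' - a) < rho / 4 -> cmod (F b' - F b - l * (b' - b)) <= K * cmod (b' - b) ^+ 2) ->
  cder setT F b l.
Proof.
move=> hb H; apply/cder_eps => e e0.
have K0 : 0 < `|K| + 1 by rewrite ltr_wpDl.
exists (Num.min (rho / 4 - cmod (b - a)) (e / (`|K| + 1))).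
  by rewrite lt_min subr_gt0 hb divr_gt0.
move=> w _; rewrite lt_min => /andP[h1]; rewrite ltr_pdivlMr// => h2.
apply: le_trans (H w _) _.
  have := cmodD (w - b) (b - a); rewrite addrA subrK => h3.
  by apply: le_lt_trans h3 _; rewrite -ltrBrDr.
rewrite expr2 mulrA ler_wpM2r ?cmod_ge0// (le_trans _ (ltW h2))// mulrC ler_wpM2l ?cmod_ge0//.
by apply: le_trans (ler_norm K) _; rewrite lerDl.
Qed.

Lemma ck_cder f b : cont_diamond f -> cmod (b - a) < rho / 4 -> cder setT (ck f) b (ck2 f b).
Proof.
move=> cf hb; have cf1 := cont_diamond_kerM hb cf; have cf2 := cont_diamond_kerM hb cf1.
have [K HK] := ck_bounded cf2.
apply: (@cder_quadratic _ b _ K) => // b' hb'.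
rewrite (ck_resolvent hb cf hb') -/(ck (fun z => f z * (z - b)^-1) b).
rewrite (_ : _ - _ = (b' - b) * (ck (fun z => f z * (z - b)^-1) b' - ck (fun z => f z * (z - b)^-1) b)); last first.
  by have -> : ck (fun z => f z * (z - b)^-1) b = ck2 f b by []; ring.
rewrite (ck_resolvent hb cf1 hb') !cmodM expr2 mulrA mulrC ler_wpM2r ?mulr_ge0 ?cmod_ge0//.
by have [] := HK _ hb'.
Qed.

Lemma ck2_cder f b : cont_diamond f -> cmod (b - a) < rho / 4 -> exists l, cder setT (ck2 f) b l.
Proof.
move=> cf hb; have cf1 := cont_diamond_kerM hb cf; have cf2 := cont_diamond_kerM hb cf1.
have cf3 := cont_diamond_kerM hb cf2.
have [K1 HK1] := ck_bounded cf2; have [K2 HK2] := ck_bounded cf3.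
exists (ck2 (fun z => f z * (z - b)^-1) b + ck (fun z => f z * (z - b)^-1 * (z - b)^-1) b).
apply: (@cder_quadratic _ b _ (K1 + K2 + K2)) => // b' hb'.
rewrite (ck2_resolvent hb cf hb').
set A1 := ck2 _ b'; set A2 := ck _ b'; set B1 := ck2 _ b; set B2 := ck _ b.
rewrite (_ : _ - _ = (b' - b) * ((A1 - B1) + (A2 - B2))); last by ring.
rewrite /A1 /B1 /A2 /B2 (ck2_resolvent hb cf1 hb') (ck_resolvent hb cf2 hb') -mulrDr.
rewrite !cmodM expr2 mulrA mulrC ler_wpM2r ?mulr_ge0 ?cmod_ge0//.
have [_ h1] := HK1 _ hb'; have [h2 _] := HK2 _ hb'.
apply: le_trans (cmodD _ _) _; apply: lerD => //.
by apply: le_trans (cmodD _ _) _; apply: lerD.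
Qed.

End Fixed.

End CauchyDiamond.

(** * Holomorphic functions *)

Section HolomorphicFunctions.
Variable R : realType.
Local Notation C := (Cplx R).
Implicit Types (z w p q v a b : C) (f g F G : C -> C) (V : set C).

Definition holo V f := forall z, V z -> exists l, cder setT f z l.

Lemma holo_onE V f : holo_on V f <-> holo V f.
Proof. by split=> H z /H /derivable_cder. Qed.

Lemma holo_sub V W f : W `<=` V -> holo V f -> holo W f.
Proof. by move=> WV H z /WV; exact: H. Qed.

Lemma holo_cst V (c : C) : holo V (fun=> c).
Proof. by move=> z _; exists 0; exact: cder_cst. Qed.

Lemma holo_id V : holo V id.
Proof. by move=> z _; exists 1; exact: cder_id. Qed.

Lemma holoD V f g : holo V f -> holo V g -> holo V (fun z => f z + g z).
Proof. by move=> df dg z Vz; have [l] := df z Vz; have [m] := dg z Vz; eexists; apply: cderD; eauto. Qed.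

Lemma holoN V f : holo V f -> holo V (fun z => - f z).
Proof. by move=> df z Vz; have [l] := df z Vz; eexists; apply: cderN; eauto. Qed.

Lemma holoB V f g : holo V f -> holo V g -> holo V (fun z => f z - g z).
Proof. by move=> df dg; apply: holoD => //; exact: holoN. Qed.

Lemma holoM V f g : holo V f -> holo V g -> holo V (fun z => f z * g z).
Proof. by move=> df dg z Vz; have [l] := df z Vz; have [m] := dg z Vz; eexists; apply: cderM; eauto. Qed.

Lemma holoV V f : holo V f -> (forall z, V z -> f z != 0) -> holo V (fun z => (f z)^-1).
Proof.
by move=> df f0 z Vz; have [l] := df z Vz; eexists; apply: cderV; [eauto|exact: f0].
Qed.

Lemma holoX V f n : holo V f -> holo V (fun z => f z ^+ n).
Proof.
move=> df; elim: n => [|n IH].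
  by rewrite (_ : (fun z => _) = fun=> 1)//; exact: holo_cst.
by rewrite (_ : (fun z => _) = fun z => f z * f z ^+ n)//; [exact: holoM|apply/funext => z; rewrite exprS].
Qed.

Lemma holoXz V f (n : int) : holo V f -> (forall z, V z -> f z != 0) ->
  holo V (fun z => f z ^ n).
Proof.
move=> df f0; case: n => n; first exact: holoX.
apply: holoV; first exact: holoX.
by move=> z Vz; rewrite expf_neq0// f0.
Qed.

Lemma holo_prod V (I : Type) (s : seq I) (F : I -> C -> C) :
  (forall i, holo V (F i)) -> holo V (fun z => \prod_(i <- s) F i z).
Proof.
move=> dF; elim: s => [|i s IH].
  by rewrite (_ : (fun z => _) = fun=> 1); [exact: holo_cst|apply/funext => z; rewrite big_nil].
rewrite (_ : (fun z => _) = fun z => F i z * \prod_(j <- s) F j z); first exact: holoM.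
by apply/funext => z; rewrite big_cons.
Qed.

Lemma holo_comp V W f g : holo W f -> holo V g -> (forall z, V z -> W (g z)) ->
  holo V (fun z => f (g z)).
Proof.
move=> df dg VW z Vz; have [l dl] := df _ (VW z Vz); have [m dm] := dg z Vz.
by exists (l * m); apply: (cder_comp (B := setT) dl dm).
Qed.

Lemma holo_eq V f g : open V -> (forall z, V z -> f z = g z) -> holo V f -> holo V g.
Proof.
move=> /openC_cmod oV fg df z Vz; have [l dl] := df z Vz; have [d d0 Vd] := oV z Vz.
by exists l; apply: (cder_near d0 _ _ dl) => [w _ /Vd|]; exact: fg.
Qed.

Lemma holo_poly V (p : {poly R[i]}) : holo V (fun z => p.[z]).
Proof.
elim/poly_ind: p => [|p c IH].
  by rewrite (_ : (fun z => _) = fun=> 0); [exact: holo_cst|apply/funext => z; rewrite horner0].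
rewrite (_ : (fun z => _) = fun z => p.[z] * z + c).
  by apply: holoD; [apply: holoM => //; exact: holo_id|exact: holo_cst].
by apply/funext => z; rewrite !hornerE.
Qed.

Lemma holo_ccont V f z : holo V f -> V z -> ccont setT f z.
Proof. by move=> df /df[l]; exact: cder_cont. Qed.

Lemma ccont_punctured_eq f g z (d : R) : 0 < d -> ccont setT f z -> ccont setT g z ->
  (forall w, w != z -> cmod (w - z) < d -> f w = g w) -> f z = g z.
Proof.
move=> d0 cf cg fg; apply/eqP; rewrite -subr_eq0 -cmod_eq0 eq_le cmod_ge0 andbT.
apply/ler_addgt0Pr => e e0; rewrite add0r.
have [d1 d10 h1] := cf _ (divr_gt0 e0 (ltr0n _ 2)).
have [d2 d20 h2] := cg _ (divr_gt0 e0 (ltr0n _ 2)).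
pose m := Num.min d (Num.min d1 d2); have m0 : 0 < m by rewrite !lt_min d0 d10.
pose w := z + (m / 2)%:C.
have wz : cmod (w - z) = m / 2.
  by rewrite /w addrAC subrr add0r cmod_real gtr0_norm// divr_gt0.
have wm : cmod (w - z) < m by rewrite wz ltr_pdivrMr// ltr_pMr// ltr1n.
have wz0 : w != z by rewrite -subr_eq0 -cmod_gt0 wz divr_gt0.
move: wm; rewrite !lt_min => /andP[wd /andP[wd1 wd2]].
have := cmodD (f z - f w) (g w - g z).
rewrite (fg w wz0 wd) addrA subrK => /le_trans; apply.
rewrite [e]splitr lerD//; first by rewrite cmodC -(fg w wz0 wd) ltW// h1.
by rewrite ltW// h2.
Qed.

Lemma cder_uniq f z l m : cder setT f z l -> cder setT f z m -> l = m.
Proof.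
move=> [p [cp <- pE]] [q [cq <- qE]]; apply: (ccont_punctured_eq ltr01 cp cq) => w wz _.
have wz0 : w - z != 0 by rewrite subr_eq0.
apply: (mulIf wz0); apply: (addrI (f z)).
by rewrite -pE// -qE.
Qed.

Lemma cder0_segment f p q :
  (forall t : R, 0 <= t <= 1 -> cder setT f (p + t%:C * (q - p)) 0) -> f p = f q.
Proof.
move=> df; have := @segint_prim R (fun=> 0) f p q df.
have := @segint_prim R (fun=> 0) (fun=> 0) p q (fun t _ => cder_cst setT 0 _).
by rewrite subrr => -> /esym/eqP; rewrite subr_eq0 => /eqP.
Qed.

Lemma open_closed_ball V a : open V -> V a ->
  exists2 rho : R, 0 < rho & forall z, cmod (z - a) <= rho -> V z.
Proof.
move=> /openC_cmod oV /oV[e e0 h]; exists (e / 2); first by rewrite divr_gt0.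
by move=> z hz; apply: h; apply: le_lt_trans hz _; rewrite ltr_pdivrMr// ltr_pMr// ltr1n.
Qed.

Lemma holo_cont_diamond V f a (rho : R) : 0 < rho ->
  (forall z, cmod (z - a) <= rho -> V z) -> holo V f -> cont_diamond a rho f.
Proof.
move=> rho0 ball df k t t01; have /andP[_ h1] := edgept_norm a rho0 k t01.
exact: holo_ccont df (ball _ h1).
Qed.

(** Near [a], [f] is the quotient of [ck f] and [ck 1]. Their derivatives are the integrals [ck2],
    which are differentiable again, and the quotient rule expresses [f'] through these four
    functions. *)
Lemma holo_derivative V f : open V -> holo V f ->
  exists2 f', (forall z, V z -> cder setT f z (f' z)) & holo V f'.
Proof.
move=> oV df; pose f' z := xget 0 [set l | cder setT f z l].
have f'P z : V z -> cder setT f z (f' z) by move=> /df[l]; exact: (@xgetI _ 0 _ l).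
exists f' => // a Va; have [rho rho0 ball] := open_closed_ball oV Va.
have cf := holo_cont_diamond rho0 ball df.
have c1 : cont_diamond a rho (fun=> 1) by exact: cont_diamond_cst.
have haa : cmod (a - a) < rho / 4 by rewrite subrr cmod0 divr_gt0.
pose W := ck a rho (fun=> 1).
have f'E b : cmod (b - a) < rho / 4 ->
    (ck2 a rho f b * W b - ck a rho f b * ck2 a rho (fun=> 1) b) / (W b) ^+ 2 = f' b.
  move=> hb; have W0 : W b != 0 := winding_neq0 rho0 hb.
  have Vb : V b by apply: ball; apply/ltW; apply: lt_le_trans hb (quarter_le rho0).
  apply: (@cder_uniq f b); last exact: f'P.
  have dW := cderV (ck_cder rho0 c1 hb) W0; have dq := cderM (ck_cder rho0 cf hb) dW.
  have [d d0 hd] : exists2 d : R, 0 < d & forall w, cmod (w - b) < d -> cmod (w - a) < rho / 4.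
    exists (rho / 4 - cmod (b - a)); first by rewrite subr_gt0.
    move=> w; rewrite ltrBrDr; apply: le_lt_trans.
    by have := cmodD (w - b) (b - a); rewrite addrA subrK.
  have fE w : cmod (w - a) < rho / 4 -> ck a rho f w * (W w)^-1 = f w.
    move=> hw; rewrite cauchy_formula// ?mulfK//; first exact: winding_neq0.
    by move=> z /ball/df.
  apply: (cder_eq (cder_near d0 (fun w _ hw => fE w (hd w hw)) (fE b hb) dq)).
  by rewrite -/(W b); field.
have [l2 dl2] := ck2_cder rho0 cf haa; have [m2 dm2] := ck2_cder rho0 c1 haa.
have W0 : W a != 0 := winding_neq0 rho0 haa.
eexists; apply: (cder_near (d := rho / 4) _ (fun w _ hw => f'E w hw) (f'E a haa)).
  by rewrite divr_gt0.
apply: cderM.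
  apply: cderB; apply: cderM; eauto.
  - exact: (ck_cder rho0 c1 haa).
  - exact: (ck_cder rho0 cf haa).
apply: cderV; last by rewrite expf_neq0.
by apply: (cder_comp (B := setT) (cderXn _ _ 2)) => //; exact: (ck_cder rho0 c1 haa).
Qed.

(** Near [a] the quotient is the Cauchy integral of [f / (z - a)] divided by that of [1]: this is
    the resolvent identity between [a] and [b], together with [f a = 0]. *)
Lemma holo_div V f a : open V -> V a -> holo V f -> f a = 0 ->
  exists2 g, holo V g & forall z, f z = (z - a) * g z.
Proof.
move=> oV Va df fa; have [rho rho0 ball] := open_closed_ball oV Va.
have cf := holo_cont_diamond rho0 ball df.
have haa : cmod (a - a) < rho / 4 by rewrite subrr cmod0 divr_gt0.
have c1 : cont_diamond a rho (fun=> 1) by exact: cont_diamond_cst.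
have ca := cont_diamond_kerM rho0 haa cf.
pose W := ck a rho (fun=> 1).
pose h b := ck a rho (fun z => f z * (z - a)^-1) b / W b.
pose g z := if z == a then h a else f z / (z - a).
have gE b : cmod (b - a) < rho / 4 -> h b = g b.
  move=> hb; rewrite /g; case: eqP => [->//|/eqP ba].
  have W0 : W b != 0 := winding_neq0 rho0 hb.
  have ba0 : b - a != 0 by rewrite subr_eq0.
  have dff z : cmod (z - a) <= rho -> exists l, cder setT f z l by move=> /ball/df.
  have := ck_resolvent rho0 haa cf hb.
  rewrite (cauchy_formula rho0 haa dff) fa mul0r subr0 (cauchy_formula rho0 hb dff) -/(W b) => H.
  by apply: (mulIf W0); rewrite /h divfK//; apply: (mulfI ba0); rewrite -H; field.
exists g.
  move=> z Vz; have [->|za] := eqVneq z a.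
    have W0 : W a != 0 := winding_neq0 rho0 haa.
    eexists; apply: (cder_near (d := rho / 4) _ (fun w _ hw => gE w hw) (gE a haa)).
      by rewrite divr_gt0.
    by apply: cderM; [exact: (ck_cder rho0 ca haa)|exact: cderV (ck_cder rho0 c1 haa) W0].
  have za0 : z - a != 0 by rewrite subr_eq0.
  have [l dl] := df z Vz; eexists.
  apply: (cder_near (d := cmod (z - a)) (f := fun w => f w * (w - a)^-1)).
  - by rewrite cmod_gt0.
  - by move=> w _; rewrite /g; case: eqP => // ->; rewrite cmodC ltxx.
  - by rewrite /g (negbTE za).
  - by apply: cderM; [exact: dl|apply: (cderV (f := fun w => w - a) _ za0); apply: cderB; [exact: cder_id|exact: cder_cst]].
move=> z; rewrite /g; case: eqP => [->|/eqP za]; first by rewrite subrr mul0r.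
by rewrite mulrC divfK// subr_eq0.
Qed.

(** Riemann's device: [(z - a)^2 f] is differentiable at [a] as well, with value and derivative [0],
    and can therefore be divided twice by [z - a]. *)
Lemma removable V f a (M d : R) : open V -> V a -> holo (V `\ a) f -> 0 < d ->
  (forall z, z != a -> cmod (z - a) < d -> cmod (f z) <= M) ->
  exists2 g, holo V g & forall z, z != a -> g z = f z.
Proof.
move=> oV Va df d0 fM; pose k z := (z - a) ^+ 2 * f z.
have dk : cder setT k a 0.
  apply/cder_eps => e e0; have M0 : 0 < `|M| + 1 by rewrite ltr_wpDl.
  exists (Num.min d (e / (`|M| + 1))); first by rewrite lt_min d0 divr_gt0.
  move=> w _; rewrite lt_min => /andP[wd]; rewrite ltr_pdivlMr// => we.
  rewrite /k subrr expr0n mul0r subr0 mul0r subr0.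
  have [->|wa] := eqVneq w a; first by rewrite subrr expr0n mul0r cmod0 mulr0.
  rewrite cmodM cmodX expr2 -mulrA mulrC ler_wpM2r ?cmod_ge0// (le_trans _ (ltW we))//.
  rewrite ler_wpM2l ?cmod_ge0// (le_trans (fM w wa wd))//.
  by apply: le_trans (ler_norm M) _; rewrite lerDl.
have hk : holo V k.
  move=> z Vz; have [->|za] := eqVneq z a; first by exists 0.
  have [l dl] := df z (conj Vz (fun e => elimN eqP za e)).
  eexists; apply: cderM; last exact: dl.
  apply: (cder_comp (B := setT) (cderXn _ _ 2)) => //.
  by apply: cderB; [exact: cder_id|exact: cder_cst].
have ka : k a = 0 by rewrite /k subrr expr0n mul0r.
have [k1 hk1 k1E] := holo_div oV Va hk ka.
have k1a : k1 a = 0.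
  have [l dl] := hk1 a Va.
  apply/esym; apply: (cder_uniq dk).
  rewrite (funext k1E); apply: cder_eq.
    by apply: cderM dl; apply: cderB; [exact: cder_id|exact: cder_cst].
  by rewrite /= subrr mul0r addr0 subr0 mul1r.
have [k2 hk2 k2E] := holo_div oV Va hk1 k1a.
exists k2 => // z za; have za0 : z - a != 0 by rewrite subr_eq0.
apply: (mulfI (expf_neq0 2 za0)).
by rewrite expr2 -mulrA -k2E -k1E /k expr2.
Qed.

(** If [f] is divisible by all powers of [z - a], then [cauchy_bound] for [f / (z - a)^N], with
    [|z - a| >= rho / 2] on the contour and [|b - a| < rho / 4], gives [|f b| <= 32 M / 2^N] for
    every [N]. *)
Lemma holo_order V f a : open V -> V a -> holo V f ->
  (exists2 d : R, 0 < d & forall z, cmod (z - a) < d -> f z = 0) \/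
  (exists N g, [/\ holo V g, g a != 0 & forall z, f z = (z - a) ^+ N * g z]).
Proof.
move=> oV Va df; have [H|H] := pselect (exists N g, [/\ holo V g, g a != 0 & forall z, f z = (z - a) ^+ N * g z]).
  by right.
left; have fN N : exists2 g, holo V g & forall z, f z = (z - a) ^+ N * g z.
  elim: N => [|N [g hg gE]]; first by exists f => // z; rewrite mul1r.
  have ga : g a = 0 by apply/eqP/negP => ga; apply: H; exists N, g; split=> //; exact/negP.
  have [g' hg' gE'] := holo_div oV Va hg ga.
  by exists g' => // z; rewrite gE gE' exprSr mulrA.
have [r r0 ball] := open_closed_ball oV Va.
have [d d0 fd] := holo_ccont df Va ltr01.
pose rho := Num.min r (d / 2); have rho0 : 0 < rho by rewrite lt_min r0 divr_gt0.
exists (rho / 4) => [|b hb]; first by rewrite divr_gt0.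
have ballr z : cmod (z - a) <= rho -> V z.
  by move=> h; apply: ball; apply: le_trans h _; rewrite ge_min lexx.
have fM z : cmod (z - a) <= rho -> cmod (f z) <= cmod (f a) + 1.
  move=> h; rewrite -[f z](subrK (f a)) addrC (le_trans (cmodD _ _))// lerD2l ltW// fd//.
  apply: le_lt_trans h _; apply: le_lt_trans (_ : _ <= d / 2) _; first by rewrite ge_min lexx orbT.
  by rewrite ltr_pdivrMr// ltr_pMr// ltr1n.
set M := cmod (f a) + 1 in fM.
have M0 : 0 < M by rewrite /M ltr_wpDl ?cmod_ge0.
have bN N : cmod (f b) <= 32 * M * (1 / 2) ^+ N.
  have [g hg gE] := fN N.
  have gb : cmod (g b) <= 32 * (M * (2 / rho) ^+ N).
    apply: (cauchy_bound rho0 hb) => [z /ballr /hg//|z /andP[h1 h2]].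
    have z0 : 0 < cmod (z - a) by apply: lt_le_trans h1; rewrite divr_gt0.
    have -> : g z = f z * (z - a) ^- N.
      by rewrite gE mulrC mulKf// expf_neq0// -cmod_gt0.
    rewrite cmodM cmodV cmodX -exprVn ler_pM ?exprn_ge0 ?invr_ge0 ?cmod_ge0//; first exact: fM.
    have r20 : 0 <= 2 / rho by rewrite divr_ge0// ltW.
    rewrite lerXn2r ?nnegrE ?invr_ge0 ?cmod_ge0//.
    by rewrite -[2 / rho]invf_div lef_pV2// posrE divr_gt0.
  rewrite gE cmodM cmodX.
  have h1 : cmod (b - a) ^+ N <= (rho / 4) ^+ N.
    by rewrite lerXn2r ?nnegrE ?cmod_ge0 ?divr_ge0 ?ltW.
  apply: le_trans (ler_pM _ _ h1 gb) _; rewrite ?exprn_ge0 ?cmod_ge0//.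
  have -> : (1 / 2 : R) = rho / 4 * (2 / rho) by field; rewrite gt_eqF.
  by rewrite [(rho / 4 * (2 / rho)) ^+ N]exprMn le_eqVlt; apply/orP; left; apply/eqP; ring.
apply/eqP; rewrite -cmod_eq0 eq_le cmod_ge0 andbT.
apply/ler_addgt0Pr => e e0; rewrite add0r.
have K0 : 0 < 32 * M by rewrite mulr_gt0.
have := archi_boundP (ltW (divr_gt0 K0 e0)).
set N := Num.bound _ => hN.
apply: le_trans (bN N) _; rewrite expr_div_n expr1n mulrA mulr1 ler_pdivrMr ?exprn_gt0//.
rewrite [e * _]mulrC -ler_pdivrMr//; apply/ltW/(lt_trans hN).
by rewrite -natrX ltr_nat; exact: ltn_expl.
Qed.

(** Induction on the growth: [(f - f 0) / z] is entire and grows with one power less. The base case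
    is Liouville's theorem, where this quotient is bounded by a constant over [rho] on diamonds of
    size [rho]. *)
Lemma liouville_poly f (K : R) N : holo setT f ->
  (forall z, cmod (f z) <= K * (1 + cmod z) ^+ N) ->
  exists p : {poly R[i]}, forall z, f z = p.[z].
Proof.
elim: N f K => [|N IH] f K df fK.
  exists (f 0)%:P => z; rewrite hornerC.
  have [g hg gE] : exists2 g, holo setT g & forall z, f z - f 0 = (z - 0) * g z.
    apply: holo_div => //; [exact: openT|by apply: holoB => //; exact: holo_cst|exact: subrr].
  suff gz : g z = 0 by apply/eqP; rewrite -subr_eq0 gE gz mulr0.
  have K0 : 0 <= K by apply: le_trans (cmod_ge0 _) (_ : cmod (f 0) <= _); rewrite -[K]mulr1; exact: fK.
  have b (rho : R) : 0 < rho -> cmod z < rho / 4 -> cmod (g z) <= 32 * (2 * K * (2 / rho)).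
    move=> rho0 hz; apply: (@cauchy_bound R 0 rho rho0) => [|w _|w /andP[h1 _]]; first by rewrite subr0.
      exact: hg.
    have w0 : 0 < cmod (w - 0) by apply: lt_le_trans h1; rewrite divr_gt0.
    have -> : g w = (f w - f 0) * (w - 0)^-1 by rewrite gE mulrC mulKf// -cmod_gt0.
    rewrite cmodM cmodV ler_pM ?invr_ge0 ?cmod_ge0//.
      apply: le_trans (cmodD _ _) _; rewrite cmodN.
      by have := fK w; have := fK 0; rewrite !expr0 !mulr1; lra.
    by rewrite -[2 / rho]invf_div lef_pV2// posrE divr_gt0.
  apply/eqP; rewrite -cmod_eq0 eq_le cmod_ge0 andbT.
  apply/ler_addgt0Pr => e e0; rewrite add0r.
  (* The first term brings [z] within [rho / 4] of the centre, the second makes the bound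
     [128 K / rho] at most [e]. *)
  pose rho := 4 * (cmod z + 1) + 128 * K / e.
  have r1 : 0 <= 128 * K / e by rewrite divr_ge0 ?mulr_ge0// ltW.
  have z0 := cmod_ge0 z.
  have rho0 : 0 < rho by rewrite /rho; lra.
  apply: le_trans (b rho rho0 _) _; first by rewrite /rho; lra.
  have -> : 32 * (2 * K * (2 / rho)) = 128 * K / rho by field; rewrite gt_eqF.
  have h : 128 * K / e <= rho by rewrite /rho; lra.
  by rewrite ler_pdivrMr// [e * _]mulrC -ler_pdivrMr.
have [g hg gE] : exists2 g, holo setT g & forall z, f z - f 0 = (z - 0) * g z.
  by apply: holo_div => //; [exact: openT|apply: holoB => //; exact: holo_cst|exact: subrr].
have K0 : 0 <= K.
  by apply: le_trans (cmod_ge0 _) (_ : cmod (f 0) <= _); have := fK 0; rewrite cmod0 addr0 expr1n mulr1.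
have gout w : 1 <= cmod w -> cmod (g w) <= 4 * K * (1 + cmod w) ^+ N.
  move=> w1; have w0 : 0 < cmod w by apply: lt_le_trans w1.
  have -> : g w = (f w - f 0) * (w - 0)^-1 by rewrite gE mulrC mulKf// subr0 -cmod_gt0.
  rewrite subr0 cmodM cmodV ler_pdivrMr//.
  apply: le_trans (cmodD _ _) _; rewrite cmodN.
  have := fK w; have := fK 0; rewrite cmod0 addr0 expr1n mulr1 exprS.
  have e1 : 1 <= (1 + cmod w) ^+ N by rewrite exprn_ege1// lerDl ltW.
  set E := (1 + cmod w) ^+ N in e1 *; set x := cmod w in w1 w0 *.
  move=> h0 h1.
  have h2 : K <= K * E by rewrite -{1}[K]mulr1 ler_wpM2l.
  have h3 : 0 <= K * E by apply: le_trans h2.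
  have : K * E <= K * E * x by rewrite -{1}[K * E]mulr1 ler_wpM2l.
  by nra.
(* Bounds [g] on the unit disc through the diamond of size [4]: the estimate is taken on
   [2 <= |z| <= 4], where [gout] applies and [1 + |z| <= 5]. *)
pose B := 32 * (4 * K * 5 ^+ N).
have B0 : 0 <= B by rewrite /B !mulr_ge0// exprn_ge0.
have [p pE] : exists p : {poly R[i]}, forall z, g z = p.[z].
  apply: (IH g (4 * K + B) hg) => w.
  have e1 : 1 <= (1 + cmod w) ^+ N by rewrite exprn_ege1// lerDl cmod_ge0.
  rewrite mulrDl; have [w1|w1] := leP 1 (cmod w).
    by apply: le_trans (gout w w1) _; rewrite lerDl mulr_ge0// (le_trans _ e1).
  apply: (@le_trans _ _ B).
    apply: (@cauchy_bound R 0 4) => //; first by rewrite subr0 divff.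
    - by move=> z _; exact: hg.
    - move=> z; rewrite subr0 => /andP[h1 h2].
      apply: le_trans (gout z _) _; first by lra.
      rewrite ler_wpM2l ?mulr_ge0// lerXn2r ?nnegrE ?addr_ge0 ?cmod_ge0//; lra.
  have h4 : B <= B * (1 + cmod w) ^+ N by rewrite -{1}[B]mulr1 ler_wpM2l.
  by apply: le_trans h4 _; rewrite lerDr !mulr_ge0// (le_trans _ e1).
exists (p * 'X + (f 0)%:P) => z.
by rewrite !hornerE -pE -[LHS](subrK (f 0)) gE subr0 mulrC.
Qed.

End HolomorphicFunctions.

(** * Roots of holomorphic units *)

Section LocalRoots.
Variable R : realType.
Local Notation C := (Cplx R).
Implicit Types (z w p q v a b : C) (f g F G : C -> C) (V : set C).

Lemma prod_gt_pow (T : eqType) (s : seq T) (u : T -> R) (d : R) : 0 <= d -> s != [::] ->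
  (forall x, x \in s -> d < u x) -> d ^+ size s < \prod_(x <- s) u x.
Proof.
move=> d0; elim: s => [//|x s IH] _ H; rewrite big_cons /= exprS.
have dx : d < u x by apply: H; rewrite mem_head.
have [->|s0] := eqVneq s [::]; first by rewrite big_nil expr0 !mulr1.
rewrite ltr_pM ?exprn_ge0//; apply: IH => // y ys; apply: H.
by rewrite inE ys orbT.
Qed.

(** The product of the distances from [y0] to the [N] roots of [X^N - c] is [|c - y0^N|], so some
    distance is at most its [N]-th root. *)
Lemma near_root (y0 c : C) N : (0 < N)%N ->
  exists2 x : C, x ^+ N = c & cmod (x - y0) ^+ N <= cmod (c - y0 ^+ N).
Proof.
move=> N0; pose p : {poly R[i]} := 'X^N - (c : R[i])%:P.
have lp : lead_coef p = 1 by rewrite lead_coefDl ?lead_coefXn// size_polyN size_polyXn (leq_ltn_trans (size_polyC_leq1 _)).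
have sp : size p = N.+1 by rewrite size_polyDl ?size_polyXn// size_polyN (leq_ltn_trans (size_polyC_leq1 _)).
have [s ps] := closed_field_poly_normal p; rewrite lp scale1r in ps.
have ss : size s = N by apply/eqP; rewrite -eqSS -(size_prod_XsubC s id) /= -ps sp.
have s0 : s != [::] by rewrite -size_eq0 ss -lt0n.
apply: contrapT => H.
have : cmod (c - y0 ^+ N) ^+ N < \prod_(x <- s) (cmod (x - y0) ^+ N).
  rewrite -[X in _ ^+ X < _]ss; apply: prod_gt_pow => //; first exact: cmod_ge0.
  move=> x xs; rewrite ltNge; apply/negP => H'; apply: H; exists x => //.
  have : root p x by rewrite ps root_prod_XsubC.
  by rewrite /root /p !hornerE subr_eq0 => /eqP.
rewrite prodrXl.
have -> : \prod_(x <- s) cmod (x - y0) = cmod (c - y0 ^+ N); last by rewrite ltxx.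
have -> : c - y0 ^+ N = - p.[y0] by rewrite /p !hornerE; ring.
rewrite cmodN ps horner_prod (big_morph (@cmod R) (@cmodM R) (cmod1 R)).
by apply: eq_bigr => x _; rewrite !hornerE cmodC.
Qed.

(** The powers of a root of unity [x != 1] add up to [0], so that [N] is the modulus of the sum of
    the [x^i - 1], each at most [N |x - 1|]. *)
Lemma unity_gap (x : C) N : (0 < N)%N -> x ^+ N = 1 -> cmod (x - 1) * N%:R < 1 -> x = 1.
Proof.
move=> N0 xN h; apply/eqP; rewrite -subr_eq0; apply: contraTT isT => x1.
have x0 : cmod x = 1.
  apply/eqP; rewrite -(@pexpr_eq1 _ _ N) ?cmod_ge0//; last by rewrite -cmodX xN cmod1.
have pow i : cmod (x ^+ i - 1) <= i%:R * cmod (x - 1).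
  elim: i => [|i IH]; first by rewrite expr0 subrr cmod0 mul0r.
  have -> : x ^+ i.+1 - 1 = x * (x ^+ i - 1) + (x - 1) by rewrite exprS; ring.
  apply: le_trans (cmodD _ _) _; rewrite cmodM x0 mul1r -natr1 mulrDl mul1r.
  by rewrite lerD2r.
have S0 : \sum_(i < N) x ^+ i = 0.
  by apply: (mulfI x1); rewrite -subrX1 xN subrr mulr0.
have : cmod (\sum_(i < N) (x ^+ i - 1)) <= \sum_(i < N) (1 * N%:R * cmod (x - 1)).
  elim/big_ind2 : _ => [|u a v b h1 h2|i _]; first by rewrite cmod0.
    by apply: le_trans (cmodD _ _) _; exact: lerD.
  apply: le_trans (pow i) _; rewrite mul1r ler_wpM2r ?cmod_ge0// ler_nat ltnW//.
rewrite sumrB S0 sub0r cmodN sumr_const card_ord mul1r.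
rewrite sumr_const card_ord -[1 *+ N]/(N%:R) -[in leLHS](rmorph_nat (real_complex R)) cmod_real.
rewrite ger0_norm// => H.
have : N%:R * 1 <= N%:R * (cmod (x - 1) * N%:R) by rewrite mulr1 mulrA mulr_natr.
by rewrite ler_pM2l ?ltr0n// leNgt h.
Qed.

Lemma root_unique (x x' : C) N : (0 < N)%N -> x' != 0 -> x ^+ N = x' ^+ N ->
  cmod (x - x') * N%:R < cmod x' -> x = x'.
Proof.
move=> N0 x0 xx h.
suff e : x / x' = 1 by rewrite -[x](divfK x0) e mul1r.
apply: (unity_gap N0); first by rewrite expr_div_n xx divff// expf_neq0.
have -> : x / x' - 1 = (x - x') / x' by field.
by rewrite cmodM cmodV mulrAC ltr_pdivrMr ?cmod_gt0// mul1r.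
Qed.

(** Among the roots of [e z] the one near a fixed root [y0] of [e a] is chosen. It is unique, hence
    continuous in [z] by [near_root], and differentiable because [x^N - y^N] is [x - y] times a
    cofactor that does not vanish at [x = y]. *)
Lemma local_root V e a N : (0 < N)%N -> open V -> V a -> holo V e -> e a != 0 ->
  exists (d : R) eta, [/\ 0 < d, (forall z, cmod (z - a) < d -> V z),
    holo [set z | cmod (z - a) < d] eta & forall z, cmod (z - a) < d -> eta z ^+ N = e z].
Proof.
move=> N0 oV Va de ea.
have [y0 y0N _] := near_root 0 (e a) N0.
have y00 : y0 != 0 by apply: contra_neq ea => y0e; rewrite -y0N y0e expr0n; case: (N) N0.
have Nr : 0 < N%:R :> R by rewrite ltr0n.
have N1 : 1 <= N%:R :> R by rewrite ler1n.
have cy : 0 < cmod y0 by rewrite cmod_gt0.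
(* Two roots within [r] of [y0] are less than [2 r] apart, and [2 r N = |y0| / 2] is below their
   moduli, which exceed [3 |y0| / 4]; [root_unique] then identifies them. *)
pose r := cmod y0 / (4 * N%:R); have r0 : 0 < r by rewrite divr_gt0// mulr_gt0.
have rE : r * N%:R = cmod y0 / 4 by rewrite /r; field; rewrite gt_eqF.
have ry : r <= cmod y0 / 4 by rewrite -rE ler_peMr// ltW.
have uniq x x' : cmod (x - y0) < r -> cmod (x' - y0) < r -> x ^+ N = x' ^+ N -> x = x'.
  move=> h1 h2; have h3 := cmodB y0 x'; rewrite (cmodC y0) in h3.
  have x'0 : cmod y0 * (3 / 4) < cmod x' by lra.
  move=> xx; apply: (root_unique N0 _ xx); first by rewrite -cmod_gt0; lra.
  have h4 := cmodD (x - y0) (y0 - x'); rewrite addrA subrK (cmodC y0) in h4.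
  have h5 : cmod (x - x') < 2 * r by lra.
  by apply: lt_trans (_ : 2 * r * N%:R < _); [rewrite ltr_pM2r|rewrite -mulrA rE; lra].
have [d1 d10 h1] := (openC_cmod V).1 oV a Va.
have [d2 d20 h2] := holo_ccont de Va (exprn_gt0 N r0).
pose d := Num.min d1 d2.
have eta_ex z : {x : C | cmod (z - a) < d -> x ^+ N = e z /\ cmod (x - y0) < r}.
  apply: cid; have [zd|zd] := pselect (cmod (z - a) < d); last by exists 0.
  have [x xN xy] := near_root y0 (e z) N0; exists x => _; split=> //.
  rewrite -(@ltr_pXn2r _ N) ?nnegrE ?cmod_ge0 ?ltW// (le_lt_trans xy)// y0N.
  by apply: h2 => //; move: zd; rewrite lt_min => /andP[].
pose eta z := sval (eta_ex z).
have etaP z : cmod (z - a) < d -> eta z ^+ N = e z /\ cmod (eta z - y0) < r := svalP (eta_ex z).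
have dV z : cmod (z - a) < d -> V z by rewrite lt_min => /andP[/h1].
exists d, eta; split=> //; first by rewrite lt_min d10.
  move=> z /= zd; have [zN zy] := etaP z zd.
  have [m m0 mz] : exists2 m : R, 0 < m & forall w, cmod (w - z) < m -> cmod (w - a) < d.
    exists (d - cmod (z - a)); first by rewrite subr_gt0.
    move=> w; rewrite ltrBrDr; apply: le_lt_trans.
    by have := cmodD (w - z) (z - a); rewrite addrA subrK.
  have ce := holo_ccont de (dV z zd).
  have ceta : ccont setT eta z.
    move=> ep ep0; pose t := Num.min ep (r - cmod (eta z - y0)).
    have t0 : 0 < t by rewrite lt_min ep0 subr_gt0.
    have [k k0 kz] := ce _ (exprn_gt0 N t0).
    exists (Num.min m k) => [|w _]; first by rewrite lt_min m0.
    rewrite lt_min => /andP[/mz wd /(kz w I) wk].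
    have [x xN xz] := near_root (eta z) (e w) N0.
    have {}xz : cmod (x - eta z) < t.
      by rewrite -(@ltr_pXn2r _ N) ?nnegrE ?cmod_ge0 ?ltW// (le_lt_trans xz)// zN.
    have [wN wy] := etaP w wd.
    move: xz; rewrite lt_min => /andP[xe xr].
    have <- // : x = eta w.
    apply: uniq => //; last by rewrite xN wN.
    have := cmodD (x - eta z) (eta z - y0); rewrite addrA subrK; lra.
  (* The cofactor of [x - eta z] in [x^N - (eta z)^N], as a polynomial in [x]; its value at [eta z]
     is [N (eta z)^(N-1)]. *)
  pose S : {poly R[i]} := \sum_(i < N) ((eta z : R[i]) ^+ i)%:P * 'X^(N.-1 - i).
  have SE w : eta w ^+ N - eta z ^+ N = (eta w - eta z) * S.[eta w].
    rewrite subrXX /S horner_sum; congr (_ * _); apply: eq_bigr => i _.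
    by rewrite !hornerE mulrC.
  have Sz : S.[eta z] != 0.
    have -> : S.[eta z] = N%:R * eta z ^+ N.-1.
      rewrite /S horner_sum (eq_bigr (fun=> eta z ^+ N.-1)).
        by rewrite sumr_const card_ord mulr_natl.
      move=> i _; rewrite !hornerE -exprD subnKC//.
      by rewrite -ltnS prednK.
    rewrite mulf_neq0 ?pnatr_eq0 -?lt0n// expf_neq0// -cmod_gt0.
    have := cmodB y0 (eta z); rewrite (cmodC y0); lra.
  have cS : ccont setT (fun w => S.[eta w]) z.
    apply: (@ccont_comp _ setT setT (fun w => S.[w]) eta) => //.
    exact: (holo_ccont (holo_poly (V := setT) S)).
  have [l [phi [cphi phiz phiE]]] := de z (dV z zd).
  have [k k0 kz] := ccont_bound0 cS Sz.
  exists (phi z * (S.[eta z])^-1).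
  apply: (@cder_near _ _ (fun w => eta z + (phi w * (S.[eta w])^-1) * (w - z)) _ _ _ (Num.min m k)).
  - by rewrite lt_min m0.
  - move=> w _; rewrite lt_min => /andP[/mz wd /(kz w I) wk].
    have Sw : S.[eta w] != 0 by rewrite -cmod_gt0 (le_lt_trans _ wk)// divr_ge0 ?cmod_ge0.
    have [wN _] := etaP w wd.
    suff -> : phi w * (S.[eta w])^-1 * (w - z) = eta w - eta z by rewrite addrC subrK.
    apply: (mulIf Sw); rewrite -SE wN zN (phiE w I).
    by field.
  - by rewrite subrr mulr0 addr0.
  - exists (fun w => phi w * (S.[eta w])^-1); split=> //.
      by apply: ccontM => //; exact: ccontV.
    by move=> w _; rewrite subrr mulr0 addr0.
by move=> z /etaP[].
Qed.

End LocalRoots.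

(** * Orders of functions at the origin *)

Section OrderAtZero.
Variable R : realType.
Local Notation C := (Cplx R).
Implicit Types (z w p q v a b : C) (f g F G : C -> C) (V : set C).

Definition ball0 (d : R) : set C := [set z | cmod z < d].

Lemma open_ball0 d : open (ball0 d).
Proof.
apply/openC_cmod => z /= zd; exists (d - cmod z); first by rewrite subr_gt0.
move=> w; rewrite ltrBrDr; apply: le_lt_trans.
by have := cmodD (w - z) z; rewrite subrK.
Qed.

(** The value of [f] at [0] is left free, so that poles are covered, as is a transition function
    that has no meaning at [0]. *)
Definition order0 f (k : int) := exists (d : R) (b : C -> C),
  [/\ 0 < d, holo (ball0 d) b, forall z, ball0 d z -> b z != 0 &
      forall z, ball0 d z -> z != 0 -> f z = z ^ k * b z].

Lemma ball0_0 d : 0 < d -> ball0 d 0.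
Proof. by move=> d0; have : cmod (0 : C) < d by rewrite cmod0. Qed.

Lemma ball0_sub d d' : d <= d' -> ball0 d `<=` ball0 d'.
Proof. by move=> dd z /= zd; apply: lt_le_trans dd. Qed.

Lemma order0M f g k l : order0 f k -> order0 g l -> order0 (fun z => f z * g z) (k + l).
Proof.
move=> [d [b [d0 hb b0 fb]]] [d' [b' [d'0 hb' b'0 gb']]].
exists (Num.min d d'), (fun z => b z * b' z).
have s1 : ball0 (Num.min d d') `<=` ball0 d by apply: ball0_sub; rewrite ge_min lexx.
have s2 : ball0 (Num.min d d') `<=` ball0 d' by apply: ball0_sub; rewrite ge_min lexx orbT.
split; first by rewrite lt_min d0.
- by apply: holoM; [exact: holo_sub hb|exact: holo_sub hb'].
- by move=> z zd; rewrite mulf_neq0 ?b0 ?b'0//; [exact: s1|exact: s2].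
- by move=> z zd z0; rewrite fb ?gb'//; [rewrite expfzDr//; ring|exact: s2|exact: s1].
Qed.

Lemma order0V f k : order0 f k -> order0 (fun z => (f z)^-1) (- k).
Proof.
move=> [d [b [d0 hb b0 fb]]]; exists d, (fun z => (b z)^-1); split=> //.
- exact: holoV.
- by move=> z zd; rewrite invr_neq0// b0.
- by move=> z zd z0; rewrite fb// invfM invr_expz.
Qed.

Lemma order0Xz f k (l : int) : order0 f k -> order0 (fun z => f z ^ l) (k * l).
Proof.
move=> [d [b [d0 hb b0 fb]]]; exists d, (fun z => b z ^ l); split=> //.
- exact: holoXz.
- by move=> z zd; rewrite expfz_neq0// b0.
- by move=> z zd z0; rewrite fb// expfzMl -exprz_exp.
Qed.

Lemma order0_holo V f : open V -> V 0 -> holo V f -> f 0 != 0 -> order0 f 0.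
Proof.
move=> /openC_cmod oV V0 hf f0; have [d1 d10 h1] := oV 0 V0.
have [d2 d20 h2] := ccont_bound0 (holo_ccont hf V0) f0.
exists (Num.min d1 d2), f; split.
- by rewrite lt_min d10.
- by apply: holo_sub hf => z; rewrite /ball0 /= lt_min => /andP[zd _]; apply: h1; rewrite subr0.
- move=> z; rewrite /ball0 /= lt_min => /andP[_ zd].
  rewrite -cmod_gt0 (le_lt_trans _ (h2 z I _)) ?subr0//.
  by rewrite divr_ge0 ?cmod_ge0.
- by move=> z _ _; rewrite mul1r.
Qed.

Lemma order0_prod (I : Type) (s : seq I) (F : I -> C -> C) (k : I -> int) :
  (forall i, order0 (F i) (k i)) -> order0 (fun z => \prod_(i <- s) F i z) (\sum_(i <- s) k i).
Proof.
move=> H; elim: s => [|i s IH].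
  rewrite big_nil; apply: (@order0_holo setT) => //; first exact: openT.
    by rewrite (_ : (fun z => _) = fun=> 1); [exact: holo_cst|apply/funext => z; rewrite big_nil].
  by rewrite big_nil oner_eq0.
rewrite big_cons (_ : (fun z => _) = fun z => F i z * \prod_(j <- s) F j z).
  exact: order0M.
by apply/funext => z; rewrite big_cons.
Qed.

Lemma order0_near f g k (d : R) : 0 < d -> (forall z, cmod z < d -> z != 0 -> f z = g z) ->
  order0 f k -> order0 g k.
Proof.
move=> d0 fg [d' [b [d'0 hb b0 fb]]]; exists (Num.min d d'), b.
have s2 : ball0 (Num.min d d') `<=` ball0 d' by apply: ball0_sub; rewrite ge_min lexx orbT.
split; [by rewrite lt_min d0|exact: holo_sub hb|by move=> z /s2; exact: b0|].
move=> z zd z0; rewrite -fb//; last exact: s2.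
by rewrite fg//; move: zd; rewrite /ball0 /= lt_min => /andP[].
Qed.

(** With [D] the degree of [p], the function [z^(n D) p(z^-n)] is a polynomial whose constant term
    is the leading coefficient of [p]. *)
Lemma order0_poly_inv (p : {poly R[i]}) n : p != 0 -> (0 < n)%N ->
  order0 (fun z => p.[z ^- n]) (- (n * (size p).-1)%:Z).
Proof.
move=> p0 n0; pose D := (size p).-1.
have sp : size p = D.+1 by rewrite /D prednK// lt0n size_poly_eq0.
pose q : {poly R[i]} := \sum_(i < size p) (p`_(D - i))%:P * 'X^(n * i).
have q0 : q.[0] != 0.
  rewrite /q sp horner_sum big_ord_recl /= muln0 expr0 mulr1 hornerC subn0.
  rewrite big1 ?addr0; first by rewrite /D -lead_coefE lead_coef_eq0.
  by move=> i _; rewrite !hornerE expr0n muln_eq0 /= -leqn0 leqNgt n0 /= mulr0.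
have [d [b [d0 hb b0 qb]]] := order0_holo openT I (holo_poly q) q0.
exists d, b; split=> // z zd z0; have := qb z zd z0; rewrite mul1r => <-.
have zn0 : z ^+ n != 0 by rewrite expf_neq0.
rewrite -exprnN exprM -/D /q horner_sum mulr_sumr horner_coef.
rewrite sp [RHS](reindex_inj rev_ord_inj) /=; apply: eq_bigr => i _.
have iD : (i <= D)%N by rewrite -ltnS.
rewrite !hornerE subSS subKn// exprVn exprM.
have -> : (z ^+ n) ^+ D = (z ^+ n) ^+ (D - i) * (z ^+ n) ^+ i by rewrite -exprD subnK.
transitivity ((z ^+ n ^+ (D - i) * z ^+ n ^+ i)^-1 * p`_i * z ^+ n ^+ (D - i) : C) => //.
by field; rewrite !expf_neq0.
Qed.

(** For large [M] the [N]-th power of [z^M f] is bounded near [0], so the singularity of [z^M f]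
    itself is removable; its order, shifted by [M], is that of [f]. *)
Lemma order0_root f k (d : R) N : (0 < N)%N -> 0 < d -> holo (ball0 d `\ 0) f ->
  order0 (fun z => f z ^+ N) k -> exists l, order0 f l.
Proof.
move=> N0 d0 hf [d' [b [d'0 hb b0 fb]]].
(* Since [N >= 1], this choice gives [M N + k >= 0]. *)
pose M := `|k|%N.
pose g z := z ^+ M * f z.
have zd0 : ball0 d' 0 by exact: ball0_0.
have cb : ccont setT b 0 by exact: holo_ccont hb zd0.
have [d2 d20 bd2] := cb _ ltr01.
pose e := Num.min 1 (Num.min d (Num.min d' d2)).
have e0 : 0 < e by rewrite !lt_min ltr01 d0 d'0.
have gN z : z != 0 -> cmod z < e -> g z ^+ N = z ^ ((M * N)%:Z + k) * b z.
  move=> z0; rewrite !lt_min => /andP[_ /andP[_ /andP[zd' _]]].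
  by rewrite /g exprMn fb// mulrA expfzDr// -exprM.
have [m mE] : exists m : nat, (M * N)%:Z + k = m%:Z.
  exists (absz ((M * N)%:Z + k)); apply/esym; rewrite gez0_abs//.
  have : `|k| <= (M * N)%:Z by rewrite -abszE -/M lez_nat leq_pmulr.
  by rewrite ler_norml => /andP[h _]; rewrite -(lerD2l (M * N)%:Z) subrr in h.
pose K := cmod (b 0) + 1.
have gM z : z != 0 -> cmod (z - 0) < e -> cmod (g z) <= K.
  rewrite subr0 => z0 ze; have := gN z z0 ze; rewrite mE => gE.
  move: ze; rewrite !lt_min => /andP[z1 /andP[_ /andP[_ zd2]]].
  have K1 : 1 <= K by rewrite /K lerDr cmod_ge0.
  have bK : cmod (b z) <= K.
    rewrite -[b z](subrK (b 0)) addrC (le_trans (cmodD _ _))// lerD2l ltW// bd2// subr0//.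
  rewrite -(@ler_pXn2r _ N) ?nnegrE ?cmod_ge0 ?(le_trans _ K1)//.
  rewrite -cmodX gE cmodM -exprnP cmodX.
  apply: le_trans (_ : 1 * K <= _).
    by rewrite ler_pM ?exprn_ge0 ?cmod_ge0// exprn_ile1 ?cmod_ge0// ltW.
  by rewrite mul1r ler_eXnr.
have ed : e <= d by rewrite !ge_min lexx orbT.
have [h hh hE] : exists2 h, holo (ball0 e) h & forall z, z != 0 -> h z = g z.
  apply: (@removable _ (ball0 e) g 0 K e) => //; first exact: open_ball0.
    exact: ball0_0.
  move=> z [ze z0]; apply: (holoM (V := ball0 d `\ 0)).
  - by apply: holoX; exact: holo_id.
  - exact: hf.
  - by split=> //; exact: (ball0_sub ed).
have e00 : ball0 e 0 by exact: ball0_0.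
have [[e' e'0 hz]|[N' [h' [hh' h'0 h'E]]]] := holo_order (@open_ball0 e) e00 hh.
  (* [h] cannot vanish identically near [0]: off [0] its [N]-th power is a power of [z] times a
     unit. *)
  exfalso; pose z : C := (Num.min e e' / 2)%:C.
  have me : 0 < Num.min e e' by rewrite lt_min e0.
  have zc : cmod z = Num.min e e' / 2 by rewrite cmod_real gtr0_norm// divr_gt0.
  have zlt : cmod z < Num.min e e' by rewrite zc ltr_pdivrMr// ltr_pMr// ltr1n.
  have z0 : z != 0 by rewrite -cmod_gt0 zc divr_gt0.
  move: zlt; rewrite lt_min => /andP[ze ze'].
  have := gN z z0 ze; rewrite -hE// hz ?subr0// expr0n eqn0Ngt N0 => /esym/eqP.
  have zd' : cmod z < d' by move: ze; rewrite !lt_min => /andP[_ /andP[_ /andP[]]].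
  by rewrite mulf_eq0 (negbTE (expfz_neq0 _ z0)) (negbTE (b0 z zd')).
exists (N'%:Z - M%:Z).
have o1 : order0 h N'%:Z.
  have [e1 [h1 [e10 hh1 h10 h1E]]] := order0_holo (@open_ball0 e) e00 hh' h'0.
  by exists e1, h1; split=> // z ze z0; rewrite h'E subr0 (h1E z ze z0) expr0z mul1r.
have o2 : order0 (fun z : C => z ^ M%:Z) (M%:Z).
  exists 1, (fun=> 1); split=> [//||z _|z _ _]; first exact: holo_cst.
    exact: oner_neq0.
  by rewrite mulr1.
apply: (order0_near e0 _ (order0M o1 (order0V o2))) => z ze z0; rewrite hE// /g -exprnP mulrC mulKf// expf_neq0//.
Qed.

End OrderAtZero.

(** * Zeros and divisors *)

Section ZerosAndDivisors.
Variable R : realType.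
Local Notation C := (Cplx R).
Implicit Types (z w p q v a b : C) (f g F G : C -> C) (V : set C).

Definition square (x y h : R) : set C :=
  [set w | x <= complex.Re w <= x + h /\ y <= complex.Im w <= y + h].

Lemma plane_bisection (P : R -> R -> R -> Prop) :
  (forall x y h, 0 < h -> P x y (h / 2) -> P (x + h / 2) y (h / 2) ->
     P x (y + h / 2) (h / 2) -> P (x + h / 2) (y + h / 2) (h / 2) -> P x y h) ->
  (forall w0, exists2 d : R, 0 < d & forall x y h, 0 < h -> square x y h w0 ->
     (forall w, square x y h w -> cmod (w - w0) < d) -> P x y h) ->
  forall x y h, 0 < h -> P x y h.
Proof.
move=> glue loc x y h h0; apply: square_bisection => // a b _ _.
have [d d0 hd] := loc (a +i* b); exists (d / 2); first by rewrite divr_gt0.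
move=> x' y' h' /andP[h'0 h'd] xa yb _ _ _ _; apply: hd => // -[u v] [/= hu hv].
apply: le_lt_trans (cmod_le_ReIm _) _.
have : `|u - a| <= h' by rewrite ler_norml; lra.
have : `|v - b| <= h' by rewrite ler_norml; lra.
rewrite /=; lra.
Qed.

Lemma square_quarters x y h w : 0 < h -> square x y h w ->
  [\/ square x y (h / 2) w, square (x + h / 2) y (h / 2) w,
      square x (y + h / 2) (h / 2) w | square (x + h / 2) (y + h / 2) (h / 2) w].
Proof.
rewrite /square /= => h0 [/andP[a b] /andP[c d]].
case: (leP (complex.Re w) (x + h / 2)) => h1; case: (leP (complex.Im w) (y + h / 2)) => h2.
- by apply: Or41; lra.
- by apply: Or43; lra.
- by apply: Or42; lra.
- by apply: Or44; lra.
Qed.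

Lemma square_cover (w w' : C) : exists x y h, [/\ 0 < h, square x y h w & square x y h w'].
Proof.
pose M := cmod w + cmod w' + 1.
have := Re_le_cmod w; have := Im_le_cmod w; have := Re_le_cmod w'; have := Im_le_cmod w'.
rewrite !ler_norml => /andP[? ?] /andP[? ?] /andP[? ?] /andP[? ?].
have := cmod_ge0 w; have := cmod_ge0 w' => ? ?.
by exists (- M), (- M), (2 * M); rewrite /square /= /M; split; lra.
Qed.

(** [Z] is given locally as a zero set; the functions at different points are unrelated, like the
    expressions of a section in different frames. *)
Variable Z : set C.
Hypothesis Zloc : forall w0, exists (d : R) f, [/\ 0 < d, holo [set w | cmod (w - w0) < d] f &
  forall w, cmod (w - w0) < d -> Z w <-> f w = 0].

Lemma open_cball (w0 : C) (d : R) : open [set w | cmod (w - w0) < d].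
Proof.
apply/openC_cmod => z /= zd; exists (d - cmod (z - w0)); first by rewrite subr_gt0.
move=> w; rewrite ltrBrDr; apply: le_lt_trans.
by have := cmodD (w - z) (z - w0); rewrite addrA subrK.
Qed.

Lemma cball_center (w0 : C) (d : R) : 0 < d -> cmod (w0 - w0) < d.
Proof. by rewrite subrr cmod0. Qed.

Lemma holo_isolated V f a : open V -> V a -> holo V f ->
  (exists2 d : R, 0 < d & forall z, cmod (z - a) < d -> f z = 0) \/
  (exists2 d : R, 0 < d & forall z, z != a -> cmod (z - a) < d -> f z != 0).
Proof.
move=> oV Va hf; have [H|[N [g [hg ga gE]]]] := holo_order oV Va hf; first by left.
right; have [d d0 gd] := ccont_bound0 (holo_ccont hg Va) ga.
exists d => // z za zd; rewrite gE mulf_neq0//; first by rewrite expf_neq0// subr_eq0.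
by rewrite -cmod_gt0 (le_lt_trans _ (gd z I zd))// divr_ge0 ?cmod_ge0.
Qed.

Lemma zeros_dichotomy w0 :
  (exists2 d : R, 0 < d & forall w, cmod (w - w0) < d -> Z w) \/
  (exists2 d : R, 0 < d & forall w, w != w0 -> cmod (w - w0) < d -> ~ Z w).
Proof.
have [d [f [d0 hf fZ]]] := Zloc w0.
have [[e e0 H]|[e e0 H]] := holo_isolated (@open_cball w0 d) (@cball_center w0 d d0) hf.
  left; exists (Num.min d e); first by rewrite lt_min d0.
  by move=> w; rewrite lt_min => /andP[wd we]; apply/(fZ w wd); exact: H.
right; exists (Num.min d e); first by rewrite lt_min d0.
move=> w ww; rewrite lt_min => /andP[wd we] /(fZ w wd) fw.
by move: (H w ww we); rewrite fw eqxx.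
Qed.

(** The identity theorem. By the dichotomy, the interior [D] of [Z] and its complement are both
    open, so that by bisection membership in [D] is constant on every square. A square containing
    both [w0] and [b] excludes [D]. *)
Lemma zeros_isolated (b : C) : ~ Z b -> forall w0,
  exists2 d : R, 0 < d & forall w, w != w0 -> cmod (w - w0) < d -> ~ Z w.
Proof.
move=> nZb w0; have [[d d0 H]|//] := zeros_dichotomy w0; exfalso.
pose D : set C := [set w | exists2 d : R, 0 < d & forall w', cmod (w' - w) < d -> Z w'].
pose P (x y h : R) := (forall w, square x y h w -> D w) \/ (forall w, square x y h w -> ~ D w).
have Pall : forall x y h, 0 < h -> P x y h.
  apply: plane_bisection.
  - move=> x y h h0 P1 P2 P3 P4.
    (* The centre lies in all four quarters and decides which alternative holds throughout. *)
    pose c : C := (x + h / 2) +i* (y + h / 2).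
    have c1 : square x y (h / 2) c by rewrite /square /=; lra.
    have c2 : square (x + h / 2) y (h / 2) c by rewrite /square /=; lra.
    have c3 : square x (y + h / 2) (h / 2) c by rewrite /square /=; lra.
    have c4 : square (x + h / 2) (y + h / 2) (h / 2) c by rewrite /square /=; lra.
    have [Dc|nDc] := pselect (D c).
      left=> w /(square_quarters h0)[] wq.
      + by case: P1 => H'; [exact: H'|case: (H' _ c1)].
      + by case: P2 => H'; [exact: H'|case: (H' _ c2)].
      + by case: P3 => H'; [exact: H'|case: (H' _ c3)].
      + by case: P4 => H'; [exact: H'|case: (H' _ c4)].
    right=> w /(square_quarters h0)[] wq.
    + by case: P1 => H'; [case: nDc; exact: H'|exact: H'].
    + by case: P2 => H'; [case: nDc; exact: H'|exact: H'].
    + by case: P3 => H'; [case: nDc; exact: H'|exact: H'].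
    + by case: P4 => H'; [case: nDc; exact: H'|exact: H'].
  - move=> w1; have [[e e0 He]|[e e0 He]] := zeros_dichotomy w1; exists e => // x y h h0 _ sq.
      left=> w /sq we; exists (e - cmod (w - w1)); first by rewrite subr_gt0.
      move=> w'; rewrite ltrBrDr => h1; apply: He; apply: le_lt_trans h1.
      by have := cmodD (w' - w) (w - w1); rewrite addrA subrK.
    right=> w /sq we [e' e'0 He'].
    pose m := Num.min (e - cmod (w - w1)) e' / 2.
    have m0 : 0 < Num.min (e - cmod (w - w1)) e' by rewrite lt_min subr_gt0 we.
    have mh : m < Num.min (e - cmod (w - w1)) e' by rewrite ltr_pdivrMr// ltr_pMr// ltr1n.
    have mm : 0 < m by rewrite divr_gt0.
    (* A disc of zeros about [w] must contain one different from [w1]: of the two points [w + m] and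
       [w - m] at least one is. *)
    have [w' [w'1 w'2]] : exists w', w' != w1 /\ cmod (w' - w) = m.
      have [e1|/eqP e1] := pselect (w + m%:C = w1); last first.
        by exists (w + m%:C); split=> //; rewrite addrAC subrr add0r cmod_real gtr0_norm.
      exists (w - m%:C); split; last by rewrite addrAC subrr add0r cmodN cmod_real gtr0_norm.
      have -> : w1 = w + m%:C by [].
      rewrite -subr_eq0 (_ : _ - _ = - (m%:C + m%:C)) ?oppr_eq0; last by ring.
      by rewrite -cmod_gt0 -rmorphD cmod_real gtr0_norm addr_gt0.
    move: mh; rewrite -w'2 lt_min => /andP[h1 h2].
    apply: (He w' w'1); last exact: He'.
    apply: le_lt_trans (_ : cmod (w' - w) + cmod (w - w1) < _); last by rewrite -ltrBrDr.
    by have := cmodD (w' - w) (w - w1); rewrite addrA subrK.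
have [x [y [h [h0 s1 s2]]]] := square_cover w0 b.
have [H'|H'] := Pall x y h h0.
  by have [e e0 He] := H' b s2; apply: nZb; apply: He; exact: cball_center.
by apply: (H' w0 s1); exists d.
Qed.

(** Small squares contain at most one zero each, and finiteness passes from the quarters to the
    square; a bounded [Z] fits in one square. *)
Lemma zeros_finite (b : C) (M : R) : ~ Z b -> (forall w, Z w -> cmod w <= M) -> finite_set Z.
Proof.
move=> nZb ZM; pose P (x y h : R) := finite_set (Z `&` square x y h).
have Pall : forall x y h, 0 < h -> P x y h.
  apply: plane_bisection.
  - move=> x y h h0 P1 P2 P3 P4.
    apply: (@sub_finite_set _ _ (((Z `&` square x y (h / 2)) `|` (Z `&` square (x + h / 2) y (h / 2)))
      `|` ((Z `&` square x (y + h / 2) (h / 2)) `|` (Z `&` square (x + h / 2) (y + h / 2) (h / 2))))).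
      move=> w [Zw /(square_quarters h0)[] sw].
      + by left; left.
      + by left; right.
      + by right; left.
      + by right; right.
    by rewrite !finite_setU.
  - move=> w0; have [d d0 H] := zeros_isolated nZb w0; exists d => // x y h h0 _ sq.
    apply: (@sub_finite_set _ _ [set w0]); last exact: finite_set1.
    move=> w [Zw /sq wd] /=; apply/eqP/negP => ww.
    by apply: (H w _ wd Zw); apply/negP.
apply: sub_finite_set (Pall (- `|M| - 1) (- `|M| - 1) (2 * (`|M| + 1)) _).
  move=> w Zw; split=> //; have := ZM w Zw; have := ler_norm M.
  have := Re_le_cmod w; have := Im_le_cmod w; rewrite !ler_norml => /andP[? ?] /andP[? ?] ? ?.
  by rewrite /square /=; lra.
by rewrite mulr_gt0// ltr_wpDl.
Qed.

End ZerosAndDivisors.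

(** * Polynomial divisors of sections *)

Section Divisor.
Variable R : realType.
Local Notation C := (Cplx R).
Implicit Types (z w p q v a b : C) (f g F G : C -> C) (V : set C).

(* A section of a line bundle on C: its expressions [f] in local frames over
   open sets [V], which differ by invertible holomorphic functions. *)
Variable L : set C -> (C -> C) -> Prop.
Hypothesis Lopen : forall V f, L V f -> open V.
Hypothesis Lholo : forall V f, L V f -> holo V f.
Hypothesis Lcover : forall w, exists V f, L V f /\ V w.
Hypothesis Ldiff : forall V f W g, L V f -> L W g -> exists2 c, holo (V `&` W) c &
  forall z, V z -> W z -> c z != 0 /\ f z = c z * g z.

Definition is_divisor_of (q : {poly R[i]}) V f := forall w0, V w0 -> exists (d : R) (e : C -> C),
  [/\ 0 < d, forall w, cmod (w - w0) < d -> V w, holo [set w | cmod (w - w0) < d] e &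
      forall w, cmod (w - w0) < d -> e w != 0 /\ f w = q.[w] * e w].

(** The polynomial is the product of the [(X - a)^(N a)] over the finitely many zeros. The
    multiplicity [N a] is the same in all frames, as these differ by units. *)
Lemma divisor_poly (M : R) : (forall V f w, L V f -> V w -> f w = 0 -> cmod w <= M) ->
  exists2 q : {poly R[i]}, q != 0 & forall V f, L V f -> is_divisor_of q V f.
Proof.
move=> LM; pose Z : set C := [set w | exists V f, [/\ L V f, V w & f w = 0]].
have ZE V f w : L V f -> V w -> Z w <-> f w = 0.
  move=> LVf Vw; split=> [[W [g [LWg Ww gw]]]|fw]; last by exists V, f.
  by have [c _ /(_ w Vw Ww)[_ ->]] := Ldiff LVf LWg; rewrite gw mulr0.
have Zloc w0 : exists (d : R) f, [/\ 0 < d, holo [set w | cmod (w - w0) < d] f &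
    forall w, cmod (w - w0) < d -> Z w <-> f w = 0].
  have [V [f [LVf Vw]]] := Lcover w0.
  have [d d0 dV] := (openC_cmod V).1 (Lopen LVf) w0 Vw.
  exists d, f; split=> //; first exact: holo_sub (Lholo LVf).
  by move=> w wd; apply: ZE LVf _; exact: dV.
(* A point beyond the bound is not a zero; by the identity theorem the section then vanishes
   identically nowhere. *)
pose b : C := (`|M| + 1)%:C.
have nZb : ~ Z b.
  move=> [V [f [LVf Vw fw]]]; have := LM V f b LVf Vw fw.
  rewrite cmod_real ger0_norm ?addr_ge0//; have := ler_norm M; lra.
have Zfin : finite_set Z.
  apply: (zeros_finite Zloc nZb (M := M)) => w [V [f [LVf Vw fw]]]; exact: LM LVf Vw fw.
have loc w0 : {N : nat | forall V f, L V f -> V w0 -> exists (d : R) e,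
   [/\ 0 < d, forall w, cmod (w - w0) < d -> V w, holo [set w | cmod (w - w0) < d] e &
     forall w, cmod (w - w0) < d -> e w != 0 /\ f w = (w - w0) ^+ N * e w]}.
  apply: cid; have [V [f [LVf Vw]]] := Lcover w0.
  have [[d d0 H]|[N [g [hg g0 gE]]]] := holo_order (Lopen LVf) Vw (Lholo LVf).
    exfalso; have [e e0 He] := zeros_isolated Zloc nZb w0.
    have [d' d'0 dV] := (openC_cmod V).1 (Lopen LVf) w0 Vw.
    pose m := Num.min d (Num.min e d'); have m0 : 0 < m by rewrite !lt_min d0 e0.
    pose w := w0 + (m / 2)%:C.
    have wE : cmod (w - w0) = m / 2 by rewrite addrAC subrr add0r cmod_real gtr0_norm// divr_gt0.
    have wm : cmod (w - w0) < m by rewrite wE ltr_pdivrMr// ltr_pMr// ltr1n.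
    have ww : w != w0 by rewrite -subr_eq0 -cmod_gt0 wE divr_gt0.
    move: wm; rewrite !lt_min => /andP[wd /andP[we wd']].
    by apply: (He w ww we); apply/(ZE V f w LVf (dV w wd')); exact: H.
  exists N => W h LWh Ww; have [c hc cE] := Ldiff LWh LVf.
  have [d1 d10 h1] := (openC_cmod V).1 (Lopen LVf) w0 Vw.
  have [d2 d20 h2] := (openC_cmod W).1 (Lopen LWh) w0 Ww.
  have [d3 d30 h3] := ccont_bound0 (holo_ccont hg Vw) g0.
  exists (Num.min d1 (Num.min d2 d3)), (fun w => c w * g w); split.
  - by rewrite !lt_min d10 d20.
  - by move=> w; rewrite !lt_min => /andP[_ /andP[/h2]].
  - apply: holoM.
      apply: holo_sub hc => w /=; rewrite !lt_min => /andP[/h1 Vw' /andP[/h2 Ww' _]]; split=> //.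
    by apply: holo_sub hg => w /=; rewrite !lt_min => /andP[/h1].
  - move=> w; rewrite !lt_min => /andP[/h1 Vw' /andP[/h2 Ww' wd3]].
    have [cw ->] := cE w Ww' Vw'; split; last by rewrite gE mulrCA.
    by rewrite mulf_neq0// -cmod_gt0 (le_lt_trans _ (h3 w I wd3))// divr_ge0 ?cmod_ge0.
pose N w0 := sval (loc w0); have NP w0 := svalP (loc w0).
have [s Zs] := (finite_seqP Z).1 Zfin.
pose s' := undup s.
have s'Z w : w \in s' <-> Z w by rewrite mem_undup Zs.
pose q : {poly R[i]} := \prod_(a <- s') ('X - (a : R[i])%:P) ^+ N a.
have qE (t : seq C) w : (\prod_(a <- t) ('X - (a : R[i])%:P) ^+ N a).[w] = \prod_(a <- t) (w - a) ^+ N a.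
  by rewrite horner_prod; apply: eq_bigr => a _; rewrite horner_exp !hornerE.
have qn0 (t : seq C) w : w \notin t -> (\prod_(a <- t) ('X - (a : R[i])%:P) ^+ N a).[w] != 0.
  move=> wt; rewrite qE prodf_seq_neq0; apply/allP => a /= at'.
  by rewrite expf_neq0// subr_eq0; apply: contraNneq wt => ->.
exists q.
  by rewrite prodf_seq_neq0; apply/allP => a _ /=; rewrite expf_neq0// polyXsubC_eq0.
move=> V f LVf w0 Vw0.
(* The factor of [q] at [w0] is split off, with exponent [0] if [w0] is not a zero; the remaining
   factors are units near [w0]. *)
have [k [t [kE tw0 qkt]]] : exists k (t : seq C), [/\ (forall w, Z w0 \/ k = 0%N),
    w0 \notin t & q = ('X - (w0 : R[i])%:P) ^+ k * \prod_(a <- t) ('X - (a : R[i])%:P) ^+ N a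
     /\ (Z w0 -> k = N w0)].
  have [Zw|nZw] := pselect (Z w0).
    exists (N w0), (rem w0 s'); split; first by left.
      by rewrite mem_rem_uniq ?undup_uniq// inE eqxx.
    by split=> //; rewrite /q (perm_big _ (perm_to_rem ((s'Z w0).2 Zw)))/= big_cons.
  exists 0%N, s'; split; first by right.
    by apply/negP => /s'Z.
  by rewrite mul1r.
move: qkt => [qkt kN].
have [d [e [d0 dV he eE]]] := NP w0 V f LVf Vw0.
pose u w := (\prod_(a <- t) ('X - (a : R[i])%:P) ^+ N a).[w].
have hu : holo setT u by exact: holo_poly.
have u0 : u w0 != 0 by exact: qn0.
have [d1 d10 h1] := ccont_bound0 (holo_ccont hu (I : setT w0)) u0.
have un0 w : cmod (w - w0) < d1 -> u w != 0.
  by move=> wd; rewrite -cmod_gt0 (le_lt_trans _ (h1 w I wd))// divr_ge0 ?cmod_ge0.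
have [e' [d2 [d20 he' e'E]]] : exists e' (d2 : R), [/\ 0 < d2, holo [set w | cmod (w - w0) < d2] e' &
    forall w, cmod (w - w0) < d2 -> V w /\ (e' w != 0 /\ f w = (w - w0) ^+ k * e' w)].
  have [Zw|nZw] := pselect (Z w0).
    by exists e, d; split=> // w wd; split; [exact: dV|rewrite (kN Zw); exact: eE].
  have k0 : k = 0%N by case: (kE 0).
  have fw0 : f w0 != 0 by apply/eqP => /(ZE V f w0 LVf Vw0).
  have [d3 d30 h3] := ccont_bound0 (holo_ccont (Lholo LVf) Vw0) fw0.
  exists f, (Num.min d d3); split; first by rewrite lt_min d0.
    by apply: holo_sub (Lholo LVf) => w /=; rewrite lt_min => /andP[/dV].
  move=> w; rewrite lt_min => /andP[/dV Vw wd3]; split=> //; rewrite k0 mul1r; split=> //.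
  by rewrite -cmod_gt0 (le_lt_trans _ (h3 w I wd3))// divr_ge0 ?cmod_ge0.
exists (Num.min d1 d2), (fun w => e' w * (u w)^-1); split.
- by rewrite lt_min d10.
- by move=> w; rewrite lt_min => /andP[_ /e'E[]].
- apply: holoM.
    by apply: holo_sub he' => w /=; rewrite lt_min => /andP[].
  apply: holoV; first exact: holo_sub hu.
  by move=> w /=; rewrite lt_min => /andP[/un0].
- move=> w; rewrite lt_min => /andP[/un0 uw /e'E[_ [e'w ->]]]; split.
    by rewrite mulf_neq0// invr_neq0.
  rewrite qkt hornerM -/(u w) horner_exp hornerXsubC.
  transitivity ((w - w0) ^+ k * u w * (e' w * (u w)^-1) : C) => //.
  by field.
Qed.

End Divisor.

(** * Tori *)

Lemma bij_seqP (T : eqType) (S : set T) m (f : nat -> T) :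
  set_bij `I_m S f ->
  exists s : seq T, [/\ uniq s, size s = m & forall y, y \in s <-> S y].
Proof.
move=> [fS finj fsurj]; exists [seq f i | i <- iota 0 m]; split; last 1 first.
- move=> y; split=> [|/fsurj[i im <-]].
    by move/mapP => [l]; rewrite mem_iota add0n => im ->; apply: fS.
  by apply: map_f; rewrite mem_iota add0n.
- rewrite map_inj_in_uniq ?iota_uniq// => i j; rewrite !mem_iota !add0n => im jm.
  by apply: finj; apply/mem_set.
- by rewrite size_map size_iota.
Qed.

Section TorusAlgebra.
Variables (R : realType) (r k : nat).
Local Notation C := (Cplx R).
Implicit Types (s t : 'rV[C]_r) (x : 'rV[C]_k) (chi : 'rV[int]_r).

Lemma torus_tmul s t : torus s -> torus t -> torus (tmul s t).
Proof. by move=> s0 t0 a; rewrite mxE mulf_neq0. Qed.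

Lemma torus_tinv t : torus t -> torus (tinv t).
Proof. by move=> t0 a; rewrite mxE invr_neq0. Qed.

Lemma torus1 : torus (const_mx 1 : 'rV[C]_r).
Proof. by move=> a; rewrite mxE oner_neq0. Qed.

Lemma tmulC s t : tmul s t = tmul t s.
Proof. by apply/rowP => a; rewrite !mxE mulrC. Qed.

Lemma tmulA s t u : tmul s (tmul t u) = tmul (tmul s t) u :> 'rV[C]_r.
Proof. by apply/rowP => a; rewrite !mxE mulrA. Qed.

Lemma tmul1 t : tmul (const_mx 1) t = t.
Proof. by apply/rowP => a; rewrite !mxE mul1r. Qed.

Lemma tmulV t : torus t -> tmul t (tinv t) = const_mx 1.
Proof. by move=> t0; apply/rowP => a; rewrite !mxE mulfV. Qed.

Lemma tinvM s t : tinv (tmul s t) = tmul (tinv s) (tinv t).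
Proof. by apply/rowP => a; rewrite !mxE invfM. Qed.

Lemma tinv1 : tinv (const_mx 1) = const_mx 1 :> 'rV[C]_r.
Proof. by apply/rowP => a; rewrite !mxE invr1. Qed.

Lemma characterM chi s t : character chi (tmul s t) = character chi s * character chi t.
Proof. by rewrite /character -big_split /=; apply: eq_bigr => a _; rewrite mxE expfzMl. Qed.

Lemma characterV chi t : character chi (tinv t) = (character chi t)^-1.
Proof.
rewrite /character -prodfV; apply: eq_bigr => a _.
by rewrite mxE exprz_inv invr_expz.
Qed.

Lemma character1 chi : character chi (const_mx 1 : 'rV[C]_r) = 1.
Proof. by rewrite /character big1// => a _; rewrite mxE exp1rz. Qed.

Lemma character_neq0 chi t : torus t -> character chi t != 0.
Proof. by move=> t0; apply/prodf_neq0 => a _; rewrite expfz_neq0. Qed.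

Variable nu : 'M[int]_(k, r).

Lemma tactE t x j : tact nu t x 0 j = character (row j nu) t * x 0 j.
Proof. by rewrite mxE. Qed.

Lemma tactM s t x : tact nu s (tact nu t x) = tact nu (tmul s t) x.
Proof. apply/rowP => j; rewrite [RHS]tactE characterM [LHS]tactE [in LHS]tactE; exact: mulrA.
Qed.

Lemma tact1 x : tact nu (const_mx 1) x = x.
Proof. by apply/rowP => j; rewrite tactE character1 mul1r. Qed.

Lemma Xss_tact (Phi : 'rV[C]_k -> 'rV[R]_r) t x : torus t -> Xss nu Phi x -> Xss nu Phi (tact nu t x).
Proof.
move=> t0 [s [y [s0 Py ->]]]; exists (tmul t s), y; split=> //; first exact: torus_tmul.
by rewrite tactM.
Qed.

Lemma stabilizer_mul x s t : stabilizer nu x s -> stabilizer nu x t -> stabilizer nu x (tmul s t).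
Proof.
move=> [s0 sx] [t0 tx]; split; first exact: torus_tmul.
by rewrite -tactM tx sx.
Qed.

(** Lagrange's theorem by the commutative argument: multiplication by [t] permutes the stabilizer,
    so the product of the [a]-th coordinates of its elements equals itself times [(t_a)^m]. *)
Lemma stabilizer_order x m t : (stabilizer nu x #= `I_m)%card -> stabilizer nu x t ->
  (0 < m)%N /\ forall a, t 0 a ^+ m = 1.
Proof.
rewrite card_eq_sym => /card_set_bijP[f fb] tS.
have [s [su ss sS]] := @bij_seqP 'rV[C]_r (stabilizer nu x) m f fb.
split; first by rewrite lt0n -ss size_eq0; apply/eqP => s0; have := (sS t).2 tS; rewrite s0.
have [t0 _] := tS.
have tinj : injective (tmul t).
  move=> y z /(congr1 (tmul (tinv t))); rewrite !tmulA ![tmul (tinv t) t]tmulC !tmulV//.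
  by rewrite !tmul1.
have pts : perm_eq s [seq tmul t y | y <- s].
  have mu : uniq [seq tmul t y | y <- s] by rewrite map_inj_uniq.
  have sub : {subset [seq tmul t y | y <- s] <= s}.
    by move=> z /mapP[y /sS yS ->]; apply/sS; exact: stabilizer_mul.
  have [_ ms] := uniq_min_size mu sub (ltac:(by rewrite size_map)).
  by apply: uniq_perm => // z; rewrite ms.
move=> a; have P0 : \prod_(y <- s) y 0 a != 0.
  by rewrite prodf_seq_neq0; apply/allP => y /sS[y0 _] /=; exact: y0.
apply: (mulIf P0); rewrite mul1r [in RHS](perm_big _ pts) /= big_map.
rewrite [RHS](eq_bigr (fun y : 'rV[C]_r => t 0 a * y 0 a)); last by move=> y _; rewrite mxE.
rewrite big_split /=; congr (_ * _); rewrite -ss.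
by elim: (s) => [|y z IH]; rewrite ?big_nil// big_cons -IH exprS.
Qed.

(** If the weights of the nonzero coordinates of [x] had rank below [r], some one-parameter subgroup
    would be orthogonal to all of them and fix [x], making the stabilizer infinite. *)
Lemma weights_basis x : finite_set (stabilizer nu x) -> exists J : 'I_r -> 'I_k,
  (forall i, x 0 (J i) != 0) /\ \det (\matrix_(i, a) nu (J i) a) != 0.
Proof.
(* Rows belonging to vanishing coordinates are replaced by [0], so that an invertible selection of
   rows avoids them. *)
move=> Sfin; pose A : 'M[rat]_(k, r) := \matrix_(j, a) if x 0 j == 0 then 0 else (nu j a)%:~R.
have [fA|nfA] := boolP (row_full A).
  exists (fullrankfun fA); have U := fullrowsub_unit fA; split.
    move=> i; apply/eqP => xi; have : \det (rowsub (fullrankfun fA) A) = 0.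
      by rewrite (expand_det_row _ i) big1// => a _; rewrite !mxE xi eqxx mul0r.
    by move=> d0; move: U; rewrite unitmxE d0 unitr0.
  move: U; rewrite unitmxE unitfE; apply: contra => /eqP d0.
  have -> : rowsub (fullrankfun fA) A = map_mx intr (\matrix_(i, a) nu (fullrankfun fA i) a).
    apply/matrixP => i a; rewrite !mxE; case: ifP => // /eqP xi; exfalso.
    have : \det (rowsub (fullrankfun fA) A) = 0.
      by rewrite (expand_det_row _ i) big1// => b _; rewrite !mxE xi eqxx mul0r.
    by move=> d1; have := fullrowsub_unit fA; rewrite unitmxE d1 unitr0.
  by rewrite det_map_mx d0.
exfalso; have : cokermx A != 0 by rewrite cokermx_eq0.
move=> /matrix0Pn[a0 [c v0]].
pose v (a : 'I_r) : rat := cokermx A a c.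
have Av j : \sum_a A j a * v a = 0.
  by have /matrixP/(_ j c) := mulmx_coker A; rewrite !mxE.
(* A common denominator: [D v] is an integral cocharacter orthogonal to the weights of the nonzero
   coordinates. *)
pose D : int := \prod_a denq (v a).
have D0 : D != 0 by apply/prodf_neq0 => a _; exact: denq_neq0.
have xiE a : {z : int | z%:~R = D%:~R * v a :> rat}.
  exists (numq (v a) * \prod_(b | b != a) denq (v b)).
  rewrite /D [X in _ = X%:~R * _](bigD1 a)//= !intrM -{3}(divq_num_den (v a)).
  by field; rewrite intr_eq0 denq_neq0.
pose xi a := sval (xiE a).
have xiP a : (xi a)%:~R = D%:~R * v a :> rat := svalP (xiE a).
have xi0 : xi a0 != 0 by rewrite -(@intr_eq0 rat) xiP mulf_neq0// intr_eq0.
have nuxi j : x 0 j != 0 -> \sum_a nu j a * xi a = 0.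
  move=> xj; apply/eqP; rewrite -(@intr_eq0 rat) rmorph_sum /=; apply/eqP.
  rewrite (eq_bigr (fun a => D%:~R * (A j a * v a))).
    by rewrite -mulr_sumr Av mulr0.
  by move=> a _; rewrite rmorphM /= xiP mxE (negbTE xj); ring.
(* The cocharacter [xi] evaluated at the powers of [2]; these are distinct points because [xi a0] is
   nonzero. *)
pose t (l : nat) : 'rV[C]_r := \row_a ((2 : C) ^ (xi a * l%:Z)).
have two0 : (2 : C) != 0 by rewrite pnatr_eq0.
have t0 l : torus (t l) by move=> a; rewrite mxE expfz_neq0.
have tS l : stabilizer nu x (t l).
  split=> //; apply/rowP => j; rewrite tactE.
  have [->|xj] := eqVneq (x 0 j) 0; first by rewrite mulr0.
  suff -> : character (row j nu) (t l) = 1 by rewrite mul1r.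
  have expsum (I : Type) (s : seq I) (F : I -> int) :
      \prod_(i <- s) (2 : C) ^ F i = 2 ^ (\sum_(i <- s) F i).
    elim: s => [|i s IH]; first by rewrite !big_nil.
    by rewrite !big_cons expfzDr// IH.
  rewrite /character (eq_bigr (fun a => (2 : C) ^ (nu j a * xi a * l%:Z))).
    by rewrite expsum -mulr_suml nuxi// mul0r.
  by move=> a _; rewrite [t l 0 a]mxE [row j nu 0 a]mxE exprz_exp [xi a * l * _]mulrC mulrA.
have tinj : injective t.
  move=> l l' /rowP/(_ a0); rewrite !mxE.
  have cabs (m : int) : cmod ((2 : C) ^ m) = 2 ^ m.
    by rewrite cmodXz (_ : (2 : C) = 2%:C) ?cmod_real ?ger0_norm// rmorph_nat.
  move=> /(congr1 (@cmod R)); rewrite !cabs => /(@ieexprIz R 2).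
  rewrite ltr0n pnatr_eq1 => /(_ isT isT)/(mulfI xi0) [].
  by [].
have := finite_preimage (f := t) (in2W tinj) Sfin.
rewrite (_ : t @^-1` _ = setT); first exact: infinite_nat.
by apply/seteqP; split=> l // _; exact: tS.
Qed.

(* [nu_J] is an isogeny of tori; the adjugate of its matrix inverts it up to
   the [det]-th power. *)
Variable J : 'I_r -> 'I_k.
Local Notation M := (\matrix_(i, a) nu (J i) a).
Let N := \det M.

Lemma expfz_sum (c : C) (I : Type) (s : seq I) (F : I -> int) : c != 0 ->
  c ^ (\sum_(i <- s) F i) = \prod_(i <- s) c ^ F i.
Proof.
move=> c0; elim: s => [|i s IH]; first by rewrite !big_nil.
by rewrite !big_cons expfzDr// IH.
Qed.

Lemma expfz_prod (I : Type) (s : seq I) (F : I -> C) (m : int) :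
  (\prod_(i <- s) F i) ^ m = \prod_(i <- s) (F i) ^ m.
Proof.
elim: s => [|i s IH]; first by rewrite !big_nil exp1rz.
by rewrite !big_cons expfzMl IH.
Qed.

Lemma isogeny_inverse (eta : 'I_r -> C) i : (forall l, eta l != 0) ->
  character (row (J i) nu) (\row_a \prod_l (eta l) ^ (\adj M a l)) = eta i ^ N.
Proof.
move=> eta0; rewrite /character.
rewrite (eq_bigr (fun a => \prod_l (eta l) ^ (M i a * \adj M a l))); last first.
  move=> a _; rewrite !mxE expfz_prod; apply: eq_bigr => l _.
  by rewrite exprz_exp !mxE mulrC.
rewrite exchange_big /= (bigD1 i)//= [X in _ * X]big1 ?mulr1.
  rewrite -expfz_sum//; congr (_ ^ _).
  transitivity ((M *m \adj M) i i); first by rewrite [RHS]mxE.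
  by rewrite mul_mx_adj mxE eqxx mulr1n.
move=> l li; rewrite -expfz_sum//.
have /matrixP/(_ i l) := mul_mx_adj M; rewrite [in LHS]mxE [in RHS]mxE eq_sym (negbTE li) mulr0n => ->.
by [].
Qed.

Lemma isogeny_power (g : 'rV[C]_r) a : torus g ->
  g 0 a ^ N = \prod_i (character (row (J i) nu) g) ^ (\adj M a i).
Proof.
move=> g0; rewrite /character.
rewrite (eq_bigr (fun i => \prod_c (g 0 c) ^ (\adj M a i * M i c))); last first.
  move=> i _; rewrite expfz_prod; apply: eq_bigr => c _.
  by rewrite exprz_exp !mxE mulrC.
rewrite exchange_big /= (bigD1 a)//= [X in _ * X]big1 ?mulr1.
  rewrite -expfz_sum//; congr (_ ^ _).
  transitivity ((\adj M *m M) a a); last by rewrite [LHS]mxE.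
  by rewrite mul_adj_mx mxE eqxx mulr1n.
move=> c ca; rewrite -expfz_sum//.
have /matrixP/(_ a c) := mul_adj_mx M; rewrite [in LHS]mxE [in RHS]mxE eq_sym (negbTE ca) mulr0n => ->.
by [].
Qed.

End TorusAlgebra.

(** * Frames of principal bundles *)

Section Bundles.
Variables (R : realType) (r : nat).
Local Notation C := (Cplx R).
Implicit Types (z w : C) (V W : set C) (g h : C -> 'rV[C]_r).

Lemma holo_torusP V g : holo_torus_on V g <->
  (forall z, V z -> torus (g z)) /\ forall a, holo V (fun z => g z 0 a).
Proof. by split=> -[h1 h2]; split=> // a; apply/holo_onE. Qed.

Lemma holo_torus_sub V W g : W `<=` V -> holo_torus_on V g -> holo_torus_on W g.
Proof.
move=> WV /holo_torusP[h1 h2]; apply/holo_torusP; split=> [z /WV/h1//|a].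
exact: holo_sub (h2 a).
Qed.

Lemma holo_torusM V g h : holo_torus_on V g -> holo_torus_on V h ->
  holo_torus_on V (fun z => tmul (g z) (h z)).
Proof.
move=> /holo_torusP[g1 g2] /holo_torusP[h1 h2]; apply/holo_torusP; split=> [z Vz|a].
  by apply: torus_tmul; [exact: g1|exact: h1].
rewrite (_ : (fun z => _) = fun z => g z 0 a * h z 0 a); first exact: holoM.
by apply/funext => z; rewrite mxE.
Qed.

Lemma holo_torusV V g : holo_torus_on V g -> holo_torus_on V (fun z => tinv (g z)).
Proof.
move=> /holo_torusP[g1 g2]; apply/holo_torusP; split=> [z Vz|a].
  by apply: torus_tinv; exact: g1.
rewrite (_ : (fun z => _) = fun z => (g z 0 a)^-1).
  by apply: holoV => // z Vz; exact: g1.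
by apply/funext => z; rewrite mxE.
Qed.

Lemma holo_torus_cst V (t : 'rV[C]_r) : torus t -> holo_torus_on V (fun=> t).
Proof. by move=> t0; apply/holo_torusP; split=> // a; exact: holo_cst. Qed.

Lemma holo_torus_local V g : (forall z, V z -> exists (d : R) h, [/\ 0 < d,
    holo_torus_on [set w | cmod (w - z) < d] h & forall w, cmod (w - z) < d -> g w = h w]) ->
  holo_torus_on V g.
Proof.
move=> H; apply/holo_torusP; split=> [z|a z] /H[d [h [d0 /holo_torusP[h1 h2] gh]]].
  by rewrite gh ?subrr ?cmod0//; apply: h1; rewrite /= subrr cmod0.
have [|l dl] := h2 a z; first by rewrite /= subrr cmod0.
exists l; apply: (cder_near d0 _ _ dl) => [w _ wd|]; first by rewrite gh.
by rewrite gh// subrr cmod0.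
Qed.

Lemma holo_torus_comp V W g (f : C -> C) : holo_torus_on W g -> holo V f ->
  (forall z, V z -> W (f z)) -> holo_torus_on V (fun z => g (f z)).
Proof.
move=> /holo_torusP[g1 g2] hf VW; apply/holo_torusP; split=> [z /VW/g1//|a].
exact: (holo_comp (g2 a) hf VW).
Qed.

Lemma holo_character V g (chi : 'rV[int]_r) : holo_torus_on V g ->
  holo V (fun z => character chi (g z)).
Proof.
move=> /holo_torusP[g1 g2]; rewrite /character.
have H (s : seq 'I_r) : holo V (fun z => \prod_(a <- s) g z 0 a ^ chi 0 a).
  elim: s => [|a s IH].
    by rewrite (_ : (fun z => _) = fun=> 1); [exact: holo_cst|apply/funext => z; rewrite big_nil].
  rewrite (_ : (fun z => _) = fun z => g z 0 a ^ chi 0 a * \prod_(b <- s) g z 0 b ^ chi 0 b).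
    by apply: holoM => //; apply: holoXz => // z Vz; exact: g1.
  by apply/funext => z; rewrite big_cons.
exact: H.
Qed.

Variable E : pbundle R r.

Lemma pact_inj (s t : 'rV[C]_r) (x : E) : torus s -> torus t -> pact s x = pact t x -> s = t.
Proof.
move=> s0 t0 e; have it0 := torus_tinv t0.
have : pact (tmul (tinv t) s) x = x.
  by rewrite -pactM// e pactM// tmulC tmulV// pact1.
move=> /(pact_free (torus_tmul it0 s0)) H.
by rewrite -[s]tmul1 -(tmulV t0) -tmulA H tmulC tmul1.
Qed.

Lemma pactV (t : 'rV[C]_r) (x y : E) : torus t -> y = pact t x -> x = pact (tinv t) y.
Proof. by move=> t0 ->; rewrite pactM//; [rewrite tmulC tmulV// pact1|exact: torus_tinv]. Qed.

Lemma tdiv_ex (x y : E) : exists t, pproj x = pproj y -> torus t /\ y = pact t x.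
Proof.
have [/pact_trans[t H]|H] := pselect (pproj x = pproj y); first by exists t.
by exists (const_mx 1).
Qed.

(** The quotient of [y] by [x] in a fibre, with an arbitrary value for points of different fibres: a
    total function, whose holomorphy along two sections can be stated. *)
Definition tdiv (x y : E) : 'rV[C]_r := sval (cid (tdiv_ex x y)).

Lemma tdivP (x y : E) : pproj x = pproj y -> torus (tdiv x y) /\ y = pact (tdiv x y) x.
Proof. exact: svalP (cid (tdiv_ex x y)). Qed.

Lemma tdiv_uniq (x : E) t : torus t -> tdiv x (pact t x) = t.
Proof.
move=> t0; have [|d0 dE] := @tdivP x (pact t x); first by rewrite pact_proj.
exact: (pact_inj d0 t0 (esym dE)).
Qed.

Lemma holo_section_plsec V (s : C -> E) : plsec V s -> holo_section V s.
Proof.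
move=> Vs; split; first exact: plsec_open Vs.
  by move=> z; exact: plsec_proj.
by move=> W t; exact: plsec_holo.
Qed.

Lemma holo_section_proj V (s : C -> E) z : holo_section V s -> V z -> pproj (s z) = z.
Proof. by move=> [_ H _]; exact: H. Qed.

Lemma ball_sub_open V z : open V -> V z ->
  exists2 d : R, 0 < d & forall w, cmod (w - z) < d -> V w.
Proof. by move=> /openC_cmod; apply. Qed.

(** Holomorphy is local, and near each point both sections are compared with one section of the
    atlas. *)
Lemma holo_section_diff V W (s t : C -> E) : holo_section V s -> holo_section W t ->
  holo_torus_on (V `&` W) (fun z => tdiv (t z) (s z)) /\
  forall z, (V `&` W) z -> s z = pact (tdiv (t z) (s z)) (t z).
Proof.
move=> Vs Wt; have [oV sp sh] := Vs; have [oW tp th] := Wt; split; last first.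
  by move=> z [Vz Wz]; have [|_] := @tdivP (t z) (s z); first by rewrite sp ?tp.
apply: holo_torus_local => z [Vz Wz].
have [U [u [Uu Uz]]] := plsec_cover E z.
have [g [hg gE]] := sh U u Uu; have [g' [hg' g'E]] := th U u Uu.
have [d1 d10 h1] := ball_sub_open oV Vz; have [d2 d20 h2] := ball_sub_open oW Wz.
have [d3 d30 h3] := ball_sub_open (plsec_open Uu) Uz.
exists (Num.min d1 (Num.min d2 d3)), (fun w => tmul (g w) (tinv (g' w))); split.
- by rewrite !lt_min d10 d20.
- apply: holo_torusM.
    by apply: holo_torus_sub hg => w; rewrite /= !lt_min => /andP[/h1 ? /andP[_ /h3]].
  apply: holo_torusV.
  by apply: holo_torus_sub hg' => w; rewrite /= !lt_min => /andP[_ /andP[/h2 ? /h3]].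
move=> w; rewrite /= !lt_min => /andP[/h1 Vw /andP[/h2 Ww /h3 Uw]].
have gw := hg.1 w (conj Vw Uw); have gw' := hg'.1 w (conj Ww Uw).
rewrite -(@tdiv_uniq (t w) (tmul (g w) (tinv (g' w)))).
  congr tdiv; rewrite -pactM//; last exact: torus_tinv.
  by rewrite (gE w)//; congr pact; apply: pactV => //; exact: g'E.
by apply: torus_tmul => //; exact: torus_tinv.
Qed.

Lemma holo_section_sub V W (s : C -> E) : open W -> W `<=` V -> holo_section V s -> holo_section W s.
Proof.
move=> oW WV [oV sp sh]; split=> [//|z /WV/sp//|U u /sh[g [hg gE]]].
exists g; split; first by apply: holo_torus_sub hg => z [/WV].
by move=> z [/WV Vz Uz]; exact: gE.
Qed.

Lemma holo_section_act V (s : C -> E) g : holo_section V s -> holo_torus_on V g ->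
  holo_section V (fun z => pact (g z) (s z)).
Proof.
move=> [oV sp sh] hg; split=> [//|z Vz|U u /sh[h [hh hE]]].
  by rewrite pact_proj ?sp//; exact: hg.1.
exists (fun z => tmul (g z) (h z)); split.
  by apply: holo_torusM; [apply: holo_torus_sub hg => z []|exact: hh].
move=> z [Vz Uz]; rewrite hE// pactM//; [exact: hg.1|exact: hh.1].
Qed.

Lemma holo_section_local V (s : C -> E) : open V ->
  (forall z, V z -> exists (d : R) t, [/\ 0 < d, holo_section [set w | cmod (w - z) < d] t &
     forall w, cmod (w - z) < d -> s w = t w]) -> holo_section V s.
Proof.
move=> oV H; split=> // [z /H[d [t [d0 ht st]]]|U u Uu].
  have zz : cmod (z - z) < d by rewrite subrr cmod0.
  by rewrite st// (holo_section_proj ht).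
exists (fun z => tdiv (u z) (s z)); split.
  apply: holo_torus_local => z [/H[d [t [d0 ht st]]] Uz].
  have [g1 g2] := holo_section_diff ht (holo_section_plsec Uu).
  have [d' d'0 h'] := ball_sub_open (plsec_open Uu) Uz.
  exists (Num.min d d'), (fun w => tdiv (u w) (t w)); split; first by rewrite lt_min d0.
    by apply: holo_torus_sub g1 => w; rewrite /= lt_min => /andP[? /h'].
  by move=> w; rewrite lt_min => /andP[/st ->].
move=> z [/H[d [t [d0 ht st]]] Uz].
have zz : cmod (z - z) < d by rewrite subrr cmod0.
have [|_] := @tdivP (u z) (s z); last by [].
by rewrite st// (holo_section_proj ht)// (plsec_proj Uu).
Qed.

End Bundles.

(** * Global frames over the affine chart *)

Section GlobalSection.
Variables (R : realType) (r k : nat) (nu : 'M[int]_(k, r)).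
Local Notation C := (Cplx R).
Implicit Types (z w : C) (V W : set C).

Lemma finite_min (I : finType) (d : I -> R) : (forall i, 0 < d i) ->
  exists2 e : R, 0 < e & forall i, e <= d i.
Proof.
move=> d0; exists (\big[Order.min/1]_i d i); last by move=> i; rewrite (bigD1 i)//= ge_min lexx.
by elim/big_ind: _ => // x y x0 y0; rewrite lt_min x0.
Qed.

Lemma poly_zeros_isolated (q : {poly R[i]}) w0 : q != 0 ->
  exists2 d : R, 0 < d & forall w, w != w0 -> cmod (w - w0) < d -> q.[w] != 0.
Proof.
move=> q0; have [m [q' q'w qE]] := multiplicity_XsubC q w0.
have {}q'w : q'.[w0] != 0 by move: q'w; rewrite q0.
have [d d0 qd] := ccont_bound0 (holo_ccont (holo_poly q') (I : [set: C] w0)) q'w.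
exists d => // w ww wd; rewrite qE hornerM horner_exp !hornerE mulf_neq0//.
  by rewrite -cmod_gt0 (le_lt_trans _ (qd w I wd))// divr_ge0 ?cmod_ge0.
by rewrite expf_neq0// subr_eq0.
Qed.

Definition convex_set V := forall (p q : C) (t : R), V p -> V q -> 0 <= t <= 1 -> V (p + t%:C * (q - p)).

Lemma convex_setI V W : convex_set V -> convex_set W -> convex_set (V `&` W).
Proof. by move=> cV cW p q t [Vp Wp] [Vq Wq] t01; split; [exact: cV|exact: cW]. Qed.

Definition orect (x1 x2 y1 y2 : R) : set C :=
  [set w | x1 < complex.Re w < x2 /\ y1 < complex.Im w < y2].

Lemma open_orect x1 x2 y1 y2 : open (orect x1 x2 y1 y2).
Proof.
apply/openC_cmod => w [/andP[a b] /andP[c d]].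
exists (Num.min (Num.min (complex.Re w - x1) (x2 - complex.Re w)) (Num.min (complex.Im w - y1) (y2 - complex.Im w))).
  by rewrite !lt_min !subr_gt0 a b c d.
move=> w'; rewrite !lt_min => /andP[/andP[h1 h2] /andP[h3 h4]].
have := Re_le_cmod (w' - w); have := Im_le_cmod (w' - w).
rewrite !raddfB /= !ler_norml => /andP[? ?] /andP[? ?].
by split; apply/andP; split; lra.
Qed.

Lemma convex_orect x1 x2 y1 y2 : convex_set (orect x1 x2 y1 y2).
Proof.
have E (a b t : R) : (a + t * (b - a)) = (1 - t) * a + t * b by ring.
have lo (x a b t : R) : x < a -> x < b -> 0 <= t <= 1 -> x < a + t * (b - a).
  move=> xa xb t01; have [ab|ba] := leP a b; nra.
have hi (x a b t : R) : a < x -> b < x -> 0 <= t <= 1 -> a + t * (b - a) < x.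
  move=> xa xb t01; have [ab|ba] := leP a b; nra.
move=> [p1 p2] [q1 q2] t [/= /andP[a b] /andP[c d]] [/= /andP[a' b'] /andP[c' d']] t01.
rewrite /orect /= !mul0r subr0 addr0.
by split; apply/andP; split; [exact: lo|exact: hi|exact: lo|exact: hi].
Qed.

Variables (E : pbundle R r) (gs : E -> 'rV[C]_k).
Hypothesis gs_act : forall t x, torus t -> gs (pact t x) = tact nu (tinv t) (gs x).
Hypothesis gs_holo : forall V s, plsec V s -> forall j, holo V (fun z => gs (s z) 0 j).
Variable J : 'I_r -> 'I_k.
Local Notation M := (\matrix_(i, a) nu (J i) a).
Hypothesis M0 : \det M != 0.

Lemma holo_gs V (s : C -> E) j : holo_section V s -> holo V (fun z => gs (s z) 0 j).
Proof.
move=> [oV sp sh] z Vz; have [W [t [Wt Wz]]] := plsec_cover E z.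
have [g [hg gE]] := sh W t Wt.
have hW : holo (V `&` W) (fun z => (character (row j nu) (g z))^-1 * gs (t z) 0 j).
  apply: holoM; last by apply: holo_sub (gs_holo Wt j) => y [].
  by apply: holoV (holo_character _ hg) _ => y /hg.1; exact: character_neq0.
have oVW := openI oV (plsec_open Wt).
apply: (holo_eq oVW _ hW) => // y yVW.
by rewrite gE// gs_act ?tactE ?characterV//; exact: hg.1.
Qed.

Lemma section_divisor i (B : R) : (forall x, gs x 0 (J i) = 0 -> cmod (pproj x) <= B) ->
  exists2 q : {poly R[i]}, q != 0 &
    forall V s, plsec V s -> is_divisor_of q V (fun z => gs (s z) 0 (J i)).
Proof.
move=> HB; pose L V f := exists2 s : C -> E, plsec V s & f = fun z => gs (s z) 0 (J i).
have [||||V f w [s Vs ->] Vw fw|q q0 H] := @divisor_poly R L _ _ _ _ B.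
- by move=> V f [s Vs _]; exact: plsec_open Vs.
- by move=> V f [s Vs ->]; exact: gs_holo.
- by move=> w; have [V [s [Vs Vw]]] := plsec_cover E w; exists V, (fun z => gs (s z) 0 (J i)); split=> //; exists s.
- move=> V f W g [s Vs ->] [t Wt ->]; have [h [hh hE]] := plsec_holo Vs Wt.
  exists (fun z => (character (row (J i) nu) (h z))^-1).
    apply: holoV; first exact: holo_character.
    by move=> z zV; apply: character_neq0; exact: hh.1.
  move=> z Vz Wz; have hz : torus (h z) by exact: hh.1.
  rewrite invr_neq0 ?character_neq0//; split=> //.
  by rewrite hE// gs_act// tactE characterV.
- by rewrite -(plsec_proj Vs Vw); exact: HB.
by exists q => // V s Vs; apply: H; exists s.
Qed.

Variable q : 'I_r -> {poly R[i]}.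
Hypothesis q0 : forall i, q i != 0.

(* Adapted sections are unique up to the finite group [nu_J = 1], whence they
   can be glued as soon as the overlap is connected. *)
Definition adapted V (s : C -> E) := holo_section V s /\
  forall z, V z -> forall i, gs (s z) 0 (J i) = (q i).[z].

Lemma adapted_sub V W s : open W -> W `<=` V -> adapted V s -> adapted W s.
Proof. by move=> oW WV [hs sq]; split=> [|z /WV]; [exact: holo_section_sub hs|exact: sq]. Qed.

(** In a local frame [u_J] is [q] times units. The adjugate turns [|det|]-th roots of these units
    into a torus-valued function whose [nu_J]-characters are the units themselves, and the frame is
    corrected by it. *)
Lemma adapted_local (w0 : C) : (forall V s, plsec V s -> forall i, is_divisor_of (q i) V (fun z => gs (s z) 0 (J i))) ->
  exists (d : R) s, 0 < d /\ adapted [set w | cmod (w - w0) < d] s.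
Proof.
move=> div; have [V [s [Vs Vw0]]] := plsec_cover E w0.
have N0 : (0 < `|\det M|)%N by rewrite absz_gt0.
have loc i : exists de : R * (C -> C), [/\ 0 < de.1, forall w, cmod (w - w0) < de.1 -> V w,
    holo [set w | cmod (w - w0) < de.1] de.2 &
    forall w, cmod (w - w0) < de.1 -> de.2 w != 0 /\ gs (s w) 0 (J i) = (q i).[w] * de.2 w ^+ `|\det M|%N].
  have [d [e [d0 dV he eE]]] := div V s Vs i w0 Vw0.
  have [e0 _] := eE _ (cball_center w0 d0).
  have [d' [eta [d'0 d'd heta etaE]]] := local_root N0 (@open_cball _ w0 d) (cball_center w0 d0) he e0.
  exists (d', eta); split=> //= w wd; first by apply: dV; exact: d'd.
  have [ew ->] := eE w (d'd w wd); rewrite etaE//; split=> //.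
  by apply: contra_neq ew => w0'; rewrite -etaE// w0' expr0n; case: `|_|%N N0.
have [de deP] := choice loc.
have de0 i : 0 < (de i).1 by have [] := deP i.
have [d1 d10 dd1] := finite_min de0.
have [d2 d20 d2V] := ball_sub_open (plsec_open Vs) Vw0.
pose d := Num.min d1 d2; have d0 : 0 < d by rewrite lt_min d10.
have dd i : d <= (de i).1 by rewrite (le_trans _ (dd1 i))// ge_min lexx.
pose B : set C := [set w | cmod (w - w0) < d].
(* The roots have order [|det|], while [isogeny_inverse] produces the power [det]; the sign is
   compensated here. *)
pose et z i := (de i).2 z ^ (sgz (\det M)).
have et0 z i : B z -> et z i != 0.
  move=> Bz; rewrite /et expfz_neq0//; have [_ _ _ /(_ z)] := deP i.
  by case=> //; exact: lt_le_trans Bz (dd i).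
pose tau z : 'rV[C]_r := \row_a \prod_l (et z l) ^ (\adj M a l).
have htau : holo_torus_on B tau.
  apply/holo_torusP; split=> [z Bz a|a].
    by rewrite mxE prodf_seq_neq0; apply/allP => l _; rewrite expfz_neq0// et0.
  rewrite (_ : (fun z => _) = fun z => \prod_(l <- index_enum 'I_r) (et z l) ^ (\adj M a l)); last first.
    by apply/funext => z; rewrite mxE.
  apply: (@holo_prod _ _ _ _ (fun l z => (et z l) ^ (\adj M a l))) => l.
  apply: holoXz; last by move=> z; exact: et0.
  have [h1 _ h3 h4] := deP l.
  apply: holoXz; first by apply: holo_sub h3 => z zd; apply: lt_le_trans zd (dd l).
  by move=> z zd; have [] := h4 z (lt_le_trans zd (dd l)).
have BV : B `<=` V.
  by move=> z Bz; apply: d2V; apply: lt_le_trans Bz _; rewrite ge_min lexx orbT.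
exists d, (fun z => pact (tau z) (s z)); split=> //.
have hs : holo_section B s by apply: holo_section_sub (holo_section_plsec Vs); [exact: open_cball|].
split; first exact: holo_section_act.
move=> z Bz i; have tz : torus (tau z) by exact: htau.1.
have [_ _ _ /(_ z (lt_le_trans Bz (dd i)))[e0 eE]] := deP i.
rewrite gs_act// tactE characterV eE /tau isogeny_inverse; last by move=> l; exact: et0.
rewrite /et exprz_exp mulrC -mulrA -abszEsg -exprnP divff ?mulr1//.
by rewrite expf_neq0.
Qed.

(** The quotient has trivial [nu_J]-characters off the zeros of [q], hence everywhere by continuity.
    Its coordinates are thus [|det|]-th roots of unity, locally constant by [root_unique], and
    constant on the convex overlap. *)
Lemma adapted_diff V W s t : adapted V s -> adapted W t -> convex_set (V `&` W) ->
  exists c : 'rV[C]_r, [/\ torus c, forall i, character (row (J i) nu) c = 1 &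
    forall z, V z -> W z -> s z = pact c (t z)].
Proof.
move=> [hs sq] [ht tq] cVW; have [h1 h2] := holo_section_diff hs ht.
set tau := fun z => tdiv (t z) (s z) in h1 h2.
have N0 : (0 < `|\det M|)%N by rewrite absz_gt0.
have [oV _ _] := hs; have [oW _ _] := ht; have oVW := openI oV oW.
have [[p Wp]|noW] := pselect (exists z, (V `&` W) z); last first.
  exists (const_mx 1); split; [exact: torus1|by move=> i; exact: character1|].
  by move=> z Vz Wz; exfalso; apply: noW; exists z.
have char1 z i : (V `&` W) z -> character (row (J i) nu) (tau z) = 1.
  move=> zW; have [d d0 dW] := ball_sub_open oVW zW.
  have [d' d'0 qd] := poly_zeros_isolated z (q0 i).
  have dd0 : 0 < Num.min d d' by rewrite lt_min d0.
  apply: (ccont_punctured_eq dd0 (holo_ccont (holo_character (row (J i) nu) h1) zW) (ccont_cst setT 1 z)).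
  move=> w wz; rewrite lt_min => /andP[/dW[Vw Ww] /(qd w wz) qw].
  have tw : torus (tau w) by exact: h1.1.
  have := sq w Vw i; rewrite h2// gs_act// tactE characterV tq// => e.
  have c0 := character_neq0 (row (J i) nu) tw.
  by apply: (mulIf qw); rewrite mul1r -{1}e mulrA divff// mul1r.
have root1 z a : (V `&` W) z -> tau z 0 a ^+ `|\det M|%N = 1.
  move=> zW; have := isogeny_power nu J a (h1.1 z zW).
  rewrite big1 => [|i _]; last by rewrite char1// exp1rz.
  case: (\det M) => m; rewrite ?NegzE /=; first by [].
  by move=> e; apply: invr_inj; rewrite invr1.
exists (tau p); split; first exact: h1.1.
  by move=> i; exact: char1.
move=> z Vz Wz; rewrite h2//; congr pact; apply/rowP => a.
apply: esym; apply: (@cder0_segment R (fun z => tau z 0 a)) => u u01.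
have xW := cVW p z u Wp (conj Vz Wz) u01; set x := p + _ in xW *.
have [d d0 dW] := ball_sub_open oVW xW.
have tx0 : tau x 0 a != 0 by apply: h1.1.
have e0 : 0 < cmod (tau x 0 a) / `|\det M|%:R by rewrite divr_gt0 ?cmod_gt0 ?ltr0n.
have hta : holo (V `&` W) (fun z => tau z 0 a) by move/holo_torusP: h1 => [].
have [d' d'0 cd] := holo_ccont hta xW e0.
have dd0 : 0 < Num.min d d' by rewrite lt_min d0.
apply: (cder_near dd0 _ _ (cder_cst setT (tau x 0 a) x)) => //.
move=> w _; rewrite lt_min => /andP[/dW wW /(cd w I)]; rewrite ltr_pdivlMr ?ltr0n// => wd.
by apply/esym/(root_unique N0 tx0 _ wd); rewrite !root1.
Qed.

Lemma adapted_act V s c : torus c -> (forall i, character (row (J i) nu) c = 1) ->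
  adapted V s -> adapted V (fun z => pact c (s z)).
Proof.
move=> c0 cJ [hs sq]; split.
  by apply: (holo_section_act hs); exact: holo_torus_cst.
by move=> z Vz i; rewrite gs_act// tactE characterV cJ invr1 mul1r sq.
Qed.

Lemma adapted_from_local V (s : C -> E) : open V ->
  (forall z, V z -> exists (d : R) t, [/\ 0 < d, adapted [set w | cmod (w - z) < d] t &
     forall w, cmod (w - z) < d -> s w = t w]) -> adapted V s.
Proof.
move=> oV H; split.
  by apply: holo_section_local => // z /H[d [t [d0 [ht _] st]]]; exists d, t.
move=> z /H[d [t [d0 [ht tq] st]]] i; rewrite st ?tq//; exact: cball_center.
Qed.

Lemma adapted_glue V W s t : adapted V s -> adapted W t -> convex_set (V `&` W) ->
  exists u, adapted (V `|` W) u.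
Proof.
move=> Vs Wt cVW; have [c [c0 cJ st]] := adapted_diff Vs Wt cVW.
have Wct := adapted_act c0 cJ Wt.
have [[oV _ _] _] := Vs; have [[oW _ _] _] := Wt.
exists (fun z => if pselect (V z) then s z else pact c (t z)).
apply: adapted_from_local; first exact: openU.
move=> z [Vz|Wz].
  have [d d0 dV] := ball_sub_open oV Vz; exists d, s; split=> // [|w /dV Vw].
    by apply: adapted_sub Vs => //; exact: open_cball.
  by case: pselect.
have [d d0 dW] := ball_sub_open oW Wz; exists d, (fun z => pact c (t z)); split=> // [|w /dW Ww].
  by apply: adapted_sub Wct => //; exact: open_cball.
by case: pselect => // Vw; rewrite st.
Qed.

Hypothesis loc : forall w0, exists (d : R) s, 0 < d /\ adapted [set w | cmod (w - w0) < d] s.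

(** The quarters are glued first to two halves and then to the square. The margin [e] makes
    neighbouring pieces overlap in open rectangles, which are convex, as [adapted_diff] requires. *)
Lemma adapted_square (x y h : R) : 0 < h ->
  exists2 e : R, 0 < e & exists s, adapted (orect (x - e) (x + h + e) (y - e) (y + h + e)) s.
Proof.
move: x y h; apply: plane_bisection => [x y h h0 [e1 e10 [s1 S1]] [e2 e20 [s2 S2]] [e3 e30 [s3 S3]] [e4 e40 [s4 S4]]|w0].
  pose e := Num.min (Num.min e1 e2) (Num.min e3 e4).
  have [ee1 ee2 ee3 ee4] : [/\ e <= e1, e <= e2, e <= e3 & e <= e4].
    by rewrite /e !ge_min !lexx !orbT.
  have e0 : 0 < e by rewrite /e !lt_min e10 e20 e30.
  have [a aS] : exists s, adapted (orect (x - e) (x + h + e) (y - e) (y + h / 2 + e)) s.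
    have [|u uS] := @adapted_glue _ _ s1 s2 S1 S2.
      by apply: convex_setI; exact: convex_orect.
    exists u; apply: adapted_sub uS; first exact: open_orect.
    clear - h0 e0 ee1 ee2 => w [/= /andP[? ?] /andP[? ?]]; have [?|?] := ltP (complex.Re w) (x + h / 2 + e); [left|right].
      by split; apply/andP; split; lra.
    by split; apply/andP; split; lra.
  have [b bS] : exists s, adapted (orect (x - e) (x + h + e) (y + h / 2 - e) (y + h + e)) s.
    have [|u uS] := @adapted_glue _ _ s3 s4 S3 S4.
      by apply: convex_setI; exact: convex_orect.
    exists u; apply: adapted_sub uS; first exact: open_orect.
    clear - h0 e0 ee3 ee4 => w [/= /andP[? ?] /andP[? ?]]; have [?|?] := ltP (complex.Re w) (x + h / 2 + e); [left|right].
      by split; apply/andP; split; lra.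
    by split; apply/andP; split; lra.
  exists e => //; have [|u uS] := @adapted_glue _ _ a b aS bS.
    by apply: convex_setI; exact: convex_orect.
  exists u; apply: adapted_sub uS; first exact: open_orect.
  clear - h0 e0 => w [/= /andP[? ?] /andP[? ?]]; have [?|?] := ltP (complex.Im w) (y + h / 2 + e); [left|right].
    by split; apply/andP; split; lra.
  by split; apply/andP; split; lra.
(* Two opposite corners are within [D / 4] of [w0]. With a margin [D / 4] both coordinates stay
   within [D / 2] of those of [w0], and the enlarged square lies in the disc. *)
have [D [s [D0 sS]]] := loc w0; exists (D / 4); first by rewrite divr_gt0.
move=> x y h h0 w0S sub; exists (D / 4); first by rewrite divr_gt0.
exists s; apply: adapted_sub sS; first exact: open_orect.
have c1 := sub (x +i* y); have c2 := sub ((x + h) +i* (y + h)).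
have {c1} := c1 _; have {c2} := c2 _.
rewrite /square /= !lexx /= => H1 H2.
have {}H1 : cmod (((x + h) +i* (y + h)) - w0) < D / 4 by apply: H1; split; apply/andP; split; lra.
have {}H2 : cmod ((x +i* y) - w0) < D / 4 by apply: H2; split; lra.
have := Re_le_cmod (((x + h) +i* (y + h)) - w0); have := Im_le_cmod (((x + h) +i* (y + h)) - w0).
have := Re_le_cmod ((x +i* y) - w0); have := Im_le_cmod ((x +i* y) - w0).
rewrite !raddfB /= !ler_norml => /andP[+ +] /andP[+ +] /andP[+ +] /andP[+ +].
clear - D0 h0 H1 H2 => ? ? ? ? ? ? ? ? w [/andP[? ?] /andP[? ?]]; rewrite /=; apply: le_lt_trans (cmod_le_ReIm _) _.
rewrite !raddfB /=.
have -> : D = D / 2 + D / 2 by lra.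
by apply: ltrD; rewrite ltr_norml; apply/andP; split; lra.
Qed.

(** Exhaustion by squares: each section is multiplied by a constant so that it agrees with the
    smallest one at [0]. Two of them then differ by a constant fixing a point, which is [1] because
    the action is free. *)
Lemma adapted_global : exists s, adapted setT s.
Proof.
pose B (n : nat) := orect (- n.+1%:R) n.+1%:R (- n.+1%:R) n.+1%:R.
have mem0 n : B n 0 by rewrite /B /orect /= oppr_lt0 ltr0n.
have BB n m : (n <= m)%N -> B n `<=` B m.
  move=> nm w [/andP[? ?] /andP[? ?]]; have : (n.+1%:R : R) <= m.+1%:R by rewrite ler_nat.
  by move=> ?; split; apply/andP; split; lra.
have cB n : convex_set (B n) by exact: convex_orect.
have ex n : exists s, adapted (B n) s.
  have h0 : 0 < (2 * n.+1%:R : R) by rewrite mulr_gt0 ?ltr0n.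
  have [e e0 [s Ss]] := adapted_square (- n.+1%:R) (- n.+1%:R) h0; exists s.
  apply: adapted_sub Ss; first exact: open_orect.
  by move=> w [/andP[? ?] /andP[? ?]]; split; apply/andP; split; lra.
have [s Ss] := choice ex.
have cex n : exists c : 'rV[C]_r, [/\ torus c, forall i, character (row (J i) nu) c = 1 &
    forall z, B 0 z -> B n z -> s 0 z = pact c (s n z)].
  by apply: adapted_diff => //; exact: convex_setI.
have [c cP] := choice cex.
pose s' n z := pact (c n) (s n z).
have Ss' n : adapted (B n) (s' n) by have [? ? _] := cP n; exact: adapted_act.
have s'0 n : s' n 0 = s 0 0 by have [_ _ H] := cP n; rewrite H.
have coh n m z : (n <= m)%N -> B n z -> s' n z = s' m z.
  move=> nm nz; have [|t [t0 tJ tE]] := @adapted_diff _ _ _ _ (Ss' n) (Ss' m).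
    exact: convex_setI.
  have t1 : t = const_mx 1.
    by apply: (pact_free t0 (x := s 0 0)); have := tE 0 (mem0 n) (mem0 m); rewrite !s'0.
  by rewrite tE//; [rewrite t1 pact1|exact: BB nz].
(* The index of a square containing [z]; on the unit disc about [z] all these indices are at most
   [(rk z).+1], so that one section serves there. *)
pose rk z := Num.truncn (cmod z).
have Brk z m : (rk z <= m)%N -> B m z.
  move=> zm; have h : cmod z < m.+1%:R.
    apply: lt_le_trans (truncnS_gt _) _; by rewrite ler_nat ltnS.
  have := Re_le_cmod z; have := Im_le_cmod z; rewrite !ler_norml => /andP[? ?] /andP[? ?].
  by split; apply/andP; split; lra.
exists (fun z => s' (rk z) z); apply: adapted_from_local; first exact: openT.
move=> z _; exists 1, (s' (rk z).+1); split=> //.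
  apply: adapted_sub (Ss' _); first exact: open_cball.
  move=> w /= wz; have h : cmod w < (rk z).+2%:R.
    have := cmodD (w - z) z; rewrite subrK; have : cmod z < (rk z).+1%:R by exact: truncnS_gt.
    rewrite -[(rk z).+2]addn1 natrD; lra.
  have := Re_le_cmod w; have := Im_le_cmod w; rewrite !ler_norml => /andP[? ?] /andP[? ?].
  by split; apply/andP; split; lra.
move=> w wz; apply: coh; last exact: Brk.
have h : cmod w < (rk z).+2%:R.
  have := cmodD (w - z) z; rewrite subrK; have : cmod z < (rk z).+1%:R by exact: truncnS_gt.
  rewrite -[(rk z).+2]addn1 natrD; lra.
by rewrite -ltnS /rk truncn_lt_nat// cmod_ge0.
Qed.

End GlobalSection.

(** * The gluing at infinity *)

Section NormalFrame.
Variables (R : realType) (r k n : nat) (nu : 'M[int]_(k, r)).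
Local Notation C := (Cplx R).
Implicit Types (z w : C) (V W : set C).
Variable m : gauged_map R n nu.
Hypothesis n_gt0 : (0 < n)%N.

Definition zpow (e : 'rV[int]_r) z : 'rV[C]_r := \row_a z ^ e 0 a.

Lemma zpowE e z a : zpow e z 0 a = z ^ e 0 a.
Proof. by rewrite mxE. Qed.

Opaque zpow.

Lemma torus_zpow e z : z != 0 -> torus (zpow e z).
Proof. by move=> z0 a; rewrite zpowE expfz_neq0. Qed.

Lemma zpowM e z w : zpow e (z * w) = tmul (zpow e z) (zpow e w).
Proof.
apply/rowP => a; rewrite [RHS]mxE.
apply: etrans (zpowE _ _ _) (etrans (expfzMl _ _ _) _).
by congr (_ * _); exact/esym/zpowE.
Qed.

Lemma inv_root w : w != 0 -> exists z, [/\ z != 0, z ^- n = w & cmod z ^+ n = (cmod w)^-1].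
Proof.
move=> w0; have [z zn _] := near_root 0 w^-1 n_gt0.
exists z; split; last by rewrite -cmodX zn cmodV.
  by apply: contra_neq w0 => z0; move: zn; rewrite z0 expr0n gtn_eqF// => /(congr1 GRing.inv); rewrite invr0 invrK.
by rewrite zn invrK.
Qed.

Lemma gsec2_tinv t (x : ob2 m) : torus t -> gsec2 x = tact nu t (gsec2 (pact t x)).
Proof. by move=> t0; rewrite gsec2_act// tactM tmulV// tact1. Qed.

Lemma gsec1_holo_section V (s : C -> ob1 m) j : holo_section V s -> holo V (fun z => gsec1 (s z) 0 j).
Proof.
apply: (holo_gs (@gsec1_act _ _ _ _ _ m)) => W t Wt l.
by apply/holo_onE; exact: gsec1_holo.
Qed.

Lemma gsec2_holo_section V (s : C -> ob2 m) j : holo_section V s -> holo V (fun z => gsec2 (s z) 0 j).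
Proof.
apply: (holo_gs (@gsec2_act _ _ _ _ _ m)) => W t Wt l.
by apply/holo_onE; exact: gsec2_holo.
Qed.

Variables (V0 : set C) (s0 : C -> ob1 m).
Hypotheses (V0s : plsec V0 s0) (V00 : V0 0).
Variable J : 'I_r -> 'I_k.
Hypothesis J0 : forall i, gsec1 (s0 0) 0 (J i) != 0.
Local Notation M := (\matrix_(i, a) nu (J i) a).
Hypothesis M0 : \det M != 0.

Lemma gsec1_near i : exists2 d : R, 0 < d & forall z, cmod z < d -> V0 z /\ gsec1 (s0 z) 0 (J i) != 0.
Proof.
have h := gsec1_holo_section (J i) (holo_section_plsec V0s).
have [d d0 hd] := ccont_bound0 (holo_ccont h V00) (J0 i).
have [d' d'0 d'V] := ball_sub_open (plsec_open V0s) V00.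
exists (Num.min d d'); first by rewrite lt_min d0.
move=> z; rewrite lt_min => /andP[zd zd']; split; first by apply: d'V; rewrite subr0.
by rewrite -cmod_gt0 (le_lt_trans _ (hd z I _)) ?subr0// divr_ge0 ?cmod_ge0.
Qed.

(** The coordinate does not vanish at infinity, hence not near it, and every point over a large [w]
    is in the orbit of a glued point. This is where stability enters the existence of the
    divisor. *)
Lemma gsec2_bounded i : exists B : R, forall x : ob2 m, gsec2 x 0 (J i) = 0 -> cmod (pproj x) <= B.
Proof.
have [d d0 hd] := gsec1_near i; exists (d ^- n) => x x0.
rewrite leNgt; apply/negP => Bx.
have dn0 : 0 < d ^- n by rewrite invr_gt0 exprn_gt0.
have px0 : pproj x != 0 by rewrite -cmod_gt0 (lt_trans dn0).
have [z [z0 zn zm]] := inv_root px0.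
have zd : cmod z < d.
  rewrite -(@ltr_pXn2r _ n)// ?nnegrE ?cmod_ge0 ?(ltW d0)// zm.
  by rewrite -[ltRHS]invrK ltf_pV2// posrE ?(lt_trans dn0).
have [Vz g0] := hd z zd.
have sz : pproj (s0 z) = z := plsec_proj V0s Vz.
have [t [t0 xE]] : exists t, torus t /\ x = pact t (oglue (s0 z)).
  by apply: pact_trans; rewrite oglue_proj ?sz.
move: x0; rewrite xE gsec2_act// tactE gsec_glue ?sz// => /eqP.
rewrite mulf_eq0 (negbTE g0) orbF; apply/negP; apply: character_neq0; exact: torus_tinv.
Qed.

Lemma global_section : exists (q : 'I_r -> {poly R[i]}) (s : C -> ob2 m),
  [/\ forall i, q i != 0, holo_section setT s & forall z i, gsec2 (s z) 0 (J i) = (q i).[z]].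
Proof.
have gh V s : @plsec _ _ (ob2 m) V s -> forall j, holo V (fun z => gsec2 (s z) 0 j).
  by move=> Vs j; apply: gsec2_holo_section; exact: holo_section_plsec.
have qex i : exists q : {poly R[i]}, q != 0 /\
    forall V s, @plsec _ _ (ob2 m) V s -> is_divisor_of q V (fun z => gsec2 (s z) 0 (J i)).
  have [B HB] := gsec2_bounded i.
  by have [q q0 H] := section_divisor (@gsec2_act _ _ _ _ _ m) gh HB; exists q.
have [q qP] := choice qex.
have loc w0 := adapted_local (@gsec2_act _ _ _ _ _ m) M0 w0 (fun V s Vs i => (qP i).2 V s Vs).
have [s [hs sq]] := adapted_global (@gsec2_act _ _ _ _ _ m) M0 (fun i => (qP i).1) loc.
by exists q, s; split=> // [i|z i]; [exact: (qP i).1|exact: sq].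
Qed.

Variables (q : 'I_r -> {poly R[i]}) (s : C -> ob2 m).
Hypotheses (q0 : forall i, q i != 0) (hs : holo_section setT s).
Hypothesis sq : forall z i, gsec2 (s z) 0 (J i) = (q i).[z].

Let g z := tdiv (s (z ^- n)) (oglue (s0 z)).

Lemma transitionP z : V0 z -> z != 0 -> torus (g z) /\ oglue (s0 z) = pact (g z) (s (z ^- n)).
Proof.
move=> Vz z0; apply: tdivP; have [_ sp _] := hs.
by rewrite sp// oglue_proj (plsec_proj V0s).
Qed.

Lemma holo_inv_pow V : (forall z, V z -> z != 0) -> holo V (fun z : C => z ^- n).
Proof.
move=> V0n; apply: holoV; first exact: holoX (@holo_id _ _).
by move=> z /V0n z0; rewrite expf_neq0.
Qed.

Lemma transition_holo : holo_torus_on (V0 `\ 0) g.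
Proof.
apply: holo_torus_local => z [Vz /= /eqP z0].
have [W [t [Wt Wz]]] := plsec_cover (ob2 m) (z ^- n).
have [g1 [hg1 g1E]] := oglue_holo V0s Wt.
set U := [set _ | _] in hg1 g1E.
have [_ _ sh] := hs; have [g2 [hg2 g2E]] := sh W t Wt.
have oU : open [set y : C | y != 0].
  apply/openC_cmod => y /= y0; exists (cmod y); first by rewrite cmod_gt0.
  by move=> x; apply: contraTneq => ->; rewrite sub0r cmodN ltxx.
have [d1 d10 h1] := ball_sub_open (plsec_open V0s) Vz.
have [d2 d20 h2] := ball_sub_open oU z0.
have [d3 d30 h3] := ball_sub_open (plsec_open Wt) Wz.
have cp : ccont setT (fun z : C => z ^- n) z by apply: holo_ccont (holo_inv_pow (V := [set y : C | y != 0]) _) _.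
have [d4 d40 h4] := cp d3 d30.
pose d := Num.min d1 (Num.min d2 d4).
have BU y : cmod (y - z) < d -> U y.
  by rewrite !lt_min => /andP[/h1 ? /andP[/h2 ? /(h4 y I)/h3 ?]]; split.
exists d, (fun y => tmul (g1 y) (tinv (g2 (y ^- n)))); split.
- by rewrite !lt_min d10 d20.
- apply: holo_torusM; first exact: holo_torus_sub hg1.
  apply: holo_torusV; apply: holo_torus_comp hg2 _ _.
    by apply: holo_inv_pow => y /BU[].
  by move=> y /BU[_ _ ?]; split.
move=> y /BU Uy; have [Vy y0 Wy] := Uy.
have t1 := hg1.1 y Uy; have t2 := hg2.1 _ (conj (I : setT (y ^- n)) Wy).
rewrite -(@tdiv_uniq _ _ _ (s (y ^- n)) (tmul (g1 y) (tinv (g2 (y ^- n))))).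
  congr tdiv; rewrite -pactM//; last exact: torus_tinv.
  by rewrite g1E//; congr pact; apply: pactV => //; exact: g2E.
by apply: torus_tmul => //; exact: torus_tinv.
Qed.

(** The [nu_J]-characters of the transition function are [q(z^-n)] divided by functions that do not
    vanish at [0], so they have orders. By the adjugate, so has a power of each coordinate, and
    [order0_root] descends to the coordinate. *)
Lemma transition_order a : exists l, order0 (fun z => g z 0 a) l.
Proof.
have [d d0 dV] := ball_sub_open (plsec_open V0s) V00.
have hga : holo (ball0 d `\ 0) (fun z => g z 0 a).
  have /holo_torusP[_ /(_ a)] := transition_holo; apply: holo_sub => z [zd z0]; split=> //.
  by apply: dV; rewrite subr0.
have ordJ i : order0 (fun z => character (row (J i) nu) (g z)) (- (n * (size (q i)).-1)%:Z - 0).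
  have h1 := order0_poly_inv (q0 i) n_gt0.
  have h2 := order0V (order0_holo (plsec_open V0s) V00 (gsec1_holo_section (J i) (holo_section_plsec V0s)) (J0 i)).
  have [d' d'0 hd'] := gsec1_near i.
  apply: (order0_near d'0 _ (order0M h1 h2)) => z /hd'[Vz g0] z0.
  have [tg gE] := transitionP Vz z0.
  have := sq (z ^- n) i; rewrite (gsec2_tinv (s (z ^- n)) tg) -gE tactE gsec_glue ?(plsec_proj V0s)// => <-.
  by rewrite mulfK.
have N0 : (0 < `|\det M|)%N by rewrite absz_gt0.
have key : exists l, order0 (fun z => g z 0 a ^+ `|\det M|%N) l.
  have h := order0Xz (sgz (\det M)) (order0_prod (index_enum 'I_r) (fun i => order0Xz (\adj M a i) (ordJ i))).
  eexists; apply: (order0_near d0 _ h) => z zd z0.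
  have Vz : V0 z by apply: dV; rewrite subr0.
  have [tg _] := transitionP Vz z0.
  by rewrite -(isogeny_power nu J a tg) exprz_exp mulrC -abszEsg.
by have [l hl] := key; apply: (order0_root N0 d0 hga hl).
Qed.

(** Each coordinate of the transition function is a power of [z] times a unit; the units are
    absorbed into the section near infinity. *)
Lemma normal_frame : exists (e : 'rV[int]_r) (d : R) (sigma : C -> ob1 m),
  [/\ 0 < d, holo_section (ball0 d) sigma &
      forall z, ball0 d z -> z != 0 -> oglue (sigma z) = pact (zpow e z) (s (z ^- n))].
Proof.
have [e eP] := choice transition_order.
have bex a : exists db : R * (C -> C), [/\ 0 < db.1, holo (ball0 db.1) db.2,
    forall z, ball0 db.1 z -> db.2 z != 0 & forall z, ball0 db.1 z -> z != 0 -> g z 0 a = z ^ e a * db.2 z].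
  by have [d [b [? ? ? ?]]] := eP a; exists (d, b).
have [db dbP] := choice bex.
have db0 a : 0 < (db a).1 by have [] := dbP a.
have [d1 d10 hd1] := finite_min db0.
have [d2 d20 d2V] := ball_sub_open (plsec_open V0s) V00.
pose d := Num.min d1 d2; have d0 : 0 < d by rewrite lt_min d10.
have dV : ball0 d `<=` V0 by move=> z zd; apply: d2V; rewrite subr0 (lt_le_trans zd)// ge_min lexx orbT.
have dd a : ball0 d `<=` ball0 (db a).1 by apply: ball0_sub; rewrite (le_trans _ (hd1 a))// ge_min lexx.
pose b z : 'rV[C]_r := \row_a (db a).2 z.
have hb : holo_torus_on (ball0 d) b.
  apply/holo_torusP; split=> [z zd a|a].
    by rewrite mxE; have [_ _ h _] := dbP a; apply: h; exact: dd.
  rewrite (_ : (fun z => _) = (db a).2); last by apply/funext => z; rewrite mxE.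
  by have [_ h _ _] := dbP a; apply: holo_sub h; exact: dd.
exists (\row_a e a), d, (fun z => pact (tinv (b z)) (s0 z)); split=> //.
  apply: holo_section_act (holo_torusV hb).
  by apply: holo_section_sub dV (holo_section_plsec V0s); exact: open_ball0.
move=> z zd z0; have [tg gE] := transitionP (dV z zd) z0.
have tb := hb.1 z zd; have tz := torus_zpow (\row_a e a) z0.
rewrite oglue_act ?(plsec_proj V0s (dV z zd))//; last exact: torus_tinv.
rewrite gE pactM//; last exact: torus_tinv.
congr pact; apply/rowP => a; rewrite zpowE !mxE.
have [_ _ h1 h2] := dbP a; have zda := dd a z zd.
by rewrite h2// mulrCA mulVf ?mulr1//; exact: h1.
Qed.

End NormalFrame.

(** * Smooth functions on the plane *)

Section SmoothCalculus.
Variable R : realType.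
Local Notation C := (Cplx R).
Implicit Types (z w v : C) (V W : set C) (f g : C -> R) (m : nat).

Lemma continuous_eps f z : {for z, continuous f} <->
  forall e : R, 0 < e -> exists2 d : R, 0 < d & forall w, cmod (w - z) < d -> `|f w - f z| < e.
Proof.
split=> [/cvgrPdist_lt H e e0|H].
  by have /nbhsC_cmod[d d0 h] := H e e0; exists d => // w /h /=; rewrite distrC.
have F : Filter (nbhs z) := nbhs_filter z.
apply/(@cvgrPdist_lt _ _ _ (nbhs z) F f (f z)) => e e0; apply/nbhsC_cmod; have [d d0 h] := H e e0.
by exists d => // w /h /=; rewrite distrC.
Qed.

Definition is_pd v f z (l : R) := is_derive (0 : R) (1 : R) (fun t : R => f (z + t%:C * v)) l.

Lemma is_pd_val v f z l : is_pd v f z l -> pd v f z = l.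
Proof. by move=> h; rewrite /pd derive1E; apply: derive_val. Qed.

Lemma derivable_is_pd v f z : derivable (fun t : R => f (z + t%:C * v)) 0 1 -> is_pd v f z (pd v f z).
Proof. by move=> h; rewrite /is_pd /pd derive1E; apply: derivableP. Qed.

Lemma is_pd_derivable v f z l : is_pd v f z l -> derivable (fun t : R => f (z + t%:C * v)) 0 1.
Proof. by case. Qed.

Lemma is_pdP v f z l : is_pd v f z l <->
  forall e, 0 < e -> exists2 d : R, 0 < d & forall s, `|s| < d ->
    `|f (z + s%:C * v) - f z - l * s| <= e * `|s|.
Proof.
rewrite /is_pd -is_derive_eps /= mul0r addr0; split=> H e /H[d d0 h]; exists d => // s.
  by move=> sd; have := h s; rewrite subr0 => /(_ sd).
by rewrite subr0 => /h.
Qed.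

Definition dir v := v = 1 \/ v = 'i%C.

Lemma dir1 : dir 1. Proof. by left. Qed.

Lemma diri : dir 'i%C. Proof. by right. Qed.

Lemma dir_norm v : dir v -> cmod v = 1.
Proof. by case=> ->; [exact: cmod1|exact: cmod_i]. Qed.

Lemma line_near V z v : open V -> V z -> dir v ->
  exists2 d : R, 0 < d & forall s : R, `|s| < d -> V (z + s%:C * v).
Proof.
move=> oV Vz dv; have [d d0 h] := (openC_cmod V).1 oV z Vz; exists d => // s sd; apply: h.
by rewrite addrAC subrr add0r cmodM cmod_real dir_norm// mulr1.
Qed.

Lemma is_pd_eq V v f g z l : open V -> V z -> dir v -> (forall w, V w -> f w = g w) ->
  is_pd v f z l -> is_pd v g z l.
Proof.
move=> oV Vz dv fg /is_pdP H; apply/is_pdP => e /H[d d0 h].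
have [d' d'0 h'] := line_near oV Vz dv.
exists (Num.min d d'); first by rewrite lt_min d0.
by move=> s; rewrite lt_min => /andP[sd sd']; rewrite -!fg//; [exact: h|exact: h'].
Qed.

(* [Cm_on] does not ask the derivatives of lower order to be continuous. *)
Definition Ck m V f := forall i, (i <= m)%N -> Cm_on i V f.

Lemma smooth_Ck V f : smooth_on V f <-> forall m, Ck m V f.
Proof. by split=> H m; [move=> i _; exact: H|apply: (H m)]. Qed.

Lemma CkW m m' V f : (m' <= m)%N -> Ck m V f -> Ck m' V f.
Proof. by move=> mm H i im; apply: H; exact: leq_trans mm. Qed.

Lemma Ck0 V f : Ck 0 V f <-> forall z, V z -> {for z, continuous f}.
Proof. by split=> [/(_ 0%N isT)//|H [|i]//]. Qed.

Lemma CkS m V f : Ck m.+1 V f <->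
  [/\ forall z, V z -> {for z, continuous f},
      forall v z, dir v -> V z -> is_pd v f z (pd v f z) &
      forall v, dir v -> Ck m V (pd v f)].
Proof.
split=> [H|[H1 H2 H3] [|i im]].
- have [h1 h2 _ _] := H 1%N isT; split; first exact: (H 0%N isT).
    move=> v z [] -> Vz; apply: derivable_is_pd; last exact: h2.
    by have := h1 z Vz; under eq_fun do rewrite -[_%:C]mulr1.
  by move=> v dv i im; have [_ _ h3 h4] := H i.+1 im; case: dv => ->.
- by move=> _; exact: H1.
split; last 2 first.
- by apply: H3 => //; left.
- by apply: H3 => //; right.
- move=> z Vz; have := is_pd_derivable (H2 1 z (or_introl erefl) Vz).
  by under eq_fun do rewrite mulr1.
- by move=> z Vz; exact: is_pd_derivable (H2 'i%C z (or_intror erefl) Vz).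
Qed.

Lemma Ck_sub m V W f : W `<=` V -> Ck m V f -> Ck m W f.
Proof.
move=> WV; elim: m f => [|m IH] f; first by move=> /Ck0 H; apply/Ck0 => z /WV; exact: H.
move=> /CkS[H1 H2 H3]; apply/CkS; split; [by move=> z /WV; exact: H1| |by move=> v dv; apply/IH/H3].
by move=> v z dv /WV; exact: H2.
Qed.

Lemma Ck_local m V f : (forall z, V z -> exists2 W : set C, W z & Ck m W f) -> Ck m V f.
Proof.
elim: m f => [|m IH] f H.
  by apply/Ck0 => z /H[W Wz /Ck0]; exact.
apply/CkS; split.
- by move=> z /H[W Wz /CkS[h _ _]]; exact: h.
- by move=> v z dv /H[W Wz /CkS[_ h _]]; exact: h.
- by move=> v dv; apply: IH => z /H[W Wz /CkS[_ _ h]]; exists W => //; exact: h.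
Qed.

Lemma continuous_eq_open V f g z : open V -> (forall w, V w -> f w = g w) -> V z ->
  {for z, continuous f} -> {for z, continuous g}.
Proof.
move=> oV fg Vz /continuous_eps H; apply/continuous_eps => e e0.
have [d d0 h] := H e e0; have [d' d'0 h'] := (openC_cmod V).1 oV z Vz.
exists (Num.min d d'); first by rewrite lt_min d0.
by move=> w; rewrite lt_min => /andP[wd /h' Vw]; rewrite -!fg//; exact: h.
Qed.

Lemma Ck_eq m V f g : open V -> (forall w, V w -> f w = g w) -> Ck m V f -> Ck m V g.
Proof.
move=> oV; elim: m f g => [|m IH] f g fg.
  by move=> /Ck0 H; apply/Ck0 => z Vz; exact: (continuous_eq_open oV fg Vz (H z Vz)).
move=> /CkS[H1 H2 H3].
have pdE v z : dir v -> V z -> is_pd v g z (pd v f z).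
  by move=> dv Vz; exact: (is_pd_eq oV Vz dv fg (H2 v z dv Vz)).
have fgpd v : dir v -> forall z, V z -> pd v f z = pd v g z.
  by move=> dv z Vz; rewrite (is_pd_val (pdE v z dv Vz)).
apply/CkS; split.
- by move=> z Vz; exact: (continuous_eq_open oV fg Vz (H1 z Vz)).
- by move=> v z dv Vz; rewrite -fgpd//; exact: pdE.
- by move=> v dv; exact: (IH _ _ (fgpd v dv) (H3 v dv)).
Qed.

Lemma Ck_cst m V (c : R) : Ck m V (fun=> c).
Proof.
elim: m c => [|m IH] c; first by apply/Ck0 => z _; exact: cst_continuous.
have pdE v z : is_pd v (fun=> c) z 0 by apply: is_derive_cst.
apply/CkS; split=> [z _|v z _ _|v dv]; first exact: cst_continuous.
  by rewrite (is_pd_val (pdE v z)).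
by rewrite (_ : pd v _ = fun=> 0)//; apply/funext => z; rewrite (is_pd_val (pdE v z)).
Qed.

Lemma is_pdD v f g z l l' : is_pd v f z l -> is_pd v g z l' -> is_pd v (fun w => f w + g w) z (l + l').
Proof. by move=> h1 h2; exact: is_deriveD. Qed.

Lemma is_pdM v f g z l l' : is_pd v f z l -> is_pd v g z l' ->
  is_pd v (fun w => f w * g w) z (l * g z + f z * l').
Proof.
move=> h1 h2; have := is_deriveM h1 h2; rewrite /= mul0r addr0 /is_pd => h.
by apply: is_derive_eq h _; rewrite addrC mulrC.
Qed.

Lemma CkD m V f g : open V -> Ck m V f -> Ck m V g -> Ck m V (fun w => f w + g w).
Proof.
move=> oV; elim: m f g => [|m IH] f g.
  by move=> /Ck0 h1 /Ck0 h2; apply/Ck0 => z Vz; apply: continuousD; [exact: h1|exact: h2].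
move=> /CkS[a1 a2 a3] /CkS[b1 b2 b3].
have pdE v z : dir v -> V z -> is_pd v (fun w => f w + g w) z (pd v f z + pd v g z).
  by move=> dv Vz; apply: is_pdD; [exact: a2|exact: b2].
apply/CkS; split=> [z Vz|v z dv Vz|v dv].
- by apply: continuousD; [exact: a1|exact: b1].
- by rewrite (is_pd_val (pdE v z dv Vz)); exact: pdE.
- apply: (Ck_eq oV _ (IH _ _ (a3 v dv) (b3 v dv))) => z Vz.
  by rewrite (is_pd_val (pdE v z dv Vz)).
Qed.

Lemma CkM m V f g : open V -> Ck m V f -> Ck m V g -> Ck m V (fun w => f w * g w).
Proof.
move=> oV; elim: m f g => [|m IH] f g.
  by move=> /Ck0 h1 /Ck0 h2; apply/Ck0 => z Vz; apply: continuousM; [exact: h1|exact: h2].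
move=> Hf Hg; have /CkS[a1 a2 a3] := Hf; have /CkS[b1 b2 b3] := Hg.
have pdE v z : dir v -> V z -> is_pd v (fun w => f w * g w) z (pd v f z * g z + f z * pd v g z).
  by move=> dv Vz; apply: is_pdM; [exact: a2|exact: b2].
apply/CkS; split=> [z Vz|v z dv Vz|v dv].
- by apply: continuousM; [exact: a1|exact: b1].
- by rewrite (is_pd_val (pdE v z dv Vz)); exact: pdE.
- have h1 := IH _ _ (a3 v dv) (CkW (leqnSn m) Hg).
  have h2 := IH _ _ (CkW (leqnSn m) Hf) (b3 v dv).
  apply: (Ck_eq oV _ (CkD oV h1 h2)) => z Vz.
  by rewrite (is_pd_val (pdE v z dv Vz)).
Qed.

Lemma is_pd_comp v f (F : R -> R) z l l' : is_pd v f z l -> is_derive (f z) (1 : R) F l' ->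
  is_pd v (fun w => F (f w)) z (l' * l).
Proof.
move=> h1 h2; have := @is_derive1_comp R F (fun t : R => f (z + t%:C * v)) 0 l' l.
by rewrite mul0r addr0 => /(_ h2 h1).
Qed.

(** The derivative of [F] is required only at the values of [f] on [V], so that inverse and
    logarithm are covered. *)
Lemma Ck_comp m V f (F F' : R -> R) : open V ->
  (forall z, V z -> is_derive (f z) (1 : R) F (F' (f z))) ->
  Ck m.+1 V f -> Ck m V (fun w => F' (f w)) -> Ck m.+1 V (fun w => F (f w)).
Proof.
move=> oV dF Hf HF'; have /CkS[a1 a2 a3] := Hf.
have pdE v z : dir v -> V z -> is_pd v (fun w => F (f w)) z (F' (f z) * pd v f z).
  by move=> dv Vz; apply: is_pd_comp; [exact: a2|exact: dF].
apply/CkS; split=> [z Vz|v z dv Vz|v dv].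
- apply: continuous_comp; first exact: a1.
  by apply/differentiable_continuous/derivable1_diffP; have := dF z Vz; case.
- by rewrite (is_pd_val (pdE v z dv Vz)); exact: pdE.
- apply: (Ck_eq oV _ (CkM oV HF' (a3 v dv))) => z Vz.
  by rewrite (is_pd_val (pdE v z dv Vz)).
Qed.

Lemma Ck_comp0 V f (F F' : R -> R) :
  (forall z, V z -> is_derive (f z) (1 : R) F (F' (f z))) ->
  Ck 0 V f -> Ck 0 V (fun w => F (f w)).
Proof.
move=> dF /Ck0 H; apply/Ck0 => z Vz; apply: continuous_comp; first exact: H.
by apply/differentiable_continuous/derivable1_diffP; have := dF z Vz; case.
Qed.

Lemma Ck_exp m V f : open V -> Ck m V f -> Ck m V (fun w => expR (f w)).
Proof.
move=> oV; elim: m => [|m IH] Hf; first exact: (@Ck_comp0 V f expR expR).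
by apply: (@Ck_comp m V f expR expR) => //; apply/IH/CkW/Hf.
Qed.

Lemma Ck_inv m V f : open V -> (forall z, V z -> f z != 0) -> Ck m V f -> Ck m V (fun w => (f w)^-1).
Proof.
move=> oV f0; have dF z : V z -> is_derive (f z) (1 : R) GRing.inv ((fun x => -1 * (x^-1 * x^-1)) (f z)).
  move=> Vz; have := @is_deriveV _ id (f z) 1 1 (f0 z Vz) (is_derive_id _ _).
  rewrite (_ : (fun _ => _) = GRing.inv); last by apply/funext.
  by move=> h; apply: is_derive_eq h _; rewrite mulN1r scaleNr -exprVn expr2 scaler1.
elim: m => [|m IH] Hf; first exact: (@Ck_comp0 V f GRing.inv (fun x => -1 * (x^-1 * x^-1)) dF Hf).
apply: (@Ck_comp m V f GRing.inv (fun x => -1 * (x^-1 * x^-1))) => //; have h := IH (CkW (leqnSn m) Hf).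
exact: (CkM oV (@Ck_cst m V (-1)) (CkM oV h h)).
Qed.

Lemma Ck_ln m V f : open V -> (forall z, V z -> 0 < f z) -> Ck m V f -> Ck m V (fun w => ln (f w)).
Proof.
move=> oV f0; have dF z : V z -> is_derive (f z) (1 : R) (@ln R) ((fun x => x^-1) (f z)).
  by move=> Vz; apply: is_derive1_ln; exact: f0.
elim: m => [|m IH] Hf; first exact: (Ck_comp0 dF Hf).
apply: (Ck_comp oV dF Hf); apply: Ck_inv => //; last exact: CkW Hf.
by move=> z Vz; rewrite gt_eqF ?f0.
Qed.

(** The factor [c] treats both components at once: [c = 1] gives the real part and [c = - 'i] the
    imaginary part. *)
Lemma cder_is_pd (c : C) (F : C -> C) z v l : cder setT F z l ->
  is_pd v (fun w => complex.Re (c * F w)) z (complex.Re (c * (v * l))).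
Proof.
move=> dF; apply/is_pdP => e e0.
pose K := (cmod c + 1) * (cmod v + 1).
have K0 : 0 < K by rewrite mulr_gt0// ltr_wpDl ?cmod_ge0.
have [d d0 h] := (cder_eps _ _ _ _).1 dF (e / K) (divr_gt0 e0 K0).
exists (d / (cmod v + 1)); first by rewrite divr_gt0// ltr_wpDl ?cmod_ge0.
move=> s; rewrite ltr_pdivlMr ?ltr_wpDl ?cmod_ge0// => sd.
have wd : cmod (z + s%:C * v - z) <= `|s| * (cmod v + 1).
  by rewrite addrAC subrr add0r cmodM cmod_real ler_wpM2l// lerDl.
have := h (z + s%:C * v) I (le_lt_trans wd sd).
set w := z + _ in wd * => hw.
have -> : complex.Re (c * F w) - complex.Re (c * F z) - complex.Re (c * (v * l)) * s =
    complex.Re (c * (F w - F z - l * (w - z))).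
  rewrite (_ : w - z = s%:C * v); last by rewrite /w; ring.
  have -> : complex.Re (c * (v * l)) * s = complex.Re (s%:C * (c * (v * l))).
    by case: (c * _) => x y /=; rewrite mul0r subr0 mulrC.
  by rewrite -!raddfB /=; congr complex.Re; ring.
apply: le_trans (Re_le_cmod _) _; rewrite cmodM.
apply: le_trans (ler_wpM2l (cmod_ge0 c) hw) _.
apply: le_trans (_ : (cmod c + 1) * (e / K * (`|s| * (cmod v + 1))) <= _); last first.
  rewrite le_eqVlt; apply/orP; left; apply/eqP; rewrite /K; field.
  by rewrite !gt_eqF// ltr_wpDl ?cmod_ge0.
apply: ler_pM; rewrite ?cmod_ge0//.
- by rewrite mulr_ge0 ?cmod_ge0// divr_ge0 ?ltW.
- by rewrite lerDl.
- by rewrite ler_wpM2l// divr_ge0 ?ltW.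
Qed.

Lemma Ck_Re m V (F : C -> C) (c : C) : open V -> holo V F -> Ck m V (fun z => complex.Re (c * F z)).
Proof.
move=> oV; elim: m F c => [|m IH] F c hF.
  apply/Ck0 => z Vz; apply/continuous_eps => e e0.
  have [d d0 h] := ccontM (ccont_cst setT c z) (holo_ccont hF Vz) e0.
  by exists d => // w /(h w I); apply: le_lt_trans; rewrite -raddfB; exact: Re_le_cmod.
have [F' dF hF'] := holo_derivative oV hF.
have pdE v z : V z -> is_pd v (fun z => complex.Re (c * F z)) z (complex.Re (c * (v * F' z))).
  by move=> Vz; apply: cder_is_pd; exact: dF.
apply/CkS; split=> [z Vz|v z dv Vz|v dv].
- by have /Ck0 := CkW (leq0n m) (IH F c hF); exact.
- by rewrite (is_pd_val (pdE v z Vz)); exact: pdE.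
- apply: (Ck_eq oV _ (IH F' (c * v) hF')) => z Vz.
  by rewrite (is_pd_val (pdE v z Vz)) mulrA.
Qed.

Lemma Ck_absq m V (F : C -> C) : open V -> holo V F -> Ck m V (fun z => absq (F z)).
Proof.
move=> oV hF; have h1 := @Ck_Re m V F 1 oV hF; have h2 := @Ck_Re m V F (- 'i%C) oV hF.
apply: (Ck_eq oV _ (CkD oV (CkM oV h1 h1) (CkM oV h2 h2))) => z _.
by rewrite /absq; case: (F z) => x y /=; ring.
Qed.

Lemma Ck_laplacian_eq V f g z : open V -> V z -> Ck 2 V f -> (forall w, V w -> f w = g w) ->
  laplacian f z = laplacian g z.
Proof.
move=> oV Vz Hf fg; have Hg := Ck_eq oV fg Hf.
have E v : dir v -> pd v (pd v f) z = pd v (pd v g) z.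
  move=> dv; have /CkS[_ a2 a3] := Hf; have /CkS[_ a4 _] := a3 v dv.
  have pdE w : V w -> pd v f w = pd v g w.
    by move=> Vw; rewrite (is_pd_val (is_pd_eq oV Vw dv fg (a2 v w dv Vw))).
  by rewrite (is_pd_val (is_pd_eq oV Vz dv pdE (a4 v z dv Vz))).
by rewrite /laplacian (E 1 dir1) (E 'i%C diri).
Qed.

Lemma laplacianD V f g z : open V -> V z -> Ck 2 V f -> Ck 2 V g ->
  laplacian (fun w => f w + g w) z = laplacian f z + laplacian g z.
Proof.
move=> oV Vz Hf Hg.
have E v : dir v -> pd v (pd v (fun w => f w + g w)) z = pd v (pd v f) z + pd v (pd v g) z.
  move=> dv; have /CkS[_ a2 a3] := Hf; have /CkS[_ b2 b3] := Hg.
  have /CkS[_ a4 _] := a3 v dv; have /CkS[_ b4 _] := b3 v dv.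
  have pdE w : V w -> pd v f w + pd v g w = pd v (fun w => f w + g w) w.
    by move=> Vw; rewrite (is_pd_val (is_pdD (a2 v w dv Vw) (b2 v w dv Vw))).
  exact: (is_pd_val (is_pd_eq oV Vz dv pdE (is_pdD (a4 v z dv Vz) (b4 v z dv Vz)))).
by rewrite /laplacian (E 1 dir1) (E 'i%C diri); exact: addrACA.
Qed.

Lemma laplacianZ V f c z : open V -> V z -> Ck 2 V f ->
  laplacian (fun w => c * f w) z = c * laplacian f z.
Proof.
move=> oV Vz Hf.
have pdZ g v w l : is_pd v g w l -> is_pd v (fun w => c * g w) w (c * l).
  move=> h; have := is_pdM (f := fun=> c) (is_derive_cst _ _ _) h.
  by rewrite /is_pd mul0r add0r.
have E v : dir v -> pd v (pd v (fun w => c * f w)) z = c * pd v (pd v f) z.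
  move=> dv; have /CkS[_ a2 a3] := Hf; have /CkS[_ a4 _] := a3 v dv.
  have pdE w : V w -> c * pd v f w = pd v (fun w => c * f w) w.
    by move=> Vw; rewrite (is_pd_val (pdZ _ _ _ _ (a2 v w dv Vw))).
  exact: (is_pd_val (is_pd_eq oV Vz dv pdE (pdZ _ _ _ _ (a4 v z dv Vz)))).
by rewrite /laplacian (E 1 dir1) (E 'i%C diri) mulrDr.
Qed.

(** The derivative in the direction [v] is the real part of [2 v F'/F], the second one that of
    [2 v^2 (F'/F)'], and the squares of the two directions [1] and ['i] cancel. *)
Lemma laplacian_ln_absq V (F : C -> C) z : open V -> V z -> holo V F ->
  (forall w, V w -> F w != 0) -> laplacian (fun w => ln (absq (F w))) z = 0.
Proof.
move=> oV Vz hF F0; have [F' dF hF'] := holo_derivative oV hF.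
pose g w := F' w * (F w)^-1.
have hg : holo V g by apply: holoM => //; exact: holoV.
have [g' dg _] := holo_derivative oV hg.
have pd1 v w : V w -> is_pd v (fun w => ln (absq (F w))) w (complex.Re (2 * v * g w)).
  move=> Vw; have aw : 0 < absq (F w) by rewrite absqE exprn_gt0// cmod_gt0 F0.
  have h1 := cder_is_pd 1 v (dF w Vw); have h2 := cder_is_pd (- 'i%C) v (dF w Vw).
  have h := is_pdD (is_pdM h1 h1) (is_pdM h2 h2).
  rewrite (_ : (fun w => _) = (fun w => absq (F w))) in h; last first.
    by apply/funext => y; rewrite /absq; case: (F y) => x y' /=; ring.
  have := is_pd_comp h (is_derive1_ln aw); rewrite /is_pd => h'; apply: is_derive_eq h' _.
  have -> : 2 * v * g w = ((absq (F w))^-1)%:C * (2 * v * F' w * ((F w)^*)%C).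
    rewrite /g; have F0w := F0 w Vw; have -> : (F w)^-1 = ((absq (F w))^-1)%:C * ((F w)^*)%C.
      apply: (mulfI F0w); rewrite divff// mulrCA.
      have -> : F w * (F w)^*%C = (absq (F w))%:C.
        by rewrite /absq; case: (F w) => x y; apply/eqP; rewrite eq_complex /=; apply/andP; split; apply/eqP; ring.
      by rewrite -rmorphM mulVf ?gt_eqF.
    ring.
  move: (absq (F w))^-1 => q; case: (F w) => x y; case: (F' w) => x' y'; case: v {h h1 h2} => v1 v2 /=.
  ring.
have E v : dir v -> pd v (pd v (fun w => ln (absq (F w)))) z = complex.Re (2 * v * (v * g' z)).
  move=> dv; have h := cder_is_pd (2 * v) v (dg z Vz).
  by apply: is_pd_val (is_pd_eq oV Vz dv _ h) => w Vw; rewrite (is_pd_val (pd1 v w Vw)).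
rewrite /laplacian (E 1 dir1) (E 'i%C diri).
by case: (g' z) => x y /=; ring.
Qed.

Lemma is_pd_line v f z (x : R) l : is_pd v f (z + x%:C * v) l ->
  is_derive x (1 : R) (fun t : R => f (z + t%:C * v)) l.
Proof.
move=> /is_pdP H; apply/is_derive_eps => e /H[d d0 h]; exists d => // s sd.
have := h (s - x) sd.
by rewrite (_ : z + x%:C * v + (s - x)%:C * v = z + s%:C * v)// rmorphB /=; ring.
Qed.

End SmoothCalculus.

(** * Integration over the plane *)

Section PlaneIntegration.
Variable R : realType.
Local Notation C := (Cplx R).
Local Notation mu := (@lebesgue_measure R).
Local Notation mu2 := (leb2 R).
Local Notation RR := (measurableTypeR R * measurableTypeR R)%type.
Implicit Types (F f : C -> R) (p : R * R).

(** Measurability refers to the product sigma-algebra; an open set is the countable union of the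
    open squares with rational centre and size that it contains. *)
Lemma open_plane_measurable (U : set C) : open U -> measurable (@cplx R @^-1` U : set RR).
Proof.
move=> /openC_cmod oU.
pose B (x y d : rat) : set (R * R) :=
  `]ratr x - ratr d, ratr x + ratr d[%classic `*` `]ratr y - ratr d, ratr y + ratr d[%classic.
pose B' x y d := if pselect (B x y d `<=` @cplx R @^-1` U) then B x y d else set0.
have -> : @cplx R @^-1` U = \bigcup_x \bigcup_y \bigcup_d B' x y d.
  apply/seteqP; split=> [[x y] Uxy|q [x _ [y _ [d _]]]]; last by rewrite /B'; case: pselect => // h /h.
  have [e e0 he] := oU _ Uxy.
  have e40 : 0 < e / 4 by rewrite divr_gt0.
  have [d] := rat_in_itvoo e40; rewrite in_itv /= => /andP[d0 de].
  have near (a : R) : exists b : rat, ratr b - ratr d < a < ratr b + ratr d.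
    have ad : a - ratr d < a + ratr d by lra.
    by have [b] := rat_in_itvoo ad; rewrite in_itv /= => ?; exists b; lra.
  have [x' xx'] := near x; have [y' yy'] := near y.
  exists x' => //; exists y' => //; exists d => //.
  rewrite /B'; case: pselect => [h|h]; first by split; rewrite /= in_itv /=.
  exfalso; apply: h.
  move=> [a b] []; rewrite /= !in_itv /= => ? ?; apply: he.
  apply: le_lt_trans (cmod_le_ReIm _) _; rewrite !raddfB /=.
  have -> : e = e / 2 + e / 2 by lra.
  by apply: ltrD; rewrite ltr_norml; apply/andP; split; lra.
apply: bigcupT_measurable_rat => x; apply: bigcupT_measurable_rat => y; apply: bigcupT_measurable_rat => d.
rewrite /B'; case: pselect => [h|h]; last exact: measurable0.
by apply: measurableX; exact: measurable_itv.
Qed.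

Lemma Ck0_measurable f : Ck 0 setT f -> measurable_fun (setT : set RR) (f \o @cplx R).
Proof.
move=> /Ck0 cf; apply: (measurability _ (RGenOpens.measurableE R)) => _ [_ [a [b ->] <-]].
rewrite setTI; apply: (@open_plane_measurable (f @^-1` `]a, b[%classic)).
apply/openC_cmod => z /=; rewrite in_itv /= => /andP[az zb].
have e0 : 0 < Num.min (f z - a) (b - f z) by rewrite lt_min !subr_gt0 az.
have [d d0 h] := (continuous_eps f z).1 (cf z I) _ e0.
exists d => // w /h; rewrite lt_min !ltr_norml => /andP[/andP[? ?] /andP[? ?]].
by rewrite /= in_itv /=; apply/andP; split; lra.
Qed.

Definition icc (rho : R) : set R := `[- rho, rho]%classic.
Definition sq (rho : R) : set (R * R) := icc rho `*` icc rho.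

Lemma sq_cmod (B : R) (w : C) : cmod w <= B -> sq B (complex.Re w, complex.Im w).
Proof.
have := Re_le_cmod w; have := Im_le_cmod w; rewrite !ler_norml => /andP[? ?] /andP[? ?] ?.
by split; rewrite /icc /= in_itv /=; apply/andP; split; lra.
Qed.

Lemma sq_measurable rho : measurable (sq rho : set RR).
Proof. by apply: measurableX; exact: measurable_itv. Qed.

Lemma sq_measure rho : 0 <= rho -> mu2 (sq rho) = ((2 * rho) ^+ 2)%:E.
Proof.
move=> rho0; have E : mu (icc rho) = (2 * rho)%:E.
  rewrite lebesgue_measure_itv /= lte_fin; case: ltP => h; last first.
    by have -> : rho = 0; [lra|rewrite mulr0].
  by rewrite -EFinB; congr EFin; ring.
rewrite /sq product_measure1E; [|exact: measurable_itv|exact: measurable_itv].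
by transitivity ((2 * rho)%:E * (2 * rho)%:E)%E; [congr (_ * _)%E|rewrite -EFinM -expr2].
Qed.

(** Compactness of the square, in the form of bisection. *)
Lemma Ck0_bounded f rho : Ck 0 setT f -> exists M, forall p, sq rho p -> `|f (cplx p)| <= M.
Proof.
move=> /Ck0 cf; pose P (x y h : R) := exists M, forall w, square x y h w -> `|f w| <= M.
have PP : forall x y h, 0 < h -> P x y h.
  apply: plane_bisection => [x y h h0 [M1 H1] [M2 H2] [M3 H3] [M4 H4]|w0].
    exists (Num.max (Num.max M1 M2) (Num.max M3 M4)) => w /(square_quarters h0)[].
    - by move=> /H1; rewrite !le_max => ->.
    - by move=> /H2; rewrite !le_max => ->; rewrite orbT.
    - by move=> /H3; rewrite !le_max => ->; rewrite orbT.
    - by move=> /H4; rewrite !le_max => ->; rewrite !orbT.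
  have [d d0 h] := (continuous_eps f w0).1 (cf w0 I) 1 ltr01.
  exists d => // x y e e0 w0S sub; exists (`|f w0| + 1) => w /sub/h wd.
  by have := ler_normD (f w - f w0) (f w0); rewrite subrK; lra.
have [|M HM] := PP (- `|rho| - 1) (- `|rho| - 1) (2 * `|rho| + 2).
  by have := normr_ge0 rho; lra.
exists M => -[x y] []; rewrite /icc /= !in_itv /= => /andP[? ?] /andP[? ?]; apply: HM.
have := ler_norm rho => ?; rewrite /square /=.
by split; apply/andP; split; lra.
Qed.

Lemma sq_integrable f rho : Ck 0 setT f -> mu2.-integrable (sq rho) (EFin \o (f \o @cplx R)).
Proof.
move=> cf; apply: measurable_bounded_integrable; first exact: sq_measurable.
- have [r0|r0] := leP 0 rho; first by have /= -> := sq_measure r0; rewrite ltry.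
  rewrite (_ : sq rho = set0) ?measure0//; apply/seteqP; split=> // -[x y] [].
  by rewrite /icc /= !in_itv /= => /andP[? ?]; lra.
- by apply: (@measurable_funS _ _ _ _ setT) => //; exact: Ck0_measurable.
have [M HM] := Ck0_bounded rho cf.
by exists M; split; [exact: num_real|move=> x Mx p /HM /le_trans; apply; exact: ltW].
Qed.

Lemma sq_integral0_x f rho : Ck 0 setT f ->
  (forall y, \int[mu]_(x in icc rho) (f (cplx (x, y)))%:E = 0)%E ->
  (\int[mu2]_(p in sq rho) (f (cplx p))%:E = 0)%E.
Proof.
move=> cf H; have [cI _] := integrable_mkcond (EFin \o (f \o @cplx R)) (sq_measurable rho) (mu := mu2).
have I2 := cI (sq_integrable rho cf).
rewrite integral_mkcond -(integral21_prod_meas1 I2).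
rewrite (eq_integral (fun=> 0%E)) ?integral0// => y _; rewrite /fubini_G.
have [yI|yI] := boolP (y \in icc rho); last first.
  rewrite (eq_integral (fun=> 0%E)) ?integral0// => x _; rewrite patchE in_setX /=.
  by rewrite (negbTE yI) andbF.
rewrite -[RHS](H y) [RHS]integral_mkcond; apply: eq_integral => x _.
by rewrite !patchE in_setX /= yI andbT.
Qed.

Lemma sq_integral0_y f rho : Ck 0 setT f ->
  (forall x, \int[mu]_(y in icc rho) (f (cplx (x, y)))%:E = 0)%E ->
  (\int[mu2]_(p in sq rho) (f (cplx p))%:E = 0)%E.
Proof.
move=> cf H; have [cI _] := integrable_mkcond (EFin \o (f \o @cplx R)) (sq_measurable rho) (mu := mu2).
have I2 := cI (sq_integrable rho cf).
rewrite integral_mkcond -(integral12_prod_meas1 I2).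
rewrite (eq_integral (fun=> 0%E)) ?integral0// => x _; rewrite /fubini_F.
have [xI|xI] := boolP (x \in icc rho); last first.
  rewrite (eq_integral (fun=> 0%E)) ?integral0// => y _; rewrite patchE in_setX /=.
  by rewrite (negbTE xI).
rewrite -[RHS](H x) [RHS]integral_mkcond; apply: eq_integral => y _.
by rewrite !patchE in_setX /= xI.
Qed.

Section Bump.
Variable rho : R.
Hypothesis rho0 : 0 < rho.

(** A polynomial cutoff with double zeros at the ends of the interval: no boundary terms arise when
    two derivatives are moved onto it. Its derivatives are [bump1] and [bump2]. *)
Definition bump (x : R) : R := (rho ^+ 2 - x ^+ 2) ^+ 2.
Definition bump1 (x : R) : R := - 4 * x * (rho ^+ 2 - x ^+ 2).
Definition bump2 (x : R) : R := 12 * x ^+ 2 - 4 * rho ^+ 2.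

Lemma is_derive_bump x : is_derive x (1 : R) bump (bump1 x).
Proof. by rewrite /bump; apply: is_derive_eq; rewrite /bump1 /GRing.scale /=; ring. Qed.

Lemma is_derive_bump1 x : is_derive x (1 : R) bump1 (bump2 x).
Proof. by rewrite /bump1; apply: is_derive_eq; rewrite /bump2 /GRing.scale /=; ring. Qed.

Lemma is_derive_bump2 x : is_derive x (1 : R) bump2 (24 * x).
Proof. by rewrite /bump2; apply: is_derive_eq; rewrite /GRing.scale /=; ring. Qed.

(** The integrand is the derivative of [g1 * bump - g * bump1], which vanishes at both ends. *)
Lemma line_zero (g g1 g2 : R -> R) :
  (forall x, is_derive x (1 : R) g (g1 x)) -> (forall x, is_derive x (1 : R) g1 (g2 x)) ->
  continuous g2 ->
  (\int[mu]_(x in icc rho) (g2 x * bump x - g x * bump2 x)%R%:E = 0)%E.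
Proof.
move=> dg dg1 cg2; pose G x := g1 x * bump x - g x * bump1 x.
have cont (h h' : R -> R) : (forall x, is_derive x (1 : R) h (h' x)) -> continuous h.
  by move=> dh x; apply/differentiable_continuous/derivable1_diffP; have := dh x; case.
have dG x : is_derive x (1 : R) G (g2 x * bump x - g x * bump2 x).
  have := is_deriveB (is_deriveM (dg1 x) (is_derive_bump x)) (is_deriveM (dg x) (is_derive_bump1 x)).
  by move=> h; apply: is_derive_eq h _; rewrite /GRing.scale /=; ring.
have rr : - rho < rho by rewrite -subr_gt0 opprK addr_gt0.
rewrite (@continuous_FTC2 _ _ G _ _ rr).
- rewrite -EFinB; congr EFin; rewrite /G /bump /bump1 sqrrN !subrr expr0n /=; ring.
- have cH : continuous (fun x : R => g2 x * bump x - g x * bump2 x).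
    by move=> x; exact: (cvgB (cvgM (cg2 x) (cont _ _ is_derive_bump x)) (cvgM (cont _ _ dg x) (cont _ _ is_derive_bump2 x))).
  by apply: continuous_subspaceT => x; exact: cH.
- split; first by move=> x _; have := dG x; case.
  + by apply: cvg_at_right_filter; exact: cont dG _.
  + by apply: cvg_at_left_filter; exact: cont dG _.
- by move=> x _; rewrite derive1E; apply: derive_val.
Qed.

Lemma bump_le x : `|x| <= rho -> 0 <= bump x <= rho ^+ 4.
Proof.
move=> xr; have x2 : x ^+ 2 <= rho ^+ 2 by rewrite -real_normK ?num_real// ler_pXn2r// ?nnegrE ?ltW.
have x20 := sqr_ge0 x; rewrite /bump sqr_ge0 (_ : rho ^+ 4 = (rho ^+ 2) ^+ 2); last by rewrite -exprM.
have a0 : 0 <= rho ^+ 2 - x ^+ 2 by lra.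
have b0 : 0 <= rho ^+ 2 by exact: sqr_ge0.
by rewrite /= ler_pXn2r ?nnegrE//; lra.
Qed.

Lemma bump2_le x : `|x| <= rho -> `|bump2 x| <= 8 * rho ^+ 2.
Proof.
move=> xr; have x2 : x ^+ 2 <= rho ^+ 2 by rewrite -real_normK ?num_real// ler_pXn2r// ?nnegrE ?ltW.
by have := sqr_ge0 x; rewrite /bump2 ler_norml => x20; apply/andP; split; lra.
Qed.

End Bump.

Lemma Ck_ReC m : Ck m setT (@complex.Re R : C -> R).
Proof.
have h := @Ck_Re R m setT id 1 openT (@holo_id _ _).
by apply: (Ck_eq openT _ h) => w _; rewrite mul1r.
Qed.

Lemma Ck_ImC m : Ck m setT (@complex.Im R : C -> R).
Proof.
have h := @Ck_Re R m setT id (- 'i%C) openT (@holo_id _ _).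
by apply: (Ck_eq openT _ h) => -[x y] _ /=; ring.
Qed.

Lemma is_derive_x F (x y : R) : Ck 1 setT F ->
  is_derive x (1 : R) (fun t : R => F (cplx (t, y))) (pd 1 F (cplx (x, y))).
Proof.
move=> /CkS[_ h _]; have E (t : R) : cplx (0, y) + t%:C * 1 = cplx (t, y) :> C.
  by rewrite mulr1; apply/eqP; rewrite eq_complex /=; apply/andP; split; apply/eqP; ring.
have := is_pd_line (h 1 (cplx (0, y) + x%:C * 1) (@dir1 R) I).
by rewrite E (_ : (fun t : R => _) = fun t : R => F (cplx (t, y)))//; apply/funext => t; rewrite E.
Qed.

Lemma is_derive_y F (x y : R) : Ck 1 setT F ->
  is_derive y (1 : R) (fun t : R => F (cplx (x, t))) (pd 'i%C F (cplx (x, y))).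
Proof.
move=> /CkS[_ h _]; have E (t : R) : cplx (x, 0) + t%:C * 'i%C = cplx (x, t) :> C.
  by apply/eqP; rewrite eq_complex /=; apply/andP; split; apply/eqP; ring.
have := is_pd_line (h 'i%C (cplx (x, 0) + y%:C * 'i%C) (@diri R) I).
by rewrite E (_ : (fun t : R => _) = fun t : R => F (cplx (x, t)))//; apply/funext => t; rewrite E.
Qed.

Lemma continuous_x f (y : R) : Ck 0 setT f -> continuous (fun x : R => f (cplx (x, y))).
Proof.
move=> /Ck0 cf x; apply/cvgrPdist_lt => e e0.
have [d d0 h] := (continuous_eps f _).1 (cf (cplx (x, y)) I) e e0.
near=> t; rewrite distrC; apply: h.
rewrite (_ : cplx _ - cplx _ = (t - x)%:C); last first.
  by apply/eqP; rewrite eq_complex /= subrr !eqxx.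
rewrite cmod_real distrC; near: t; exact: cvgr_dist_lt.
Unshelve. all: by end_near. Qed.

Lemma continuous_y f (x : R) : Ck 0 setT f -> continuous (fun y : R => f (cplx (x, y))).
Proof.
move=> /Ck0 cf y; apply/cvgrPdist_lt => e e0.
have [d d0 h] := (continuous_eps f _).1 (cf (cplx (x, y)) I) e e0.
near=> t; rewrite distrC; apply: h.
rewrite (_ : cplx _ - cplx _ = (t - y)%:C * 'i%C); last first.
  by apply/eqP; rewrite eq_complex /=; apply/andP; split; apply/eqP; ring.
rewrite cmodM cmod_i mulr1 cmod_real distrC; near: t; exact: cvgr_dist_lt.
Unshelve. all: by end_near. Qed.

(** The two sides differ by two integrals, one per direction, and each vanishes by [line_zero] on
    the lines of that direction. *)
Lemma green_square F rho : 0 < rho -> Ck 2 setT F ->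
  (\int[mu2]_(p in sq rho) (laplacian F (cplx p) * (bump rho p.1 * bump rho p.2))%R%:E =
   \int[mu2]_(p in sq rho) (F (cplx p) * (bump2 rho p.1 * bump rho p.2 + bump rho p.1 * bump2 rho p.2))%R%:E)%E.
Proof.
move=> rho0 HF; have /CkS[_ _ HF1] := HF.
have cF : Ck 0 setT F by exact: CkW HF.
have cb (h : C -> R) : Ck 0 setT h -> Ck 0 setT (fun w => bump rho (h w)).
  by apply: Ck_comp0 => z _; exact: is_derive_bump.
have cb2 (h : C -> R) : Ck 0 setT h -> Ck 0 setT (fun w => bump2 rho (h w)).
  by apply: (@Ck_comp0 _ _ _ _ (fun x => 24 * x)) => z _; exact: is_derive_bump2.
have cbx := cb _ (@Ck_ReC 0); have cby := cb _ (@Ck_ImC 0).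
have cb2x := cb2 _ (@Ck_ReC 0); have cb2y := cb2 _ (@Ck_ImC 0).
have cxx : Ck 0 setT (pd 1 (pd 1 F)) by have /CkS[_ _] := HF1 1 (@dir1 R); apply; exact: dir1.
have cyy : Ck 0 setT (pd 'i%C (pd 'i%C F)) by have /CkS[_ _] := HF1 'i%C (@diri R); apply; exact: diri.
pose H1 w := (pd 1 (pd 1 F) w * bump rho (complex.Re w) + (-1) * (F w * bump2 rho (complex.Re w))) * bump rho (complex.Im w).
pose H2 w := (pd 'i%C (pd 'i%C F) w * bump rho (complex.Im w) + (-1) * (F w * bump2 rho (complex.Im w))) * bump rho (complex.Re w).
have oT := @openT C.
have cc (c : R) : Ck 0 setT (fun _ : C => c) by exact: Ck_cst.
have cH1 : Ck 0 setT H1.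
  exact: CkM oT (CkD oT (CkM oT cxx cbx) (CkM oT (cc (-1)) (CkM oT cF cb2x))) cby.
have cH2 : Ck 0 setT H2.
  exact: CkM oT (CkD oT (CkM oT cyy cby) (CkM oT (cc (-1)) (CkM oT cF cb2y))) cbx.
have Z1 : (\int[mu2]_(p in sq rho) (H1 (cplx p))%:E = 0)%E.
  apply: sq_integral0_x => // y; pose c := bump rho y.
  have d1 x : is_derive x (1 : R) (fun x : R => F (cplx (x, y)) * c) (pd 1 F (cplx (x, y)) * c).
    apply: is_derive_eq (is_deriveM (is_derive_x x y (CkW _ HF)) (is_derive_cst c _ _)) _ => //.
    by rewrite /GRing.scale /=; ring.
  have d2 x : is_derive x (1 : R) (fun x : R => pd 1 F (cplx (x, y)) * c) (pd 1 (pd 1 F) (cplx (x, y)) * c).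
    apply: is_derive_eq (is_deriveM (is_derive_x x y (HF1 1 (@dir1 R))) (is_derive_cst c _ _)) _ => //.
    by rewrite /GRing.scale /=; ring.
  have cg : continuous (fun x : R => pd 1 (pd 1 F) (cplx (x, y)) * c).
    exact: (@continuous_x (fun w => pd 1 (pd 1 F) w * c) y (CkM oT cxx (cc c))).
  rewrite -[RHS](line_zero rho0 d1 d2 cg).
  by apply: eq_integral => x _; congr EFin; rewrite /H1 /c /=; ring.
have Z2 : (\int[mu2]_(p in sq rho) (H2 (cplx p))%:E = 0)%E.
  apply: sq_integral0_y => // x; pose c := bump rho x.
  have d1 y : is_derive y (1 : R) (fun y : R => F (cplx (x, y)) * c) (pd 'i%C F (cplx (x, y)) * c).
    apply: is_derive_eq (is_deriveM (is_derive_y x y (CkW _ HF)) (is_derive_cst c _ _)) _ => //.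
    by rewrite /GRing.scale /=; ring.
  have d2 y : is_derive y (1 : R) (fun y : R => pd 'i%C F (cplx (x, y)) * c) (pd 'i%C (pd 'i%C F) (cplx (x, y)) * c).
    apply: is_derive_eq (is_deriveM (is_derive_y x y (HF1 'i%C (@diri R))) (is_derive_cst c _ _)) _ => //.
    by rewrite /GRing.scale /=; ring.
  have cg : continuous (fun y : R => pd 'i%C (pd 'i%C F) (cplx (x, y)) * c).
    exact: (@continuous_y (fun w => pd 'i%C (pd 'i%C F) w * c) x (CkM oT cyy (cc c))).
  rewrite -[RHS](line_zero rho0 d1 d2 cg).
  by apply: eq_integral => y _; congr EFin; rewrite /H2 /c /=; ring.
have cB : Ck 0 setT (fun w : C => F w * (bump2 rho (complex.Re w) * bump rho (complex.Im w) +
    bump rho (complex.Re w) * bump2 rho (complex.Im w))).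
  exact: CkM oT cF (CkD oT (CkM oT cb2x cby) (CkM oT cbx cb2y)).
have I1 := sq_integrable rho cH1; have I2 := sq_integrable rho cH2; have IB := sq_integrable rho cB.
have mS := sq_measurable rho.
transitivity (\int[mu2]_(p in sq rho) ((H1 (cplx p))%:E + ((H2 (cplx p))%:E + (F (cplx p) *
   (bump2 rho p.1 * bump rho p.2 + bump rho p.1 * bump2 rho p.2))%R%:E)))%E.
  apply: eq_integral => -[x y] _; rewrite -!EFinD; congr EFin; rewrite /H1 /H2 /laplacian /=.
  move: (pd 1 (pd 1 F) _) (pd 'i%C (pd 'i%C F) _) (F _) (bump rho x) (bump rho y) (bump2 rho x) (bump2 rho y).
  by move=> a b f p q s t; ring.
rewrite (integralD mS I1 (integrableD mS I2 IB)) (integralD mS I2 IB).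
by rewrite [X in (X + _)%E]Z1 [X in (_ + (X + _))%E]Z2 !add0e.
Qed.

(** Wherever a cutoff is differentiated the weight is at most [16 rho^6]. Outside the disc of radius
    [B] the function is at most [e], whence [e] times the area; the contribution of the fixed square
    around this disc is the constant [K]. *)
Lemma green_bound F (e B : R) : Ck 2 setT F -> 0 < e -> (forall w, B < cmod w -> `|F w| <= e) ->
  exists K, forall rho, 0 < rho ->
  (`|\int[mu2]_(p in sq rho) (laplacian F (cplx p) * (bump rho p.1 * bump rho p.2))%R%:E| <=
   (16 * rho ^+ 6 * (e * (2 * rho) ^+ 2 + K))%:E)%E.
Proof.
move=> HF e0 HB; have cF : Ck 0 setT F by exact: CkW HF.
have [M HM] := Ck0_bounded B cF.
pose M' := Num.max M 0; pose B' := Num.max B 0.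
exists (M' * (2 * B') ^+ 2) => rho rho0; rewrite green_square//.
have mS := sq_measurable rho; have mB := sq_measurable B'.
have c0 : 0 <= 16 * rho ^+ 6 by rewrite mulr_ge0// exprn_ge0// ltW.
have M'0 : 0 <= M' by rewrite le_max lexx orbT.
have B'0 : 0 <= B' by rewrite le_max lexx orbT.
have pt p : sq rho p -> `|F (cplx p) * (bump2 rho p.1 * bump rho p.2 + bump rho p.1 * bump2 rho p.2)| <=
    16 * rho ^+ 6 * (e + M' * \1_(sq B') p).
  case: p => x y [] /=; rewrite /icc /= !in_itv /= -!ler_norml => xr yr.
  have F1 : `|F (cplx (x, y))| <= e + M' * \1_(sq B') (x, y).
    have [h|h] := ltP B (cmod (cplx (x, y))).
      apply: le_trans (HB _ h) _; rewrite lerDl mulr_ge0//.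
    have B0 : 0 <= B by apply: le_trans h; exact: cmod_ge0.
    have BB : B' = B by rewrite /B' max_l.
    have sB : sq B (x, y) by exact: sq_cmod h.
    rewrite indicE BB mem_set// mulr1 (le_trans (HM _ sB))// (le_trans _ (_ : M' <= _))//.
      by rewrite le_max lexx.
    by rewrite lerDr ltW.
  rewrite normrM mulrC; apply: ler_pM => //.
  have /andP[b1 b1'] := bump_le rho0 xr; have /andP[b2 b2'] := bump_le rho0 yr.
  have b3 := bump2_le rho0 xr; have b4 := bump2_le rho0 yr.
  apply: le_trans (ler_normD _ _) _; rewrite (normrM (bump2 rho x)) (normrM (bump rho x)) (ger0_norm b1) (ger0_norm b2).
  have -> : 16 * rho ^+ 6 = 8 * rho ^+ 2 * rho ^+ 4 + rho ^+ 4 * (8 * rho ^+ 2) by ring.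
  by apply: lerD; apply: ler_pM.
have oT := @openT C.
have cb (h : C -> R) : Ck 0 setT h -> Ck 0 setT (fun w => bump rho (h w)).
  by apply: Ck_comp0 => z _; exact: is_derive_bump.
have cb2 (h : C -> R) : Ck 0 setT h -> Ck 0 setT (fun w => bump2 rho (h w)).
  by apply: (@Ck_comp0 _ _ _ _ (fun x => 24 * x)) => z _; exact: is_derive_bump2.
have cG := CkM oT cF (CkD oT (CkM oT (cb2 _ (@Ck_ReC 0)) (cb _ (@Ck_ImC 0))) (CkM oT (cb _ (@Ck_ReC 0)) (cb2 _ (@Ck_ImC 0)))).
have iG := sq_integrable rho cG.
apply: le_trans (le_abse_integral _ mS (measurable_int _ iG)) _.
have m1 : measurable_fun (sq rho) (fun p : R * R => (16 * rho ^+ 6 * (e + M' * \1_(sq B') p))%:E).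
  apply/measurable_EFinP; apply: measurable_funM; first exact: measurable_cst.
  apply: measurable_funD; first exact: measurable_cst.
  apply: measurable_funM; first exact: measurable_cst.
  by apply: (@measurable_funS _ _ _ _ setT) => //; exact: measurable_indic.
apply: (@le_trans _ _ (\int[mu2]_(p in sq rho) (16 * rho ^+ 6 * (e + M' * \1_(sq B') p))%R%:E)%E).
  apply: ge0_le_integral => //.
  by apply: measurableT_comp => //; exact: measurable_int iG.
have mi : measurable_fun (sq rho : set RR) (fun p => (\1_(sq B') p : R)%:E).
  by apply/measurable_EFinP; apply: measurable_funTS; exact: measurable_indic.
under eq_integral => p _ do rewrite (EFinM (16 * rho ^+ 6)) (EFinD e) (EFinM M').
have i0 p : (0 <= M'%:E * (\1_(sq B') p : R)%:E)%E by rewrite -EFinM lee_fin mulr_ge0.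
have mMi : measurable_fun (sq rho : set RR) (fun p => M'%:E * (\1_(sq B') p : R)%:E)%E by exact: measurable_funeM.
rewrite (@ge0_integralZl_EFin _ _ R mu2 _ mS)//; last 2 first.
- by move=> p _; apply: adde_ge0 => //; rewrite lee_fin ltW.
- by apply: emeasurable_funD => //; exact: measurable_cst.
rewrite (@ge0_integralD _ _ R mu2 _ mS)//; last by move=> p _; rewrite lee_fin ltW.
rewrite (@integral_cst _ _ R mu2 _ mS) (@ge0_integralZl_EFin _ _ R mu2 _ mS)//.
rewrite (@integral_indic _ _ R mu2 _ mS _ mB).
rewrite (EFinM (16 * rho ^+ 6) (_ + _)); apply: lee_wpmul2l; first by rewrite lee_fin.
rewrite EFinD; apply: leeD; rewrite EFinM; apply: lee_wpmul2l; rewrite ?lee_fin ?(ltW e0)//.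
  by have <- : mu2 (sq rho) = ((2 * rho) ^+ 2)%:E by apply: sq_measure; exact: ltW.
have <- : mu2 (sq B') = ((2 * B') ^+ 2)%:E by exact: sq_measure.
by apply: le_measure; rewrite ?inE//; exact: measurableI.
Qed.

Lemma bump_lim (x : R) : (fun n => bump n.+1%:R x / n.+1%:R ^+ 4) @ \oo --> (1 : R).
Proof.
have E0 (N : R) : N != 0 -> bump N x / N ^+ 4 = (1 - (x * N^-1) ^+ 2) ^+ 2.
  by move=> N0; rewrite /bump; field.
have E n : bump n.+1%:R x / n.+1%:R ^+ 4 = (1 - (x * n.+1%:R^-1) ^+ 2) ^+ 2.
  by apply: E0; rewrite pnatr_eq0.
under eq_fun do rewrite E.
have h : (fun n => x * n.+1%:R^-1 : R) @ \oo --> x * 0 by apply: cvgMr; exact: cvg_harmonic.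
have h1 : (fun n => (1 - (x * n.+1%:R^-1) ^+ 2) : R) @ \oo --> 1 - (x * 0) * (x * 0).
  by apply: cvgB; [exact: cvg_cst|under eq_fun do rewrite expr2; exact: cvgM].
have := cvgM h1 h1; rewrite mulr0 mulr0 subr0 mulr1.
rewrite (_ : _ \* _ = fun n : nat => (1 - (x * n.+1%:R^-1) ^+ 2) ^+ 2)//.
by move=> H; apply: H.
Qed.

(* Green's formula against the cutoff [bump rho x * bump rho y / rho ^ 8]: the
   terms where the cutoff is differentiated are O(sup |F|). *)
Lemma laplacian_integral0 F : Ck 2 setT F ->
  mu2.-integrable setT (fun p => (laplacian F (cplx p))%:E) ->
  (forall e, 0 < e -> exists B, forall w, B < cmod w -> `|F w| <= e) ->
  (\int[mu2]_p (laplacian F (cplx p))%:E = 0)%E.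
Proof.
move=> HF iF F0; have mF := measurable_int _ iF.
have oT := @openT C.
(* With this normalisation the cutoff is at most [1] on the square and tends to [1] pointwise, so
   that dominated convergence applies. *)
pose u n (p : RR) : R := (n.+1%:R ^+ 8)^-1 * (laplacian F (cplx p) * (bump n.+1%:R p.1 * bump n.+1%:R p.2)).
pose f_ n := ((EFin \o u n) \_ (sq n.+1%:R) : RR -> \bar R).
have N0 n : 0 < (n.+1%:R : R) by rewrite ltr0n.
have cL : Ck 0 setT (laplacian F).
  have /CkS[_ _ HF1] := HF; have /CkS[_ _ h1] := HF1 1 (@dir1 R); have /CkS[_ _ h2] := HF1 'i%C (@diri R).
  exact: CkD oT (h1 1 (@dir1 R)) (h2 'i%C (@diri R)).
have cb N (h : C -> R) : Ck 0 setT h -> Ck 0 setT (fun w => bump N (h w)).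
  by apply: Ck_comp0 => z _; exact: is_derive_bump.
have cG N := CkM oT cL (CkM oT (cb N _ (@Ck_ReC 0)) (cb N _ (@Ck_ImC 0))).
have mu_ n : measurable_fun (setT : set RR) (EFin \o u n).
  apply/measurable_EFinP; apply: measurable_funM; first exact: measurable_cst.
  exact: Ck0_measurable (cG _).
have mf_ n : measurable_fun (setT : set RR) (f_ n).
  have [h _] := @measurable_restrictT _ _ RR _ (sq n.+1%:R) (EFin \o u n) (sq_measurable n.+1%:R).
  by apply: h; apply: measurable_funTS; exact: mu_.
have uE n p : u n p = laplacian F (cplx p) * (bump n.+1%:R p.1 / n.+1%:R ^+ 4) * (bump n.+1%:R p.2 / n.+1%:R ^+ 4).
  rewrite /u; move: (laplacian F _) (bump _ _) (bump _ p.2) => a b c.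
  have n0 : (n.+1%:R : R) != 0 by rewrite pnatr_eq0.
  by move: (n.+1%:R : R) n0 => N n0; field.
have lim p : setT p -> f_ ^~ p @ \oo --> (laplacian F (cplx p))%:E.
  move=> _; have h : (fun n => u n p) @ \oo --> laplacian F (cplx p) * 1 * 1.
    under eq_fun do rewrite uE.
    apply: cvgM; last exact: bump_lim.
    by apply: cvgM; [exact: cvg_cst|exact: bump_lim].
  have {}h : (fun n => (u n p)%:E) @ \oo --> (laplacian F (cplx p))%:E.
    by apply: cvg_EFin; [near=> n|rewrite !mulr1 in h].
  apply: cvg_trans h; apply: near_eq_cvg; exists (Num.truncn (`|p.1| + `|p.2|)) => // n /= hn.
  rewrite /f_ patchE mem_set//.
  have : `|p.1| + `|p.2| < n.+1%:R by apply: lt_le_trans (truncnS_gt _) _; rewrite ler_nat ltnS.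
  have := normr_ge0 p.1; have := normr_ge0 p.2 => ? ? ?.
  by split; rewrite /icc /= in_itv /= -ler_norml; lra.
have dom p n : setT p -> (`|f_ n p| <= `|(laplacian F (cplx p))%:E|)%E.
  move=> _; rewrite /f_ patchE; case: ifPn => [|_]; last by rewrite abse0 abse_ge0.
  rewrite inE => -[]; rewrite /icc /= !in_itv /= -!ler_norml => h1 h2.
  have b1 (x : R) : `|x| <= n.+1%:R -> `|bump n.+1%:R x / n.+1%:R ^+ 4| <= (1 : R).
    move=> /(bump_le (N0 n))/andP[x0 x1]; have n4 : 0 < (n.+1%:R ^+ 4 : R) by rewrite exprn_gt0.
    by rewrite ger0_norm ?divr_ge0 ?(ltW n4)// ler_pdivrMr// mul1r.
  rewrite lee_fin uE -mulrA normrM ler_piMr// (normrM (bump _ _ / _)).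
  by apply: mulr_ile1 => //; exact: b1.
have [||_ _ cv] := @dominated_convergence _ _ R mu2 setT measurableT f_ _ (fun p => `|(laplacian F (cplx p))%:E|%E)
  mf_ mF _ (integrable_abse iF).
- by apply: aeW => p; exact: lim.
- by apply: aeW => p n; exact: dom.
have intE n : (\int[mu2]_p f_ n p = ((n.+1%:R ^+ 8)^-1)%:E *
    \int[mu2]_(p in sq n.+1%:R) (laplacian F (cplx p) * (bump n.+1%:R p.1 * bump n.+1%:R p.2))%R%:E)%E.
  rewrite /f_ -integral_mkcond -(integralZl (sq_measurable _) (sq_integrable _ (cG n.+1%:R))).
  by apply: eq_integral => p _; rewrite -EFinM.
apply/eqP; rewrite -abse_eq0 eq_le abse_ge0 andbT; apply/lee_addgt0Pr => e' e'0; rewrite add0e.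
(* The final bound is [64 e + 16 K / N^2], and [K / N^2 <= e] for large [N]. *)
pose e := e' / 80; have e0 : 0 < e by rewrite divr_gt0.
have [B HB] := F0 e e0; have [K HK] := green_bound HF e0 HB.
have cva : (fun n => (`|\int[mu2]_p f_ n p|)%E) @ \oo --> (`|\int[mu2]_p (laplacian F (cplx p))%:E|)%E.
  by apply: cvg_abse; exact: cv.
rewrite -(cvg_lim _ cva)//.
apply: lime_le; first by apply/cvg_ex; eexists; exact: cva.
exists (Num.truncn (`|K| / e)) => // n /= hn.
have Kn : `|K| / e < n.+1%:R by apply: lt_le_trans (truncnS_gt _) _; rewrite ler_nat ltnS.
rewrite intE abseM abse_EFin ger0_norm ?invr_ge0 ?exprn_ge0//.
apply: le_trans (lee_wpmul2l _ (HK n.+1%:R (N0 n))) _; first by rewrite lee_fin invr_ge0 exprn_ge0.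
rewrite -EFinM lee_fin.
have N1 : 1 <= (n.+1%:R : R) by rewrite ler1n.
move: (n.+1%:R : R) (N0 n) Kn N1 => N Np Kn N1.
have -> : (N ^+ 8)^-1 * (16 * N ^+ 6 * (e * (2 * N) ^+ 2 + K)) = 64 * e + 16 * (K / N ^+ 2).
  by field; exact: lt0r_neq0.
have : K / N ^+ 2 <= e.
  rewrite ler_pdivrMr ?exprn_gt0//; apply: le_trans (ler_norm _) _.
  rewrite ltr_pdivrMr// in Kn; apply: le_trans (ltW Kn) _; rewrite mulrC ler_wpM2l ?(ltW e0)//.
  by rewrite expr2 ler_peMr// ltW.
rewrite /e; lra.
Unshelve. all: by end_near. Qed.

Lemma integral_even (f F : R -> R) (l : R) : (forall x, 0 <= f x) -> continuous f ->
  (forall x, f (- x) = f x) -> (forall x, is_derive x (1 : R) F (f x)) -> F 0 = 0 ->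
  F x @[x --> +oo] --> l -> (\int[mu]_x (f x)%:E = (2 * l)%:E)%E.
Proof.
move=> f0 cf fN dF F0 Fl; rewrite ge0_symfun_integralT//; last by move=> x; rewrite /= fN.
rewrite -set_itvcy (@ge0_continuous_FTC2y _ f F 0 l)//.
- by rewrite F0 sube0 EFinM.
- by apply: continuous_subspaceT => x; exact: cf.
- apply: cvg_at_right_filter; apply/differentiable_continuous/derivable1_diffP.
  by have := dF 0; case.
- by move=> x _; rewrite derive1E; apply: derive_val.
Qed.

(** The parameter is written [c ^- 2] because it will be [1 + x^2] with [c = cos (atan x)]: the
    result is then a power of a cosine, with an explicit primitive in the other variable. *)
Lemma integral_line_kernel (c : R) : 0 < c ->
  (\int[mu]_y ((c ^- 2 + y ^+ 2) ^- 2)%:E = (pi / 2 * c ^+ 3)%:E)%E.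
Proof.
move=> c0; have c20 : 0 < c ^- 2 by rewrite invr_gt0 exprn_gt0.
have D0 (y : R) : 0 < c ^- 2 + y ^+ 2 by rewrite ltr_pwDl ?sqr_ge0.
have dD (y : R) : is_derive y (1 : R) (fun y : R => c ^- 2 + y ^+ 2) (2 * y).
  by apply: is_derive_eq; rewrite /GRing.scale /=; ring.
have cc (h h' : R -> R) : (forall x, is_derive x (1 : R) h (h' x)) -> continuous h.
  by move=> dh x; apply/differentiable_continuous/derivable1_diffP; have := dh x; case.
have dV (y : R) : is_derive y (1 : R) (fun y : R => (c ^- 2 + y ^+ 2)^-1) (- (c ^- 2 + y ^+ 2) ^- 2 * (2 * y)).
  have h := @is_deriveV _ (fun y : R => c ^- 2 + y ^+ 2) y (2 * y) 1 (lt0r_neq0 (D0 y)) (dD y).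
  by apply: is_derive_eq h _; rewrite /GRing.scale /=.
pose F (y : R) := c ^+ 2 / 2 * (y * (c ^- 2 + y ^+ 2)^-1) + c ^+ 3 / 2 * atan (c * y).
have dF (y : R) : is_derive y (1 : R) F ((c ^- 2 + y ^+ 2) ^- 2).
  have da : is_derive y (1 : R) (fun y : R => atan (c * y)) ((1 + (c * y) ^+ 2)^-1 * c).
    have dc : is_derive y (1 : R) (fun y : R => c * y) c.
      by apply: is_derive_eq; rewrite /GRing.scale /=; ring.
    exact: (is_derive1_comp (is_derive1_atan (c * y)) dc).
  have := is_deriveD (is_deriveM (is_derive_cst (c ^+ 2 / 2) y 1) (is_deriveM (is_derive_id y 1) (dV y)))
    (is_deriveM (is_derive_cst (c ^+ 3 / 2) y 1) da).
  move=> h; apply: is_derive_eq h _; rewrite /GRing.scale /=.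
  have -> : 1 + (c * y) ^+ 2 = c ^+ 2 * (c ^- 2 + y ^+ 2) by field; exact: lt0r_neq0.
  have D1 := lt0r_neq0 (D0 y); have c1 := lt0r_neq0 c0.
  have yE : y ^+ 2 = (c ^- 2 + y ^+ 2) - c ^- 2 by ring.
  move: (c ^- 2 + y ^+ 2) D1 yE => D D1 yE.
  rewrite !mulr0 !addr0 mulr1; have -> : y * (- D ^- 2 * (2 * y)) = - 2 * y ^+ 2 * D ^- 2 by ring.
  by rewrite yE; field; rewrite c1 D1.
have cK : continuous (fun y : R => (c ^- 2 + y ^+ 2) ^- 2).
  rewrite (_ : (fun y => _) = fun y : R => (c ^- 2 + y ^+ 2)^-1 * (c ^- 2 + y ^+ 2)^-1); last first.
    by apply/funext => y; rewrite -exprVn expr2.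
  by move=> y; apply: cvgM; exact: cc dV y.
rewrite (@integral_even _ F (c ^+ 3 / 2 * (pi / 2))); first by congr EFin; field.
- by move=> y; rewrite invr_ge0 exprn_ge0// ltW.
- exact: cK.
- by move=> y; rewrite sqrrN.
- by rewrite /F !mulr0 mul0r atan0 !mulr0 addr0.
- rewrite -[X in _ --> X]add0r -[X in _ --> X + _](mulr0 (c ^+ 2 / 2)).
  apply: cvgD; apply: cvgMr.
    apply/cvgrPdist_le => e e0; near=> y.
    have y0 : 0 < y by near: y; exact: nbhs_pinfty_gt.
    have ye : e^-1 <= y by near: y; apply: nbhs_pinfty_ge; exact: num_real.
    rewrite sub0r normrN ger0_norm ?mulr_ge0 ?invr_ge0 ?(ltW y0) ?(ltW (D0 y))//.
    rewrite ler_pdivrMr//; apply: (@le_trans _ _ (e * y ^+ 2)); last by rewrite ler_pM2l// lerDr ltW.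
    by rewrite expr2 mulrA ler_peMl ?(ltW y0)// -(mulfV (lt0r_neq0 e0)) ler_pM2l.
  apply: (cvg_comp (fun y : R => c * y) atan _ (@cvgy_atan R)).
  apply/cvgryPge => M; near=> y; rewrite -ler_pdivrMl//.
Unshelve. all: by end_near. Qed.

(** By Tonelli: the inner integral is [pi / 2 * cos (atan x)^3], which is the derivative of
    [pi / 2 * sin (atan x)]. *)
Lemma plane_kernel : (\int[mu2]_p ((1 + absq (cplx p)) ^- 2)%:E = pi%:E)%E.
Proof.
have D0 (w : C) : 0 < 1 + absq w by rewrite ltr_pwDl ?absq_ge0.
have cK : Ck 0 setT (fun w : C => ((1 + absq w)^-1) * (1 + absq w)^-1).
  have oT := @openT C.
  have h : Ck 0 setT (fun w : C => (1 + absq w)^-1).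
    apply: Ck_inv => //; first by move=> w _; exact: lt0r_neq0.
    by apply: CkD => //; [exact: Ck_cst|exact: Ck_absq (@holo_id _ _)].
  exact: CkM.
have mK : measurable_fun (setT : set RR) (fun p => ((1 + absq (cplx p)) ^- 2)%:E).
  apply/measurable_EFinP; apply: eq_measurable_fun (Ck0_measurable cK) => p _.
  by rewrite /= -exprVn expr2.
rewrite (@fubini_tonelli1 _ _ _ _ _ mu mu _ mK); last first.
  by move=> p; rewrite lee_fin invr_ge0 exprn_ge0// ltW.
rewrite /fubini_F.
have cosE (x : R) : cos (atan x) ^- 2 = 1 + x ^+ 2.
  by rewrite cos_atan exprVn sqr_sqrtr ?invrK// addr_ge0 ?sqr_ge0.
have cos0 (x : R) : 0 < cos (atan x).
  by rewrite cos_atan invr_gt0 sqrtr_gt0 ltr_pwDl ?sqr_ge0.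
under eq_integral => x _.
  under eq_integral => y _ do rewrite /absq /= addrA -cosE.
  rewrite integral_line_kernel//.
  over.
have dcos (x : R) : is_derive x (1 : R) (fun x : R => sin (atan x)) (cos (atan x) ^+ 3).
  have h := is_derive1_comp (is_derive_sin (atan x)) (is_derive1_atan x).
  by apply: is_derive_eq h _; rewrite -cosE invrK -exprS.
have cc : continuous (fun x : R => cos (atan x)).
  by move=> x; apply: continuous_comp; [exact: continuous_atan|exact: continuous_cos].
have dG (x : R) : is_derive x (1 : R) (fun x : R => pi / 2 * sin (atan x)) (pi / 2 * cos (atan x) ^+ 3).
  have h := is_deriveM (is_derive_cst (pi / 2 : R) x 1) (dcos x).
  by apply: is_derive_eq h _; rewrite /GRing.scale /= mulr0 addr0.
rewrite (@integral_even (fun x => pi / 2 * cos (atan x) ^+ 3) (fun x => pi / 2 * sin (atan x)) (pi / 2 * 1)).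
- by congr EFin; field.
- by move=> x; rewrite mulr_ge0 ?divr_ge0 ?pi_ge0// exprn_ge0// ltW.
- move=> x; apply: cvgMr; have := cvgM (cc x) (cvgM (cc x) (cc x)).
  by apply.
- by move=> x; rewrite atanN cosN.
- by rewrite atan0 sin0 mulr0.
- apply: cvgMr; rewrite -[X in _ --> X](@sin_pihalf R).
  apply: (cvg_comp (@atan R) (@sin R) (@cvgy_atan R)); exact: continuous_sin.
Qed.

End PlaneIntegration.

(** * The degree *)

Section Degree.
Variable R : realType.
Local Notation C := (Cplx R).
Local Notation mu2 := (leb2 R).
Local Notation RR := (measurableTypeR R * measurableTypeR R)%type.
Implicit Types (z w v : C) (V W : set C).

Lemma is_pd_cst v z (c : R) : is_pd v (fun=> c) z 0.
Proof. exact: is_derive_cst. Qed.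

Lemma is_pd_ReC v z : is_pd v (@complex.Re R : C -> R) z (complex.Re v).
Proof.
have := cder_is_pd 1 v (cder_id setT z); rewrite !mul1r mulr1.
by rewrite (_ : (fun w => _) = (@complex.Re R : C -> R))//; apply/funext => w; rewrite mul1r.
Qed.

Lemma is_pd_ImC v z : is_pd v (@complex.Im R : C -> R) z (complex.Im v).
Proof.
have := cder_is_pd (- 'i%C) v (cder_id setT z); rewrite mulr1.
have E w : complex.Re (- 'i%C * w) = complex.Im w by case: w => x y /=; ring.
by rewrite E (_ : (fun w => _) = (@complex.Im R : C -> R))//; apply/funext => w; rewrite E.
Qed.

Lemma kernel_gt0 w : 0 < 1 + absq w.
Proof. by rewrite ltr_pwDl ?absq_ge0. Qed.

Lemma Ck_kernel m : Ck m setT (fun w : C => 1 + absq w).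
Proof. by apply: CkD; [exact: openT|exact: Ck_cst|exact: Ck_absq openT (@holo_id _ _)]. Qed.

Lemma Ck_ln_kernel m : Ck m setT (fun w : C => ln (1 + absq w)).
Proof. by apply: Ck_ln (@Ck_kernel m); [exact: openT|move=> w _; exact: kernel_gt0]. Qed.

(** The curvature of the Fubini-Study metric; by [plane_kernel] its total over the plane is
    [4 pi]. *)
Lemma laplacian_ln_kernel w : laplacian (fun w : C => ln (1 + absq w)) w = 4 * (1 + absq w) ^- 2.
Proof.
pose q v w : R := 2 * (complex.Re v * complex.Re w + complex.Im v * complex.Im w).
have du v z : is_pd v (fun w => 1 + absq w) z (q v z).
  have h := is_pdD (is_pd_cst v z 1)
    (is_pdD (is_pdM (is_pd_ReC v z) (is_pd_ReC v z)) (is_pdM (is_pd_ImC v z) (is_pd_ImC v z))).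
  rewrite (_ : (fun w => 1 + absq w) = fun w : C => 1 + (complex.Re w * complex.Re w + complex.Im w * complex.Im w)).
    by apply: is_derive_eq h _; rewrite /q; ring.
  by apply/funext => y; rewrite /absq !expr2.
have d1 v z : is_pd v (fun w => ln (1 + absq w)) z ((1 + absq z)^-1 * q v z).
  exact: is_pd_comp (du v z) (is_derive1_ln (kernel_gt0 z)).
have dq v z : is_pd v (q v) z (q v v).
  have h := is_pdM (is_pd_cst v z 2)
    (is_pdD (is_pdM (is_pd_cst v z (complex.Re v)) (is_pd_ReC v z))
      (is_pdM (is_pd_cst v z (complex.Im v)) (is_pd_ImC v z))).
  by apply: is_derive_eq h _; rewrite /q; ring.
have dV v z : is_pd v (fun w => (1 + absq w)^-1) z (- (1 + absq z) ^- 2 * q v z).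
  have u0 := lt0r_neq0 (kernel_gt0 z); apply: is_pd_comp (du v z) _.
  have := @is_deriveV _ id (1 + absq z) 1 1 u0 (is_derive_id _ _).
  rewrite (_ : (fun _ => _) = GRing.inv); last by apply/funext.
  by move=> h; apply: is_derive_eq h _; rewrite scaler1.
have E v : pd v (pd v (fun w => ln (1 + absq w))) w = - (1 + absq w) ^- 2 * q v w * q v w + (1 + absq w)^-1 * q v v.
  rewrite (_ : pd v (fun w => ln (1 + absq w)) = fun z => (1 + absq z)^-1 * q v z); last by apply/funext => z; rewrite (is_pd_val (d1 v z)).
  exact: is_pd_val (is_pdM (dV v w) (dq v w)).
rewrite /laplacian !E /q /=.
have u0 := lt0r_neq0 (kernel_gt0 w).
have aE : complex.Re w ^+ 2 + complex.Im w ^+ 2 = (1 + absq w) - 1 by rewrite /absq; ring.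
move: (1 + absq w) u0 aE => u u0 aE.
transitivity (- 4 * u ^- 2 * (complex.Re w ^+ 2 + complex.Im w ^+ 2) + 4 * u^-1); first by ring.
by rewrite aE; field.
Qed.

Lemma kernel_integrable : mu2.-integrable setT (fun p => ((1 + absq (cplx p)) ^- 2)%:E).
Proof.
apply/integrableP; split.
  have cK : Ck 0 setT (fun w : C => ((1 + absq w)^-1) * (1 + absq w)^-1).
    have h : Ck 0 setT (fun w : C => (1 + absq w)^-1).
      by apply: Ck_inv (@Ck_kernel 0); [exact: openT|move=> w _; exact: lt0r_neq0 (kernel_gt0 w)].
    exact: (CkM openT h h).
  apply/measurable_EFinP; apply: eq_measurable_fun (Ck0_measurable cK) => p _.
  by rewrite /= -exprVn expr2.
under eq_integral => p _ do rewrite abse_EFin ger0_norm ?invr_ge0 ?exprn_ge0 ?(ltW (kernel_gt0 _))//.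
by rewrite plane_kernel ltry.
Qed.

Variables (r n : nat) (P : orbibundle R r n).
Hypothesis n_gt0 : (0 < n)%N.

Lemma character_zpow (chi e : 'rV[int]_r) z : z != 0 ->
  character chi (zpow e z) = z ^ (\sum_a e 0 a * chi 0 a).
Proof.
move=> z0; rewrite expfz_sum// /character; apply: eq_bigr => a _.
by rewrite zpowE exprz_exp.
Qed.

Lemma ln_absqXz z (p : int) : z != 0 -> ln (absq (z ^ p)) = p%:~R * ln (absq z).
Proof.
move=> z0; have a0 : 0 < absq z by rewrite absqE exprn_gt0// cmod_gt0.
have E (m : nat) : ln (absq (z ^+ m)) = m%:R * ln (absq z).
  elim: m => [|m IH]; first by rewrite absqE cmodX expr0 expr1n ln1 mul0r.
  rewrite exprS absqM lnM ?posrE//; last by rewrite absqE exprn_gt0// cmod_gt0 expf_neq0.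
  by rewrite IH -[m.+1]addn1 natrD; ring.
case: p => m; first exact: E.
rewrite NegzE -exprnN mulrNz mulNr -(E m.+1) absqE cmodV exprVn lnV; last first.
  by rewrite posrE exprn_gt0// cmod_gt0 expf_neq0.
by rewrite -absqE.
Qed.

Lemma metric2_frame (chi : 'rV[int]_r) (h1 : ob1 P -> R) (h2 : ob2 P -> R) V s W t :
  hermitian_metric chi h1 h2 -> holo_section V s -> @plsec _ _ (ob2 P) W t ->
  exists g, [/\ holo (V `&` W) g, forall z, (V `&` W) z -> g z != 0 &
    forall z, (V `&` W) z -> h2 (s z) = absq (g z) * h2 (t z)].
Proof.
move=> [_ [_ hact] _ _ _] [_ _ sh] Wt; have [g [hg gE]] := sh W t Wt.
exists (fun z => character chi (g z)); split; first exact: holo_character.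
  by move=> z zV; apply: character_neq0; exact: hg.1.
by move=> z zV; rewrite gE// hact//; exact: hg.1.
Qed.

Lemma metric1_continuous (chi : 'rV[int]_r) (h1 : ob1 P -> R) (h2 : ob2 P -> R) V (s : C -> ob1 P) z :
  hermitian_metric chi h1 h2 -> holo_section V s -> V z -> {for z, continuous (fun y => h1 (s y))}.
Proof.
move=> [_ [hact _] _ hs _] [oV _ sh] Vz; have [W [t [Wt Wz]]] := plsec_cover (ob1 P) z.
have [g [hg gE]] := sh W t Wt; have oVW := openI oV (plsec_open Wt).
have h : Ck 0 (V `&` W) (fun y => absq (character chi (g y)) * h1 (t y)).
  apply: CkM => //; first by apply: Ck_absq => //; exact: holo_character.
  by apply: (@Ck_sub _ _ W) => [y []//|]; apply/(smooth_Ck _ _).1; exact: hs.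
have /Ck0 h' : Ck 0 (V `&` W) (fun y => h1 (s y)).
  by apply: Ck_eq h => // y yVW; rewrite gE// hact//; exact: hg.1.
exact: h'.
Qed.

Variables (e : 'rV[int]_r) (d : R) (s : C -> ob2 P) (sigma : C -> ob1 P).
Hypotheses (d0 : 0 < d) (hs : holo_section setT s) (hsigma : holo_section (ball0 d) sigma).
Hypothesis glueE : forall z, ball0 d z -> z != 0 -> oglue (sigma z) = pact (zpow e z) (s (z ^- n)).

Let sum3_bounds (a b x : R) : 0 <= a -> 0 <= b -> a + 1 + b < x -> [/\ a < x, 1 <= x & b <= x].
Proof. by move=> *; split; lra. Qed.

Let inv_square_bound (a x y : R) : 0 < y -> 1 <= x -> 2 * a / y <= x -> a * (x ^+ 2)^-1 <= y / 2.
Proof.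
move=> y0 x1; have x0 : 0 < x by exact: lt_le_trans ltr01 x1.
rewrite ler_pdivrMr// ler_pdivrMr ?exprn_gt0// => ax.
have : y * x <= y * x ^+ 2 by rewrite ler_pM2l// expr2 ler_pMr.
by lra.
Qed.

(* [phi = log h2(s)] differs by a function vanishing at infinity from
   [kappa log (1 + |w|^2) + L], whose curvature is known. *)
Lemma frame_degree (chi : 'rV[int]_r) delta : line_degree P chi delta ->
  delta = - (\sum_a e 0 a * chi 0 a)%:~R / n%:R.
Proof.
move=> [h1 [h2 [c1 [hm c1E ic1 ->]]]].
have [[h1p h2p] [h1act h2act] [_ h2glue] sm1 sm2] := hm.
set p : int := \sum_a _; pose kappa : R := p%:~R / n%:R.
pose phi w := ln (h2 (s w)).
have pi0 : (pi : R) != 0 by rewrite gt_eqF ?pi_gt0.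
have n0 : (n%:R : R) != 0 by rewrite pnatr_eq0 -lt0n.
(* In a frame of the atlas [phi] changes by [ln (absq g)] with [g] a holomorphic unit. This term is
   harmonic, so that [phi] has the Laplacian prescribed by [c1]. *)
have phiP w : exists2 W : set C, open W /\ W w & (forall m, Ck m W phi) /\ laplacian phi w = - 4 * pi * c1 w.
  have [W [t [Wt Ww]]] := plsec_cover (ob2 P) w.
  have [g []] := metric2_frame hm hs Wt; rewrite setTI => hg g0 gE.
  have oW := plsec_open Wt; exists W => //.
  have cl m : Ck m W (fun y => ln (absq (g y))).
    apply: (Ck_ln oW _ (@Ck_absq R m W g oW hg)) => y Wy.
    by rewrite absqE exprn_gt0// cmod_gt0 g0.
  have ch m : Ck m W (fun y => ln (h2 (t y))).
    by apply: Ck_ln => //; apply/(smooth_Ck _ _).1; exact: sm2.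
  have E y : W y -> ln (absq (g y)) + ln (h2 (t y)) = phi y.
    move=> Wy; rewrite /phi gE// lnM// posrE//.
    by rewrite absqE exprn_gt0// cmod_gt0 g0.
  split; first by move=> m; exact: Ck_eq oW E (CkD oW (cl m) (ch m)).
  rewrite -(Ck_laplacian_eq oW Ww (CkD oW (cl 2) (ch 2)) E) (laplacianD oW Ww (cl 2) (ch 2)).
  rewrite (laplacian_ln_absq oW Ww hg g0) add0r (c1E W t Wt w Ww).
  move: (laplacian _ w) => l; transitivity ((4 * pi) * (4 * pi)^-1 * l); last by ring.
  by rewrite divff ?mul1r// mulf_neq0// pnatr_eq0.
have cphi m : Ck m setT phi by apply: Ck_local => w _; have [W [_ Ww] [h _]] := phiP w; exists W.
pose L := ln (h1 (sigma 0)).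
pose F w := (phi w + (- kappa) * ln (1 + absq w)) + (- L).
have oT := @openT C.
have cF1 := CkM oT (@Ck_cst R 2 setT (- kappa)) (@Ck_ln_kernel 2).
have cF2 := CkD oT (cphi 2) cF1.
have cF : Ck 2 setT F := CkD oT cF2 (@Ck_cst R 2 setT (- L)).
have lapE w : laplacian F w = - 4 * pi * c1 w - 4 * kappa * (1 + absq w) ^- 2.
  rewrite (laplacianD oT I cF2 (@Ck_cst R 2 setT (- L))) (laplacianD oT I (cphi 2) cF1).
  rewrite (laplacianZ (- kappa) oT I (@Ck_ln_kernel 2)) laplacian_ln_kernel.
  have [_ _ [_ ->]] := phiP w.
  have -> : laplacian (fun=> - L) w = 0.
    have h v : pd v (fun _ : C => - L) = fun=> 0.
      by apply/funext => y; apply: is_pd_val; exact: is_derive_cst.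
    rewrite /laplacian !h.
    have h' v : pd v (fun _ : C => 0 : R) = fun=> 0.
      by apply/funext => y; apply: is_pd_val; exact: is_derive_cst.
    by rewrite !h' addr0.
  by rewrite addr0; ring.
have F0 eps : 0 < eps -> exists B, forall w, B < cmod w -> `|F w| <= eps.
  move=> eps0; have e20 : 0 < eps / 2 by rewrite divr_gt0.
  have ch : {for (0 : C), continuous (fun z => ln (h1 (sigma z)))}.
    apply: continuous_comp; first exact: metric1_continuous hm hsigma (ball0_0 d0).
    exact: continuous_ln.
  have [d1 d10 hd1] := (continuous_eps _ _).1 ch _ e20.
  pose rho := Num.min d d1; have rho0 : 0 < rho by rewrite lt_min d0.
  have k0 : 0 <= 2 * `|kappa| / eps by rewrite divr_ge0 ?mulr_ge0// ltW.
  have rn0 : 0 < rho ^- n by rewrite invr_gt0 exprn_gt0.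
  (* The first term puts [z] where [ln (h1 (sigma z))] is within [eps / 2] of its value at [0]; the
     other two give [|kappa| / |w|^2 <= eps / 2]. *)
  exists (rho ^- n + 1 + 2 * `|kappa| / eps) => w wB.
  have [rw w1 kw] := sum3_bounds (ltW rn0) k0 wB.
  have cw0 : 0 < cmod w by exact: lt_le_trans ltr01 w1.
  have w0 : w != 0 by rewrite -cmod_gt0.
  have a0 : 0 < absq w by rewrite absqE exprn_gt0.
  have [z [z0 zw zn]] := inv_root n_gt0 w0.
  have zr : cmod z < rho.
    rewrite -(@ltr_pXn2r _ n)// ?nnegrE ?cmod_ge0 ?(ltW rho0)// zn.
    by rewrite -[ltRHS]invrK ltf_pV2// posrE.
  have zd : ball0 d z by rewrite /ball0 /= (lt_le_trans zr)// ge_min lexx.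
  have az0 : 0 < absq z by rewrite absqE exprn_gt0// cmod_gt0.
  have h1E : h1 (sigma z) = absq (z ^ p) * h2 (s w).
    rewrite -h2glue; last by rewrite (holo_section_proj hsigma zd).
    by rewrite glueE// h2act ?character_zpow ?zw//; exact: torus_zpow.
  have lnw : ln (absq w) = - n%:R * ln (absq z).
    by rewrite -zw exprnN ln_absqXz// mulrNz.
  (* The orbifold chart enters here: since [|w| = |z|^-n], the factor [|z^p|^2] coming from the
     gluing contributes [p / n] times [ln (absq w)]. *)
  have phiE : phi w = ln (h1 (sigma z)) + kappa * ln (absq w).
    have azp : 0 < absq (z ^ p) by rewrite absqE exprn_gt0// cmod_gt0 expfz_neq0.
    by rewrite h1E lnM ?posrE// (ln_absqXz p z0) lnw /kappa /phi; field.
  have lnE : ln (1 + absq w) = ln (absq w) + ln (1 + (absq w)^-1).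
    have E : absq w * (1 + (absq w)^-1) = 1 + absq w by rewrite mulrDr mulr1 divff ?lt0r_neq0// addrC.
    by rewrite -E lnM ?posrE// addr_gt0 ?invr_gt0.
  have ln1 : 0 <= ln (1 + (absq w)^-1) <= (absq w)^-1.
    have a1 : 0 < (absq w)^-1 by rewrite invr_gt0.
    by rewrite le_ln1Dx ?ln_ge0// ?lerDl ?ltW// (lt_trans _ a1)// ltrN10.
  have kb : `|kappa| * (absq w)^-1 <= eps / 2 by rewrite absqE; exact: inv_square_bound.
  have := hd1 z; rewrite subr0 => /(_ (lt_le_trans zr _)); rewrite ge_min lexx orbT => /(_ isT) hz.
  have -> : F w = (ln (h1 (sigma z)) - L) - kappa * ln (1 + (absq w)^-1).
    by rewrite /F phiE lnE; ring.
  rewrite [leRHS]splitr.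
  apply: le_trans (ler_normB _ _) _; apply: lerD; first exact: ltW.
  rewrite normrM; apply: le_trans kb; apply: ler_wpM2l => //.
  by have /andP[? ?] := ln1; rewrite ger0_norm.
have iF : mu2.-integrable setT (fun q => (laplacian F (cplx q))%:E).
  have h := integrableD measurableT (integrableZl measurableT (- 4 * pi) ic1)
    (integrableZl measurableT (- 4 * kappa) kernel_integrable).
  apply: eq_integrable h => // q _.
  by rewrite lapE -!EFinM -EFinD; congr EFin; ring.
have := laplacian_integral0 cF iF F0.
rewrite (eq_integral (fun q : RR => (- 4 * pi)%:E * (c1 (cplx q))%:E + (- 4 * kappa)%:E * ((1 + absq (cplx q)) ^- 2)%:E)%E); last first.
  by move=> q _; rewrite lapE -!EFinM -EFinD; congr EFin; ring.
rewrite (@integralD _ _ R mu2 _ measurableT); last 2 first.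
- exact: integrableZl.
- exact: (integrableZl measurableT (- 4 * kappa) kernel_integrable).
rewrite (@integralZl _ _ R mu2 _ measurableT) // (@integralZl _ _ R mu2 _ measurableT) //; last exact: kernel_integrable.
rewrite plane_kernel.
rewrite /integral_over preimage_setT /Rintegral.
have /fineK <- : (\int[mu2]_q (c1 (cplx q))%:E)%E \is a fin_num by exact: integrable_fin_num.
rewrite -!EFinM -EFinD => -[]; move: (fine _) => I0 h.
have : 4 * pi * (I0 + kappa) = 0 by lra.
move=> /eqP; rewrite mulf_eq0 mulf_eq0 pnatr_eq0 (negbTE pi0) /= => /eqP h'.
by rewrite mulNr; apply/eqP; rewrite -addr_eq0; apply/eqP.
Qed.

Lemma frame_has_degree (deg : 'rV[R]_r) a : has_degree P deg -> deg 0 a = - (e 0 a)%:~R / n%:R.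
Proof.
move=> /(_ (delta_mx 0 a))/frame_degree; rewrite /pairing.
rewrite (bigD1 a)//= big1 => [|b ba]; last by rewrite mxE eqxx (negbTE ba) mul0r.
have -> : \sum_b e 0 b * (delta_mx 0 a : 'rV[int]_r) 0 b = e 0 a.
  by rewrite (bigD1 a)//= big1 => [|b ba]; rewrite mxE ?eqxx ?(negbTE ba) ?mulr0// mulr1 addr0.
by rewrite mxE !eqxx mul1r addr0.
Qed.

End Degree.

(** * From gauged maps to polynomials *)

Section Polynomials.
Variable R : realType.
Local Notation C := (Cplx R).
Implicit Types (z w : C) (u p q : {poly R[i]}).

Lemma poly_ext p q : (forall z : C, p.[z] = q.[z]) -> p = q.
Proof.
move=> pq; apply/eqP; rewrite -subr_eq0; apply: contraT => d0.
have [d d1 h] := poly_zeros_isolated (0 : C) d0.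
have := h (d / 2)%:C; rewrite subr0 cmod_real ger0_norm ?divr_ge0 ?ltW//.
rewrite hornerD hornerN pq subrr eqxx; apply=> //; last by lra.
by rewrite (_ : (0 : C) = (0 : R)%:C)// (inj_eq (@complexI R)) mulf_neq0 ?gt_eqF.
Qed.

(** As [h] has no zeros, every root of [p] is one of [q]; a common linear factor is cancelled,
    continuity extending the relation to the root. Once [p] is constant, [q] has no roots either. *)
Lemma horner_ratio_cst (h : C -> C) p q : p != 0 -> q != 0 -> (forall z, ccont setT h z) ->
  (forall z, h z != 0) -> (forall z, q.[z] = h z * p.[z]) -> exists2 c : R[i], c != 0 & forall z, h z = c.
Proof.
move=> p0 q0 ch h0; have [N sp] := ubnP (size p); elim: N => // N IH in p q p0 q0 sp *.
move=> qE; have [p1|p1] := boolP (size p == 1%N).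
  have q1 : size q = 1%N.
    apply/eqP; apply: contraT => /closed_rootP[x /rootP qx].
    have /size_poly1P[c c0 pc] := p1; move: qx; rewrite qE pc hornerC => /eqP.
    by rewrite mulf_eq0 (negbTE (h0 x)) (negbTE c0).
  have /size_poly1P[c c0 pc] := p1; move/eqP: q1 => /size_poly1P[c' c'0 qc].
  exists (c' / c); first by rewrite mulf_neq0// invr_eq0.
  by move=> z; have := qE z; rewrite pc qc !hornerC => ->; rewrite mulfK.
have /closed_rootP[x /[dup] px /factor_theorem[p2 pE]] := p1.
have : root q x by apply/rootP; rewrite qE (rootP px) mulr0.
move=> /factor_theorem[q2 qE2].
have p20 : p2 != 0 by apply: contra_neq p0 => p20; rewrite pE p20 mul0r.
have q20 : q2 != 0 by apply: contra_neq q0 => q20; rewrite qE2 q20 mul0r.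
apply: (IH p2 q2) => //.
  by move: sp; rewrite pE size_mul ?polyXsubC_eq0// size_XsubC addn2.
have off z : z != x -> q2.[z] = h z * p2.[z].
  move=> zx; have := qE z; rewrite pE qE2 !hornerM !hornerXsubC mulrA; apply: mulIf.
  by rewrite subr_eq0.
move=> z; have [->|/off//] := eqVneq z x.
apply: (@ccont_punctured_eq R (fun z => q2.[z]) (fun z => h z * p2.[z]) x 1 ltr01).
- exact: (holo_ccont (holo_poly q2) (I : [set: C] x)).
- by apply: ccontM; [exact: ch|exact: (holo_ccont (holo_poly p2) (I : [set: C] x))].
- by move=> w wx _; exact: off.
Qed.

Lemma order0_bounded_ge0 (f : C -> C) k (K d : R) : 0 < d ->
  (forall z, cmod z < d -> z != 0 -> cmod (f z) <= K) -> order0 f k -> 0 <= k.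
Proof.
move=> d0 fK [d' [b [d'0 hb b0 fb]]]; rewrite leNgt; apply/negP => k0.
have [d2 d20 hd2] := ccont_bound0 (holo_ccont hb (ball0_0 d'0)) (b0 0 (ball0_0 d'0)).
pose B := cmod (b 0) / 2; have B0 : 0 < B by rewrite divr_gt0// cmod_gt0 b0//; exact: ball0_0.
(* A point of the real axis so close to [0] that [B / x], a lower bound of [|f x|] when [k < 0],
   exceeds [K]. *)
pose x : R := Num.min (Num.min (Num.min d d') (Num.min d2 1)) (B / (`|K| + 1)) / 2.
have K0 : 0 < `|K| + 1 by rewrite ltr_wpDl.
have m0 : 0 < Num.min (Num.min (Num.min d d') (Num.min d2 1)) (B / (`|K| + 1)).
  by rewrite !lt_min d0 d'0 d20 ltr01 divr_gt0.
have x0 : 0 < x by rewrite divr_gt0.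
have xm : x < Num.min (Num.min (Num.min d d') (Num.min d2 1)) (B / (`|K| + 1)).
  by rewrite /x; lra.
move: xm; rewrite !lt_min => /andP[/andP[/andP[xd xd'] /andP[xd2 x1]] xB].
have cx : cmod x%:C = x by rewrite cmod_real gtr0_norm.
have xC0 : (x%:C : C) != 0 by rewrite -cmod_gt0 cx.
have := fK x%:C; rewrite cx => /(_ xd xC0).
rewrite fb//; last by rewrite /ball0 /= cx.
rewrite cmodM cmodXz cx => h.
have := hd2 x%:C I; rewrite subr0 cx => /(_ xd2) hB.
have hx : x^-1 <= x ^ k.
  move: (k) k0 => [//|m _]; rewrite NegzE -exprnN lef_pV2 ?posrE ?exprn_gt0//.
  by rewrite exprS ler_piMr ?(ltW x0)// exprn_ile1 ?ltW.
have : x^-1 * B <= K by apply: le_trans h; apply: ler_pM => //; rewrite ?invr_ge0 ?(ltW x0) ?(ltW B0) ?(ltW hB).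
rewrite ler_pdivrMl// => hh.
move: xB; rewrite ltr_pdivlMr// => xB.
have := ler_norm K; have := normr_ge0 K; nra.
Qed.

(* z^N u(z^-n), provided that [n * deg u <= N]. *)
Definition revpoly (N : int) (n : nat) u : {poly R[i]} :=
  \sum_(i < size u) (u`_i)%:P * 'X^(`|N - (n * i)%:Z|)%N.

Lemma revpoly_inv (N : int) n u z : u = 0 \/ (n * (size u).-1)%:Z <= N -> z != 0 ->
  (revpoly N n u).[z] = z ^ N * u.[z ^- n].
Proof.
move=> [->|uN] z0; first by rewrite /revpoly size_poly0 big_ord0 !horner0 mulr0.
rewrite /revpoly horner_sum horner_coef mulr_sumr; apply: eq_bigr => i _.
rewrite hornerM hornerC hornerXn.
have iN : (n * i)%:Z <= N.
  apply: le_trans uN; rewrite lez_nat leq_mul2l -ltnS (leq_trans (ltn_ord i)) ?orbT//.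
  exact: leqSpred.
transitivity (u`_i * z ^ (N - (n * i)%:Z)).
  by rewrite -{2}(gez0_abs (_ : 0 <= N - (n * i)%:Z))// subr_ge0.
rewrite expfzDr// -exprnN exprM -exprVn mulrCA; congr (_ * (_ * _)).
Qed.

(** At [0] only the term of exponent [N - n i = 0] survives; it exists only if [N] is a nonnegative
    multiple of [n]. *)
Lemma revpoly0 (N : int) n u : (0 < n)%N -> u = 0 \/ (n * (size u).-1)%:Z <= N ->
  (revpoly N n u).[0] = if (0 <= N) && (n %| `|N|)%N then u`_(`|N| %/ n) else 0.
Proof.
move=> n0 uN; rewrite /revpoly horner_sum.
case: ifP => [/andP[N0 nN]|nN]; last first.
  rewrite big1// => i _; rewrite hornerM hornerXn expr0n absz_eq0 subr_eq0.
  case: eqP => [NE|_]; last by rewrite mulr0.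
  by move: nN; rewrite NE /= dvdn_mulr.
have NE : N = (n * (`|N| %/ n))%:Z by rewrite mulnC divnK// gez0_abs.
have [ui|ui] := ltnP (`|N| %/ n) (size u); last first.
  rewrite nth_default// big1// => i _; rewrite hornerM hornerXn expr0n absz_eq0 subr_eq0 NE.
  rewrite eqz_nat eqn_pmul2l// eq_sym (ltn_eqF (leq_trans (ltn_ord i) ui)) ?mulr0//.
rewrite (bigD1 (Ordinal ui))//= big1 => [|i ine].
  by rewrite addr0 hornerM hornerC hornerXn -NE subrr expr0 mulr1.
rewrite hornerM hornerXn expr0n absz_eq0 subr_eq0 NE eqz_nat eqn_pmul2l// eq_sym.
by rewrite (_ : _ == _ = false) ?mulr0//; exact: negbTE ine.
Qed.

Variables (r k n : nat) (nu : 'M[int]_(k, r)).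

Lemma value_at_infinityE (d : 'rV[R]_r) (u : 'I_k -> {poly R[i]}) (N : int) j : (0 < n)%N ->
  N%:~R = n%:R * pairing (row j nu) d -> u j = 0 \/ (n * (size (u j)).-1)%:Z <= N ->
  value_at_infinity nu d u 0 j = (revpoly N n (u j)).[0].
Proof.
move=> n0 NE uN; rewrite revpoly0// mxE.
set dl := pairing _ _ in NE *.
have nR : (n%:R : R) != 0 by rewrite pnatr_eq0 -lt0n.
have [/natrP[l dE]|nat_d] := boolP (dl \is a Num.nat).
  have N' : N = (n * l)%:Z by apply/eqP; rewrite -(eqr_int R) NE dE -natrM.
  by rewrite N' /= dvdn_mulr//= mulKn// dE natr_nat natrK.
rewrite /= (negbTE nat_d); case: ifP => // /andP[N0 /dvdnP[l lE]]; case/negP: nat_d.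
have -> : dl = l%:R; last exact: natr_nat.
by apply: (mulfI nR); rewrite -NE -(gez0_abs N0) lE -pmulrn natrM mulrC.
Qed.

End Polynomials.

(** * The polynomials of a stable gauged map *)

Section Classification.
Variables (R : realType) (r k n : nat) (nu : 'M[int]_(k, r)) (Phi : 'rV[Cplx R]_k -> 'rV[R]_r).
Local Notation C := (Cplx R).
Implicit Types (z w : C) (V W : set C) (m : gauged_map R n nu).
Hypothesis n_gt0 : (0 < n)%N.
Hypothesis fin : forall x, Xss nu Phi x -> finite_set (stabilizer nu x).

(* In terms of the frames [s] over U_2 and [sigma] near infinity, the bundle is
   glued by the cocharacter z^e. *)
Definition normal m (s : C -> ob2 m) (e : 'rV[int]_r) (d : R) (sigma : C -> ob1 m) :=
  [/\ 0 < d, holo_section setT s, holo_section (ball0 d) sigma &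
    forall z, ball0 d z -> z != 0 -> oglue (sigma z) = pact (zpow e z) (s (z ^- n))].

Definition expresses m (s : C -> ob2 m) (u : 'I_k -> {poly R[i]}) :=
  forall z j, gsec2 (s z) 0 j = (u j).[z].

Lemma expressed_byP m (u : 'I_k -> {poly R[i]}) : expressed_by m u <->
  exists2 s, holo_section setT s & expresses (m := m) s u.
Proof.
split=> [[s [hs sE]]|[s hs sE]]; exists s => //; first by move=> z j; rewrite sE mxE.
by split=> // z; apply/rowP => j; rewrite sE mxE.
Qed.

Lemma stable_basis m : stable Phi m -> exists (V0 : set C) (s0 : C -> ob1 m) (J : 'I_r -> 'I_k),
  [/\ plsec V0 s0, V0 0, forall i, gsec1 (s0 0) 0 (J i) != 0 & \det (\matrix_(i, a) nu (J i) a) != 0].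
Proof.
move=> st; have [V0 [s0 [V0s V00]]] := plsec_cover (ob1 m) 0.
have /fin/weights_basis[J [J0 M0]] := st (s0 0) (plsec_proj V0s V00).
by exists V0, s0, J.
Qed.

Lemma stable_frame m : stable Phi m -> exists s e d sigma, @normal m s e d sigma.
Proof.
move=> /stable_basis[V0 [s0 [J [V0s V00 J0 M0]]]].
have [q [s [q0 hs sq]]] := global_section n_gt0 V0s V00 J0 M0.
have [e [d [sigma [d0 hsigma glueE]]]] := normal_frame n_gt0 V0s V00 J0 M0 q0 hs sq.
by exists s, e, d, sigma.
Qed.

(** A zero polynomial would give zeros of arbitrarily large modulus, against [gsec2_bounded]. *)
Lemma expressed_neq0 m V0 (s0 : C -> ob1 m) (J : 'I_r -> 'I_k) (s : C -> ob2 m) (u : 'I_k -> {poly R[i]}) i :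
  plsec V0 s0 -> V0 0 -> (forall i, gsec1 (s0 0) 0 (J i) != 0) ->
  holo_section setT s -> expresses s u -> u (J i) != 0.
Proof.
move=> V0s V00 J0 hs su; apply/eqP => u0; have [B HB] := gsec2_bounded n_gt0 V0s V00 J0 i.
pose w : C := (`|B| + 1)%:C.
have := HB (s w); rewrite su u0 horner0 (holo_section_proj hs I) => /(_ erefl).
rewrite cmod_real ger0_norm ?addr_ge0//; have := ler_norm B; lra.
Qed.

(** Any frame over the affine chart in which the section is polynomial has a normal form at
    infinity, since [u_J] can play the role of [q]. Hence the gluing exponent can be read off in a
    given expression. *)
Lemma expressed_frame m s (u : 'I_k -> {poly R[i]}) : stable Phi m -> holo_section setT s -> expresses (m := m) s u ->
  exists e d sigma, @normal m s e d sigma.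
Proof.
move=> /stable_basis[V0 [s0 [J [V0s V00 J0 M0]]]] hs su.
have u0 i := expressed_neq0 i V0s V00 J0 hs su.
have [e [d [sigma [d0 hsigma glueE]]]] := normal_frame n_gt0 V0s V00 J0 M0 u0 hs (fun z i => su z (J i)).
by exists e, d, sigma.
Qed.

Section Frame.
Variables (m : gauged_map R n nu) (s : C -> ob2 m) (e : 'rV[int]_r) (d : R) (sigma : C -> ob1 m).
Hypothesis nm : normal s e d sigma.

(** The exponent [N] of the overview for the [j]-th weight; by [weight_orderE] it is [n] times the
    pairing of this weight with the degree. *)
Definition weight_order j : int := - \sum_a e 0 a * row j nu 0 a.

Lemma normal_gsec1 z j : ball0 d z -> z != 0 ->
  gsec1 (sigma z) 0 j = z ^ weight_order j * gsec2 (s (z ^- n)) 0 j.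
Proof.
move=> zd z0; have [d0 hs hsigma glueE] := nm.
rewrite -gsec_glue; last by rewrite (holo_section_proj hsigma zd).
rewrite glueE// gsec2_act; last exact: torus_zpow.
by rewrite tactE characterV character_zpow// /weight_order invr_expz.
Qed.

Lemma weight_orderE (deg : 'rV[R]_r) j : has_degree m deg ->
  (weight_order j)%:~R = n%:R * pairing (row j nu) deg.
Proof.
move=> hd; have [d0 hs hsigma glueE] := nm.
rewrite (frame_degree n_gt0 d0 hs hsigma glueE (hd (row j nu))) /weight_order rmorphN mulrC divfK//.
by rewrite pnatr_eq0 -lt0n.
Qed.

Lemma normal_rescale (t0 : 'rV[C]_r) : torus t0 ->
  normal (fun z => pact t0 (s z)) e d (fun z => pact t0 (sigma z)).
Proof.
move=> t00; have [d0 hs hsigma glueE] := nm; split=> //.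
- by apply: holo_section_act => //; exact: holo_torus_cst.
- by apply: holo_section_act => //; exact: holo_torus_cst.
move=> z zd z0; have tz := torus_zpow e z0.
rewrite oglue_act//; last by rewrite (holo_section_proj hsigma zd).
by rewrite glueE// !pactM// tmulC.
Qed.

Lemma gsec1_bounded j : exists (d' K : R), [/\ 0 < d', d' <= 1, d' <= d &
  forall z, cmod z < d' -> cmod (gsec1 (sigma z) 0 j) <= K].
Proof.
have [d0 hs hsigma glueE] := nm.
have hg := gsec1_holo_section j hsigma.
have [d' d'0 hd'] := holo_ccont hg (ball0_0 d0) ltr01.
exists (Num.min d' (Num.min 1 d)), (cmod (gsec1 (sigma 0) 0 j) + 1); split.
- by rewrite !lt_min d'0 ltr01.
- by rewrite !ge_min lexx orbT.
- by rewrite !ge_min lexx !orbT.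
move=> z; rewrite lt_min => /andP[zd _]; have := hd' z I; rewrite subr0 => /(_ zd) h.
have := cmodD (gsec1 (sigma z) 0 j - gsec1 (sigma 0) 0 j) (gsec1 (sigma 0) 0 j).
rewrite subrK; lra.
Qed.

Lemma le_of_sqr (c M : R) : 0 <= c -> c ^+ 2 <= M -> c <= 1 + `|M|.
Proof. by move=> c0 cM; have := ler_norm M; nra. Qed.

(** For large [w = z^-n] the coordinate is [z^-N] times a function bounded near infinity, and
    [|z|^-1 <= 1 + |w|]; for small [w] it is bounded by compactness. The growth is thus
    polynomial. *)
Lemma frame_polynomial j : exists u : {poly R[i]}, forall w, gsec2 (s w) 0 j = u.[w].
Proof.
have [d0 hs hsigma glueE] := nm.
have [d' [K [d'0 d'1 d'd hK]]] := gsec1_bounded j.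
have hf : holo setT (fun w => gsec2 (s w) 0 j) := gsec2_holo_section j hs.
pose B := d' ^- n.
have B0 : 0 < B by rewrite invr_gt0 exprn_gt0.
have B1 : 1 <= B by rewrite invf_ge1 ?exprn_gt0// exprn_ile1// ltW.
have [M HM] := Ck0_bounded B (@Ck_absq R 0 setT _ openT hf).
pose N := `|weight_order j|%N.
apply: (@liouville_poly R _ (Num.max (`|K|) (1 + `|M|)) N hf) => w.
have w1 : 1 <= 1 + cmod w by rewrite lerDl cmod_ge0.
have wN : 1 <= (1 + cmod w) ^+ N by exact: exprn_ege1.
have [wB|wB] := leP (cmod w) B.
  have wsq : sq B (complex.Re w, complex.Im w).
    exact: sq_cmod.
  have := HM _ wsq; rewrite /cplx /= (_ : _ +i* _ = w); last by case: (w).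
  rewrite absqE => h; set c := cmod (gsec2 _ _ _) in h *.
  have c0 : 0 <= c := cmod_ge0 _.
  apply: (@le_trans _ _ (1 + `|M|)); first by move: h; rewrite ger0_norm ?sqr_ge0//; exact: le_of_sqr c0.
  apply: (@le_trans _ _ (Num.max `|K| (1 + `|M|))); first by rewrite le_max lexx orbT.
  by rewrite ler_peMr// le_max normr_ge0.
have w0 : w != 0 by rewrite -cmod_gt0 (lt_trans B0).
have [z [z0 zw zn]] := inv_root n_gt0 w0.
have zd' : cmod z < d'.
  rewrite -(@ltr_pXn2r _ n)// ?nnegrE ?cmod_ge0 ?(ltW d'0)// zn.
  by rewrite -[ltRHS]invrK ltf_pV2// posrE (lt_trans B0).
have zd : ball0 d z := lt_le_trans zd' d'd.
have cz0 : 0 < cmod z by rewrite cmod_gt0.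
have E : gsec2 (s w) 0 j = z ^ (- weight_order j) * gsec1 (sigma z) 0 j.
  by rewrite normal_gsec1// zw mulrA -expfzDr// addNr expr0z mul1r.
rewrite E cmodM cmodXz mulrC; apply: ler_pM; rewrite ?cmod_ge0 ?exprz_ge0 ?cmod_ge0//.
  by rewrite (le_trans (hK z zd'))// le_max ler_norm.
have zw' : (cmod z)^-1 <= 1 + cmod w.
  have -> : cmod w = (cmod z)^-1 ^+ n by rewrite exprVn zn invrK.
  have zi1 : 1 <= (cmod z)^-1 by rewrite invf_ge1// (le_trans (ltW zd')).
  have : (cmod z)^-1 <= (cmod z)^-1 ^+ n by case: (n) n_gt0 => // n' _; rewrite exprS ler_peMr ?invr_ge0 ?cmod_ge0// exprn_ege1.
  by move=> h; rewrite (le_trans h)// lerDr.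
rewrite /N; case: (weight_order j) => p.
  rewrite -exprnN -exprVn /=; apply: lerXn2r => //; by rewrite nnegrE ?invr_ge0 ?cmod_ge0// addr_ge0 ?cmod_ge0.
rewrite NegzE opprK /=; apply: (@le_trans _ _ 1); last exact: exprn_ege1.
by apply: exprn_ile1; rewrite ?cmod_ge0// ltW// (lt_le_trans zd').
Qed.

Variable u : 'I_k -> {poly R[i]}.
Hypothesis su : expresses s u.

(** Near infinity the coordinate has order [N - n deg u_j], which cannot be negative because the
    coordinate extends to infinity and is bounded there. *)
Lemma frame_degree_bound j : u j = 0 \/ (n * (size (u j)).-1)%:Z <= weight_order j.
Proof.
have [->|uj] := eqVneq (u j) 0; [by left|right].
have [d0 hs hsigma glueE] := nm.
have [d' [K [d'0 d'1 d'd hK]]] := gsec1_bounded j.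
rewrite -subr_ge0; apply: (@order0_bounded_ge0 R (fun z => gsec1 (sigma z) 0 j) _ K d' d'0).
  by move=> z zd _; exact: hK.
have h1 := order0_poly_inv uj n_gt0.
have h2 : order0 (fun z : C => z ^ weight_order j) (weight_order j).
  exists 1, (fun=> 1); split=> //; first exact: holo_cst.
  - by move=> z _ _; rewrite mulr1.
apply: (order0_near d'0 _ (order0M h2 h1)) => z zd z0.
by rewrite normal_gsec1 ?su//; exact: lt_le_trans d'd.
Qed.

Lemma frame_revpoly z j : ball0 d z -> gsec1 (sigma z) 0 j = (revpoly (weight_order j) n (u j)).[z].
Proof.
have [d0 hs hsigma glueE] := nm.
have off y : ball0 d y -> y != 0 -> gsec1 (sigma y) 0 j = (revpoly (weight_order j) n (u j)).[y].
  by move=> yd y0; rewrite normal_gsec1// su revpoly_inv//; exact: frame_degree_bound.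
have [->|z0] := eqVneq z 0; last by move=> zd; exact: off.
move=> zd; apply: (@ccont_punctured_eq R (fun z => gsec1 (sigma z) 0 j) (fun z => (revpoly (weight_order j) n (u j)).[z]) 0 d d0).
- exact: holo_ccont (gsec1_holo_section j hsigma) zd.
- exact: (holo_ccont (holo_poly (revpoly (weight_order j) n (u j))) (I : [set: C] 0)).
- by move=> y y0; rewrite subr0 => yd; exact: off.
Qed.

Lemma frame_value (deg : 'rV[R]_r) : has_degree m deg -> value_at_infinity nu deg u = gsec1 (sigma 0).
Proof.
move=> hd; have [d0 _ _ _] := nm; apply/rowP => j.
rewrite frame_revpoly; last exact: ball0_0.
exact: value_at_infinityE n_gt0 (weight_orderE j hd) (frame_degree_bound j).
Qed.

Lemma frame_polynomial_data (deg : 'rV[R]_r) : stable Phi m -> has_degree m deg -> polynomial_data nu Phi deg u.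
Proof.
move=> st hd; have [d0 _ hsigma _] := nm; split.
  move=> j uj; have [u0|] := frame_degree_bound j; first by rewrite u0 eqxx in uj.
  rewrite -(ler_int R) (weight_orderE j hd) -pmulrn natrM ler_pM2l// ltr0n//.
rewrite frame_value//; apply: st; exact: holo_section_proj hsigma (ball0_0 d0).
Qed.

End Frame.

Lemma stable_polynomial m (deg : 'rV[R]_r) : stable Phi m -> has_degree m deg ->
  exists u, polynomial_data nu Phi deg u /\ expressed_by m u.
Proof.
move=> st hd; have [s [e [d [sigma nm]]]] := stable_frame st.
have [u su] := choice (frame_polynomial nm).
have su' : expresses s u by move=> z j; exact: su.
exists u; split; first exact: (frame_polynomial_data nm su' st hd).
by apply/expressed_byP; exists s => //; have [] := nm.
Qed.

End Classification.

(** * Isomorphisms of gauged maps *)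

Section Isomorphisms.
Variables (R : realType) (r k n : nat) (nu : 'M[int]_(k, r)) (Phi : 'rV[Cplx R]_k -> 'rV[R]_r).
Local Notation C := (Cplx R).
Implicit Types (z w : C) (V W : set C) (m : gauged_map R n nu).
Hypothesis n_gt0 : (0 < n)%N.
Hypothesis fin : forall x, Xss nu Phi x -> finite_set (stabilizer nu x).

Lemma holo_section_map (E E' : pbundle R r) (F : E -> E') V (s : C -> E) :
  (forall t x, torus t -> F (pact t x) = pact t (F x)) ->
  (forall W t, plsec W t -> holo_section W (F \o t)) ->
  holo_section V s -> holo_section V (F \o s).
Proof.
move=> Fact Fh [oV sp sh]; apply: holo_section_local => // z Vz.
have [W [t [Wt Wz]]] := plsec_cover E z; have [g [hg gE]] := sh W t Wt.
have [d d0 dVW] := ball_sub_open (openI oV (plsec_open Wt)) (conj Vz Wz).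
exists d, (fun y => pact (g y) ((F \o t) y)); split=> // [|y /dVW yVW].
  apply: holo_section_act; last exact: holo_torus_sub hg.
  by apply: holo_section_sub (Fh W t Wt) => [|y /dVW[]//]; exact: open_cball.
by rewrite /= gE// Fact//; exact: hg.1.
Qed.

Lemma iso_poly_equiv m m' (u u' : 'I_k -> {poly R[i]}) : stable Phi m -> stable Phi m' ->
  expressed_by m u -> expressed_by m' u' -> gauged_iso m m' -> poly_equiv nu u u'.
Proof.
move=> st st' /expressed_byP[s hs su] /expressed_byP[s' hs' su'].
move=> [f1 [f2 [_ [_ f2act] [_ f2h] _ [_ f2gsec]]]].
pose v := f2 \o s.
have hv : holo_section setT v by exact: holo_section_map f2act f2h hs.
have vu : expresses v u by move=> z j; rewrite /v /= f2gsec su.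
have [V0 [s0 [J [V0s V00 J0 M0]]]] := stable_basis fin st'.
have uJ i := expressed_neq0 n_gt0 i V0s V00 J0 hv vu.
have u'J i := expressed_neq0 n_gt0 i V0s V00 J0 hs' su'.
have [htau tauE] := holo_section_diff hv hs'; rewrite setTI in htau tauE.
pose tau z := tdiv (s' z) (v z); rewrite -/tau in htau tauE.
have ratio z j : (u' j).[z] = character (row j nu) (tau z) * (u j).[z].
  have tz : torus (tau z) by exact: htau.1.
  by rewrite -su' -vu (gsec2_tinv _ tz) tactE tauE.
pose t0 := tau 0; have t00 : torus t0 by exact: htau.1.
have t0J i z : character (row (J i) nu) t0 = character (row (J i) nu) (tau z).
  have [z'|z'|c _ hc] := @horner_ratio_cst R (fun z => character (row (J i) nu) (tau z)) _ _ (uJ i) (u'J i) _ _ (fun z => ratio z (J i)).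
  - exact: holo_ccont (holo_character _ htau) I.
  - by apply: character_neq0; exact: htau.1.
  - by rewrite /t0 !hc.
have hs'' : holo_section setT (fun z => pact t0 (s' z)).
  by apply: (holo_section_act hs'); exact: holo_torus_cst.
(* So far only the [nu_J]-characters of [tau] are constant. After the correction by [t0] both
   sections are adapted to the same polynomials, and [adapted_diff] makes their quotient
   constant. *)
have ad1 : adapted (@gsec2 _ _ _ _ _ m') J (fun i => u (J i)) setT v by split=> // z _ i; rewrite vu.
have ad2 : adapted (@gsec2 _ _ _ _ _ m') J (fun i => u (J i)) setT (fun z => pact t0 (s' z)).
  split=> // z _ i; apply: (mulfI (character_neq0 (row (J i) nu) t00)).
  by rewrite (t0J i z) -ratio -su' (gsec2_tinv (s' z) t00) tactE (t0J i z).
have [|c [c0 _ cE]] := adapted_diff (@gsec2_act _ _ _ _ _ m') M0 uJ ad1 ad2.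
  by move=> p q t _ _ _.
have ct : torus (tmul c t0) by exact: torus_tmul.
exists (tmul c t0); split=> // j; apply: poly_ext => z.
rewrite hornerZ -su' -vu (gsec2_tinv (s' z) ct) tactE; congr (_ * gsec2 _ _ _).
by rewrite -pactM// -cE.
Qed.

Lemma zetaX_n : (0 < n)%N -> zeta R n ^+ n = 1.
Proof.
move=> n0; pose a : R := 2 * pi / n%:R.
have E l : zeta R n ^+ l = cos (l%:R * a) +i* sin (l%:R * a) :> C.
  elim: l => [|l IH]; first by rewrite expr0 mul0r cos0 sin0.
  have -> : l.+1%:R * a = l%:R * a + a by rewrite -addn1 natrD mulrDl mul1r.
  rewrite exprSr IH cosD sinD /zeta -/a.
  by apply/eqP; rewrite eq_complex /=; apply/andP; split; apply/eqP; ring.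
rewrite E; have -> : n%:R * a = pi *+ 2 :> R.
  by rewrite /a mulrC divfK ?pnatr_eq0 -?lt0n// mulr_natl.
by rewrite cos2pi sin2pi.
Qed.

Lemma zeta_neq0 : zeta R n != 0.
Proof. by have := zetaX_n n_gt0; apply: contra_eq_neq => ->; rewrite expr0n gtn_eqF// eq_sym oner_eq0. Qed.

Lemma cmod_zeta : cmod (zeta R n)^-1 = 1.
Proof.
rewrite cmodV; apply: invr_inj; rewrite invrK invr1.
apply/eqP; rewrite -(@pexpr_eq1 _ _ n) ?cmod_ge0//.
by rewrite -cmodX zetaX_n// cmod1.
Qed.

Lemma zetaV_pow z : ((zeta R n)^-1 * z) ^- n = z ^- n.
Proof. by rewrite exprMn exprVn zetaX_n// invr1 mul1r. Qed.

Section OneFrame.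
Variables (m : gauged_map R n nu) (s : C -> ob2 m) (e : 'rV[int]_r) (d : R) (sigma : C -> ob1 m).
Hypothesis nm : normal s e d sigma.

Lemma normal_orot_holo : holo_section (ball0 d) (fun z => orot (sigma ((zeta R n)^-1 * z))).
Proof.
have [d0 hs hsigma glueE] := nm; set c := (zeta R n)^-1.
have cc y z : cmod (c * y - c * z) = cmod (y - z) by rewrite -mulrBr cmodM cmod_zeta mul1r.
have cB z : ball0 d z -> ball0 d (c * z) by rewrite /ball0 /= cmodM cmod_zeta mul1r.
apply: holo_section_local => [|z zd]; first exact: (@open_ball0 _ d).
have [W [t [Wt Wz]]] := plsec_cover (ob1 m) (c * z).
have [oB _ sh] := hsigma; have [g [hg gE]] := sh W t Wt.
have [d' d'0 hd'] := ball_sub_open (openI oB (plsec_open Wt)) (conj (cB z zd) Wz).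
have sub y : cmod (y - z) < d' -> (ball0 d `&` W) (c * y) by rewrite -cc => /hd'.
exists d', (fun y => pact (g (c * y)) (orot (t (c * y)))); split=> // [|y /sub yBW].
  apply: holo_section_act.
    by apply: holo_section_sub (orot_holo Wt) => [|y /sub[]//]; exact: open_cball.
  apply: (holo_torus_comp hg) => //.
  by apply: holoM; [exact: holo_cst|exact: holo_id].
by rewrite gE// orot_act//; exact: hg.1.
Qed.

(** The isotropy representation at infinity is determined by the gluing exponent: off [0] the action
    of the rotation on [sigma] is forced by its compatibility with the gluing, and continuity gives
    it at [0]. *)
Lemma normal_orot : orot (sigma 0) = pact (zpow e (zeta R n)^-1) (sigma 0).
Proof.
have [d0 hs hsigma glueE] := nm; set c := (zeta R n)^-1.
have c0 : c != 0 by rewrite invr_eq0 zeta_neq0.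
have B0 := ball0_0 d0.
have [] := holo_section_diff normal_orot_holo hsigma; rewrite setIid -/c.
pose h z := tdiv (sigma z) (orot (sigma (c * z))); rewrite -/h => hh hE.
have off z : ball0 d z -> z != 0 -> h z = zpow e c.
  move=> zd z0; have cz0 : c * z != 0 by rewrite mulf_neq0.
  have czd : ball0 d (c * z) by rewrite /ball0 /= cmodM cmod_zeta mul1r.
  have hz : torus (h z) by exact: hh.1.
  have tz := torus_zpow e z0; have tc := torus_zpow e c0.
  have := congr1 (@oglue _ _ _ m) (hE z zd).
  rewrite oglue_rot; last by rewrite (holo_section_proj hsigma czd).
  rewrite oglue_act//; last by rewrite (holo_section_proj hsigma zd).
  rewrite !glueE// zetaV_pow pactM// zpowM => /pact_inj E.
  have {}E := E (torus_tmul tc tz) (torus_tmul hz tz).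
  apply/rowP => a; move/rowP: E => /(_ a); rewrite [LHS]mxE [RHS]mxE => /(mulIf (tz a)).
  exact: esym.
have h0 : h 0 = zpow e c.
  apply/rowP => a; apply: (@ccont_punctured_eq R (fun z => h z 0 a) (fun=> zpow e c 0 a) 0 d d0).
  - by move/holo_torusP: hh => [_ /(_ a) H]; exact: holo_ccont H B0.
  - exact: ccont_cst.
  - by move=> y y0; rewrite subr0 => yd; rewrite off.
by have := hE 0 B0; rewrite -/(h 0) h0 mulr0.
Qed.

Lemma oglue_inj (y y' : ob1 m) : pproj y = pproj y' -> pproj y != 0 -> oglue y = oglue y' -> y = y'.
Proof.
move=> /pact_trans[t [t0 ->]] y0; rewrite oglue_act// => /esym/(pact_free t0) ->.
by rewrite pact1.
Qed.

End OneFrame.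

Section TwoFrames.
Variables (m m' : gauged_map R n nu) (s : C -> ob2 m) (s' : C -> ob2 m') (e : 'rV[int]_r) (d : R).
Variables (sigma : C -> ob1 m) (sigma' : C -> ob1 m').
Hypotheses (nm : normal s e d sigma) (nm' : normal s' e d sigma').
Variable u : 'I_k -> {poly R[i]}.
Hypotheses (su : expresses s u) (su' : expresses s' u).

Let hs : holo_section setT s. Proof. by have [] := nm. Qed.
Let hs' : holo_section setT s'. Proof. by have [] := nm'. Qed.
Let hsigma : holo_section (ball0 d) sigma. Proof. by have [] := nm. Qed.
Let hsigma' : holo_section (ball0 d) sigma'. Proof. by have [] := nm'. Qed.
Let d0 : 0 < d. Proof. by have [] := nm. Qed.
Let sp z : pproj (s z) = z. Proof. exact: holo_section_proj hs I. Qed.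
Let sp' z : pproj (s' z) = z. Proof. exact: holo_section_proj hs' I. Qed.
Let B0 := ball0_0 d0.
Let gp : pproj (sigma 0) = 0. Proof. exact: holo_section_proj hsigma B0. Qed.
Let gp' : pproj (sigma' 0) = 0. Proof. exact: holo_section_proj hsigma' B0. Qed.

Let f2 (x : ob2 m) : ob2 m' := pact (tdiv (s (pproj x)) x) (s' (pproj x)).

Let frame2 (x : ob2 m) : exists2 t, torus t & x = pact t (s (pproj x)).
Proof. by have [|h1 h2] := @tdivP _ _ _ (s (pproj x)) x; [rewrite sp|exists (tdiv (s (pproj x)) x)]. Qed.

Let f2E t z : torus t -> f2 (pact t (s z)) = pact t (s' z).
Proof. by move=> t0; rewrite /f2 pact_proj// sp tdiv_uniq. Qed.

Let f2_proj x : pproj (f2 x) = pproj x.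
Proof. by have [t t0 ->] := frame2 x; rewrite f2E// !pact_proj// sp sp'. Qed.

Let f2_act t x : torus t -> f2 (pact t x) = pact t (f2 x).
Proof.
move=> t0; have [t' t'0 ->] := frame2 x.
by rewrite pactM// !f2E// ?pactM//; exact: torus_tmul.
Qed.

Let f2_holo V t : @plsec _ _ (ob2 m) V t -> holo_section V (f2 \o t).
Proof.
move=> Vt; have oV := plsec_open Vt.
have [] := holo_section_diff (holo_section_plsec Vt) hs; rewrite setIT => hg gE.
have hs'V : holo_section V s' by exact: holo_section_sub hs'.
have [_ p h] := holo_section_act hs'V hg; apply: holo_section_local => // z Vz.
have [d' d'0 d'V] := ball_sub_open oV Vz.
exists d', (fun z => pact (tdiv (s z) (t z)) (s' z)); split=> // [|w /d'V Vw].
  by apply: holo_section_sub (holo_section_act hs'V hg) => //; exact: open_cball.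
by rewrite /= /f2 (plsec_proj Vt Vw).
Qed.

Let f2_gsec x : gsec2 (f2 x) = gsec2 x.
Proof.
have [t t0 ->] := frame2 x; rewrite f2E// !gsec2_act//; congr tact.
by apply/rowP => j; rewrite su su'.
Qed.

Let point_ex z : exists y : ob1 m', pproj y = z.
Proof. by have [V [t [Vt Vz]]] := plsec_cover (ob1 m') z; exists (t z); exact: plsec_proj Vt Vz. Qed.
Let y0 z := sval (cid (point_ex z)).
Let y0P z : pproj (y0 z) = z. Proof. exact: svalP (cid (point_ex z)). Qed.

(** Off [0] the map is [f2] transported through the two gluings, [y0] being an auxiliary point of
    the target fibre; over [0], where there is no gluing, it is defined by the frames. [f1_sigma]
    shows that the two branches fit together. *)
Let f1 (x : ob1 m) : ob1 m' :=
  if pproj x == 0 then pact (tdiv (sigma 0) x) (sigma' 0)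
  else pact (tdiv (oglue (y0 (pproj x))) (f2 (oglue x))) (y0 (pproj x)).

Let frame1 (x : ob1 m) : pproj x = 0 -> exists2 t, torus t & x = pact t (sigma 0).
Proof. by move=> x0; have [|h1 h2] := @tdivP _ _ _ (sigma 0) x; [rewrite gp|exists (tdiv (sigma 0) x)]. Qed.

Let f1E0 t : torus t -> f1 (pact t (sigma 0)) = pact t (sigma' 0).
Proof. by move=> t0; rewrite /f1 pact_proj// gp eqxx tdiv_uniq. Qed.

Let f1P x : pproj x != 0 -> pproj (f1 x) = pproj x /\ oglue (f1 x) = f2 (oglue x).
Proof.
move=> x0; rewrite /f1 (negbTE x0).
have [|t0 tE] := @tdivP _ _ _ (oglue (y0 (pproj x))) (f2 (oglue x)).
  by rewrite f2_proj !oglue_proj ?y0P.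
by rewrite pact_proj// oglue_act ?y0P// -tE.
Qed.

Let f1_uniq x y : pproj x != 0 -> pproj y = pproj x -> oglue y = f2 (oglue x) -> f1 x = y.
Proof. by move=> x0 yx yE; have [h1 h2] := f1P x0; apply: oglue_inj; rewrite ?h1 ?h2. Qed.

Let f1_proj x : pproj (f1 x) = pproj x.
Proof.
have [x0|/f1P[]//] := eqVneq (pproj x) 0.
by have [t t0 ->] := frame1 x0; rewrite f1E0// !pact_proj// gp gp'.
Qed.

Let f1_act t x : torus t -> f1 (pact t x) = pact t (f1 x).
Proof.
move=> t0; have [x0|x0] := eqVneq (pproj x) 0.
  have [t' t'0 ->] := frame1 x0.
  by rewrite pactM// !f1E0// ?pactM//; exact: torus_tmul.
have [h1 h2] := f1P x0; apply: f1_uniq; rewrite ?pact_proj//.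
by rewrite !oglue_act ?h1// h2 f2_act.
Qed.

Let f1_sigma z : ball0 d z -> f1 (sigma z) = sigma' z.
Proof.
move=> zd; have [->|z0] := eqVneq z 0.
  by rewrite -[sigma 0]pact1 f1E0 ?pact1//; exact: torus1.
have pz := holo_section_proj hsigma zd; have pz' := holo_section_proj hsigma' zd.
have [_ _ _ gE] := nm; have [_ _ _ gE'] := nm'.
apply: f1_uniq; rewrite ?pz ?pz'//.
by rewrite gE// gE'// f2E//; exact: torus_zpow.
Qed.

(** Near [0] the map is read in the frames [sigma] and [sigma'], which correspond to each other;
    away from [0] it is the quotient of the transition functions of both bundles. *)
Let f1_holo V t : @plsec _ _ (ob1 m) V t -> holo_section V (f1 \o t).
Proof.
move=> Vt; have oV := plsec_open Vt; apply: holo_section_local => // z Vz.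
have [z0|z0] := eqVneq z 0.
  rewrite z0 in Vz *; have [hg gE] := holo_section_diff (holo_section_plsec Vt) hsigma.
  have [d1 d10 hd1] := ball_sub_open (openI oV (@open_ball0 _ d)) (conj Vz B0).
  exists d1, (fun y => pact (tdiv (sigma y) (t y)) (sigma' y)); split=> // [|y /hd1[Vy yd]].
    apply: holo_section_act; last by apply: holo_torus_sub hg => y /hd1.
    by apply: holo_section_sub hsigma' => [|y /hd1[]//]; exact: open_cball.
  by rewrite /= {1}gE// f1_act ?f1_sigma//; exact: (hg.1 y (conj Vy yd)).
have [W [t' [Wt' Wz]]] := plsec_cover (ob1 m') z.
pose tr y := tdiv (s (y ^- n)) (oglue (t y)); pose tr' y := tdiv (s' (y ^- n)) (oglue (t' y)).
have htr := transition_holo Vt hs; have htr' := transition_holo Wt' hs'.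
have oU : open [set y : C | y != 0].
  apply/openC_cmod => y /= yn0; exists (cmod y); first by rewrite cmod_gt0.
  by move=> x; apply: contraTneq => ->; rewrite sub0r cmodN ltxx.
have [d1 d10 hd1] := ball_sub_open (openI oV (openI (plsec_open Wt') oU)) (conj Vz (conj Wz z0)).
exists d1, (fun y => pact (tmul (tr y) (tinv (tr' y))) (t' y)); split=> // [|y /hd1[Vy [Wy yn0]]].
  apply: holo_section_act.
    by apply: holo_section_sub (holo_section_plsec Wt') => [|y /hd1[_ []]//]; exact: open_cball.
  apply: holo_torusM.
    by apply: holo_torus_sub htr => y /hd1[Vy [_ /eqP yn0]].
  by apply: holo_torusV; apply: holo_torus_sub htr' => y /hd1[_ [Wy /eqP yn0]].
have [h1 h2] := transitionP Vt hs Vy yn0; have [h1' h2'] := transitionP Wt' hs' Wy yn0.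
rewrite -/(tr y) in h1 h2; rewrite -/(tr' y) in h1' h2'.
have py := plsec_proj Vt Vy; have py' := plsec_proj Wt' Wy.
have tt : torus (tmul (tr y) (tinv (tr' y))) by apply: torus_tmul => //; exact: torus_tinv.
apply: f1_uniq; rewrite ?py ?pact_proj ?py'//.
rewrite oglue_act ?py'// h2 f2E// h2' pactM// -tmulA [tmul (tinv _) _]tmulC tmulV//.
by rewrite tmulC tmul1.
Qed.

Let f1_rot x : f1 (orot x) = orot (f1 x).
Proof.
have [x0|x0] := eqVneq (pproj x) 0.
  have [t t0 ->] := frame1 x0; rewrite orot_act// !f1_act//.
  have z0 : torus (zpow e (zeta R n)^-1 : 'rV[C]_r) by apply: torus_zpow; rewrite invr_eq0 zeta_neq0.
  by rewrite (normal_orot nm) f1_act// f1_sigma// orot_act// (normal_orot nm').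
have [h1 h2] := f1P x0; have zx0 : zeta R n * pproj x != 0 by rewrite mulf_neq0// zeta_neq0.
by apply: f1_uniq; rewrite ?orot_proj ?h1// !oglue_rot ?h1.
Qed.

Let f1_gsec x : gsec1 (f1 x) = gsec1 x.
Proof.
have [x0|x0] := eqVneq (pproj x) 0.
  have [t t0 ->] := frame1 x0; rewrite f1E0// !gsec1_act//; congr tact.
  by apply/rowP => j; rewrite (frame_revpoly n_gt0 nm su)// (frame_revpoly n_gt0 nm' su').
by have [h1 h2] := f1P x0; rewrite -gsec_glue ?h1// h2 f2_gsec gsec_glue.
Qed.

Lemma frames_iso : gauged_iso m m'.
Proof.
exists f1, f2; split; [by split|by split|by split; [exact: f1_holo|exact: f2_holo]| |by split].
by split=> [|x x0]; [exact: f1_rot|have [_ ->] := f1P x0].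
Qed.

End TwoFrames.

Lemma normal_sub m s e (d d' : R) sigma : 0 < d' -> d' <= d -> normal (m := m) s e d sigma -> normal s e d' sigma.
Proof.
move=> d'0 d'd [d0 hs hsigma gE]; split=> //; last by move=> z /(ball0_sub d'd); exact: gE.
by apply: holo_section_sub hsigma; [exact: (@open_ball0 _ d')|exact: ball0_sub].
Qed.

(** Equal degrees force equal gluing exponents. Once the second frame is rescaled by [t] and the
    radii are made equal, both gauged maps have the same gluing and the same polynomials. *)
Lemma poly_equiv_iso m m' (u u' : 'I_k -> {poly R[i]}) (deg : 'rV[R]_r) : stable Phi m -> stable Phi m' ->
  has_degree m deg -> has_degree m' deg ->
  expressed_by m u -> expressed_by m' u' -> poly_equiv nu u u' -> gauged_iso m m'.
Proof.
move=> st st' hd hd' /expressed_byP[s hs su] /expressed_byP[s' hs' su'] [t [t0 uu']].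
have [e [d [sigma nm]]] := expressed_frame n_gt0 fin st hs su.
have [e' [d' [sigma' nm']]] := expressed_frame n_gt0 fin st' hs' su'.
have ee' : e' = e.
  apply/rowP => a; have [d0 _ hsg gE] := nm; have [d'0 _ hsg' gE'] := nm'.
  have := frame_has_degree n_gt0 d0 hs hsg gE a hd; rewrite (frame_has_degree n_gt0 d'0 hs' hsg' gE' a hd').
  have nV0 : (n%:R^-1 : R) != 0 by rewrite invr_eq0 pnatr_eq0 -lt0n.
  by move=> /(mulIf nV0)/oppr_inj/eqP; rewrite eqr_int => /eqP.
rewrite {e'}ee' in nm'.
have [d0 _ _ _] := nm; have [d'0 _ _ _] := nm'.
have m0 : 0 < Num.min d d' by rewrite lt_min d0.
have m1 : Num.min d d' <= d by rewrite ge_min lexx.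
have m2 : Num.min d d' <= d' by rewrite ge_min lexx orbT.
apply: (frames_iso (normal_sub m0 m1 nm) (normal_rescale (normal_sub m0 m2 nm') t0) su).
move=> z j; apply: (mulfI (character_neq0 (row j nu) t0)).
by rewrite -hornerZ -uu' -su' (gsec2_tinv (s' z) t0) tactE.
Qed.

End Isomorphisms.

(** * From polynomials to gauged maps *)

Section UnitCircle.
Variables (R : realType) (r : nat).
Local Notation C := (Cplx R).

Definition expi (x : R) : C := cos x +i* sin x.

Lemma expiD x y : expi (x + y) = expi x * expi y.
Proof. by rewrite /expi cosD sinD; apply/eqP; rewrite eq_complex /=; apply/andP; split; apply/eqP; ring. Qed.

Lemma expi0 : expi 0 = 1.
Proof. by rewrite /expi cos0 sin0. Qed.

Lemma expi_neq0 x : expi x != 0.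
Proof.
apply: contraTneq (oner_neq0 C) => x0.
by rewrite -expi0 -(subrr x) expiD x0 mul0r eqxx.
Qed.

Lemma expiN x : expi (- x) = (expi x)^-1.
Proof. by apply: (mulIf (expi_neq0 x)); rewrite -expiD addNr expi0 mulVf// expi_neq0. Qed.

Lemma expiXz x (m : int) : expi x ^ m = expi (m%:~R * x).
Proof.
have E (l : nat) : expi x ^+ l = expi (l%:R * x).
  elim: l => [|l IH]; first by rewrite expr0 mul0r expi0.
  by rewrite exprSr IH -expiD -addn1 natrD mulrDl mul1r.
case: m => l; first exact: E.
by rewrite NegzE -exprnN E mulrNz mulNr expiN.
Qed.

Lemma expi_sum (I : Type) (s : seq I) (F : I -> R) : expi (\sum_(i <- s) F i) = \prod_(i <- s) expi (F i).
Proof.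
elim: s => [|i s IH]; first by rewrite !big_nil expi0.
by rewrite !big_cons expiD IH.
Qed.

Lemma expi_nat (l : nat) : expi (2 * pi * l%:R) = 1.
Proof.
have -> : 2 * pi * l%:R = l%:R * (pi *+ 2) :> R by rewrite mulr2n; ring.
by rewrite -[l%:R]/(l%:Z%:~R) -expiXz /expi cos2pi sin2pi; apply: exp1rz.
Qed.

(** For the fractional part [f], the half-angle formula turns [cos (2 pi f) = 1] into
    [sin (pi f) = 0], impossible for [0 < f < 1]. *)
Lemma expi_eq1 (x : R) : expi (2 * pi * x) = 1 -> exists m : int, x = m%:~R.
Proof.
move=> x1; exists (Num.floor x); pose f := x - (Num.floor x)%:~R.
have fE : expi (2 * pi * f) = 1.
  by rewrite /f mulrBr expiD x1 mul1r -mulrN -mulrNz mulrC -expiXz (_ : expi (2 * pi) = 1) ?exp1rz// -[2 * pi]mulr1 (expi_nat 1).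
have f0 : 0 <= f by rewrite subr_ge0 ge_floor.
have f1 : f < 1 by rewrite ltrBlDl -[X in _ < _ + X]/(1%:~R) -rmorphD /= floorD1_gt.
have [f_gt0|fle] := ltP 0 f; last by apply/eqP; rewrite -subr_eq0 -/f eq_le fle f0.
have : cos (2 * pi * f) = 1 by move: fE => /(congr1 (@complex.Re R)).
have -> : 2 * pi * f = (pi * f) *+ 2 by rewrite mulr2n; ring.
have pf0 : 0 < sin (pi * f :> R).
  by apply: sin_gt0_pi; rewrite mulr_gt0 ?pi_gt0//= gtr_pMr ?pi_gt0.
rewrite cos_mulr2n => h; have := cos2Dsin2 (pi * f).
have -> : cos (pi * f) ^+ 2 = 1 by move: h; rewrite mulr2n; lra.
by move=> /eqP; rewrite eq_sym -subr_eq0 opprD addNKr oppr_eq0 sqrf_eq0 (gt_eqF pf0).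
Qed.

Lemma character_expi (chi : 'rV[int]_r) (d : 'rV[R]_r) :
  character chi (\row_a expi (2 * pi * d 0 a)) = expi (2 * pi * pairing chi d).
Proof.
rewrite /character /pairing mulr_sumr expi_sum; apply: eq_bigr => a _.
by rewrite mxE expiXz; congr expi; ring.
Qed.

End UnitCircle.

(** * The model gauged map and its degree *)

Section Model.
Variables (R : realType) (r k n : nat) (nu : 'M[int]_(k, r)).
Local Notation C := (Cplx R).
Hypothesis n_gt0 : (0 < n)%N.

Lemma expfz_cancel (c z y : C) (N : int) : c != 0 -> c^-1 ^ N * ((c * z) ^ N * y) = z ^ N * y.
Proof.
move=> c0; have -> : (c * z) ^ N = c ^ N * z ^ N by exact: expfzMl.
by rewrite exprz_inv -invr_expz -!mulrA mulKf// expfz_neq0.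
Qed.

Definition tpoint := {t : 'rV[C]_r | torus t}.

Lemma tpoint_eq (x y : tpoint) : sval x = sval y -> x = y.
Proof.
by case: x y => [x px] [y py] /= xy; subst y; congr exist; exact: Prop_irrelevance.
Qed.

Lemma zpow1 (e : 'rV[int]_r) : zpow e 1 = const_mx 1 :> 'rV[C]_r.
Proof. by apply/rowP => a; rewrite zpowE mxE exp1rz. Qed.

Definition tpoint1 : tpoint := exist _ (const_mx 1) (@torus1 R r).

(* For [t] outside of the torus the value is irrelevant. *)
Definition tpoint_mul (t : 'rV[C]_r) (x : tpoint) : tpoint :=
  if pselect (torus t) is left h then exist _ (tmul t (sval x)) (torus_tmul h (svalP x)) else x.

Lemma tpoint_mulE t x : torus t -> sval (tpoint_mul t x) = tmul t (sval x).
Proof. by rewrite /tpoint_mul; case: pselect. Qed.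

Opaque tpoint_mul.

Lemma tpoint_mulM s t x : torus s -> torus t -> tpoint_mul s (tpoint_mul t x) = tpoint_mul (tmul s t) x.
Proof.
by move=> s0 t0; apply: tpoint_eq; rewrite !tpoint_mulE ?tmulA//; exact: torus_tmul.
Qed.

(** The atlas of the trivial bundle consists of a single global section, so that every holomorphy
    condition concerns coordinates only. *)
Definition triv_sec (V : set C) (s : C -> C * tpoint) := V = setT /\ s = fun z => (z, tpoint1).

Definition triv_act (t : 'rV[C]_r) (x : C * tpoint) : C * tpoint := (x.1, tpoint_mul t x.2).

Lemma triv_act1 x : triv_act (const_mx 1) x = x.
Proof.
case: x => z t; congr (_, _); apply: tpoint_eq; rewrite tpoint_mulE ?tmul1//; exact: torus1.
Qed.

Lemma triv_actM s t x : torus s -> torus t -> triv_act s (triv_act t x) = triv_act (tmul s t) x.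
Proof. by move=> s0 t0; rewrite /triv_act tpoint_mulM. Qed.

Lemma triv_act_free t x : torus t -> triv_act t x = x -> t = const_mx 1.
Proof.
case: x => z x t0 [/(congr1 sval)]; rewrite tpoint_mulE// => tx; apply/rowP => a.
move/rowP: tx => /(_ a); rewrite !mxE -[RHS]mul1r; apply: mulIf; exact: (svalP x).
Qed.

Lemma triv_act_trans (x y : C * tpoint) : x.1 = y.1 -> exists t, torus t /\ y = triv_act t x.
Proof.
case: x y => [z x] [_ y] /= <-; have x0 := torus_tinv (svalP x).
have t0 := torus_tmul (svalP y) x0; exists (tmul (sval y) (tinv (sval x))); split=> //.
congr (_, _); apply: tpoint_eq.
by rewrite tpoint_mulE// -tmulA [tmul (tinv _) _]tmulC tmulV ?[tmul _ (const_mx 1)]tmulC ?tmul1//; exact: svalP.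
Qed.

Lemma triv_sec_holo V s W t : triv_sec V s -> triv_sec W t -> exists g, holo_torus_on (V `&` W) g /\
  forall z, (V `&` W) z -> s z = triv_act (g z) (t z).
Proof.
move=> [_ ->] [_ ->]; exists (fun=> const_mx 1); split; first by apply: holo_torus_cst; exact: torus1.
by move=> z _; rewrite triv_act1.
Qed.

Definition triv_bundle : pbundle R r.
Proof.
refine (@PBundle R r (C * tpoint)%type fst triv_act _ triv_act1 triv_actM triv_act_free triv_act_trans triv_sec _ _ _ triv_sec_holo).
- by [].
- by move=> V s [-> _]; exact: openT.
- by move=> V s z [_ ->].
- by move=> z; exists setT, (fun z => (z, tpoint1)).
Defined.

Variable e : 'rV[int]_r.
Local Notation T := triv_bundle.

Section Rotation.
Variables (c : C) (c0 : c != 0).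

(** The fibre component is forced by invariance of the gluing: [zpow e (c z)] times [zpow e c^-1] is
    [zpow e z]. The order divides [n] as soon as [c^n = 1]. *)
Definition model_rot (x : T) : T := (c * x.1, tpoint_mul (zpow e c^-1) x.2).

Let cV0 : c^-1 != 0. Proof. by rewrite invr_eq0. Qed.
Let tc : torus (zpow e c^-1). Proof. exact: torus_zpow. Qed.

Lemma model_rot_act (t : 'rV[C]_r) x : torus t -> model_rot (pact t x) = pact t (model_rot x).
Proof. by move=> t0; congr (_, _); rewrite /= !tpoint_mulM// tmulC. Qed.

Lemma model_rotE z t : model_rot (z, t) = (c * z, tpoint_mul (zpow e c^-1) t).
Proof. by []. Qed.

Lemma tpoint_mul_zpow a b x : a != 0 -> b != 0 ->
  tpoint_mul (zpow e a) (tpoint_mul (zpow e b) x) = tpoint_mul (zpow e (a * b)) x.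
Proof.
move=> a0 b0; have ta := torus_zpow e a0; have tb := torus_zpow e b0.
exact: etrans (tpoint_mulM _ ta tb) (congr1 (tpoint_mul^~ x) (esym (zpowM e a b))).
Qed.

Lemma model_rot_iter l x : iter l model_rot x = (c ^+ l * x.1, tpoint_mul (zpow e (c^-1 ^+ l)) x.2).
Proof.
case: x => z t; elim: l => [|l IH]; first by rewrite !expr0 mul1r zpow1 -[LHS]triv_act1.
have E1 : c * (c ^+ l * z) = c ^+ l.+1 * z by rewrite mulrA -exprS.
have E2 : tpoint_mul (zpow e c^-1) (tpoint_mul (zpow e (c^-1 ^+ l)) t) = tpoint_mul (zpow e (c^-1 ^+ l.+1)) t.
  by apply: etrans (tpoint_mul_zpow _ cV0 (expf_neq0 l cV0)) _; rewrite -exprS.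
by rewrite iterS IH; exact: (congr2 pair E1 E2).
Qed.

Lemma model_rot_order x : c ^+ n = 1 -> iter n model_rot x = x.
Proof. by move=> cn; rewrite model_rot_iter exprVn cn invr1 mul1r zpow1 -[RHS]triv_act1. Qed.

Lemma model_rot_holo V s : @plsec _ _ T V s ->
  holo_section [set z | V (c^-1 * z)] (fun z => model_rot (s (c^-1 * z))).
Proof.
move=> [-> ->].
have h : holo_section setT (fun z => @pact _ _ T (zpow e c^-1) (z, tpoint1)).
  by apply: holo_section_act (holo_torus_cst _ tc); exact: (@holo_section_plsec _ _ T setT (fun z => (z, tpoint1))).
rewrite (_ : (fun z => _) = fun z => @pact _ _ T (zpow e c^-1) (z, tpoint1)); first exact: h.
by apply/funext => z; rewrite /model_rot /= mulrA divff ?mul1r.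
Qed.

Definition model_glue (x : T) : T := (x.1 ^- n, tpoint_mul (zpow e x.1) x.2).

Lemma model_glue_rot (x : T) : c ^+ n = 1 -> pproj x != 0 -> model_glue (model_rot x) = model_glue x.
Proof.
move=> cn x0; have cx0 : c * x.1 != 0 by rewrite mulf_neq0.
case: x x0 cx0 => z t /= z0 cz0; rewrite /model_glue.
have E1 : (c * z) ^- n = z ^- n by rewrite exprMn cn mul1r.
have E2 : zpow e z = tmul (zpow e (c * z)) (zpow e c^-1) :> 'rV[C]_r by rewrite -zpowM mulrAC divff ?mul1r.
by rewrite model_rotE E2 -(tpoint_mulM _ (torus_zpow e cz0) tc) -E1.
Qed.

End Rotation.

Let zeta0 : zeta R n != 0 :> C. Proof. exact: zeta_neq0. Qed.
Let zetan : (zeta R n : C) ^+ n = 1. Proof. exact: zetaX_n. Qed.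
Local Notation mrot := (model_rot (zeta R n)).

Lemma model_glue_proj (x : T) : pproj x != 0 -> pproj (model_glue x) = pproj x ^- n.
Proof. by []. Qed.

Lemma model_glue_act (t : 'rV[C]_r) (x : T) : torus t -> pproj x != 0 ->
  model_glue (pact t x) = pact t (model_glue x).
Proof.
move=> t0 x0; have tx := torus_zpow e x0.
by congr (_, _); rewrite /= !tpoint_mulM// tmulC.
Qed.

Lemma holo_zpow (V : set C) : (forall z, V z -> z != 0) -> holo_torus_on V (@zpow R r e).
Proof.
move=> V0; split; first by move=> z Vz; exact: torus_zpow (V0 z Vz).
move=> a; apply/holo_onE.
rewrite (_ : (fun z => _) = fun z => z ^ e 0 a); last by apply/funext => z; rewrite zpowE.
by apply: holoXz => //; exact: holo_id.
Qed.

Lemma model_glue_holo V s W t : @plsec _ _ T V s -> @plsec _ _ T W t ->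
  let U := [set z : C | [/\ V z, z != 0 & W (z ^- n)]] in
  exists g, holo_torus_on U g /\ forall z, U z -> model_glue (s z) = pact (g z) (t (z ^- n)).
Proof.
move=> [-> ->] [-> ->] U; exists (zpow e); split; last by [].
by apply: holo_zpow => z [].
Qed.

Definition model_bundle : orbibundle R r n :=
  @OrbiBundle R r n T T mrot (fun x => erefl) (@model_rot_act _ zeta0) (fun x => model_rot_order zeta0 x zetan)
    (@model_rot_holo _ zeta0) model_glue model_glue_proj model_glue_act (fun x => model_glue_rot zeta0 zetan) model_glue_holo.

Local Notation RR := (measurableTypeR R * measurableTypeR R)%type.

(** The metric is [(1 + |w|^2)^(- delta)] in the affine chart. Near infinity it is multiplied by
    [|z^p|^2], and [p = - n delta] makes it [(1 + |z|^(2n))^(- delta)], smooth at [0]; its curvature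
    is a multiple of the kernel integrated in [plane_kernel]. *)
Lemma model_line_degree (chi : 'rV[int]_r) (delta : R) :
  (\sum_a e 0 a * chi 0 a)%:~R = - n%:R * delta -> line_degree model_bundle chi delta.
Proof.
set p : int := \sum_a _ => pE.
pose F (w : C) : R := expR (- delta * ln (1 + absq w)).
pose h2 (x : T) := absq (character chi (sval x.2)) * F x.1.
pose h1 (x : T) := absq (character chi (sval x.2)) * F (x.1 ^+ n).
have F0 w : 0 < F w by exact: expR_gt0.
have a0 (z : C) : z != 0 -> 0 < absq z by move=> z0; rewrite absqE exprn_gt0// cmod_gt0.
have ch0 (t : tpoint) : character chi (sval t) != 0 by apply: character_neq0; exact: svalP.
have cF m : Ck m setT F.
  by apply: Ck_exp openT (CkM openT (@Ck_cst R m setT (- delta)) (@Ck_ln_kernel R m)).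
have cF1 m : Ck m setT (fun z => F (z ^+ n)).
  apply: Ck_exp openT (CkM openT (@Ck_cst R m setT (- delta)) _).
  apply: (Ck_ln openT) => [z _|]; first by rewrite ltr_pwDl// absqE sqr_ge0.
  apply: (CkD openT (@Ck_cst R m setT 1)).
  exact: (@Ck_absq R m setT (fun z => z ^+ n) openT (holoX n (@holo_id R setT))).
have FE (z : C) : z != 0 -> absq (z ^ p) * F (z ^- n) = F (z ^+ n).
  move=> z0; have zp0 : 0 < absq (z ^ p) by rewrite a0// expfz_neq0.
  apply: ln_inj; rewrite ?posrE ?mulr_gt0// lnM ?posrE// ln_absqXz// pE /F !expRK.
  have zn0 : z ^+ n != 0 by rewrite expf_neq0.
  have an := a0 _ zn0; have lnn : ln (absq (z ^+ n)) = n%:R * ln (absq z) by exact: (ln_absqXz n z0).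
  have -> : absq (z ^- n) = (absq (z ^+ n))^-1.
    have h : absq (z ^- n) * absq (z ^+ n) = 1 by rewrite -absqM mulVf// absqE cmod1 expr1n.
    by rewrite -[LHS]mulr1 -(divff (lt0r_neq0 an)) mulrA h mul1r.
  have E : absq (z ^+ n) * (1 + (absq (z ^+ n))^-1) = 1 + absq (z ^+ n).
    by rewrite mulrDr mulr1 divff ?lt0r_neq0// addrC.
  have q0 : 0 < 1 + (absq (z ^+ n))^-1 by rewrite ltr_pwDl// invr_ge0 ltW.
  rewrite -E lnM ?posrE//.
  rewrite lnn; ring.
have pi0 : (pi : R) != 0 by rewrite gt_eqF ?pi_gt0.
exists h1, h2, (fun w => delta / pi * (1 + absq w) ^- 2); split.
- split.
  + by split=> x; rewrite mulr_gt0// a0.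
  + by split=> t x t0; rewrite /h1 /h2 /= tpoint_mulE// characterM absqM mulrA.
  + split=> [x|x x0].
      have zV0 : (zeta R n)^-1 != 0 :> C by rewrite invr_eq0.
      have E : (zeta R n * x.1) ^+ n = x.1 ^+ n by rewrite (exprMn n (zeta R n : C)) zetan mul1r.
      have c1 : absq ((zeta R n)^-1 ^ p) = 1.
        by apply: ln_inj; rewrite ?posrE ?a0 ?expfz_neq0// ln_absqXz// absqE cmod_zeta// expr1n ln1 mulr0.
      by rewrite /h1 /= E tpoint_mulE ?characterM ?absqM ?character_zpow -/p ?c1 ?mul1r//; exact: torus_zpow.
    rewrite /h1 /h2 /= tpoint_mulE; last exact: torus_zpow.
    rewrite characterM absqM character_zpow// -/p mulrAC mulrC; congr (_ * _).
    exact: (FE x.1 x0).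
  + move=> V s [-> ->]; apply/smooth_Ck => m.
    exact: (CkM openT (@Ck_cst R m setT (absq (character chi (sval tpoint1)))) (cF1 m)).
  + move=> V s [-> ->]; apply/smooth_Ck => m.
    exact: (CkM openT (@Ck_cst R m setT (absq (character chi (sval tpoint1)))) (cF m)).
- move=> V s [-> ->] z _.
  have -> : (fun w => ln (h2 (w, tpoint1))) = fun w => - delta * ln (1 + absq w).
    apply/funext => w; rewrite /h2 /= character1.
    have -> : absq (1 : C) = 1 by rewrite absqE cmod1 expr1n.
    by rewrite mul1r /F expRK.
  rewrite (laplacianZ (- delta) (@openT C) I (@Ck_ln_kernel R 2)) laplacian_ln_kernel.
  by move: ((1 + absq z) ^+ 2)^-1 (pi : R) pi0 => a b b0; field.
- have h := integrableZl measurableT (delta / pi) (kernel_integrable R).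
  by apply: eq_integrable h => // q _; rewrite EFinM.
- rewrite /integral_over preimage_setT /Rintegral.
  rewrite (eq_integral (fun q : RR => (delta / pi)%:E * ((1 + absq (cplx q)) ^- 2)%:E)%E); last first.
    by move=> q _; rewrite EFinM.
  rewrite (@integralZl _ _ R (leb2 R) _ measurableT)//; last exact: kernel_integrable.
  by rewrite plane_kernel -EFinM /= -mulrA mulVf ?mulr1.
Qed.

Variable u : 'I_k -> {poly R[i]}.
Hypothesis uN : forall j, u j = 0 \/ (n * (size (u j)).-1)%:Z <= weight_order nu e j.

Definition model_sec2 (x : T) : 'rV[C]_k := tact nu (tinv (sval x.2)) (\row_j (u j).[x.1]).
Definition model_sec1 (x : T) : 'rV[C]_k :=
  tact nu (tinv (sval x.2)) (\row_j (revpoly (weight_order nu e j) n (u j)).[x.1]).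

Lemma model_sec2_act (t : 'rV[C]_r) x : torus t -> model_sec2 (pact t x) = tact nu (tinv t) (model_sec2 x).
Proof. by move=> t0; rewrite /model_sec2 /= tpoint_mulE// tinvM tactM. Qed.

Lemma model_sec1_act (t : 'rV[C]_r) x : torus t -> model_sec1 (pact t x) = tact nu (tinv t) (model_sec1 x).
Proof. by move=> t0; rewrite /model_sec1 /= tpoint_mulE// tinvM tactM. Qed.

Lemma model_sec_glue (x : T) : pproj x != 0 -> model_sec2 (model_glue x) = model_sec1 x.
Proof.
move=> x0; rewrite /model_sec2 /model_sec1 /= tpoint_mulE; last exact: torus_zpow.
rewrite tmulC tinvM -tactM; congr tact; apply/rowP => j.
by rewrite tactE characterV character_zpow// [in LHS]mxE [RHS]mxE revpoly_inv// /weight_order -invr_expz.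
Qed.

(** Off [0], [revpoly] is [z^N u(z^-n)], whose second factor is invariant under the rotation while
    the first takes the character of the fibre action; the value at [0] follows by continuity. *)
Lemma model_sec1_rot x : model_sec1 (mrot x) = model_sec1 x.
Proof.
have zV0 : (zeta R n)^-1 != 0 :> C by rewrite invr_eq0.
rewrite /model_sec1 /= tpoint_mulE; last exact: torus_zpow.
rewrite tmulC tinvM -tactM; congr tact; apply/rowP => j.
rewrite tactE characterV character_zpow// [in LHS]mxE [RHS]mxE invr_expz -/(weight_order nu e j).
set w := weight_order nu e j; set p := revpoly _ _ _.
move: (zeta R n : C) zeta0 zetan {zV0} => c c0 cn.
have off z : z != 0 -> c^-1 ^ w * p.[c * z] = p.[z].
  move=> z0'; have cz0 : c * z != 0 by rewrite mulf_neq0.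
  have E : (c * z) ^- n = z ^- n by rewrite exprMn cn mul1r.
  rewrite /p (revpoly_inv (uN j) cz0) (revpoly_inv (uN j) z0') E; exact: expfz_cancel.
have [x0|] := eqVneq x.1 0; last exact: off.
have hp : holo setT (fun z : C => c^-1 ^ w * p.[c * z]).
  apply: holoM; first exact: holo_cst.
  apply: (holo_comp (holo_poly p) (W := setT)) => //.
  by apply: holoM; [exact: holo_cst|exact: holo_id].
rewrite x0; apply: (@ccont_punctured_eq R (fun z => c^-1 ^ w * p.[c * z]) (fun z => p.[z]) 0 1 ltr01).
- exact: (holo_ccont hp (I : [set: C] 0)).
- exact: (holo_ccont (holo_poly p) (I : [set: C] 0)).
- by move=> y y0 _; exact: off.
Qed.

Lemma model_sec_holo (q : 'I_k -> {poly R[i]}) V s j : @plsec _ _ T V s ->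
  holo_on V (fun z => (tact nu (tinv (sval (s z).2)) (\row_j (q j).[(s z).1])) 0 j).
Proof.
move=> [_ ->]; apply/holo_onE.
rewrite (_ : (fun z => _) = fun z => (q j).[z]); first exact: holo_poly.
by apply/funext => z; rewrite tactE mxE /= tinv1 character1 mul1r.
Qed.

Definition model : gauged_map R n nu :=
  @GaugedMap R r k n nu model_bundle model_sec1 model_sec2 model_sec1_act model_sec2_act
    model_sec1_rot model_sec_glue 
    (fun V s Vs j => @model_sec_holo (fun j => revpoly (weight_order nu e j) n (u j)) V s j Vs)
    (fun V s Vs j => @model_sec_holo u V s j Vs).

Lemma model_expressed : expressed_by model u.
Proof.
exists (fun z => (z, tpoint1)); split; first exact: (@holo_section_plsec _ _ T setT (fun z => (z, tpoint1))).
by move=> z; rewrite /= /model_sec2 /= tinv1 tact1.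
Qed.

End Model.

Section ModelExists.
Variables (R : realType) (r k n : nat) (nu : 'M[int]_(k, r)) (Phi : 'rV[Cplx R]_k -> 'rV[R]_r).
Local Notation C := (Cplx R).
Hypotheses (n_gt0 : (0 < n)%N).
Hypothesis fin : forall x, Xss nu Phi x -> finite_set (stabilizer nu x).
Hypothesis n_div : forall x m, Xss nu Phi x -> (stabilizer nu x #= `I_m)%card -> (m %| n)%N.

(* exp(2 pi d) fixes the value at infinity, hence has order dividing [n]. *)
Lemma degree_integral (d : 'rV[R]_r) u a : polynomial_data nu Phi d u -> exists m : int, n%:R * d 0 a = m%:~R.
Proof.
move=> [_ xss]; have [m sm] := fin xss.
have /dvdnP [q nE] := n_div xss sm.
have : stabilizer nu (value_at_infinity nu d u) (\row_b expi (2 * pi * d 0 b)).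
  split=> [b|]; first by rewrite mxE expi_neq0.
  apply/rowP => j; rewrite tactE character_expi [_ 0 j]mxE /=.
  (* A coordinate at infinity can be nonzero only if the pairing of its weight with [d] is a natural
     number, and then the weight is [1] on [exp(2 pi d)]. *)
  case: ifP => [/natrP[l ->]|_]; last by rewrite mulr0.
  by rewrite expi_nat mul1r.
move=> /(stabilizer_order sm)[_ /(_ a)]; rewrite mxE => tm.
apply: expi_eq1; have -> : 2 * pi * (n%:R * d 0 a) = n%:~R * (2 * pi * d 0 a) by rewrite -[n%:~R]/(n%:R); ring.
by rewrite -expiXz -[_ ^ n]/(_ ^+ n) nE mulnC exprM tm expr1n.
Qed.

Lemma model_exists (d : 'rV[R]_r) (u : 'I_k -> {poly R[i]}) : polynomial_data nu Phi d u ->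
  exists m : gauged_map R n nu, [/\ stable Phi m, has_degree m d & expressed_by m u].
Proof.
(* The exponent [- n d]; the floor merely names the integer provided by [degree_integral]. *)
move=> ud; pose e : 'rV[int]_r := \row_a - Num.floor (n%:R * d 0 a).
have eE a : (e 0 a)%:~R = - (n%:R * d 0 a).
  by rewrite mxE rmorphN /=; have [m ->] := degree_integral a ud; rewrite intrKfloor.
have eP (chi : 'rV[int]_r) : (\sum_a e 0 a * chi 0 a)%:~R = - n%:R * pairing chi d.
  rewrite rmorph_sum /pairing mulr_sumr; apply: eq_bigr => a _.
  by rewrite rmorphM /= eE; ring.
have wE j : (weight_order nu e j)%:~R = n%:R * pairing (row j nu) d.
  by rewrite /weight_order rmorphN /= eP; ring.
have uN j : u j = 0 \/ (n * (size (u j)).-1)%:Z <= weight_order nu e j.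
  have [->|u0] := eqVneq (u j) 0; first by left.
  right; rewrite -(ler_int R) wE.
  have -> : ((n * (size (u j)).-1)%:Z)%:~R = n%:R * (size (u j)).-1%:R :> R by rewrite -natrM.
  by rewrite ler_pM2l ?ltr0n//; exact: ud.1.
exists (model n_gt0 uN); split.
- move=> x x0.
  have -> : gsec1 x = tact nu (tinv (sval x.2)) (value_at_infinity nu d u).
    rewrite /= /model_sec1; congr tact; apply/rowP => j.
    by rewrite mxE (value_at_infinityE n_gt0 (wE j) (uN j)) -x0.
  by apply: Xss_tact; [apply: torus_tinv; exact: svalP|exact: ud.2].
- by move=> chi; apply: model_line_degree; exact: eP.
- exact: model_expressed.
Qed.

End ModelExists.

(** * Invariance under isomorphism and passage to vortices *)

Section IsoInvariance.
Variables (R : realType) (r k n : nat) (nu : 'M[int]_(k, r)).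

Lemma expressed_iso (m m' : gauged_map R n nu) u : gauged_iso m m' -> expressed_by m u -> expressed_by m' u.
Proof.
move=> [f1 [f2 [_ [_ fa] [_ fh] _ [_ fs]]]] [s [hs su]].
exists (f2 \o s); split; first exact: holo_section_map fa fh hs.
by move=> z; rewrite /= fs su.
Qed.

(** Allows the classification of vortices to be applied to one vortex obtained from two gauged
    maps. *)
Lemma gauge_equiv_refl (v : kpair R r k) : gauge_equiv nu v v.
Proof.
have c0 w (c : Cplx R) z : cpd w (fun=> c) z = 0.
  by rewrite /cpd !(is_pd_val (is_pd_cst _ _ _)).
exists (fun=> const_mx 1); split.
- by move=> z a; rewrite mxE normr1.
- by move=> b; split; apply/smooth_Ck => m; exact: Ck_cst.
- by move=> z; rewrite tact1.
- by move=> z b; rewrite c0 mulr0 add0r.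
- by move=> z b; rewrite c0 mulr0 add0r.
Qed.

End IsoInvariance.

Theorem proposition1p2 (R : realType) (r k n : nat) (nu : 'M[int]_(k, r))
    (Q : 'M[R]_r) (Phi : 'rV[Cplx R]_k -> 'rV[R]_r) (p : R)
    (half_space : in_open_half_space R nu)
    (span : weights_span R nu)
    (Q_inner : inner_product Q)
    (Phi_moment : moment_map nu Q Phi)
    (finite_stab : forall x, Xss nu Phi x -> finite_set (stabilizer nu x))
    (n_gt0 : (0 < n)%N)
    (n_div : forall x m, Xss nu Phi x -> (stabilizer nu x #= `I_m)%card -> (m %| n)%N)
    (p_bounds : 2 < p < 2 * (1 + n%:R^-1))
    (d : 'rV[R]_r) :
  induces_bijection
    (fun m : gauged_map R n nu => stable Phi m /\ has_degree m d)
    (@gauged_iso R r k n nu)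
    (polynomial_data nu Phi d) (poly_equiv nu)
    (@expressed_by R r k n nu)
  /\
  (vortex_bijection n nu p Q Phi ->
   induces_bijection
     (fun v => fe_vortex nu Q Phi v /\ vortex_degree n nu p Phi v d)
     (gauge_equiv nu)
     (polynomial_data nu Phi d) (poly_equiv nu)
     (vortex_expressed_by n nu p Phi)).
Proof.
have A := @stable_polynomial R r k n nu Phi n_gt0 finite_stab.
have B := @model_exists R r k n nu Phi n_gt0 finite_stab n_div.
have I := @iso_poly_equiv R r k n nu Phi n_gt0 finite_stab.
have E := @poly_equiv_iso R r k n nu Phi n_gt0 finite_stab.
split.
  split=> [m [ms md]|u /B[m [ms md mu]]|m m' u u' [ms md] [ms' md'] _ _ mu mu'].
  - by have [u [ud mu]] := A m d ms md; exists u.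
  - by exists m.
  - split; first exact: I.
    exact: E md md' mu mu'.
move=> [V1 V2 V3].
(* Injectivity of the classification, with the same vortex on both sides. *)
have W0 (m m' : gauged_map R n nu) v : stable Phi m -> stable Phi m' -> fe_vortex nu Q Phi v ->
    reduces_to p m v -> reduces_to p m' v -> gauged_iso m m'.
  by move=> ms ms' vv mv mv'; apply/(V3 m m' v v) => //; exact: gauge_equiv_refl.
(* The degree and the polynomial expression of a vortex are each witnessed by a gauged map of their
   own. By [W0] the two maps are isomorphic, and the expression is transported to the one that
   carries the degree. *)
have D v u : fe_vortex nu Q Phi v -> vortex_degree n nu p Phi v d -> vortex_expressed_by n nu p Phi v u ->
    exists m : gauged_map R n nu, [/\ stable Phi m, reduces_to p m v, has_degree m d & expressed_by m u].
  move=> vv [m [ms mv md]] [m' [ms' mv' mu]]; exists m; split=> //.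
  by apply: expressed_iso mu; exact: W0 mv' mv.
split=> [v [vv [m [ms mv md]]]|u /B[m [ms md mu]]|v v' u u' [vv vd] [vv' vd'] _ _ vu vu'].
- by have [u [ud mu]] := A m d ms md; exists u; split=> //; exists m.
- have [v [vv mv]] := V1 m ms.
  by exists v; split; [split=> //; exists m|exists m].
- have [m [ms mv md mu]] := D v u vv vd vu.
  have [m' [ms' mv' md' mu']] := D v' u' vv' vd' vu'.
  apply: iff_trans (iff_sym (V3 m m' v v' ms ms' vv vv' mv mv')) _.
  split; first exact: I.
  exact: E md md' mu mu'.
Qed.
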